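(* Let $\Omega\subset\mathbb{R}^2$ be a bounded convex domain with $C^\infty$-smooth boundary. Then the following hold. (i) If $\mathcal{B}\subset\mathbb{R}^2$ is the disk such that $\partial\mathcal{B}$ has the same elastic energy as $\partial\Omega$, that is, $E(\partial\mathcal{B})=E(\partial\Omega)$, then $\lambda_2^\alpha(\Omega^{\rm c})\le\lambda_2^\alpha(\mathcal{B}^{\rm c})$ for every $\alpha\in\mathbb{R}$. (ii) $\alpha_\star(\Omega^{\rm c})\ge-\frac{1}{\pi}E(\partial\Omega)$, and equality is attained when $\Omega$ is a disk.
   Context: For a bounded smooth planar domain $\Omega$, write $\Omega^{\rm c}:=\mathbb{R}^2\setminus\overline{\Omega}$ for its exterior (and likewise $\mathcal{B}^{\rm c}:=\mathbb{R}^2\setminus\overline{\mathcal{B}}$). For $\alpha\in\mathbb{R}$ define $$\lambda_2^\alpha(\Omega^{\rm c}):=\inf_{\substack{\mathcal{L}\subset H^1(\Omega^{\rm c})\\ \dim\mathcal{L}=2}}\ \sup_{u\in\mathcal{L}\setminus\{0\}}\frac{\int_{\Omega^{\rm c}}|\nabla u|^2\,dx+\alpha\int_{\partial\Omega}|u|^2\,d\sigma}{\int_{\Omega^{\rm c}}|u|^2\,dx},$$ where the infimum is over two-dimensional linear subspaces, $u$ on $\partial\Omega$ is understood in the sense of traces and $d\sigma$ is the one-dimensional Hausdorff measure on $\partial\Omega$. If this number is negative it is the second eigenvalue (counted with multiplicity) of the Robin Laplacian on $\Omega^{\rm c}$, whose essential spectrum is $[0,\infty)$; otherwise it equals $0$.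 The critical coupling constant is $$\alpha_\star(\Omega^{\rm c}):=\sup\{\alpha\in\mathbb{R}:\lambda_2^\alpha(\Omega^{\rm c})<0\}.$$ The elastic energy of $\partial\Omega$ is $E(\partial\Omega):=\frac12\int_{\partial\Omega}\kappa^2\,d\sigma$, where $\kappa$ is the curvature of $\partial\Omega$. *)

(* Defs.v *)
From HB Require Import structures.
From mathcomp Require Import all_boot all_order all_algebra.
From mathcomp Require Import all_classical all_reals all_analysis.

Set Implicit Arguments.
Unset Strict Implicit.
Unset Printing Implicit Defensive.

Import Order.TTheory GRing.Theory Num.Theory.
Import numFieldNormedType.Exports.

Local Open Scope classical_set_scope.
Local Open Scope ring_scope.

Section Hausdorff.
Context {R : realType}.
Implicit Types (p q : R * R) (A : set (R * R)) (F : (set (R * R))^nat).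

(* The norm of the product type [R * R] is the sup norm. *)
Definition edist p q : R :=
  Num.sqrt ((p.1 - q.1) ^+ 2 + (p.2 - q.2) ^+ 2).

(* The point 0 makes the diameter of the empty set 0 instead of -oo. *)
Definition ediam A : \bar R :=
  ereal_sup (0%E |` [set (edist pq.1 pq.2)%:E | pq in A `*` A]).

Local Open Scope ereal_scope.

Definition hausdorff_delta (delta : R) A : \bar R :=
  ereal_inf [set \sum_(n <oo) ediam (F n) | F in
    [set F | (forall n, ediam (F n) <= delta%:E) /\ A `<=` \bigcup_n F n]].

Definition hausdorff A : \bar R :=
  ereal_sup [set hausdorff_delta delta A | delta in [set delta | (0 < delta)%R]].

Lemma ediam_ge0 A : 0 <= ediam A.
Proof. by apply: ereal_sup_ubound; left. Qed.

Lemma ediam0 : ediam set0 = 0.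
Proof.
apply/eqP; rewrite eq_le ediam_ge0 andbT.
by apply: ge_ereal_sup => x [->//|[pq [[]]]].
Qed.

Lemma hausdorff_delta_ge0 delta A : 0 <= hausdorff_delta delta A.
Proof.
apply: le_ereal_inf_tmp => _ [F _ <-].
by apply: nneseries_ge0 => n _ _; exact: ediam_ge0.
Qed.

Lemma hausdorff_delta0 delta : (0 < delta)%R -> hausdorff_delta delta set0 = 0.
Proof.
move=> d0; apply/eqP; rewrite eq_le hausdorff_delta_ge0 andbT.
apply: ereal_inf_lbound; exists (fun=> set0).
  by split=> // n; rewrite ediam0 lee_fin ltW.
by rewrite eseries0// => n _ _; exact: ediam0.
Qed.

Lemma le_hausdorff_delta delta :
  {homo hausdorff_delta delta : A B / A `<=` B >-> A <= B}.
Proof.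
move=> A B AB; apply/ereal_inf_le_tmp => _ [F [dF BF] <-].
by exists F => //; split=> //; exact: subset_trans BF.
Qed.

Lemma hausdorff_delta_sigma_subadditive delta :
  sigma_subadditive (hausdorff_delta delta).
Proof.
move=> A; have [[i ioo]|] := pselect (exists i, hausdorff_delta delta (A i) = +oo).
  rewrite (eseries_pinfty _ _ ioo) ?leey// => n _.
  by rewrite -ltNye (lt_le_trans _ (hausdorff_delta_ge0 _ _)).
rewrite -forallNE => Aoo.
apply/lee_addgt0Pr => _/posnumP[e].
rewrite (le_trans _ (epsilon_trick _ _ _))//; last first.
  by move=> n; exact: hausdorff_delta_ge0.
pose P n (B : (set (R * R))^nat) :=
  ((forall k, ediam (B k) <= delta%:E) /\ A n `<=` \bigcup_k B k) /\
  \sum_(k <oo) ediam (B k) <=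
    hausdorff_delta delta (A n) + (e%:num / (2 ^ n.+1)%:R)%:E.
have [G PG] : {G : ((set (R * R))^nat)^nat & forall n, P n (G n)}.
  apply: (@choice _ _ P) => n; rewrite /P.
  have en1 : (0 < e%:num / (2 ^ n.+1)%:R :> R)%R by [].
  have fA : hausdorff_delta delta (A n) \is a fin_num.
    rewrite ge0_fin_numE ?hausdorff_delta_ge0// ltey; exact/eqP/Aoo.
  have [_ [B BP <-] /ltW BA] := lb_ereal_inf_adherent en1 fA.
  by exists B.
have G_ge0 x : 0 <= (ediam \o uncurry G) x by exact: ediam_ge0.
apply: (@le_trans _ _ (\esum_(i in setT) (ediam \o uncurry G) i)).
  apply: ereal_inf_lbound => /=.
  have /card_esym/ppcard_eqP[f] := card_nat2.
  exists (uncurry G \o f).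
    split=> [i|].
      by rewrite /=; case: (f i) => a b /=; have [[dG _] _] := PG a.
    move=> t [i _ Ait]; have [[_ AG] _] := PG i; have [j _ Gt] := AG _ Ait.
    by exists (f^-1%FUN (i, j)) => //=; rewrite invK ?inE.
  rewrite -(esum_pred_image (ediam \o uncurry G) _ xpredT) ?[fun=> _]set_true//.
  by rewrite image_eq.
rewrite (_ : esum _ _ = \sum_(i <oo) \sum_(j <oo) ediam (G i j)); last first.
  pose J : nat -> set (nat * nat) := fun i => [set (i, j) | j in setT].
  rewrite (_ : setT = \bigcup_k J k); last first.
    by rewrite predeqE => -[a b]; split => // _; exists a => //; exists b.
  rewrite esum_bigcupT /=; last 2 first.
    - apply/trivIsetP => i j _ _ ij.
      rewrite predeqE => -[n m] /=; split => //= -[] [_] _ [<-{n} _].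
      by move=> [m' _] [] /esym/eqP; rewrite (negbTE ij).
    - by move=> /= [n m]; exact: ediam_ge0.
  rewrite -(image_id [set: nat]) -fun_true esum_pred_image//; last first.
    by move=> n _; apply: esum_ge0 => *; exact: ediam_ge0.
  apply: eq_eseriesr => /= j _.
  rewrite -(esum_pred_image (ediam \o uncurry G) (pair j) predT)/=; first last.
    - by move=> ? ? _ _; exact: (@can_inj _ _ _ snd).
    - by move=> n _; exact: ediam_ge0.
  by congr esum; rewrite predeqE => -[a b]; split; move=> [i _ <-]; exists i.
apply: lee_lim.
- apply: is_cvg_nneseries => n *.
  by apply: nneseries_ge0 => m *; exact: (G_ge0 (n, m)).
- apply: is_cvg_nneseries => n *; apply: adde_ge0 => //.
  exact: hausdorff_delta_ge0.
- by near=> n; apply: lee_sum => i _; have [_] := PG i.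
Unshelve. all: by end_near. Qed.

Lemma hausdorff_ge0 A : 0 <= hausdorff A.
Proof.
apply: (le_trans (hausdorff_delta_ge0 1 A)).
by apply: ereal_sup_ubound; exists 1%R => //=; exact: ltr01.
Qed.

Lemma hausdorff0 : hausdorff set0 = 0.
Proof.
apply/eqP; rewrite eq_le hausdorff_ge0 andbT.
by apply: ge_ereal_sup => _ [d d0 <-]; rewrite hausdorff_delta0.
Qed.

Lemma le_hausdorff : {homo hausdorff : A B / A `<=` B >-> A <= B}.
Proof.
move=> A B AB; apply: ge_ereal_sup => _ [d d0 <-].
rewrite (le_trans (le_hausdorff_delta d AB))//.
by apply: ereal_sup_ubound; exists d.
Qed.

Lemma hausdorff_sigma_subadditive : sigma_subadditive hausdorff.
Proof.
move=> F; apply: ge_ereal_sup => _ [d d0 <-].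
rewrite (le_trans (hausdorff_delta_sigma_subadditive d F))//.
apply: lee_nneseries => n *; first exact: hausdorff_delta_ge0.
by apply: ereal_sup_ubound; exists d.
Qed.

HB.instance Definition _ := isOuterMeasure.Build R (R * R)%type hausdorff
  hausdorff0 hausdorff_ge0 le_hausdorff hausdorff_sigma_subadditive.

End Hausdorff.

Definition hausdorff_outer (R : realType) :
  {outer_measure set (R * R) -> \bar R} := hausdorff.

Definition arclength (R : realType) :
    {measure set (caratheodory_type (hausdorff_outer R)) -> \bar R} :=
  hausdorff_outer R.

Definition area (R : realType) :
  {measure set (measurableTypeR R * measurableTypeR R) -> \bar R} :=
  (@lebesgue_measure R \x @lebesgue_measure R)%E.

Section Smooth.
Context {R : realType}.
Implicit Types (f : R * R -> R) (p : R * R).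

Definition unit_vec (i : 'I_2) : R * R := ((i == 0)%:R, (i == 1)%:R).

Definition partial (i : 'I_2) f p : R := 'D_(unit_vec i) f p.

Fixpoint Ck (k : nat) f : Prop :=
  if k is k'.+1 then
    forall i, (forall p, derivable f p (unit_vec i)) /\ Ck k' (partial i f)
  else continuous f.

Definition smooth f := forall k, Ck k f.

Definition smooth1 (x : R -> R) := forall k t, derivable (derive1n k x) t 1.

Definition test_function (U : set (R * R)) f :=
  smooth f /\
  exists K : set (R * R), [/\ compact K, K `<=` U & forall p, ~ K p -> f p = 0].

End Smooth.

Section Domain.
Context {R : realType}.
Implicit Types (Omega : set (R * R)) (p : R * R).

Definition disk p (r : R) : set (R * R) := [set q | edist q p < r].

Definition exterior Omega : set (R * R) := ~` closure Omega.

Definition boundary Omega : set (R * R) := closure Omega `\` interior Omega.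

(* [F] is a local defining function. Its smoothness on the whole plane is no
   restriction, as only its germ at [p] matters. *)
Definition smooth_boundary Omega := forall p, boundary Omega p ->
  exists2 F : R * R -> R, smooth F &
    \forall q \near p, (exists i, partial i F q != 0) /\ (Omega q <-> F q < 0).

(* [(x, y)] is an arc of the boundary parametrized by arc length near 0, with
   [Omega] on its left, so that a disk of radius [r] has curvature [1 / r]. *)
Definition is_curvature Omega p (k : R) := exists x y : R -> R,
  [/\ smooth1 x /\ smooth1 y,
      (x 0, y 0) = p,
      \forall t \near 0,
        boundary Omega (x t, y t) /\ derive1 x t ^+ 2 + derive1 y t ^+ 2 = 1,
      \forall h \near 0^'+, Omega (x 0 - h * derive1 y 0, y 0 + h * derive1 x 0) &
      k = derive1 x 0 * derive1n 2 y 0 - derive1 y 0 * derive1n 2 x 0].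

Definition curvature Omega p : R := get (is_curvature Omega p).

Definition elastic_energy Omega : \bar R :=
  ((2^-1)%:E * \int[arclength R]_(p in boundary Omega)
    (curvature Omega p ^+ 2)%:E)%E.

End Domain.

Section Sobolev.
Context {R : realType}.
Implicit Types (U Omega : set (R * R)) (u g t : R * R -> R).

Definition L2 d (T : measurableType d) (mu : {measure set T -> \bar R})
  (D : set T) (f : T -> R) : Prop := f \_ D \in Lfun mu 2%:E.

Definition cvg_L2 d (T : measurableType d) (mu : {measure set T -> \bar R})
    (D : set T) (f_ : (T -> R)^nat) (f : T -> R) :=
  (fun n => 'N[mu]_2%:E [EFin \o ((f_ n \- f)%R \_ D)])%E @ \oo --> 0%E.

Definition is_weak_partial U (i : 'I_2) u g := L2 (area R) U g /\
  forall f, test_function U f ->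
    \int[area R]_(p in U) (u p * partial i f p) =
    - \int[area R]_(p in U) (g p * f p).

Definition weak_partial U i u : R * R -> R := get (is_weak_partial U i u).

Definition H1 U : set (R * R -> R) :=
  [set u | L2 (area R) U u /\ forall i, exists g, is_weak_partial U i u g].

(* The trace operator on [H1 (exterior Omega)] is the continuous extension of the
   restriction to the boundary of functions of C_c^oo(R^2). *)
Definition is_trace Omega u t := L2 (arclength R) (boundary Omega) t /\
  exists f_ : (R * R -> R)^nat,
  [/\ forall n, test_function setT (f_ n),
      cvg_L2 (area R) (exterior Omega) f_ u,
      forall i, cvg_L2 (area R) (exterior Omega)
        (fun n => partial i (f_ n)) (weak_partial (exterior Omega) i u) &
      cvg_L2 (arclength R) (boundary Omega) f_ t].

Definition trace Omega u : R * R -> R := get (is_trace Omega u).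

Definition rayleigh Omega (alpha : R) u : R :=
  (\int[area R]_(p in exterior Omega)
     (\sum_(i < 2) weak_partial (exterior Omega) i u p ^+ 2) +
   alpha * \int[arclength R]_(p in boundary Omega) (trace Omega u p ^+ 2)) /
  \int[area R]_(p in exterior Omega) (u p ^+ 2).

Definition null U : set (R * R -> R) :=
  [set u | {ae area R, forall p, U p -> u p = 0}].

(* Subspaces of [H1 U] of dimension 2, dimension being taken modulo equality
   almost everywhere on [U]. *)
Definition plane U (L : set (R * R -> R)) := exists u v : R * R -> R,
  [/\ H1 U u, H1 U v,
      forall a b : R, null U (a \*o u \+ b \*o v) -> a = 0 /\ b = 0 &
      L = [set w | exists a b : R, w = a \*o u \+ b \*o v]].

Definition lambda2 (alpha : R) Omega : \bar R :=
  ereal_inf [set ereal_sup [set (rayleigh Omega alpha u)%:E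
                           | u in L `\` null (exterior Omega)]
            | L in plane (exterior Omega)].

Definition alpha_star Omega : \bar R :=
  ereal_sup [set alpha%:E | alpha in [set alpha | (lambda2 alpha Omega < 0)%E]].

End Sobolev.

(* Main.v *)
(** Let [gamma] be the arc length parametrization of the boundary, [n] its outward
    normal, [kappa] its curvature, [L] its length and [k = E / pi]. Normal
    coordinates [gamma s + t n s] map onto the exterior with Jacobian
    [1 + kappa t]. The upper bound uses the trial planes spanned by [phi t] and
    [phi t * n_j s], [j = 1, 2]: the two functions are orthogonal for the mass and
    for the form because [n_j] and [kappa n_j] have zero mean. Summing the form
    over [j] leaves the curvature only through the mean of
    [kappa ^ 2 / (1 + kappa t)], which the tangent line of the concave function
    [x / (1 + x t)] at [k] bounds by [2 pi k / (1 + k t)], while Cauchy-Schwarz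
    gives [L k >= 2 pi]. What remains is the radial form of the disk of radius
    [1 / k]. For a disk the bound is sharp: if the radial form is nonnegative, then
    by Wirtinger's inequality on concentric circles so is the full form on
    functions of zero boundary mean, and every plane contains such a function. The
    radial form changes sign exactly at [alpha = - k], with threshold solution
    [1 / (1 + k t)]. *)
From HB Require Import structures.
From mathcomp Require Import all_boot all_order all_algebra.
From mathcomp Require Import all_classical all_reals all_analysis.
From mathcomp Require Import measurable_realfun zify ring lra.
Require Import Defs.
Set Implicit Arguments.
Unset Strict Implicit.
Unset Printing Implicit Defensive.
Import Order.TTheory GRing.Theory Num.Theory.
Import numFieldNormedType.Exports.
Local Open Scope classical_set_scope.
Local Open Scope ring_scope.

(** No eigenfunction occurs. Fix [lam <= 0]: a radial profile of negative energy bounds [lambda2] of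
    every convex domain with the same [k] by [lam], and on the disk [lambda2 < lam] produces such a
    profile. Part (i) follows by inserting [lam] between two values in the wrong order; [lam <= 0]
    is possible because [lambda2 alpha Omega <= 0]. Only the sum of the energies of the two trial
    planes is controlled, so the better one is used, without knowing which. For the converse on the
    disk, Fourier series are replaced by differences of a function between two points of a parallel
    circle, each difference being a radial profile. Two obstacles shape the rest. The change of
    variables is obtained without inverting the coordinates: the image of the weighted measure
    annihilates partial derivatives, hence is a multiple of Lebesgue measure, and a Gaussian gives
    the factor. And traces are defined through test functions of the whole plane, so the normal
    coordinates are continued slightly into [Omega] and the trial functions are cut off there; they
    are then test functions and their own traces. *)

Notation is_deriv x := (is_derive x (1 : Real.sort _)).

(** * Calculus on the line *)

Section Kit.
Context {R : realType}.
Implicit Types (f g F G : R -> R) (a b c : R).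
Notation mu := (@lebesgue_measure R).

Lemma contD (T : topologicalType) (f g : T -> R) :
  continuous f -> continuous g -> continuous (fun x => f x + g x).
Proof. by move=> cf cg x; exact: (@continuousD _ R^o _ f g x (cf x) (cg x)). Qed.

Lemma contN (T : topologicalType) (f : T -> R) :
  continuous f -> continuous (fun x => - f x).
Proof. by move=> cf x; exact: (@continuousN _ R^o _ f x (cf x)). Qed.

Lemma contB (T : topologicalType) (f g : T -> R) :
  continuous f -> continuous g -> continuous (fun x => f x - g x).
Proof. by move=> cf cg; apply: contD => //; exact: contN. Qed.

Lemma contM (T : topologicalType) (f g : T -> R) :
  continuous f -> continuous g -> continuous (fun x => f x * g x).
Proof. by move=> cf cg x; exact: (@continuousM _ _ f g x (cf x) (cg x)). Qed.

Lemma contX (T : topologicalType) (f : T -> R) n :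
  continuous f -> continuous (fun x => f x ^+ n).
Proof.
move=> cf; elim: n => [|n IH]; first by under eq_fun do rewrite expr0; exact: cst_continuous.
by under eq_fun do rewrite exprS; exact: contM.
Qed.

Lemma contV (T : topologicalType) (f : T -> R) :
  (forall x, f x != 0) -> continuous f -> continuous (fun x => (f x)^-1).
Proof. by move=> f0 cf x; exact: (@continuousV _ _ f x (f0 x) (cf x)). Qed.

Lemma cont_comp (T U : topologicalType) (f : U -> R) (g : T -> U) :
  continuous f -> continuous g -> continuous (fun x => f (g x)).
Proof. by move=> cf cg x; exact: (@continuous_comp _ _ _ g f x (cg x) (cf _)). Qed.

Lemma cont_cst (T : topologicalType) (a : R) : continuous (fun _ : T => a).
Proof. exact: cst_continuous. Qed.

Lemma cont_fst (T U : topologicalType) : continuous (fun p : T * U => p.1).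
Proof. by move=> p; exact: cvg_fst. Qed.

Lemma cont_snd (T U : topologicalType) : continuous (fun p : T * U => p.2).
Proof. by move=> p; exact: cvg_snd. Qed.

Lemma cont_pair (T U V : topologicalType) (f : T -> U) (g : T -> V) :
  continuous f -> continuous g -> continuous (fun x => (f x, g x)).
Proof. by move=> cf cg x; apply: cvg_pair; [exact: cf|exact: cg]. Qed.

Lemma cont_pair_at (T U V : topologicalType) (f : T -> U) (g : T -> V) (x : T) :
  {for x, continuous f} -> {for x, continuous g} ->
  {for x, continuous (fun x => (f x, g x))}.
Proof. by move=> cf cg; apply: cvg_pair; [exact: cf|exact: cg]. Qed.

Lemma cont_id (T : topologicalType) : continuous (fun x : T => x).
Proof. by move=> x; exact: cvg_id. Qed.

Lemma cont_max (T : topologicalType) (f g : T -> R) :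
  continuous f -> continuous g -> continuous (fun x => Num.max (f x) (g x)).
Proof. by move=> cf cg x; exact: (@continuous_max _ _ f g x (cf x) (cg x)). Qed.

Implicit Types (x d df dg : R).

Lemma is_derive_cont (f df : R -> R) :
  (forall x, is_deriv x f (df x)) -> continuous f.
Proof.
move=> fd x; apply/differentiable_continuous/derivable1_diffP.
exact: (@ex_derive _ _ _ _ _ _ _ (fd x)).
Qed.

Lemma ide_eq f x d d' : is_deriv x f d -> d = d' -> is_deriv x f d'.
Proof. by move=> ? <-. Qed.

Lemma ideD f g x df dg : is_deriv x f df -> is_deriv x g dg ->
  is_deriv x (fun t => f t + g t) (df + dg).
Proof. by move=> hf hg; exact: (@is_deriveD _ R^o R^o f g). Qed.

Lemma ideN f x df : is_deriv x f df -> is_deriv x (fun t => - f t) (- df).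
Proof. by move=> hf; exact: (@is_deriveN _ R^o R^o f). Qed.

Lemma ideB f g x df dg : is_deriv x f df -> is_deriv x g dg ->
  is_deriv x (fun t => f t - g t) (df - dg).
Proof. by move=> hf hg; exact: (@is_deriveB _ R^o R^o f g). Qed.

Lemma ideM f g x df dg : is_deriv x f df -> is_deriv x g dg ->
  is_deriv x (fun t => f t * g t) (df * g x + f x * dg).
Proof.
move=> hf hg; have := @is_deriveM _ _ f g x 1 df dg hf hg.
by rewrite /GRing.scale /= addrC [g x * _]mulrC.
Qed.

Lemma ideV f x df : f x != 0 -> is_deriv x f df ->
  is_deriv x (fun t => (f t)^-1) (- df / f x ^+ 2).
Proof.
move=> f0 hf; have := @is_deriveV _ f x df 1 f0 hf.
by rewrite /GRing.scale /= mulrC mulrN mulNr.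
Qed.

Lemma ideX f n x df : is_deriv x f df ->
  is_deriv x (fun t => f t ^+ n.+1) (n.+1%:R * f x ^+ n * df).
Proof.
move=> hf; elim: n => [|n IH]; first by rewrite mul1r expr0 mul1r; under eq_fun do rewrite expr1.
under eq_fun do rewrite exprS.
apply: ide_eq (ideM hf IH) _.
by rewrite -[n.+2]addn1 natrD /= exprS; ring.
Qed.

Lemma ide_cst (a x : R) : is_deriv x (fun=> a) (0 : R).
Proof. exact: is_derive_cst. Qed.

Lemma ide_id (x : R) : is_deriv x (fun t => t) (1:R).
Proof. exact: is_derive_id. Qed.

Lemma ide_comp f g x df dg : is_derive (g x) 1 f df -> is_deriv x g dg ->
  is_deriv x (fun t => f (g t)) (df * dg).
Proof. by move=> hf hg; exact: (@is_derive1_comp _ f g). Qed.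

Lemma ide_near f g x d : (\forall t \near x, f t = g t) ->
  is_deriv x f d -> is_deriv x g d.
Proof.
move=> fg [h1 h2]; split.
  by apply: near_eq_derivable h1 => //; exact: oner_neq0.
by rewrite -h2; apply/esym; apply: near_eq_derive => //; exact: oner_neq0.
Qed.

Lemma ide_uniq f x d d' : is_deriv x f d -> is_deriv x f d' -> d = d'.
Proof. by move=> [_ <-] [_ <-]. Qed.

Lemma cont_intgb f a b : continuous f -> mu.-integrable `[a, b] (EFin \o f).
Proof.
move=> cf; apply: continuous_compact_integrable; first exact: segment_compact.
exact: continuous_subspaceT.
Qed.

Lemma FTC f F a b : a <= b -> continuous f -> (forall x, is_deriv x F (f x)) ->
  \int[mu]_(x in `[a, b]) f x = F b - F a.
Proof.
rewrite le_eqVlt => /predU1P[->|ab] cf Ff.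
  by rewrite set_itv1 Rintegral_set1 subrr.
have cF := is_derive_cont Ff.
rewrite /Rintegral (@continuous_FTC2 _ f F) //.
- exact: continuous_subspaceT.
- split; first by move=> x _; exact: (@ex_derive _ _ _ _ _ _ _ (Ff x)).
  + exact/cvg_at_right_filter/cF.
  + exact/cvg_at_left_filter/cF.
- by move=> x _; rewrite derive1E; exact: (@derive_val _ _ _ _ _ _ _ (Ff x)).
Qed.

Lemma intD f g a b : continuous f -> continuous g ->
  \int[mu]_(x in `[a, b]) (f x + g x) =
  \int[mu]_(x in `[a, b]) f x + \int[mu]_(x in `[a, b]) g x.
Proof. by move=> cf cg; apply: RintegralD => //; exact: cont_intgb. Qed.

Lemma intB f g a b : continuous f -> continuous g ->
  \int[mu]_(x in `[a, b]) (f x - g x) =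
  \int[mu]_(x in `[a, b]) f x - \int[mu]_(x in `[a, b]) g x.
Proof. by move=> cf cg; apply: RintegralB => //; exact: cont_intgb. Qed.

Lemma intZ (k : R) f a b : continuous f ->
  \int[mu]_(x in `[a, b]) (k * f x) = k * \int[mu]_(x in `[a, b]) f x.
Proof. by move=> cf; apply: RintegralZl => //; exact: cont_intgb. Qed.

Lemma intZr (k : R) f a b : continuous f ->
  \int[mu]_(x in `[a, b]) (f x * k) = \int[mu]_(x in `[a, b]) f x * k.
Proof. by move=> cf; apply: RintegralZr => //; exact: cont_intgb. Qed.

Lemma int_le f g a b : continuous f -> continuous g ->
  (forall x, a <= x <= b -> f x <= g x) ->
  \int[mu]_(x in `[a, b]) f x <= \int[mu]_(x in `[a, b]) g x.
Proof.
move=> cf cg fg; by apply: le_Rintegral => //; exact: cont_intgb.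
Qed.

Lemma int_ge0 f a b : (forall x, a <= x <= b -> 0 <= f x) ->
  0 <= \int[mu]_(x in `[a, b]) f x.
Proof. by move=> f0; apply: Rintegral_ge0 => x /=; rewrite in_itv /=; exact: f0. Qed.

Lemma int_eq f g a b : (forall x, a <= x <= b -> f x = g x) ->
  \int[mu]_(x in `[a, b]) f x = \int[mu]_(x in `[a, b]) g x.
Proof. by move=> fg; apply: eq_Rintegral => x; rewrite inE /= in_itv /=; exact: fg. Qed.

Lemma int_cst (k a b : R) : a <= b -> \int[mu]_(x in `[a, b]) k = k * (b - a).
Proof.
move=> ab; have H x : is_deriv x (fun x => k * x) k.
  by apply: (ide_eq (ideM (ide_cst k x) (ide_id x))); lra.
by rewrite (FTC ab (@cont_cst _ k) H); lra.
Qed.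

Lemma antiderivative f : continuous f -> exists F, forall x, is_deriv x F (f x).
Proof.
move=> cf.
(* One of the two intervals is empty or a point, so this is the signed integral from 0 for either
   sign of [x]. To differentiate, the base point is moved to some [a] below both [x] and 0, which
   changes [F] by a constant. *)
pose F x := \int[mu]_(t in `[0, x]) f t - \int[mu]_(t in `[x, 0]) f t.
exists F => x.
have [a [b [ax xb a0 b0]]] : exists a b, [/\ a < x, x < b, a < 0 & 0 < b].
  exists (Num.min x 0 - 1), (Num.max x 0 + 1).
  by case: (lerP x 0); rewrite /Order.min /Order.max; case: (ltP x 0) => *; split; lra.
have FE y : a <= y -> F y = \int[mu]_(t in `[a, y]) f t - \int[mu]_(t in `[a, 0]) f t.
  move=> ay; rewrite /F; case: (lerP y 0) => y0.
    have -> : \int[mu]_(t in `[0, y]) f t = 0.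
      case: (ltrP y 0) => [y0'|y0'].
        by rewrite set_itv_ge ?Rintegral_set0 // bnd_simp -ltNge.
      by rewrite (_ : y = 0) ?set_itv1 ?Rintegral_set1; lra.
    have := @Rintegral_itvB _ f (BLeft a) (BRight 0) y (cont_intgb _ _ cf).
    rewrite !bnd_simp => /(_ ay y0) H.
    rewrite -(@Rintegral_itv_obnd_cbnd _ y (BRight 0)) -?H; first lra.
    apply: integrableS; last exact: (@cont_intgb _ y 0 cf) => //; [by []|by []|].
    by apply: subset_itvr; rewrite bnd_simp.
  have -> : \int[mu]_(t in `[y, 0]) f t = 0.
    by rewrite set_itv_ge ?Rintegral_set0 // bnd_simp -ltNge.
  have := @Rintegral_itvB _ f (BLeft a) (BRight y) 0 (cont_intgb _ _ cf).
  rewrite !bnd_simp => /(_ (ltW a0) (ltW y0)) H.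
  rewrite -(@Rintegral_itv_obnd_cbnd _ 0 (BRight y)) -?H; first lra.
  apply: integrableS; last exact: (@cont_intgb _ 0 y cf) => //; [by []|by []|].
  by apply: subset_itvr; rewrite bnd_simp.
have [dF vF] := @continuous_FTC1_closed _ f a x b xb (cont_intgb _ _ cf) ax (cf x).
have H : is_deriv x (fun y => \int[mu]_(t in `[a, y]) f t) (f x).
  by split; [exact: dF|rewrite -derive1E].
apply: (ide_near _ (ide_eq (ideB H (ide_cst (\int[mu]_(t in `[a, 0]) f t) x)) (subr0 _))).
near=> y; rewrite FE //; near: y.
by apply: filterS (lt_nbhsr ax) => y /ltW.
Unshelve. all: by end_near. Qed.

Lemma int_split f a b c : continuous f -> a <= b -> b <= c ->
  \int[mu]_(x in `[a, c]) f x =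
  \int[mu]_(x in `[a, b]) f x + \int[mu]_(x in `[b, c]) f x.
Proof.
move=> cf ab bc; have [F FF] := antiderivative cf.
by rewrite !(FTC _ cf FF) //; [lra|exact: le_trans bc].
Qed.

Lemma int_abs f a b : continuous f ->
  `|\int[mu]_(x in `[a, b]) f x| <= \int[mu]_(x in `[a, b]) `|f x|.
Proof. by move=> cf; apply: le_normr_Rintegral => //; exact: cont_intgb. Qed.

Lemma int_bound f a b M : continuous f -> a <= b -> (forall x, a <= x <= b -> `|f x| <= M) ->
  `|\int[mu]_(x in `[a, b]) f x| <= M * (b - a).
Proof.
move=> cf ab fM; apply: le_trans (int_abs _ _ cf) _.
rewrite -int_cst //; apply: int_le => //; last exact: cont_cst.
by move=> x; apply: (@continuous_comp _ _ _ f Num.norm x (cf x)); exact: norm_continuous.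
Qed.

Lemma int_gt0 f a b c : continuous f -> (forall x, a <= x <= b -> 0 <= f x) ->
  a < c -> c < b -> 0 < f c -> 0 < \int[mu]_(x in `[a, b]) f x.
Proof.
move=> cf f0 ac cb fc.
have : \forall x \near c, f c / 2 < f x.
  by apply: (cf c (fun y => f c / 2 < y)); apply: lt_nbhsr; lra.
move=> /nbhs_ballP[e /= e0 He].
pose d := Num.min (e / 2) (Num.min (b - c) (c - a)).
have d0 : 0 < d by rewrite /d !lt_min; apply/and3P; split; lra.
have [de db da] : [/\ d <= e / 2, d <= b - c & d <= c - a].
  by rewrite /d !ge_min !lexx !orbT; split.
have ad : a <= c - d by lra. have db' : c + d <= b by lra. have dd : c - d <= c + d by lra.
rewrite (int_split cf (le_trans ad dd) db') (int_split cf ad dd).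
have H1 : 0 <= \int[mu]_(x in `[a, c - d]) f x.
  by apply: int_ge0 => x /andP[? ?]; apply: f0; apply/andP; split; lra.
have H2 : 0 <= \int[mu]_(x in `[c + d, b]) f x.
  by apply: int_ge0 => x /andP[? ?]; apply: f0; apply/andP; split; lra.
have H3 : f c / 2 * (c + d - (c - d)) <= \int[mu]_(x in `[c - d, c + d]) f x.
  rewrite -int_cst //; apply: int_le => //; first exact: cont_cst.
  move=> x /andP[x1 x2]; apply: ltW; apply: He; rewrite /ball /= ltr_norml; apply/andP; split; lra.
have : 0 < f c / 2 * (c + d - (c - d)) by apply: mulr_gt0; lra.
lra.
Qed.

End Kit.

(** * Continuous functions of two variables *)

Section Plane.
Context {R : realType}.
Notation mu := (@lebesgue_measure R).
Notation mR := (measurableTypeR R).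
Implicit Types (h : R -> R -> R) (a b c d x y t : R).

(** The measurable sets are those of the product sigma-algebra. An open set is the union of the
    rational squares that it contains, and these are countably many measurable rectangles. *)
Lemma open_measurable2 (A : set (R * R)) : open A -> measurable (A : set (mR * mR)).
Proof.
move=> oA.
pose B (q : rat * (rat * rat)) : set (R * R) :=
  ball (ratr q.1 : R) (ratr q.2.2) `*` ball (ratr q.2.1 : R) (ratr q.2.2).
have -> : A = \bigcup_(q in [set q | B q `<=` A]) B q.
  apply/seteqP; split=> [[x y] Axy|]; last by move=> p [q /= qA] /qA.
  have /nbhs_ballP[e /= e0 eA] : nbhs (x, y) A by exact: open_nbhs_nbhs.
  have [r /[!in_itv]/= /andP[r0 re]] : exists r : rat, (ratr r : R) \in `]0, e / 2[.
    by apply: rat_in_itvoo; lra.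
  have [p /[!in_itv]/= /andP[p1 p2]] : exists r' : rat, (ratr r' : R) \in `]x - ratr r, x + ratr r[.
    by apply: rat_in_itvoo; lra.
  have [q /[!in_itv]/= /andP[q1 q2]] : exists r' : rat, (ratr r' : R) \in `]y - ratr r, y + ratr r[.
    by apply: rat_in_itvoo; lra.
  exists (p, (q, r)) => /=; last first.
    by split; rewrite /ball /= ltr_norml; apply/andP; split; lra.
  move=> [u v] [/= Bu Bv]; apply: eA; move: Bu Bv; rewrite /ball /= !ltr_norml.
  by move=> /andP[? ?] /andP[? ?]; split; rewrite /ball /= ltr_norml; apply/andP; split; lra.
rewrite bigcup_mkcond; apply: countable_bigcupT_measurable; first exact: countableP.
move=> q; case: ifP => // _.
by apply: measurableX; apply: open_measurable; exact: ball_open.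
Qed.

Lemma cont_measurable2 (f : R * R -> R) D : measurable (D : set (mR * mR)) ->
  continuous f -> measurable_fun (D : set (mR * mR)) f.
Proof.
move=> mD cf; apply: (measurability _ (RGenOInfty.measurableE R)).
move=> _ [_ [a ->] <-]; apply: measurableI => //.
apply: open_measurable2; move/continuousP: cf; apply; exact: interval_open.
Qed.

Lemma cont_box_bound (f : R * R -> R) a b c d : continuous f ->
  exists2 M, 0 < M & forall x y, a <= x <= b -> c <= y <= d -> `|f (x, y)| <= M.
Proof.
move=> cf.
have K : compact (f @` (`[a, b] `*` `[c, d])).
  apply: continuous_compact; first exact: continuous_subspaceT.
  by apply: compact_setX; exact: segment_compact.
have [M [Mr HM]] := compact_bounded K.
exists (Num.max (M + 1) 1); first by rewrite lt_max ltr01 orbT.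
move=> x y xab ycd; apply: (HM (Num.max (M + 1) 1)).
  by rewrite lt_max ltrDl ltr01.
by exists (x, y) => //; split; rewrite /= in_itv.
Qed.

Lemma cont_sec1 (f : R * R -> R) y : continuous f -> continuous (fun x => f (x, y)).
Proof.
move=> cf; apply: (cont_comp cf).
by apply: cont_pair; [exact: cont_id|exact: cont_cst].
Qed.

Lemma cont_sec2 (f : R * R -> R) x : continuous f -> continuous (fun y => f (x, y)).
Proof.
move=> cf; apply: (cont_comp cf).
by apply: cont_pair; [exact: cont_cst|exact: cont_id].
Qed.

Lemma cont_int2 (f : R * R -> R) c d : continuous f ->
  continuous (fun x => \int[mu]_(y in `[c, d]) f (x, y)).
Proof.
move=> cf x.
have [M M0 HM] := cont_box_bound (x - 1) (x + 1) c d cf.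
apply: (@continuity_under_integral R _ mR mu (fun x y => f (x, y)) `[c, d] _
   (x - 1) (x + 1) _ _ (fun=> M)) => //.
- by move=> y _; apply: cont_intgb; exact: cont_sec2.
- by apply: aeW => y _ z _; exact: cont_sec1.
- by apply: cont_intgb; exact: cont_cst.
- move=> y /=; rewrite in_itv /= => /andP[y1 y2]; apply: aeW => z /=; rewrite in_itv /= => zcd.
  by apply: HM => //; rewrite !ltW.
- by rewrite inE /= in_itv /=; apply/andP; split; lra.
Qed.

(** The derivative is dominated by its bound on a compact box around [x], which is all that
    differentiation under the integral sign requires. *)
Lemma ide_int (f f' : R * R -> R) c d x : continuous f -> continuous f' ->
  (forall x y, is_deriv x (fun x => f (x, y)) (f' (x, y))) ->
  is_deriv x (fun x => \int[mu]_(y in `[c, d]) f (x, y))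
    (\int[mu]_(y in `[c, d]) f' (x, y)).
Proof.
move=> cf cf' ff'.
have [M M0 HM] := cont_box_bound (x - 1) (x + 1) c d cf'.
have p1 u y : partial1of2 (fun x y => f (x, y)) u y = f' (u, y).
  by rewrite /partial1of2 derive1E; exact: (@derive_val _ _ _ _ _ _ _ (ff' u y)).
have Ix : `]x - 1, x + 1[%classic x by rewrite /= in_itv /=; apply/andP; split; lra.
have I1 u : `]x - 1, x + 1[%classic u -> mu.-integrable `[c, d] (EFin \o (fun y => f (u, y))).
  by move=> _; apply: cont_intgb; exact: cont_sec2.
have I2 u y : `]x - 1, x + 1[%classic u -> `[c, d]%classic y -> derivable (fun u => f (u, y)) u 1.
  by move=> _ _; exact: (@ex_derive _ _ _ _ _ _ _ (ff' u y)).
have I3 : mu.-integrable `[c, d] (EFin \o (fun=> M)) by apply: cont_intgb; exact: cont_cst.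
have I4 u y : `]x - 1, x + 1[%classic u -> `[c, d]%classic y ->
    `|partial1of2 (fun x y => f (x, y)) u y| <= M.
  rewrite /= !in_itv /= => /andP[u1 u2] ycd; rewrite p1; apply: HM => //.
  by rewrite !ltW.
have M0' (y : R) : 0 <= M by exact: ltW.
have md : measurable (`[c, d]%classic : set mR) by [].
split.
  exact: (derivable_under_integral md Ix I1 I2 M0' I3 I4).
rewrite -derive1E (differentiation_under_integral md Ix I1 I2 M0' I3 I4).
by apply: eq_Rintegral => y _; exact: p1.
Qed.

Lemma cont_box_intgb (f : R * R -> R) a b c d : continuous f ->
  (area R).-integrable (`[a, b] `*` `[c, d]) (EFin \o f).
Proof.
move=> cf; have mB : measurable (`[a, b] `*` `[c, d] : set (mR * mR)) by exact: measurableX.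
apply: measurable_bounded_integrable => //.
- rewrite /area /= product_measure1E //= !lebesgue_measure_itv /=.
  by case: ifP => _; case: ifP => _; rewrite ?mule0 ?mul0e ?ltry // -?EFinB -?EFinM ?ltry.
- exact: cont_measurable2.
- have [M M0 HM] := cont_box_bound a b c d cf.
  exists M; split; first exact: num_real.
  move=> N MN [x y] /= [xab ycd]; apply: le_trans (ltW MN).
  by move: xab ycd; rewrite !in_itv /=; exact: HM.
Qed.

Lemma area_box12 (f : R * R -> R) a b c d : continuous f ->
  (\int[area R]_(p in `[a, b] `*` `[c, d]) (f p)%:E =
  (\int[mu]_(x in `[a, b]) \int[mu]_(y in `[c, d]) f (x, y))%:E)%E.
Proof.
move=> cf; have mB : measurable (`[a, b] `*` `[c, d] : set (mR * mR)) by exact: measurableX.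
have iB := cont_box_intgb a b c d cf.
rewrite integral_mkcond -(@integral12_prod_meas1 _ _ mR mR R mu mu); last first.
  by move/(integrable_mkcond _ mB) : iB; apply.
rewrite /Rintegral fineK; last first.
  apply: integrable_fin_num => //.
  by apply: (@cont_intgb _ (fun x => \int[mu]_(y in `[c, d]) f (x, y))); exact: cont_int2.
rewrite [RHS]integral_mkcond; apply: eq_integral => x _.
rewrite /fubini_F /patch; case: ifPn => xab.
  rewrite /Rintegral fineK; last first.
    by apply: integrable_fin_num => //; apply: cont_intgb; exact: cont_sec2.
  rewrite [RHS]integral_mkcond; apply: eq_integral => y _.
  by rewrite /patch in_setX xab /=.
by apply: integral0_eq => y _; rewrite in_setX (negbTE xab).
Qed.

Lemma area_box21 (f : R * R -> R) a b c d : continuous f ->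
  (\int[area R]_(p in `[a, b] `*` `[c, d]) (f p)%:E =
  (\int[mu]_(y in `[c, d]) \int[mu]_(x in `[a, b]) f (x, y))%:E)%E.
Proof.
move=> cf; have mB : measurable (`[a, b] `*` `[c, d] : set (mR * mR)) by exact: measurableX.
have iB := cont_box_intgb a b c d cf.
have cf' : continuous (fun p : R * R => f (p.2, p.1)).
  by apply: (cont_comp cf); apply: cont_pair; [exact: cont_snd|exact: cont_fst].
rewrite integral_mkcond -(@integral21_prod_meas1 _ _ mR mR R mu mu); last first.
  by move/(integrable_mkcond _ mB) : iB; apply.
rewrite /Rintegral fineK; last first.
  apply: integrable_fin_num => //.
  have H : continuous (fun y : R => \int[mu]_(x in `[a, b]) f (x, y)) := @cont_int2 _ a b cf'.
  exact: (cont_intgb _ _ H).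
rewrite [RHS]integral_mkcond; apply: eq_integral => y _.
rewrite /fubini_G /patch; case: ifPn => ycd.
  rewrite /Rintegral fineK; last first.
    by apply: integrable_fin_num => //; apply: cont_intgb; exact: cont_sec1.
  rewrite [RHS]integral_mkcond; apply: eq_integral => x _.
  by rewrite /patch in_setX ycd andbT /=.
by apply: integral0_eq => x _; rewrite in_setX (negbTE ycd) andbF.
Qed.

Lemma int_swap (f : R * R -> R) a b c d : continuous f ->
  \int[mu]_(x in `[a, b]) \int[mu]_(y in `[c, d]) f (x, y) =
  \int[mu]_(y in `[c, d]) \int[mu]_(x in `[a, b]) f (x, y).
Proof. by move=> cf; apply: EFin_inj; rewrite -area_box12 // -area_box21. Qed.

End Plane.

(** * Smooth functions of one variable and bump functions *)

Section Smoothness.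
Context {R : realType}.
Implicit Types (f g : R -> R).

(** Differentiability to order [k] near [x0], with the derivatives given as witnesses in place of
    iterated [derive1]. The rules for sums, products, inverses and compositions become inductions on
    [k]; [smooth1P] returns to [smooth1]. *)
Fixpoint smat (k : nat) f (x0 : R) : Prop :=
  if k is k'.+1 then exists2 f', (\forall x \near x0, is_deriv x f (f' x)) & smat k' f' x0
  else True.

Lemma smat_near k f g (x0 : R) : (\forall x \near x0, f x = g x) -> smat k f x0 -> smat k g x0.
Proof.
case: k => //= k fg [f' ff' sf']; exists f' => //.
move: fg => /near_join fg; near=> x.
by apply: (@ide_near _ f); near: x.
Unshelve. all: by end_near. Qed.

Lemma smatS k f (x0 : R) : smat k.+1 f x0 -> smat k f x0.
Proof. by elim: k f => //= k IH f [f' ff' /IH sf']; exists f'. Qed.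

Lemma smat_ide k f (x0 : R) : smat k.+1 f x0 -> exists d, is_deriv x0 f d.
Proof. by move=> [f' /nbhs_singleton ff' _]; exists (f' x0). Qed.

Lemma smat_cst k (c x0 : R) : smat k (fun=> c) x0.
Proof.
elim: k c => //= k IH c; exists (fun=> 0) => //.
by near=> x; exact: ide_cst.
Unshelve. all: by end_near. Qed.

Lemma smat_id k (x0 : R) : smat k (fun x => x) x0.
Proof.
case: k => //= k; exists (fun=> 1); last exact: smat_cst.
by near=> x; exact: ide_id.
Unshelve. all: by end_near. Qed.

Lemma smatD k f g (x0 : R) : smat k f x0 -> smat k g x0 -> smat k (fun x => f x + g x) x0.
Proof.
elim: k f g => //= k IH f g [f' ff' sf] [g' gg' sg].
exists (fun x => f' x + g' x); last exact: IH.
by near=> x; apply: ideD; near: x.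
Unshelve. all: by end_near. Qed.

Lemma smatM k f g (x0 : R) : smat k f x0 -> smat k g x0 -> smat k (fun x => f x * g x) x0.
Proof.
elim: k f g => //= k IH f g sf0 sg0.
have [f' ff' sf] := sf0; have [g' gg' sg] := sg0.
exists (fun x => f' x * g x + f x * g' x).
  by near=> x; apply: ideM; near: x.
by apply: smatD; apply: IH => //; exact: smatS.
Unshelve. all: by end_near. Qed.

Lemma smatN k f (x0 : R) : smat k f x0 -> smat k (fun x => - f x) x0.
Proof.
move=> sf; apply: smat_near (smatM (smat_cst k (-1) x0) sf).
by near=> x; rewrite mulN1r.
Unshelve. all: by end_near. Qed.

Lemma smatB k f g (x0 : R) : smat k f x0 -> smat k g x0 -> smat k (fun x => f x - g x) x0.
Proof. by move=> sf sg; apply: smatD => //; exact: smatN. Qed.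

Lemma ide_continuous_at f (x d : R) : is_deriv x f d -> {for x, continuous f}.
Proof.
move=> fd; apply/differentiable_continuous/derivable1_diffP.
exact: (@ex_derive _ _ _ _ _ _ _ fd).
Qed.

Lemma smatV k f (x0 : R) : f x0 != 0 -> smat k f x0 -> smat k (fun x => (f x)^-1) x0.
Proof.
move=> f0; elim: k => //= k IH sf0.
have [f' ff' sf] := sf0.
have cf : {for x0, continuous f} by exact: (ide_continuous_at (nbhs_singleton ff')).
exists (fun x => - f' x / f x ^+ 2).
  near=> x; apply: ideV; last by near: x.
  by near: x; exact: (cvgr_neq0 _ cf f0).
have sV : smat k (fun x => (f x)^-1) x0 by apply: IH; exact: smatS.
apply: smat_near (smatM (smatN sf) (smatM sV sV)).
by near=> x; rewrite expr2 invfM.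
Unshelve. all: by end_near. Qed.

Lemma smat_comp k f g (x0 : R) : smat k f (g x0) -> smat k g x0 -> smat k (fun x => f (g x)) x0.
Proof.
elim: k f g => //= k IH f g [f' ff' sf'] sg0.
have [g' gg' sg'] := sg0.
have cg : {for x0, continuous g} by exact: (ide_continuous_at (nbhs_singleton gg')).
exists (fun x => f' (g x) * g' x); last first.
  by apply: smatM => //; apply: IH => //; exact: smatS.
near=> x; apply: ide_comp; last by near: x.
by near: x; exact: (cg _ ff').
Unshelve. all: by end_near. Qed.

Lemma smat_sincos k (x0 : R) : smat k sin x0 /\ smat k cos x0.
Proof.
elim: k => //= k [IHs IHc]; split.
  by exists cos => //; near=> x; exact: is_derive_sin.
exists (fun x => - sin x); last exact: smatN.
by near=> x; exact: is_derive_cos.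
Unshelve. all: by end_near. Qed.

Lemma smooth1P f : smooth1 f <-> forall k x0, smat k f x0.
Proof.
split=> [sf k x0|sf k t].
  elim: k f sf => //= k IH f sf; exists (derive1 f).
    near=> x; split; first exact: (sf 0%N x).
    by rewrite derive1E.
  by apply: IH => n t; rewrite -derive1Sn; exact: (sf n.+1 t).
elim: k f sf t => [|k IH] f sf t.
  by have [d [df _]] := smat_ide (sf 1%N t).
rewrite derive1Sn; apply: IH => n x0.
have [f' ff' sf'] := sf n.+1 x0.
apply: smat_near sf'; near=> x.
have [df df'] : is_deriv x f (f' x) by near: x.
by rewrite derive1E df'.
Unshelve. all: by end_near. Qed.

Lemma smooth1_ide f : smooth1 f -> forall x, is_deriv x f ((derive1 f) x).
Proof. by move=> sf x; split; [exact: (sf 0%N x)|rewrite derive1E]. Qed.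

Lemma smooth1_derive f : smooth1 f -> smooth1 (derive1 f).
Proof. by move=> sf k t; rewrite -derive1Sn; exact: (sf k.+1 t). Qed.

Lemma smooth1_cont f : smooth1 f -> continuous f.
Proof. by move=> /smooth1_ide /is_derive_cont. Qed.

(** The functions [x ^- n * exp (- 1 / x)], continued by 0, form a family closed under
    differentiation up to linear combinations. Smoothness of [flat_exp], the member [n = 0], is
    therefore one induction for the whole family. *)
Let g (n : nat) (x : R) : R := if x <= 0 then 0 else x^-1 ^+ n * expR (- x^-1).

(** With [y = 1 / x] this is [exp y >= (y / (n + 2)) ^ (n + 2)]. A quadratic bound is what
    differentiability at the origin needs. *)
Let g_bound n (x : R) : `|g n x| <= (n.+2)%:R ^+ n.+2 * x ^+ 2.
Proof.
rewrite /g; case: (lerP x 0) => x0.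
  by rewrite normr0; apply: mulr_ge0; [apply: exprn_ge0; exact: ler0n|exact: sqr_ge0].
have y0 : 0 < x^-1 by rewrite invr_gt0.
rewrite ger0_norm; last by rewrite mulr_ge0 ?expR_ge0 // exprn_ge0 // ltW.
rewrite expRN ler_pdivrMr ?expR_gt0 //.
have H : (x^-1 / n.+2%:R) ^+ n.+2 <= expR x^-1.
  have -> : expR x^-1 = (expR (x^-1 / n.+2%:R)) ^+ n.+2.
    by rewrite -expRM_natl mulrC -mulrA mulVf ?mulr1 // pnatr_eq0.
  apply: lerXn2r; rewrite ?nnegrE ?expR_ge0 //; first by rewrite divr_ge0 // ltW.
  by apply: ltW; apply: le_lt_trans (expR_gt1Dx _); rewrite ?lerDr // gt_eqF // divr_gt0.
move: H; rewrite expr_div_n ler_pdivrMr ?exprn_gt0 // => H.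
have -> : x^-1 ^+ n = x^-1 ^+ n.+2 * x ^+ 2.
  by rewrite -addn2 exprD -mulrA -exprMn mulVf ?gt_eqF // expr1n mulr1.
by rewrite [leRHS]mulrAC; apply: ler_wpM2r; [exact: sqr_ge0|rewrite mulrC].
Qed.

Let g_ide n (x : R) : is_deriv x (g n) (- n%:R * g n.+1 x + g n.+2 x).
Proof.
have [x0|x0|->] := ltrgtP x 0.
- apply: (@ide_near _ (fun=> 0)).
    near=> t; rewrite /g ifT //; apply: ltW; near: t; exact: lt_nbhsl.
  apply: ide_eq (ide_cst _ _) _; rewrite /g ltW //; lra.
- apply: (@ide_near _ (fun t => t^-1 ^+ n * expR (- t^-1))).
    near=> t; rewrite /g ifF //; apply/negbTE; rewrite -ltNge; near: t; exact: lt_nbhsr.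
  have xV : x != 0 by rewrite gt_eqF.
  have dV := ideV xV (ide_id x).
  have dE := @ide_comp _ expR (fun t => - t^-1) x _ _ (is_derive_expR (- x^-1)) (ideN dV).
  have gE m : g m x = x^-1 ^+ m * expR (- x^-1) by rewrite /g ifF // lt_geF.
  rewrite !gE; case: n => [|n].
    have -> : (fun t : R => t^-1 ^+ 0 * expR (- t^-1)) = fun t => expR (- t^-1).
      by apply/funext => t; rewrite expr0 mul1r.
    by apply: (ide_eq dE); rewrite expr2; field.
  apply: (ide_eq (ideM (ideX n dV) dE)).
  by rewrite !mulN1r -exprVn !exprS; ring.
- have -> : - n%:R * g n.+1 0 + g n.+2 0 = 0 by rewrite /g lexx mulr0 addr0.
  (* At the origin the slope is [g n z / z], which tends to 0 by the quadratic bound. *)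
  apply/is_derive1_caratheodory; exists (fun z => g n z / z); split.
  + move=> z; rewrite {2}/g lexx !subr0; have [->|z0] := eqVneq z 0; last by rewrite divfK.
    by rewrite mulr0 /g lexx.
  + have g00 : g n 0 / 0 = 0 by rewrite invr0 mulr0.
    rewrite /prop_for /continuous_at g00; apply/cvgr0Pnorm_lt => e e0; near=> z.
    have [->|z0] := eqVneq z 0; first by rewrite invr0 mulr0 normr0.
    rewrite normrM normfV ltr_pdivrMr ?normr_gt0 //.
    apply: (le_lt_trans (g_bound n z)); rewrite -[z ^+ 2]ger0_norm ?sqr_ge0 // expr2 normrM mulrA.
    rewrite ltr_pM2r ?normr_gt0 // -ltr_pdivlMl ?exprn_gt0 //.
    near: z; apply: (@nbhs0_lt R R^o); rewrite mulr_gt0 // invr_gt0 exprn_gt0.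
  + by rewrite invr0 mulr0.
Unshelve. all: by end_near. Qed.

Let smat_g k n (x0 : R) : smat k (g n) x0.
Proof.
elim: k n => //= k IH n; exists (fun x => - n%:R * g n.+1 x + g n.+2 x).
  by near=> x; exact: g_ide.
by apply: smatD => //; apply: smatM => //; exact: smat_cst.
Unshelve. all: by end_near. Qed.

Definition flat_exp (x : R) : R := if x <= 0 then 0 else expR (- x^-1).

Let flat_expE : flat_exp = g 0%N.
Proof. by apply/funext => x; rewrite /flat_exp /g; case: ifP => // _; rewrite expr0 mul1r. Qed.

Lemma smat_flat_exp k x0 : smat k flat_exp x0.
Proof. by rewrite flat_expE; exact: smat_g. Qed.

Lemma flat_exp_gt0 (x : R) : 0 < x -> 0 < flat_exp x.
Proof. by move=> x0; rewrite /flat_exp lt_geF // expR_gt0. Qed.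

Lemma flat_exp_le0 (x : R) : x <= 0 -> flat_exp x = 0.
Proof. by rewrite /flat_exp => ->. Qed.

Lemma flat_exp_ge0 (x : R) : 0 <= flat_exp x.
Proof. by rewrite /flat_exp; case: ifP => // _; exact: expR_ge0. Qed.

Lemma flat_exp_le1 (x : R) : flat_exp x <= 1.
Proof.
rewrite /flat_exp; case: (leP x 0) => x0; first exact: ler01.
by rewrite -expR0 ler_expR oppr_le0 invr_ge0 ltW.
Qed.

Lemma flat_exp_homo : {homo flat_exp : x y / x <= y}.
Proof.
move=> x y xy; have [x0|x0] := leP x 0; first by rewrite flat_exp_le0 // flat_exp_ge0.
have y0 := lt_le_trans x0 xy.
by rewrite /flat_exp (lt_geF x0) (lt_geF y0) ler_expR lerN2 lef_pV2.
Qed.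

(* Increases with [k] to the indicator of [`]p, q[]. *)
Definition bump (k : nat) (p q x : R) : R :=
  flat_exp (k.+1%:R * (x - p)) * flat_exp (k.+1%:R * (q - x)).

Lemma smooth1_bump k p q : smooth1 (bump k p q).
Proof.
apply/smooth1P => n x0; apply: smatM; apply: smat_comp; try exact: smat_flat_exp.
  by apply: smatM; [exact: smat_cst|apply: smatB; [exact: smat_id|exact: smat_cst]].
by apply: smatM; [exact: smat_cst|apply: smatB; [exact: smat_cst|exact: smat_id]].
Qed.

Lemma bump_ge0 k p q x : 0 <= bump k p q x.
Proof. by rewrite mulr_ge0 // flat_exp_ge0. Qed.

Lemma bump_le1 k p q x : bump k p q x <= 1.
Proof. by rewrite mulr_ile1 // ?flat_exp_ge0 ?flat_exp_le1. Qed.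

Lemma bump_gt0 k p q x : p < x < q -> 0 < bump k p q x.
Proof. by move=> /andP[px xq]; rewrite mulr_gt0 // flat_exp_gt0 // mulr_gt0 ?subr_gt0. Qed.

Lemma bump_out k p q x : ~~ (p < x < q) -> bump k p q x = 0.
Proof.
rewrite negb_and -!leNgt => /orP[H|H]; rewrite /bump.
  by rewrite flat_exp_le0 ?mul0r // pmulr_rle0 ?subr_le0.
by rewrite [X in _ * X]flat_exp_le0 ?mulr0 // pmulr_rle0 ?subr_le0.
Qed.

Lemma bump_nd p q x : nondecreasing_seq (fun k => bump k p q x).
Proof.
move=> m n mn; have [pq|pq] := boolP (p < x < q); last by rewrite !bump_out.
have /andP[px xq] := pq.
by rewrite ler_pM ?flat_exp_ge0 //; apply: flat_exp_homo; rewrite ler_pM2r ?subr_gt0 // ler_nat.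
Qed.

Lemma bump_cvg (p q x : R) : (fun k => bump k p q x) @ \oo --> (((p < x < q)%R)%:R : R).
Proof.
have [pq|pq] := boolP (p < x < q); last first.
  by under eq_fun do rewrite bump_out //; exact: cvg_cst.
have /andP[px xq] := pq; rewrite -[(true)%:R]mulr1 -[1]/(1%:R) .
have H (z : R) : 0 < z -> (fun k : nat => flat_exp (k.+1%:R * z)) @ \oo --> (1:R).
  move=> z0; have -> : (fun k : nat => flat_exp (k.+1%:R * z)) = (fun k => expR (- (z^-1 * harmonic k))).
    apply/funext => k; rewrite /flat_exp lt_geF ?mulr_gt0 //.
    by rewrite invfM mulrC.
  have -> : (1:R) = expR (- (z^-1 * 0)) by rewrite mulr0 oppr0 expR0.
  apply: continuous_cvg; first exact: continuous_expR.
  by apply: cvgN; apply: cvgMr; exact: cvg_harmonic.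
by apply: cvgM; apply: H; rewrite subr_gt0.
Qed.

End Smoothness.

(** * Partial derivatives and test functions *)

Section Partials.
Context {R : realType}.
Implicit Types (f g : R * R -> R) (p q : R * R) (a b : R -> R) (x y t d : R).

Lemma unit_vec0 : unit_vec 0 = (1, 0) :> R * R.
Proof. by rewrite /unit_vec. Qed.

Lemma unit_vec1 : unit_vec 1 = (0, 1) :> R * R.
Proof. by rewrite /unit_vec. Qed.

Lemma is_partial0 f p d :
  is_derive p (unit_vec 0) f d <-> is_deriv p.1 (fun x => f (x, p.2)) d.
Proof.
have E : (fun h : R => h^-1 *: ((f \o shift p) (h *: (unit_vec 0 : R * R)) - f p)) =
    (fun h : R => h^-1 *: (((fun x => f (x, p.2)) \o shift p.1) (h *: (1:R)) - (fun x => f (x, p.2)) p.1)).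
  apply/funext => h; rewrite unit_vec0 /= /shift /=; case: p => x y /=.
  by congr (_ *: (f _ - _)); rewrite /GRing.add /= /add_pair /= /GRing.scale /= /scale_pair /= [h * 0]mulr0 add0r.
split=> -[h1 h2]; split.
- by rewrite /derivable -E; exact: h1.
- by rewrite /derive -E; exact: h2.
- by rewrite /derivable E; exact: h1.
- by rewrite /derive E; exact: h2.
Qed.

Lemma is_partial1 f p d :
  is_derive p (unit_vec 1) f d <-> is_deriv p.2 (fun y => f (p.1, y)) d.
Proof.
have E : (fun h : R => h^-1 *: ((f \o shift p) (h *: (unit_vec 1 : R * R)) - f p)) =
    (fun h : R => h^-1 *: (((fun y => f (p.1, y)) \o shift p.2) (h *: (1:R)) - (fun y => f (p.1, y)) p.2)).
  apply/funext => h; rewrite unit_vec1 /= /shift /=; case: p => x y /=.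
  by congr (_ *: (f _ - _)); rewrite /GRing.add /= /add_pair /= /GRing.scale /= /scale_pair /= [h * 0]mulr0 add0r.
split=> -[h1 h2]; split.
- by rewrite /derivable -E; exact: h1.
- by rewrite /derive -E; exact: h2.
- by rewrite /derivable E; exact: h1.
- by rewrite /derive E; exact: h2.
Qed.

Lemma ord2 (i : 'I_2) : i = 0 \/ i = 1.
Proof. by case: i => [[|[|]]] // H; [left|right]; exact: val_inj. Qed.

Lemma near0_partial f i p : (\forall q \near p, f q = 0) -> is_derive p (unit_vec i) f 0.
Proof.
case: p => x y nf; have [->|->] := ord2 i.
  apply/is_partial0; apply: (ide_near _ (ide_cst 0 x)).
  have c : {for x, continuous (fun h : R => (h, y))} by apply: cont_pair_at; [exact: cont_id|exact: cst_continuous].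
  have : nbhs x [set h | f (h, y) = 0] := c _ nf.
  by apply: filterS => h /= ->.
apply/is_partial1; apply: (ide_near _ (ide_cst 0 y)).
have c : {for y, continuous (fun h : R => (x, h))} by apply: cont_pair_at; [exact: cst_continuous|exact: cont_id].
have : nbhs y [set h | f (x, h) = 0] := c _ nf.
by apply: filterS => h /= ->.
Qed.

Lemma Ck_ide0 k f x y : Ck k.+1 f -> is_deriv x (fun x => f (x, y)) (partial 0 f (x, y)).
Proof. by move=> /(_ 0)[/(_ (x, y)) H _]; apply/(is_partial0 f (x, y)); split. Qed.

Lemma Ck_ide1 k f x y : Ck k.+1 f -> is_deriv y (fun y => f (x, y)) (partial 1 f (x, y)).
Proof. by move=> /(_ 1)[/(_ (x, y)) H _]; apply/(is_partial1 f (x, y)); split. Qed.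

(** No order between [x] and [y] is assumed, and the intermediate point is only located by its
    distance to [x]. In this form it can be chosen as a function of [y], and continuity of [y] at a
    point passes to it. *)
Lemma mean_value a a' x y : (forall t, is_deriv t a (a' t)) ->
  exists2 c, `|c - x| <= `|y - x| & a y - a x = a' c * (y - x).
Proof.
move=> aa'; have ca := is_derive_cont aa'.
have [xy|yx|->] := ltgtP x y.
- have [c] := MVT xy (fun t _ => aa' t) (continuous_subspaceT ca).
  rewrite in_itv /= => /andP[xc cy] ->; exists c => //.
  by rewrite !ger0_norm ?subr_ge0 ?ltW //; lra.
- have [c] := MVT yx (fun t _ => aa' t) (continuous_subspaceT ca).
  rewrite in_itv /= => /andP[xc cy] H; exists c; last by lra.
  by rewrite !ler0_norm ?subr_le0 ?ltW //; lra.
- by exists y; rewrite ?subrr ?mulr0.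
Qed.

(** Chain rule: the increment in the first variable is absorbed by the mean value
    theorem, so that continuity of one partial derivative suffices. *)
Lemma ide_pair f (f0 : R * R -> R) (d : R) (u v : R -> R) t u' v' :
  (forall x y, is_deriv x (fun x => f (x, y)) (f0 (x, y))) ->
  continuous f0 -> is_deriv (v t) (fun y => f (u t, y)) d ->
  is_deriv t u u' -> is_deriv t v v' ->
  is_deriv t (fun t => f (u t, v t)) (f0 (u t, v t) * u' + d * v').
Proof.
move=> ff0 cf0 ff1 uu' vv'.
have /choice[C HC] : forall s, exists c, `|c - u t| <= `|u s - u t| /\
    f (u s, v s) - f (u t, v s) = f0 (c, v s) * (u s - u t).
  by move=> s; have [c] := mean_value (u t) (u s) (fun x => ff0 x (v s)); exists c.
have /is_derive1_caratheodory[U [hU cU Ut]] := uu'.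
have /is_derive1_caratheodory[V [hV cV Vt]] := ide_comp ff1 vv'.
apply/is_derive1_caratheodory; exists (fun s => f0 (C s, v s) * U s + V s); split.
- move=> s; have [_ H] := HC s; rewrite -[LHS](subrKA (f (u t, v s))) H hV hU; ring.
- have cC : {for t, continuous C}.
    have [HCt _] := HC t.
    have Ct : C t = u t by apply/eqP; rewrite -subr_eq0 -normr_le0 (le_trans HCt) // subrr normr0.
    rewrite /prop_for /continuous_at Ct; apply/cvgrPdist_lt => e e0.
    have /cvgrPdist_lt /(_ e e0) := ide_continuous_at uu'.
    apply: filterS => s Hs; rewrite distrC; have [H _] := HC s.
    by apply: le_lt_trans H _; rewrite distrC.
  have cv := ide_continuous_at vv'.
  apply: (@continuousD _ R^o); last exact: cV.
  apply: continuousM; last exact: cU.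
  apply: (@continuous_comp _ _ _ (fun s => (C s, v s)) f0); last exact: cf0.
  exact: (@cont_pair_at _ _ _ C v t cC cv).
- have [HCt _] := HC t.
  have -> : C t = u t by apply/eqP; rewrite -subr_eq0 -normr_le0 (le_trans HCt) // subrr normr0.
  by rewrite Ut Vt.
Qed.

Lemma Ck_ide_pair k f (u v : R -> R) t u' v' : Ck k.+1 f -> continuous (partial 0 f) ->
  is_deriv t u u' -> is_deriv t v v' ->
  is_deriv t (fun t => f (u t, v t))
    (partial 0 f (u t, v t) * u' + partial 1 f (u t, v t) * v').
Proof.
move=> kf c0; apply: (ide_pair (fun x y => Ck_ide0 x y kf) c0).
exact: (Ck_ide1 _ _ kf).
Qed.

Lemma smooth_partial f i : smooth f -> smooth (partial i f).
Proof. by move=> sf k; have [] := sf k.+1 i. Qed.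

Lemma smooth_cont f : smooth f -> continuous f.
Proof. by move=> /(_ 0%N). Qed.

Lemma smooth_ide0 f x y : smooth f -> is_deriv x (fun x => f (x, y)) (partial 0 f (x, y)).
Proof. by move=> /(_ 1%N); exact: Ck_ide0. Qed.

Lemma smooth_ide1 f x y : smooth f -> is_deriv y (fun y => f (x, y)) (partial 1 f (x, y)).
Proof. by move=> /(_ 1%N); exact: Ck_ide1. Qed.

Lemma smooth_chain f (u v : R -> R) t u' v' : smooth f ->
  is_deriv t u u' -> is_deriv t v v' ->
  is_deriv t (fun t => f (u t, v t))
    (partial 0 f (u t, v t) * u' + partial 1 f (u t, v t) * v').
Proof.
move=> sf; apply: (Ck_ide_pair (sf 1%N)).
exact: smooth_cont (smooth_partial _ sf).
Qed.

Lemma smat_pair k f (u v : R -> R) t : smooth f -> smat k u t -> smat k v t ->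
  smat k (fun t => f (u t, v t)) t.
Proof.
elim: k f => //= k IH f sf su0 sv0.
have [u' uu' su] := su0; have [v' vv' sv] := sv0.
exists (fun t => partial 0 f (u t, v t) * u' t + partial 1 f (u t, v t) * v' t).
  by near=> s; apply: smooth_chain => //; near: s.
have IH' i : smat k (fun t => partial i f (u t, v t)) t.
  by apply: IH; [exact: smooth_partial|exact: (@smatS _ k u)|exact: (@smatS _ k v)].
by apply: smatD; apply: smatM.
Unshelve. all: by end_near. Qed.

Lemma Ck_ext k f g : (forall p, f p = g p) -> Ck k f -> Ck k g.
Proof. by move=> /funext ->. Qed.

Lemma is_partial_Ck k f g0 g1 :
  (forall x y, is_deriv x (fun x => f (x, y)) (g0 (x, y))) ->
  (forall x y, is_deriv y (fun y => f (x, y)) (g1 (x, y))) ->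
  Ck k g0 -> Ck k g1 -> Ck k.+1 f.
Proof.
move=> f0 f1 k0 k1 i; have [->|->] := ord2 i.
  have H p : is_derive p (unit_vec 0) f (g0 p).
    by apply/is_partial0; case: p => x y; exact: f0.
  split=> [p|]; first by have [] := H p.
  by apply: Ck_ext k0 => p; have [_ <-] := H p.
have H p : is_derive p (unit_vec 1) f (g1 p).
  by apply/is_partial1; case: p => x y; exact: f1.
split=> [p|]; first by have [] := H p.
by apply: Ck_ext k1 => p; have [_ <-] := H p.
Qed.

Lemma partial0E f x y d : is_deriv x (fun x => f (x, y)) d -> partial 0 f (x, y) = d.
Proof. by move/(is_partial0 f (x, y)) => -[]. Qed.

Lemma partial1E f x y d : is_deriv y (fun y => f (x, y)) d -> partial 1 f (x, y) = d.
Proof. by move/(is_partial1 f (x, y)) => -[]. Qed.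

Lemma smoothD f g : smooth f -> smooth g -> smooth (fun p => f p + g p).
Proof.
move=> sf sg k; elim: k f g sf sg => [|k IH] f g sf sg.
  by apply: contD; exact: smooth_cont.
apply: (@is_partial_Ck _ _ (fun p => partial 0 f p + partial 0 g p)
    (fun p => partial 1 f p + partial 1 g p)).
- by move=> x y; apply: ideD; exact: smooth_ide0.
- by move=> x y; apply: ideD; exact: smooth_ide1.
- by apply: IH; exact: smooth_partial.
- by apply: IH; exact: smooth_partial.
Qed.

Lemma smooth_tensor a b : smooth1 a -> smooth1 b -> smooth (fun p => a p.1 * b p.2).
Proof.
move=> sa sb k; elim: k a b sa sb => [|k IH] a b sa sb.
  apply: contM; apply: cont_comp; try exact: smooth1_cont; first exact: cont_fst.
  exact: cont_snd.
apply: (@is_partial_Ck _ _ (fun p => derive1 a p.1 * b p.2) (fun p => a p.1 * derive1 b p.2)).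
- move=> x y; apply: ide_eq (ideM (smooth1_ide sa x) (ide_cst (b y) x)) _.
  by rewrite /= mulr0 addr0.
- move=> x y; apply: ide_eq (ideM (ide_cst (a x) y) (smooth1_ide sb y)) _.
  by rewrite /= mul0r add0r.
- by apply: IH; [exact: smooth1_derive|exact: sb].
- by apply: IH; [exact: sa|exact: smooth1_derive].
Qed.

Lemma partial0_tensor a b x y : smooth1 a ->
  partial 0 (fun p => a p.1 * b p.2) (x, y) = derive1 a x * b y.
Proof.
move=> sa; apply: partial0E; apply: ide_eq (ideM (smooth1_ide sa x) (ide_cst (b y) x)) _.
by rewrite /= mulr0 addr0.
Qed.

Lemma partial1_tensor a b x y : smooth1 b ->
  partial 1 (fun p => a p.1 * b p.2) (x, y) = a x * derive1 b y.
Proof.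
move=> sb; apply: partial1E; apply: ide_eq (ideM (ide_cst (a x) y) (smooth1_ide sb y)) _.
by rewrite /= mul0r add0r.
Qed.

Lemma compact_box x1 x2 y1 y2 : compact (`[x1, x2] `*` `[y1, y2] : set (R * R)).
Proof. by apply: compact_setX; exact: segment_compact. Qed.

Lemma test_function_tensor (U : set (R * R)) a b x1 x2 y1 y2 :
  smooth1 a -> smooth1 b ->
  (forall x, ~~ (x1 <= x <= x2) -> a x = 0) -> (forall y, ~~ (y1 <= y <= y2) -> b y = 0) ->
  (forall x y, x1 <= x <= x2 -> y1 <= y <= y2 -> U (x, y)) ->
  test_function U (fun p => a p.1 * b p.2).
Proof.
move=> sa sb a0 b0 BU; split; first exact: smooth_tensor.
exists (`[x1, x2] `*` `[y1, y2]); split; first exact: compact_box.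
  by move=> [x y] [/= + +]; rewrite !in_itv /=; exact: BU.
move=> [x y] /= nB; have [Hx|Hx] := boolP (x1 <= x <= x2); last by rewrite a0 // mul0r.
have [Hy|Hy] := boolP (y1 <= y <= y2); last by rewrite b0 // mulr0.
by case: nB; rewrite /= !in_itv.
Qed.

Lemma test_function_support (U : set (R * R)) f : test_function U f ->
  exists2 M, 0 < M & forall x y, ~~ ((- M <= x <= M) && (- M <= y <= M)) -> f (x, y) = 0.
Proof.
move=> [sf [K [cK KU f0]]].
have [M [Mr HM]] := compact_bounded cK.
exists (Num.max 1 (M + 1)); first by rewrite lt_max ltr01.
move=> x y; set N := Num.max _ _ => /negP nB; apply: f0 => Kxy; apply: nB.
have := HM N; rewrite lt_max ltrDl ltr01 orbT => /(_ isT _ Kxy) /=.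
by rewrite prod_normE /= ge_max !ler_norml.
Qed.

End Partials.

(** * Arc length measure *)

Section EuclideanPlane.
Context {R : realType}.
Implicit Types (p q r : R * R) (A B C X : set (R * R)).

Lemma edist_ge0 p q : 0 <= edist p q.
Proof. exact: sqrtr_ge0. Qed.

Lemma sqr_edist p q : edist p q ^+ 2 = (p.1 - q.1) ^+ 2 + (p.2 - q.2) ^+ 2.
Proof. by rewrite sqr_sqrtr // addr_ge0 ?sqr_ge0. Qed.

Lemma edistC p q : edist p q = edist q p.
Proof. by rewrite /edist -[in LHS]sqrrN -[X in _ + X]sqrrN !opprB. Qed.

Lemma edistpp p : edist p p = 0.
Proof. by rewrite /edist !subrr expr0n addr0 sqrtr0. Qed.

Lemma edist_le p q (e : R) : 0 <= e ->
  (edist p q <= e) = ((p.1 - q.1) ^+ 2 + (p.2 - q.2) ^+ 2 <= e ^+ 2).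
Proof. by move=> e0; rewrite -sqr_edist ler_pXn2r // nnegrE ?edist_ge0. Qed.

Lemma edist_triangle q p r : edist p r <= edist p q + edist q r.
Proof.
rewrite edist_le ?addr_ge0 ?edist_ge0 //.
have := sqr_edist p q; have := sqr_edist q r; have := edist_ge0 p q; have := edist_ge0 q r.
move: (edist p q) (edist q r) => u v v0 u0 Ev Eu.
set a := p.1 - q.1 in Eu; set b := p.2 - q.2 in Eu.
set c := q.1 - r.1 in Ev; set d := q.2 - r.2 in Ev.
have -> : p.1 - r.1 = a + c by rewrite /a /c; ring.
have -> : p.2 - r.2 = b + d by rewrite /b /d; ring.
have H : a * c + b * d <= u * v.
  apply: le_trans (ler_norm _) _.
  rewrite -(@ler_pXn2r _ 2) ?nnegrE ?mulr_ge0 // real_normK ?num_real // exprMn Eu Ev.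
  by have := sqr_ge0 (a * d - b * c); nra.
by rewrite sqrrD; nra.
Qed.

Lemma edist_ge_dot p q (a b : R) : a ^+ 2 + b ^+ 2 = 1 ->
  a * (p.1 - q.1) + b * (p.2 - q.2) <= edist p q.
Proof.
move=> ab; apply: le_trans (ler_norm _) _.
rewrite -(@ler_pXn2r _ 2) ?nnegrE ?edist_ge0 // real_normK ?num_real // sqr_edist.
set x := p.1 - q.1; set y := p.2 - q.2.
by have := sqr_ge0 (a * y - b * x); have := sqr_ge0 x; have := sqr_ge0 y; nra.
Qed.

Lemma edist_ge1 p q : `|p.1 - q.1| <= edist p q.
Proof.
rewrite -(@ler_pXn2r _ 2) ?nnegrE ?edist_ge0 // real_normK ?num_real // sqr_edist.
by rewrite lerDl sqr_ge0.
Qed.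

Lemma edist_ge2 p q : `|p.2 - q.2| <= edist p q.
Proof.
rewrite -(@ler_pXn2r _ 2) ?nnegrE ?edist_ge0 // real_normK ?num_real // sqr_edist.
by rewrite lerDr sqr_ge0.
Qed.

Lemma edist_le_sup p q (e : R) : `|p.1 - q.1| <= e -> `|p.2 - q.2| <= e ->
  edist p q <= 2 * e.
Proof.
move=> H1 H2; have e0 : 0 <= e by exact: le_trans (normr_ge0 _) H1.
rewrite edist_le ?mulr_ge0 //.
have S (x : R) : `|x| <= e -> x ^+ 2 <= e ^+ 2.
  by move=> xe; rewrite -[x ^+ 2]real_normK ?num_real // ler_pXn2r ?nnegrE.
by have := S _ H1; have := S _ H2; nra.
Qed.

(** The topology of [R * R] comes from the sup norm. The comparison constant of [edist_le_sup] is 2,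
    so a ball of radius [e / 3] fits. *)
Lemma near_edist p (P : set (R * R)) :
  (\forall q \near p, P q) <-> exists2 e, 0 < e & forall q, edist q p < e -> P q.
Proof.
split=> [/nbhs_ballP[e /= e0 eP]|[e e0 eP]].
  exists e => // q qe; apply: eP; split; rewrite /ball /= distrC.
    by apply: le_lt_trans (edist_ge1 _ _) qe.
  by apply: le_lt_trans (edist_ge2 _ _) qe.
apply/nbhs_ballP; exists (e / 3); first by rewrite /= divr_gt0.
move=> q [/= q1 q2]; apply: eP.
apply: (@le_lt_trans _ _ (2 * (e / 3))); last by lra.
by apply: edist_le_sup; rewrite distrC ltW.
Qed.

Lemma cont_edist (q : R * R) : continuous (fun p => edist p q).
Proof.
move=> p; apply/cvgrPdist_lt => e e0; apply/near_edist; exists e => // r re.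
rewrite ltr_norml; have := edist_triangle p r q; have := edist_triangle r p q.
by rewrite [edist p r]edistC => ? ?; apply/andP; split; lra.
Qed.

Lemma ediam_ge A p q : A p -> A q -> ((edist p q)%:E <= ediam A)%E.
Proof. by move=> Ap Aq; apply: ereal_sup_ubound; right; exists (p, q). Qed.

Lemma ediam_le A (d : R) : 0 <= d -> (forall p q, A p -> A q -> edist p q <= d) ->
  (ediam A <= d%:E)%E.
Proof.
move=> d0 H; apply: ge_ereal_sup => _ [->|[[p q] [/= Ap Aq] <-]]; rewrite lee_fin //.
exact: H.
Qed.

Lemma le_ediam A B : A `<=` B -> (ediam A <= ediam B)%E.
Proof.
move=> AB; apply: ereal_sup_le => _ [->|[[p q] [/= Ap Aq] <-]]; first by left.
by right; exists (p, q) => //; split; exact: AB.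
Qed.

Local Open Scope ereal_scope.

Lemma hausdorff_delta_le (d1 d2 : R) A : (d1 <= d2)%R ->
  hausdorff_delta d2 A <= hausdorff_delta d1 A.
Proof.
move=> d12; apply: ereal_inf_le_tmp => _ [F [dF AF] <-]; exists F => //; split=> // n.
by apply: le_trans (dF n) _; rewrite lee_fin.
Qed.

(** A covering set of diameter at most [d < e] cannot meet both [A] and [B], so every cover of the
    union splits into a cover of each. *)
Lemma hausdorff_delta_metric (d e : R) A B : (d < e)%R ->
  (forall p q, A p -> B q -> (e <= edist p q)%R) ->
  hausdorff_delta d A + hausdorff_delta d B <= hausdorff_delta d (A `|` B).
Proof.
move=> de AB; apply: le_ereal_inf_tmp => _ [F [dF ABF] <-].
pose P C n : set (R * R) := [set p | (exists2 q, F n q & C q) /\ F n p].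
have PF C n : ediam (P C n) <= ediam (F n) by apply: le_ediam => p [].
have cov C : C `<=` A `|` B -> hausdorff_delta d C <= \sum_(n <oo) ediam (P C n).
  move=> CAB; apply: ereal_inf_lbound; exists (P C) => //; split=> [n|p Cp].
    exact: le_trans (PF _ _) (dF n).
  have [n _ Fp] := ABF _ (CAB _ Cp); exists n => //.
  by split=> //; exists p.
apply: le_trans (leeD (cov A _) (cov B _)) _; [by move=> p; left|by move=> p; right|].
rewrite -nneseriesD; [|by move=> *; exact: ediam_ge0|by move=> *; exact: ediam_ge0].
apply: lee_nneseries => [n _ _|n _]; first by rewrite adde_ge0 ?ediam_ge0.
have P0 C : ~ (exists2 q, F n q & C q) -> ediam (P C n) = 0.
  by move=> nC; rewrite (_ : P C n = set0) ?ediam0 // -subset0 => p [].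
have [[p Fp Ap]|/P0 ->] := pselect (exists2 q, F n q & A q); last by rewrite add0e.
have [[q Fq Bq]|/P0 ->] := pselect (exists2 q, F n q & B q); last by rewrite adde0.
have := ediam_ge Fp Fq; move=> /le_trans /(_ (dF n)); rewrite lee_fin => H.
by have := lt_le_trans de (AB _ _ Ap Bq); rewrite ltNge H.
Qed.

(** The two suprema on the left run over independent scales [d1] and [d2]; both are compared at one
    scale below [d1], [d2] and [e]. *)
Lemma hausdorff_metric (e : R) A B : (0 < e)%R ->
  (forall p q, A p -> B q -> (e <= edist p q)%R) ->
  hausdorff A + hausdorff B <= hausdorff (A `|` B).
Proof.
move=> e0 AB.
have H (d1 d2 : R) : (0 < d1)%R -> (0 < d2)%R ->
    hausdorff_delta d1 A + hausdorff_delta d2 B <= hausdorff (A `|` B).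
  move=> d10 d20; pose d := Num.min (Num.min d1 d2) (e / 2)%R.
  have [dd1 dd2 dd3] : [/\ (d <= d1)%R, (d <= d2)%R & (d <= e / 2)%R].
    by rewrite /d !ge_min !lexx ?orbT.
  have d0 : (0 < d)%R by rewrite /d !lt_min d10 d20 divr_gt0.
  apply: le_trans (leeD (hausdorff_delta_le A dd1) (hausdorff_delta_le B dd2)) _.
  apply: (le_trans (@hausdorff_delta_metric d e A B _ AB)); first by lra.
  by apply: ereal_sup_ubound; exists d.
have [Hoo|Hfin] := eqVneq (hausdorff (A `|` B)) +oo; first by rewrite Hoo leey.
have fin C : C `<=` A `|` B -> hausdorff C \is a fin_num.
  move=> CAB; rewrite ge0_fin_numE ?hausdorff_ge0 //.
  by apply: le_lt_trans (le_hausdorff CAB) _; rewrite ltey.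
have fA := fin A (@subsetUl _ _ _); have fB := fin B (@subsetUr _ _ _).
rewrite addeC -leeBrDr //; apply: ge_ereal_sup => _ [d2 d20 <-].
rewrite leeBrDr // addeC.
have fB2 : hausdorff_delta d2 B \is a fin_num.
  rewrite ge0_fin_numE ?hausdorff_delta_ge0 //; apply: (@le_lt_trans _ _ (hausdorff B)).
    by apply: ereal_sup_ubound; exists d2.
  by move: fB; rewrite ge0_fin_numE ?hausdorff_ge0.
rewrite -leeBrDr //; apply: ge_ereal_sup => _ [d1 d10 <-].
by rewrite leeBrDr //; exact: H.
Qed.

(** Caratheodory's criterion for metric outer measures. The parts [X_ n] of [X] at distance at least
    [1 / (n + 1)] from [C] exhaust [X] minus [C]. The layers [R_ n] between them have summable
    measure, so the measures of [X_ n] tend to that of the whole complement. *)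
Lemma closed_cara C : closed C -> (hausdorff_outer R).-caratheodory C.
Proof.
move=> clC; apply: le_caratheodory_measurable => X; rewrite /hausdorff_outer /=.
have [Hoo|Hfin] := eqVneq (hausdorff X) +oo; first by rewrite Hoo leey.
have fin Y : Y `<=` X -> hausdorff Y \is a fin_num.
  move=> YX; rewrite ge0_fin_numE ?hausdorff_ge0 //.
  by apply: le_lt_trans (le_hausdorff YX) _; rewrite ltey.
pose X_ n := [set x | X x /\ forall c, C c -> (n.+1%:R^-1 <= edist x c)%R].
pose R_ n := X_ n.+1 `\` X_ n.
have X_X n : X_ n `<=` X by move=> x [].
have R_X n : R_ n `<=` X by move=> x [/X_X].
have X_homo m n : (m <= n)%N -> X_ m `<=` X_ n.
  move=> mn x [Xx Hx]; split=> // c /Hx; apply: le_trans.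
  by rewrite lef_pV2 ?posrE // ler_nat.
(* A point of [R_ n.+1] is closer than [1 / (n + 2)] to [C], a point of [X_ n] at least
   [1 / (n + 1)] away; consecutive layers would not be separated. *)
have sep n : hausdorff (X_ n) + hausdorff (R_ n.+1) <= hausdorff (X_ n.+2).
  apply: (@le_trans _ _ (hausdorff (X_ n `|` R_ n.+1))); last first.
    by apply: le_hausdorff => x [|[]//]; apply: X_homo; rewrite -addn2 leq_addr.
  have e0 : (0 < n.+1%:R^-1 - n.+2%:R^-1 :> R)%R.
    by rewrite subr_gt0 ltf_pV2 ?posrE // ltr_nat.
  apply: (hausdorff_metric e0) => p q [Xp Hp] [[Xq _] /not_andP[//|]].
  move=> /existsNP[c /not_implyP[Cc /negP]]; rewrite -ltNge => Hq.
  have := edist_triangle q p c; have := Hp c Cc.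
  by move: Hq; move: (n.+1%:R^-1)%R (n.+2%:R^-1)%R => u v; lra.
pose a n : R := fine (hausdorff (X_ n)).
pose r n : R := fine (hausdorff (R_ n)).
have aE n : (a n)%:E = hausdorff (X_ n) by rewrite fineK // fin.
have rE n : (r n)%:E = hausdorff (R_ n) by rewrite fineK // fin.
have ra n : (r n.+1 <= a n.+2 - a n)%R.
  by have := sep n; rewrite -!aE -rE -EFinD lee_fin; lra.
have a_nd : nondecreasing_seq a.
  by move=> m n mn; rewrite -lee_fin !aE; apply: le_hausdorff; exact: X_homo.
have a_ub n : (a n <= fine (hausdorff X))%R.
  by rewrite -lee_fin aE fineK ?fin //; apply: le_hausdorff.
have a_cvg : cvgn a.
  apply: nondecreasing_is_cvgn => //; exists (fine (hausdorff X)) => _ [n _ <-]; exact: a_ub.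
set l := limn a.
have al n : (a n <= l)%R by exact: nondecreasing_cvgn_le.
have a_l : a @ \oo --> l by [].
clearbody l a r.
(* The bounds on the layers telescope in steps of two, which leaves two final and two initial
   terms. *)
have sumr n N : (\sum_(0 <= k < N) r (n.+1 + k)%N <= a (n + N)%N + a (n + N).+1 - a n - a n.+1)%R.
  elim: N => [|N IH]; first by rewrite big_geq // addn0; lra.
  rewrite big_nat_recr //= addSn addnS; have := ra (n + N)%N; move: IH.
  by move: (\sum_(0 <= k < N) _)%R (a _) (a _) (a _) (a _) (r _) => *; lra.
have tail n : hausdorff (X `&` ~` C) <= (a n.+1 + 2 * (l - a n))%:E.
  pose F k := if k is k'.+1 then R_ (n.+1 + k')%N else X_ n.+1.
  have cov : X `&` ~` C `<=` \bigcup_k F k.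
    move=> x [Xx nCx].
    have [m Hm] : exists m, X_ m x.
      have /near_edist[e e0 He] : \forall y \near x, ~ C y.
        by apply: open_nbhs_nbhs; split=> //; exact: closed_openC.
      exists (Num.truncn e^-1); split=> // c Cc.
      rewrite leNgt; apply/negP => Hlt; apply: (He c) => //; rewrite edistC.
      apply: (lt_le_trans Hlt); rewrite -[leRHS]invrK lef_pV2 ?posrE ?invr_gt0 //.
      by apply: ltW; exact: truncnS_gt.
    have [Hn|Hn] := pselect (X_ n.+1 x); first by exists 0%N.
    have nm : (n.+1 < m)%N.
      by rewrite ltnNge; apply/negP => mn; apply: Hn; exact: X_homo Hm.
    have [k [nk Hk nHk]] : exists k, [/\ (n.+1 <= k)%N, X_ k.+1 x & ~ X_ k x].
      elim: m nm Hm => // m IH; rewrite ltnS leq_eqVlt => /predU1P[<-|nm] Hm.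
        by exists n.+1.
      by have [/(IH nm)//|Hm'] := pselect (X_ m x); exists m; split=> //; exact: ltnW.
    by exists (k - n.+1).+1 => //=; rewrite subnKC.
  apply: (le_trans (le_hausdorff cov)).
  apply: (le_trans (outer_measure_sigma_subadditive (hausdorff_outer R) F)).
  apply: lime_le; first by apply: is_cvg_nneseries => k _ _; exact: hausdorff_ge0.
  apply: nearW => -[|N].
    rewrite big_geq // lee_fin; have := al n; have := hausdorff_ge0 (X_ n.+1).
    by rewrite -aE lee_fin; lra.
  rewrite big_nat_recl //= /hausdorff_outer /= -aE.
  under eq_bigr do rewrite -rE.
  rewrite sumEFin -EFinD lee_fin; have := sumr n N.
  have := al (n + N)%N; have := al (n + N).+1; have := a_nd n n.+1 (leqnSn n); lra.
have lim_tail : hausdorff (X `&` ~` C) <= l%:E.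
  apply/lee_addgt0Pr => e e0.
  have /cvgrPdist_lt /(_ _ (divr_gt0 e0 (@ltr0Sn R 1))) [N _ HN] := a_l.
  have := HN N (leqnn N) => /= HN'.
  apply: (le_trans (tail N)); rewrite -EFinD lee_fin.
  have := al N; have := al N.+1; move: HN'; rewrite ltr_norml => /andP[]; lra.
have HXC n : hausdorff (X `&` C) + (a n)%:E <= hausdorff X.
  rewrite aE; apply: (@le_trans _ _ (hausdorff ((X `&` C) `|` X_ n))); last first.
    by apply: le_hausdorff => x [[]|[]].
  have e0 : (0 < n.+1%:R^-1 :> R)%R by rewrite invr_gt0.
  by apply: (hausdorff_metric e0) => p q [Xp Cp] [Xq Hq]; rewrite edistC; exact: Hq.
apply: le_trans (leeD (lexx _) lim_tail) _.
have fXC : hausdorff (X `&` C) \is a fin_num by apply: fin => x [].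
rewrite -(fineK fXC) -(fineK (fin X (@subset_refl _ X))) -EFinD lee_fin.
rewrite -lerBrDl -(cvg_lim _ a_l) //; apply: limr_le => //; near=> n.
by have := HXC n; rewrite -{1}(fineK fXC) -{1}(fineK (fin X (@subset_refl _ X))) -EFinD lee_fin; lra.
Unshelve. all: by end_near. Qed.

End EuclideanPlane.

Section Cousin.
Context {R : realType}.

(** Cousin's lemma: the supremum of the [b] with [P l b] is attained, and cannot lie below [u] since
    the local hypothesis would carry [P] beyond it. It compares integrals along the boundary with
    integrals over the parameter without handling partitions. *)
Lemma interval_induction (P : R -> R -> Prop) (l u : R) : l <= u ->
  (forall a b c, l <= a -> a <= b -> b <= c -> c <= u -> P a b -> P b c -> P a c) ->
  (forall x, l <= x <= u -> exists2 d, 0 < d & forall a b, l <= a -> a <= x -> x <= b -> b <= u ->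
     b - a < d -> P a b) ->
  P l u.
Proof.
move=> lu Padd Ploc.
pose S := [set b | l <= b <= u /\ P l b].
have Sl : S l.
  have [|d d0 H] := Ploc l; first by rewrite lexx.
  by split; [rewrite lexx|apply: H; rewrite ?lexx // subrr].
have ubS : has_ubound S by exists u => b [/andP[]].
have ls : l <= sup S by exact: ub_le_sup.
have su : sup S <= u by apply: ge_sup; [exists l|move=> b [/andP[]]].
have lsu : l <= sup S <= u by rewrite ls su.
have [d d0 H] := Ploc _ lsu.
have [b [/andP[lb bu] Pb] sb] : exists2 b, S b & sup S - d / 2 < b.
  by apply: sup_adherent; [exact: divr_gt0|split=> //; exists l].
have bs : b <= sup S by apply: ub_le_sup => //; split=> //; rewrite lb bu.
pose c := Num.min u (sup S + d / 4).
have cu : c <= u by rewrite /c ge_min lexx.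
have sc : sup S <= c by rewrite /c le_min su; lra.
have cd : c <= sup S + d / 4 by rewrite /c ge_min lexx orbT.
have Pc : P l c.
  apply: (Padd l b c) => //; [exact: le_trans sc|].
  by apply: H => //; lra.
have cs : c <= sup S.
  by apply: ub_le_sup => //; split=> //; rewrite cu (le_trans ls).
have [uc|uc] := leP u c; first by have -> : u = c by lra.
by move: uc cs; rewrite /c gt_min ltxx /=; case: leP => //; lra.
Qed.

End Cousin.

(** * Hausdorff measure of arcs *)

Section Arcs.
Context {R : realType}.
Notation mu := (@lebesgue_measure R).
Variables (gx gy tx ty : R -> R).
Hypothesis (dgx : forall s, is_deriv s gx (tx s)).
Hypothesis (dgy : forall s, is_deriv s gy (ty s)).
Hypothesis (unit_t : forall s, tx s ^+ 2 + ty s ^+ 2 = 1).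

Definition curve_arc (a b : R) : set (R * R) := [set (gx s, gy s) | s in `[a, b[].

(** Project the curve on the direction of the chord: the mean value theorem bounds the square of the
    chord by its length times [|s - s'|], because the tangent is a unit vector. *)
Lemma curve_lipschitz s s' : edist (gx s, gy s) (gx s', gy s') <= `|s - s'|.
Proof.
set p := (gx s, gy s); set q := (gx s', gy s').
have d0 := edist_ge0 p q.
have [->|dn0] := eqVneq (edist p q) 0; first exact: normr_ge0.
have dp : 0 < edist p q by rewrite lt_neqAle eq_sym dn0.
have H u : is_deriv u (fun u => (p.1 - q.1) * gx u + (p.2 - q.2) * gy u)
    ((p.1 - q.1) * tx u + (p.2 - q.2) * ty u).
  apply: (ide_eq (ideD (ideM (ide_cst (p.1 - q.1) _) (dgx u)) (ideM (ide_cst (p.2 - q.2) _) (dgy u)))).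
  by rewrite !mul0r !add0r.
have [c _ Hc] := mean_value s' s H.
have E : edist p q ^+ 2 = ((p.1 - q.1) * tx c + (p.2 - q.2) * ty c) * (s - s').
  by rewrite -Hc sqr_edist /=; ring.
have F : `|(p.1 - q.1) * tx c + (p.2 - q.2) * ty c| <= edist p q.
  rewrite ler_norml; apply/andP; split.
    have := @edist_ge_dot _ p q (- tx c) (- ty c); rewrite !sqrrN unit_t => /(_ erefl); lra.
  by have := @edist_ge_dot _ p q (tx c) (ty c) (unit_t c); lra.
rewrite -(ler_pM2l dp) -expr2 E; apply: le_trans (ler_norm _) _.
by rewrite normrM ler_wpM2r.
Qed.

(** Cut the parameter interval into [N] pieces of length [h <= d]; each piece of the curve has
    diameter at most [h]. The cover is completed by empty sets. *)
Lemma hausdorff_arc_le (a b : R) : a <= b -> (hausdorff (curve_arc a b) <= (b - a)%:E)%E.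
Proof.
move=> ab; apply: ge_ereal_sup => _ [d d0 <-].
pose N := (Num.truncn ((b - a) / d)).+1.
pose h := (b - a) / N%:R.
have h0 : 0 <= h by rewrite divr_ge0 // subr_ge0.
have hd : h <= d.
  rewrite /h ler_pdivrMr // mulrC -ler_pdivrMr //; apply: ltW; exact: truncnS_gt.
have hN : h * N%:R = b - a by rewrite /h divfK // pnatr_eq0.
pose F n := if (n < N)%N then [set (gx s, gy s) | s in `[a + n%:R * h, a + n.+1%:R * h]] else set0.
have dF n : (ediam (F n) <= (if (n < N)%N then h else 0)%:E)%E.
  rewrite /F; case: ifP => _; last by rewrite ediam0.
  apply: ediam_le => // _ _ [s /= + <-] [s' /= + <-].
  rewrite !in_itv /= -!natr1 => /andP[s1 s2] /andP[s3 s4].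
  by apply: le_trans (curve_lipschitz s s') _; rewrite ler_norml; apply/andP; split; lra.
have FA : curve_arc a b `<=` \bigcup_n F n.
  move=> _ [s /= + <-]; rewrite in_itv /= => /andP[s1 s2].
  have hp : 0 < h by rewrite divr_gt0 // subr_gt0; lra.
  pose n := Num.truncn ((s - a) / h).
  have sah : 0 <= (s - a) / h by rewrite divr_ge0 // subr_ge0.
  have /andP[n1 n2] := truncn_itv sah.
  exists n => //; rewrite /F.
  have nN : (n < N)%N.
    rewrite -(ltr_nat R); apply: (le_lt_trans n1); rewrite ltr_pdivrMr // mulrC hN; lra.
  rewrite nN; exists s => //=; rewrite in_itv /=.
  by move: n1 n2; rewrite ler_pdivlMr // ltr_pdivrMr // => n1 n2; apply/andP; split; lra.
apply: (@le_trans _ _ (\sum_(n <oo) ediam (F n))%E).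
  apply: ereal_inf_lbound; exists F => //; split=> // n.
  by apply: le_trans (dF n) _; rewrite lee_fin; case: ifP => // _; exact: ltW.
apply: lime_le; first by apply: is_cvg_nneseries => k _ _; exact: ediam_ge0.
apply: nearW => M; apply: (@le_trans _ _ (\sum_(0 <= n < M) (if (n < N)%N then h else 0)%:E)%E).
  exact: lee_sum.
rewrite sumEFin lee_fin -hN.
have H : \sum_(0 <= n < M) (if (n < N)%N then h else 0) <= h * (minn M N)%:R.
  elim: M => [|M IH]; first by rewrite big_geq // min0n mulr0.
  rewrite big_nat_recr //=; case: (ltnP M N) => MN.
    by move: IH; rewrite (minn_idPl (ltnW MN)) (minn_idPl MN) -natr1 mulrDr; lra.
  by move: IH; rewrite (minn_idPr MN) (minn_idPr (leqW MN)); lra.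
by apply: (le_trans H); rewrite ler_wpM2l // ler_nat geq_minr.
Qed.

(** Projection on the direction [(v, w)] does not increase distances, so a cover of the arc projects
    to a cover of an interval of length at least [c * (b - a)]. Subadditivity of Lebesgue measure
    concludes. *)
Lemma hausdorff_arc_ge (a b v w c : R) : a <= b -> 0 <= c -> v ^+ 2 + w ^+ 2 = 1 ->
  (forall u, a <= u <= b -> c <= tx u * v + ty u * w) ->
  ((c * (b - a))%:E <= hausdorff (curve_arc a b))%E.
Proof.
move=> ab c0 vw Hc.
pose pj (p : R * R) := p.1 * v + p.2 * w.
have pj_le p q : pj p - pj q <= edist p q.
  by apply: le_trans (edist_ge_dot p q vw); rewrite /pj; lra.
pose g u := gx u * v + gy u * w.
have dg u : is_deriv u g (tx u * v + ty u * w).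
  apply: (ide_eq (ideD (ideM (dgx u) (ide_cst v u)) (ideM (dgy u) (ide_cst w u)))).
  by rewrite !mulr0 !addr0.
have cg := is_derive_cont dg.
have gab : c * (b - a) <= g b - g a.
  have [ab'|ba|<-] := ltgtP a b; last by rewrite !subrr mulr0.
    have [e] := MVT ab' (fun t _ => dg t) (continuous_subspaceT cg).
    rewrite in_itv /= => /andP[ae eb] ->; apply: ler_wpM2r; first by rewrite subr_ge0.
    by apply: Hc; rewrite !ltW.
  by move: ab; rewrite leNgt ba.
apply: (@le_trans _ _ (hausdorff_delta 1 (curve_arc a b))); last first.
  by apply: ereal_sup_ubound; exists 1 => //=.
apply: le_ereal_inf_tmp => _ [F [dF AF] <-].
apply: (@le_trans _ _ (mu `[g a, g b[)).
  rewrite lebesgue_measure_itv /= lte_fin; case: ltP => [_|H]; first by rewrite -EFinD lee_fin.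
  by rewrite lee_fin; lra.
have dfin n : ediam (F n) \is a fin_num.
  by rewrite ge0_fin_numE ?ediam_ge0 // (le_lt_trans (dF n)) // ltry.
pose d n := fine (ediam (F n)).
have dE n : (d n)%:E = ediam (F n) by rewrite fineK.
have d0 n : 0 <= d n by rewrite -lee_fin dE ediam_ge0.
(* The projection of [F n] lies in the interval of length [d n] that starts at [m n]. *)
pose m n := inf [set pj p | p in F n].
have mF n p : F n p -> m n <= pj p <= m n + d n.
  move=> Fp; have lb : lbound [set pj p | p in F n] (pj p - d n).
    move=> _ [q Fq <-]; rewrite lerBlDr -lerBlDl; apply: le_trans (pj_le p q) _.
    by rewrite -lee_fin dE; exact: ediam_ge.
  apply/andP; split.
    by apply: ge_inf; [exists (pj p - d n)|exists p].
  by rewrite -lerBlDr; apply: lb_le_inf => //; exists (pj p), p.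
apply: (@le_trans _ _ (\sum_(n <oo) mu (`[m n, (m n + d n)%R]%classic : set R))%E); last first.
  apply: lee_nneseries => // n _; rewrite -dE lebesgue_measure_itv /= lte_fin.
  by case: ifP => _; [rewrite -EFinD lee_fin; lra|rewrite lee_fin; exact: d0].
apply: measure_sigma_subadditive => //.
move=> z /=; rewrite in_itv /= => /andP[z1 z2].
have [u] : exists2 u, u \in `[a, b] & g u = z.
  apply: (IVT ab (continuous_subspaceT cg)).
  by rewrite min_l ?max_r ?z1 ?(ltW z2) //; lra.
rewrite in_itv /= => /andP[au ub] guz.
have ub' : u < b by rewrite lt_neqAle ub andbT; apply: contraTneq z2 => <-; rewrite guz ltxx.
have [n _ Fn] : (\bigcup_n F n) (gx u, gy u) by apply: AF; exists u => //=; rewrite in_itv /= au.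
exists n => //=; rewrite in_itv /= -guz; exact: (mF n _ Fn).
Qed.

End Arcs.

Definition segment_closed (R : realType) (Omega : set (R * R)) := forall p q (t : R),
  Omega p -> Omega q -> 0 <= t <= 1 -> Omega (p.1 + t * (q.1 - p.1), p.2 + t * (q.2 - p.2)).

(** Counterclockwise arc length parametrization [(gx, gy)] of the boundary, [ang]
    being the angle of its tangent. *)
Record convex_curve (R : realType) (Omega : set (R * R)) := ConvexCurve {
  len : R; gx : R -> R; gy : R -> R; ang : R -> R;
  len_gt0 : 0 < len;
  dgx_ang : forall s, is_deriv s gx (cos (ang s));
  dgy_ang : forall s, is_deriv s gy (sin (ang s));
  smooth_ang : smooth1 ang;
  ang_per : forall s, ang (s + len) = ang s + 2 * pi;
  dang_ge0 : forall s, 0 <= derive1 ang s;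
  gx_per : forall s, gx (s + len) = gx s;
  gy_per : forall s, gy (s + len) = gy s;
  boundary_curve : boundary Omega = [set (gx s, gy s) | s in `[0, len[];
  curve_inj : forall s s', 0 <= s < len -> 0 <= s' < len ->
    gx s = gx s' -> gy s = gy s' -> s = s';
  support_ang : forall q s, Omega q ->
    (q.1 - gx s) * sin (ang s) - (q.2 - gy s) * cos (ang s) < 0;
  curvature_dang : forall s, curvature Omega (gx s, gy s) = derive1 ang s
}.

Section TangentFrame.
Context {R : realType} (Omega : set (R * R)) (c : convex_curve Omega).

Definition tx (s : R) : R := cos (ang c s).
Definition ty (s : R) : R := sin (ang c s).
Definition ka (s : R) : R := derive1 (ang c) s.

Lemma dgx s : is_deriv s (gx c) (tx s). Proof. exact: dgx_ang. Qed.

Lemma dgy s : is_deriv s (gy c) (ty s). Proof. exact: dgy_ang. Qed.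

Lemma support_lt q s : Omega q -> (q.1 - gx c s) * ty s - (q.2 - gy c s) * tx s < 0.
Proof. exact: support_ang. Qed.

Lemma dang s : is_deriv s (ang c) (ka s).
Proof. by apply: smooth1_ide; exact: smooth_ang. Qed.

Lemma dtx s : is_deriv s tx (- ka s * ty s).
Proof. by apply: (ide_eq (ide_comp (is_derive_cos (ang c s)) (dang s))); rewrite /ty; ring. Qed.

Lemma dty s : is_deriv s ty (ka s * tx s).
Proof. by apply: (ide_eq (ide_comp (is_derive_sin (ang c s)) (dang s))); rewrite /tx; ring. Qed.

Lemma smooth_ka : smooth1 ka.
Proof. by apply: smooth1_derive; exact: smooth_ang. Qed.

Lemma cont_ka : continuous ka.
Proof. by apply: smooth1_cont; exact: smooth_ka. Qed.

Lemma ka_ge0 s : 0 <= ka s. Proof. exact: dang_ge0. Qed.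

Lemma unit_t s : tx s ^+ 2 + ty s ^+ 2 = 1.
Proof. exact: cos2Dsin2. Qed.

Lemma int_ka : \int[@lebesgue_measure R]_(s in `[0, len c]) ka s = 2 * pi.
Proof.
rewrite (FTC (ltW (len_gt0 c)) cont_ka dang) -{1}[len c]add0r ang_per; ring.
Qed.

Lemma curvature_ka s : curvature Omega (gx c s, gy c s) = ka s.
Proof. exact: curvature_dang. Qed.

End TangentFrame.

Section IntegralBounds.
Context d (T : measurableType d) (R : realType) (mu : {measure set T -> \bar R}).
Variables (D : set T) (f : T -> R) (c : R).
Hypotheses (mD : measurable D) (mf : measurable_fun D f).

Lemma integral_le_cst : (forall x, D x -> 0 <= f x <= c) ->
  (\int[mu]_(x in D) (f x)%:E <= c%:E * mu D)%E.
Proof.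
move=> fc; rewrite -(integral_cst mu mD c%:E); apply: ge0_le_integral => //.
- by move=> x /fc /andP[? _]; rewrite lee_fin.
- exact/measurable_EFinP.
- by move=> x /fc /andP[_ ?]; rewrite lee_fin.
Qed.

Lemma integral_ge_cst : 0 <= c -> (forall x, D x -> c <= f x) ->
  (c%:E * mu D <= \int[mu]_(x in D) (f x)%:E)%E.
Proof.
move=> c0 fc; rewrite -(integral_cst mu mD c%:E); apply: ge0_le_integral => //.
by apply/measurable_EFinP.
Qed.

End IntegralBounds.

(** * Integration over the boundary *)

Section BoundaryIntegral.
Context {R : realType} (Omega : set (R * R)) (K : convex_curve Omega).
Notation mu := (@lebesgue_measure R).
Notation H1 := (@arclength R).
Notation L := (len K).
Notation gx := (gx K).
Notation gy := (gy K).
Notation tx := (tx K).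
Notation ty := (ty K).
Notation arc := (curve_arc gx gy).
Implicit Types (a b c e x s u : R).

Lemma cont_cgx : continuous gx. Proof. exact: is_derive_cont (dgx K). Qed.
Lemma cont_cgy : continuous gy. Proof. exact: is_derive_cont (dgy K). Qed.
Lemma cont_ctx : continuous tx. Proof. exact: is_derive_cont (dtx K). Qed.
Lemma cont_cty : continuous ty. Proof. exact: is_derive_cont (dty K). Qed.

(** The sublevel condition serves twice: a constant [phi] gives closed arcs, a general one the
    measurability of functions on the boundary. *)
Lemma closed_curve_image (a b : R) (phi : R -> R) (c : R) : continuous phi ->
  closed [set (gx s, gy s) | s in `[a, b] `&` [set s | phi s <= c]].
Proof.
move=> cphi; apply: compact_closed; first exact: norm_hausdorff.
apply: continuous_compact.
  apply: continuous_subspaceT; apply: cont_pair; [exact: cont_cgx|exact: cont_cgy].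
apply: (subclosed_compact _ (@segment_compact _ a b)); last by move=> s [].
apply: closedI; first exact: itv_closed.
by apply: (@closed_comp _ _ phi [set x | x <= c]) => [x _|]; [exact: cphi|exact: closed_le].
Qed.

(** A half-open arc is a closed arc minus its end point. The end point must not be attained earlier,
    in particular not at [a]; hence the condition that the arc is shorter than a full turn. *)
Lemma cara_arc (a b : R) : 0 <= a -> a <= b -> b <= L -> b - a < L ->
  measurable (arc a b : set (caratheodory_type (hausdorff_outer R))).
Proof.
move=> a0 ab bL baL.
have [->|ab'] := eqVneq a b.
  rewrite (_ : arc b b = set0) // -subset0 => p [s /=].
  by rewrite in_itv /= => /andP[h1 h2]; have := le_lt_trans h1 h2; rewrite ltxx.
have {}ab : a < b by rewrite lt_neqAle ab'.
have -> : arc a b = [set (gx s, gy s) | s in `[a, b] `&` [set s : R | (fun=> 0 : R) s <= 0]]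
    `\` [set (gx s, gy s) | s in `[b, b] `&` [set s : R | (fun=> 0 : R) s <= 0]].
  apply/seteqP; split=> [_ [s /= + <-]|_ [[s [/= + _] <-] nb]]; rewrite in_itv /=.
    move=> /andP[as_ sb]; split; first by exists s => //; split=> //; rewrite in_itv /= as_ (ltW sb).
    move=> [u [/= + _] [gxu gyu]]; rewrite in_itv /= -eq_le => /eqP bu.
    move: gxu gyu; rewrite -bu => gxu gyu.
    have [bL'|bL'] := ltP b L.
      have : b = s by apply: (curve_inj (c := K)) => //; apply/andP; split; lra.
      lra.
    have E : b = 0 + L by lra.
    have : 0 = s.
      apply: (curve_inj (c := K)); first by rewrite lexx len_gt0.
      + by apply/andP; split; lra.
      + by rewrite -(gx_per K) -E.
      + by rewrite -(gy_per K) -E.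
    lra.
  move=> /andP[as_ sb]; exists s => //=; rewrite in_itv /= as_ lt_neqAle sb andbT.
  apply/eqP => sbE; apply: nb; exists s; rewrite ?sbE //; split=> //; rewrite /= in_itv /= lexx //.
by apply: measurableD; apply: closed_cara; apply: closed_curve_image; exact: cont_cst.
Qed.

Lemma cara_boundary : measurable (boundary Omega : set (caratheodory_type (hausdorff_outer R))).
Proof.
rewrite (boundary_curve K); have L0 := len_gt0 K.
have -> : [set (gx s, gy s) | s in `[0, L[] = arc 0 (L / 2) `|` arc (L / 2) L.
  apply/seteqP; split=> [_ [s /= + <-]|_ [|] [s /= + <-]]; rewrite in_itv /= => /andP[s1 s2].
  - have [h|h] := ltP s (L / 2); first by left; exists s => //=; rewrite in_itv /= s1 h.
    by right; exists s => //=; rewrite in_itv /= s2 h.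
  - by exists s => //=; rewrite in_itv /=; apply/andP; split; lra.
  - by exists s => //=; rewrite in_itv /=; apply/andP; split; lra.
by apply: measurableU; apply: cara_arc; lra.
Qed.

Variables (f : R * R -> R) (phi : R -> R).
Hypothesis cphi : continuous phi.
Hypothesis fphi : forall s, f (gx s, gy s) = phi s.

Lemma cara_measurable_fun :
  measurable_fun (boundary Omega : set (caratheodory_type (hausdorff_outer R))) f.
Proof.
move=> mB; apply: (measurability _ (RGenOInfty.measurableE R)) => //.
move=> _ [_ [a ->] <-].
have -> : boundary Omega `&` f @^-1` `]a, +oo[ =
    boundary Omega `\` [set (gx s, gy s) | s in `[0, L] `&` [set s | phi s <= a]].
  apply/seteqP; split=> [p [Bp /=]|p [Bp np]]; rewrite ?in_itv /= ?andbT.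
    move=> afp; split=> // -[s [/= _ sa] ps]; move: afp; rewrite -ps fphi; lra.
  split=> //=; rewrite in_itv /= andbT ltNge; apply/negP => fpa; apply: np.
  move: Bp; rewrite (boundary_curve K) => -[s /= + ps]; rewrite in_itv /= => /andP[s1 s2].
  by exists s => //; split; [rewrite /= in_itv /= s1 ltW|rewrite /= -fphi ps].
by apply: measurableD => //; apply: closed_cara; exact: closed_curve_image.
Qed.

Hypothesis f_ge0 : forall s, 0 <= phi s.

(** The error is proportional to the length of the interval, so the estimate adds up over adjacent
    arcs as [interval_induction] demands. *)
Let arc_spec (e a b : R) :=
  [/\ measurable (arc a b : set (caratheodory_type (hausdorff_outer R))),
      (\int[H1]_(p in arc a b) (f p)%:E \is a fin_num)%E &
      `|fine (\int[H1]_(p in arc a b) (f p)%:E)%E - \int[mu]_(s in `[a, b]) phi s| <= e * (b - a)].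

Let mf_arc (a b : R) : 0 <= a -> b <= L ->
  measurable_fun (arc a b : set (caratheodory_type (hausdorff_outer R))) f.
Proof.
move=> a0 bL; apply: measurable_funS cara_measurable_fun; first exact: cara_boundary.
rewrite (boundary_curve K) => _ [s /= + <-]; rewrite in_itv /= => /andP[? ?].
by exists s => //=; rewrite in_itv /=; apply/andP; split; lra.
Qed.

Let arc_spec_add (e a b c : R) : 0 <= a -> a <= b -> b <= c -> c <= L ->
  arc_spec e a b -> arc_spec e b c -> arc_spec e a c.
Proof.
move=> a0 ab bc cL [m1 f1 e1] [m2 f2 e2].
have E : arc a c = arc a b `|` arc b c.
  apply/seteqP; split=> [_ [s /= + <-]|_ [|] [s /= + <-]]; rewrite in_itv /= => /andP[s1 s2].
  - have [h|h] := ltP s b; first by left; exists s => //=; rewrite in_itv /= s1 h.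
    by right; exists s => //=; rewrite in_itv /= s2 h.
  - by exists s => //=; rewrite in_itv /=; apply/andP; split; lra.
  - by exists s => //=; rewrite in_itv /=; apply/andP; split; lra.
have I : (\int[H1]_(p in arc a c) (f p)%:E =
    \int[H1]_(p in arc a b) (f p)%:E + \int[H1]_(p in arc b c) (f p)%:E)%E.
  rewrite E; apply: (@ge0_integral_setU _ _ _ H1 _ _ m1 m2 (fun p => (f p)%:E)).
  - rewrite -E; apply/measurable_EFinP; exact: mf_arc.
  - by move=> _ [|] [s _ <-]; rewrite lee_fin fphi; exact: f_ge0.
  - apply/disj_set2P; rewrite -subset0 => _ [[s /= + <-] [u /= + [gxu gyu]]].
    rewrite !in_itv /= => /andP[s1 s2] /andP[u1 u2].
    have : u = s by apply: (curve_inj (c := K)) => //; apply/andP; split; lra.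
    lra.
split; first by rewrite E; exact: measurableU.
  by rewrite I fin_numD f1 f2.
rewrite I fineD // (int_split cphi ab bc).
move: e1 e2; rewrite !ler_norml => /andP[? ?] /andP[? ?]; apply/andP; split; lra.
Qed.

(** Near [x] the function is close to [phi x] and the tangent close to its direction at [x], so the
    arc measures between [(1 - e') * (b - a)] and [b - a]. *)
Let arc_spec_loc (e x : R) : 0 < e -> 0 <= x <= L -> exists2 d, 0 < d &
  forall a b, 0 <= a -> a <= x -> x <= b -> b <= L -> b - a < d -> arc_spec e a b.
Proof.
move=> e0 xL; have L0 := len_gt0 K.
have px := f_ge0 x.
(* The lower estimate [(phi x - e') * (1 - e')] and the upper estimate [phi x + e'] differ by at
   most [e' * (2 + phi x)]; [e' <= 1] keeps [1 - e'] nonnegative. *)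
pose e' := Num.min 1 (e / (2 + phi x)).
have e'0 : 0 < e' by rewrite lt_min ltr01 divr_gt0 //; lra.
have e'1 : e' <= 1 by rewrite /e' ge_min lexx.
have e'e : e' * (2 + phi x) <= e by rewrite -ler_pdivlMr ?ge_min ?lexx ?orbT //; lra.
have /cvgrPdist_lt /(_ _ e'0) N1 := @cphi x.
have N2 : \forall u \near x, 1 - e' < tx u * tx x + ty u * ty x.
  have cc : continuous (fun u => tx u * tx x + ty u * ty x).
    by apply: contD; apply: contM; (exact: cont_ctx || exact: cont_cty || exact: cont_cst).
  apply: (cc x (fun y => 1 - e' < y)); apply: lt_nbhsr; rewrite -!expr2 unit_t; lra.
have /nbhs_ballP[d /= d0 Hd] : \forall u \near x, `|phi x - phi u| < e' /\
    1 - e' < tx u * tx x + ty u * ty x by exact: filterI N1 N2.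
exists (Num.min d (L / 2)); first by rewrite lt_min d0 divr_gt0.
move=> a b a0 ax xb bL; rewrite lt_min => /andP[bad baL].
have Hu u : a <= u <= b -> phi x - e' <= phi u <= phi x + e' /\ 1 - e' <= tx u * tx x + ty u * ty x.
  move=> /andP[au ub]; have [|] := Hd u.
    by rewrite /ball /= ltr_norml; apply/andP; split; lra.
  by rewrite ltr_norml => /andP[? ?] ?; split; [apply/andP; split|]; lra.
have mA : measurable (arc a b : set (caratheodory_type (hausdorff_outer R))).
  by apply: cara_arc => //; lra.
have ab := le_trans ax xb.
have HA1 : (H1 (arc a b) <= (b - a)%:E)%E := hausdorff_arc_le (dgx K) (dgy K) (unit_t K) ab.
have HA2 : (((1 - e') * (b - a))%:E <= H1 (arc a b))%E.
  apply: (hausdorff_arc_ge (dgx K) (dgy K) ab _ (unit_t K x)); first by lra.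
  by move=> u /Hu[_ Hu2]; exact: Hu2.
have fA : H1 (arc a b) \is a fin_num.
  by rewrite ge0_fin_numE ?measure_ge0 // (le_lt_trans HA1) // ltry.
have I1 : (\int[H1]_(p in arc a b) (f p)%:E <= ((phi x + e') * (b - a))%:E)%E.
  rewrite EFinM; apply: (le_trans (@integral_le_cst _ _ _ H1 _ _ (phi x + e') mA (mf_arc a0 bL) _)).
    move=> _ [s /= + <-]; rewrite in_itv /= => /andP[s1 s2]; rewrite fphi f_ge0 /=.
    by have [|/andP[]//] := Hu s; rewrite s1 ltW.
  by apply: lee_wpmul2l; rewrite // lee_fin; lra.
have I0 : (0 <= \int[H1]_(p in arc a b) (f p)%:E)%E.
  by apply: integral_ge0 => _ [s _ <-]; rewrite lee_fin fphi.
have fI : (\int[H1]_(p in arc a b) (f p)%:E)%E \is a fin_num.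
  by rewrite ge0_fin_numE // (le_lt_trans I1) // ltry.
split => //.
have I2 : (phi x - e') * (1 - e') * (b - a) <= fine (\int[H1]_(p in arc a b) (f p)%:E)%E.
  have [neg|pos] := ltP (phi x - e') 0.
    apply: (@le_trans _ _ 0); last exact: fine_ge0.
    by apply: mulr_le0_ge0; [apply: mulr_le0_ge0|]; lra.
  rewrite -lee_fin fineK //.
  apply: (@le_trans _ _ ((phi x - e')%:E * H1 (arc a b))%E).
    by rewrite -mulrA EFinM; apply: lee_wpmul2l; rewrite // lee_fin.
  apply: (integral_ge_cst H1 mA (mf_arc a0 bL) pos) => _ [s /= + <-].
  rewrite in_itv /= => /andP[s1 s2]; rewrite fphi.
  by have [|/andP[]//] := Hu s; rewrite s1 ltW.
have I3 : fine (\int[H1]_(p in arc a b) (f p)%:E)%E <= (phi x + e') * (b - a).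
  by rewrite -lee_fin fineK.
have J1 : (phi x - e') * (b - a) <= \int[mu]_(s in `[a, b]) phi s.
  by rewrite -int_cst //; apply: int_le => //; [exact: cont_cst|move=> u /Hu[/andP[]]].
have J2 : \int[mu]_(s in `[a, b]) phi s <= (phi x + e') * (b - a).
  by rewrite -int_cst //; apply: int_le => //; [exact: cont_cst|move=> u /Hu[/andP[]]].
have B1 : e' * (2 + phi x) * (b - a) <= e * (b - a) by apply: ler_wpM2r => //; lra.
have B2 : 0 <= e' * phi x * (b - a) by rewrite !mulr_ge0 ?subr_ge0 // ltW.
have B3 : 0 <= e' * e' * (b - a) by rewrite !mulr_ge0 ?subr_ge0 // ltW.
by rewrite ler_norml; apply/andP; split; lra.
Qed.

Lemma boundary_integral :
  (\int[H1]_(p in boundary Omega) (f p)%:E = (\int[mu]_(s in `[0%R, L]) phi s)%:E)%E.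
Proof.
have L0 := len_gt0 K.
have H e : 0 < e -> arc_spec e 0 L.
  move=> e0; apply: (interval_induction (ltW L0)); last by move=> x; exact: arc_spec_loc.
  by move=> a b c a0 ab bc cL; exact: arc_spec_add.
rewrite (boundary_curve K) -/(arc 0 L).
have [_ fI _] := H 1 ltr01.
rewrite -(fineK fI); congr EFin; apply/eqP; rewrite -subr_eq0 -normr_le0.
apply/ler_addgt0Pr => e e0; rewrite add0r.
have [_ _] := H (e / L) (divr_gt0 e0 L0).
by rewrite subr0 divfK // gt_eqF.
Qed.

End BoundaryIntegral.

(** * Weighted image measures *)

Section Density.
Context d d' (T : measurableType d) (T' : measurableType d') (R : realType).
Variables (m : {measure set T -> \bar R}) (D : set T) (w : T -> R) (G : T -> T').
Hypotheses (mD : measurable D) (mw : measurable_fun setT w) (mG : measurable_fun setT G).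
Hypothesis w_ge0 : forall x, 0 <= w x.
Local Open Scope ereal_scope.

Let dm (A : set T') : \bar R := \int[m]_(x in D) (w x * \1_A (G x))%:E.

Let mwG (A : set T') : measurable A -> measurable_fun D (fun x => (w x * \1_A (G x))%:E).
Proof.
move=> mA; apply/measurable_EFinP/measurable_funM; first exact: measurable_funTS.
by apply: measurable_funTS; apply: measurableT_comp => //; exact: measurable_indic.
Qed.

Let dm0 : dm set0 = 0.
Proof. by apply: integral0_eq => x _; rewrite indic0 mulr0. Qed.

Let dm_ge0 A : 0 <= dm A.
Proof. by apply: integral_ge0 => x _; rewrite lee_fin mulr_ge0. Qed.

Let dm_sigma : semi_sigma_additive dm.
Proof.
move=> F mF tF mUF; rewrite /dm.
have -> : (fun n => \sum_(0 <= i < n) \int[m]_(x in D) (w x * \1_(F i) (G x))%:E) =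
    (fun n => \int[m]_(x in D) (\sum_(0 <= i < n) (w x * \1_(F i) (G x))%:E)).
  apply/funext => n; rewrite ge0_integral_sum //; first by move=> i; exact: mwG.
  by move=> i x _; rewrite lee_fin mulr_ge0.
have -> : \int[m]_(x in D) (w x * \1_(\bigcup_n F n) (G x))%:E =
    \int[m]_(x in D) (limn (fun n => \sum_(0 <= i < n) (w x * \1_(F i) (G x))%:E)).
  apply: eq_integral => x _; rewrite EFinM indic_bigcup // -nneseriesZl; last first.
    by move=> i _; rewrite lee_fin.
  by congr (limn _); apply/funext => n; apply: eq_bigr => i _; rewrite -EFinM.
apply: cvg_monotone_convergence => //.
- by move=> n; apply: emeasurable_sum => i; exact: mwG.
- by move=> n x _; apply: sume_ge0 => i _; rewrite lee_fin mulr_ge0.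
- by move=> x _ a b ab; apply: ereal_nondecreasing_series => // i _ _; rewrite lee_fin mulr_ge0.
Qed.

Import HBNNSimple.

(** The image under [G] of the measure with density [w]. Only the integration formula is exported.
    It serves for the coordinate maps of the plane and, with [G] the identity, for the positive and
    negative parts of a function. *)
Lemma density_pushforward : exists nu : {measure set T' -> \bar R},
  forall F : T' -> \bar R, measurable_fun setT F -> (forall x, 0 <= F x) ->
  \int[nu]_x F x = \int[m]_(x in D) ((w x)%:E * F (G x)).
Proof.
pose Hm := isMeasure.Build _ _ _ dm dm0 dm_ge0 dm_sigma.
pose nu : {measure set T' -> \bar R} := HB.pack dm Hm.
exists nu => F mF F0.
have nuE A : nu A = \int[m]_(x in D) (w x * \1_A (G x))%:E by [].
pose f_ := nnsfun_approx measurableT mF.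
have fF x : (f_ n x)%:E @[n --> \oo] --> F x by apply: cvg_nnsfun_approx.
have mwf n : measurable_fun D (fun x => (w x * f_ n (G x))%:E).
  apply/measurable_EFinP/measurable_funM; first exact: measurable_funTS.
  by apply: measurable_funTS; apply: measurableT_comp.
have -> : \int[nu]_x F x = limn (fun n => \int[nu]_x (f_ n x)%:E).
  rewrite -monotone_convergence //.
  - by apply: eq_integral => y _; apply/esym/cvg_lim.
  - by move=> n; exact/measurable_EFinP/measurable_funP.
  - by move=> n y _; rewrite lee_fin.
  - by move=> y _ p q pq; rewrite lee_fin; exact/lefP/nd_nnsfun_approx.
have -> : \int[m]_(x in D) ((w x)%:E * F (G x)) =
    limn (fun n => \int[m]_(x in D) (w x * f_ n (G x))%:E).
  rewrite -monotone_convergence //.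
  - apply: eq_integral => y _; apply/esym/cvg_lim => //.
    under eq_fun do rewrite EFinM.
    by apply: cvgeZl => //; exact: fF.
  - by move=> n y _; rewrite lee_fin mulr_ge0.
  - by move=> y _ p q pq; rewrite lee_fin ler_wpM2l //; exact/lefP/nd_nnsfun_approx.
congr (limn _); apply/funext => n.
under eq_integral do rewrite fimfunE -fsumEFin //.
rewrite ge0_integral_fsum //; last 2 first.
- by move=> y; exact/measurable_EFinP/measurable_funM.
- by move=> y x _; rewrite nnfun_muleindic_ge0.
under eq_fsbigr do rewrite integralZl_indic_nnsfun // integral_indic // setIT nuE.
have E x : (w x * f_ n (G x))%:E = \sum_(k \in range (f_ n))
    ((w x)%:E * (k * \1_(f_ n @^-1` [set k]) (G x))%:E).
  rewrite EFinM [in LHS]fimfunE -fsumEFin // ge0_mule_fsumr // => r.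
  by rewrite nnfun_muleindic_ge0.
rewrite [RHS](eq_integral _ _ (fun x _ => E x)).
rewrite ge0_integral_fsum //; last 2 first.
- move=> r; apply: emeasurable_funM; first by apply/measurable_EFinP; exact: measurable_funTS.
  apply/measurable_EFinP/measurable_funM => //.
  by apply: measurable_funTS; apply: measurableT_comp => //; exact: measurable_indic.
- by move=> r x _; apply: mule_ge0; [rewrite lee_fin|rewrite EFinM nnfun_muleindic_ge0].
apply: eq_fsbigr => r _.
have [r0|r0] := ltP r 0%R.
  have -> : f_ n @^-1` [set r] = set0 by exact: preimage_nnfun0.
  rewrite !integral0_eq ?mule0 // => x _; rewrite ?indic0 ?mulr0 ?mule0 //.
rewrite -ge0_integralZl //; last 2 first.
- exact: mwG.
- by move=> x _; rewrite lee_fin mulr_ge0.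
by apply: eq_integral => x _; rewrite -!EFinM; congr EFin; ring.
Qed.

End Density.

Section ProductIntegral.
Context {R : realType}.
Notation mu := (@lebesgue_measure R).
Notation mR := (measurableTypeR R).
Local Open Scope ereal_scope.

Lemma integral_prod21 (A B : set R) (f : R * R -> \bar R) :
  measurable (A : set mR) -> measurable (B : set mR) ->
  measurable_fun (setT : set (mR * mR)) f -> (forall p, 0 <= f p) ->
  \int[area R]_(p in A `*` B) f p = \int[mu]_(y in B) \int[mu]_(x in A) f (x, y).
Proof.
move=> mA mB mf f0.
have mAB : measurable (A `*` B : set (mR * mR)) by exact: measurableX.
rewrite integral_mkcond (@fubini_tonelli2 _ _ mR mR R mu mu); last 2 first.
- by apply/(measurable_restrictT _ mAB); exact: measurable_funTS.
- by move=> p; rewrite erestrict_ge0 // => q _.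
rewrite [RHS]integral_mkcond; apply: eq_integral => y _.
rewrite /fubini_G /patch; case: ifPn => yB.
  rewrite [RHS]integral_mkcond; apply: eq_integral => x _.
  by rewrite /patch in_setX yB andbT.
by apply: integral0_eq => x _; rewrite in_setX (negbTE yB) andbF.
Qed.

Local Notation obox p q r s := (`]p, q[%classic `*` `]r, s[%classic : set (R * R)).

Definition open_boxes : set (set (R * R)) :=
  [set X | exists p q r s : R, X = obox p q r s].

Lemma itvoo_nat (x : R) : exists n, (- n.+1%:R < x < n.+1%:R)%R.
Proof. by exists (Num.truncn `|x|); rewrite -ltr_norml truncnS_gt. Qed.

Lemma measurable_open_boxes :
  (measurable : set (set (mR * mR))) = <<s open_boxes >>.
Proof.
apply/seteqP; split; last first.
  apply: smallest_sub; first exact: sigma_algebra_measurable.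
  by move=> _ [p [q [r [s ->]]]]; exact: measurableX.
rewrite measurable_prod_measurableType; apply: smallest_sub.
  exact: smallest_sigma_algebra.
move=> _ [A mA [B mB <-]].
pose S := g_sigma_algebraType open_boxes.
have mS X : <<s open_boxes >> X <-> measurable (X : set S) by [].
have -> : A `*` B = ((setT : set S) `&` fst @^-1` A) `&` ((setT : set S) `&` snd @^-1` B).
  by rewrite !setTI.
apply/mS; apply: measurableI.
  have mfst : measurable_fun (setT : set S) (fst : S -> mR).
    apply: (measurability _ (RGenOpens.measurableE R)) => _ [_ [a [b ->]] <-].
    rewrite setTI (_ : _ @^-1` _ = \bigcup_n obox a b (- n.+1%:R)%R n.+1%:R); last first.
      apply/seteqP; split=> [p pab|p [n _ []//]].
      have [n Hn] := itvoo_nat p.2.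
      by exists n => //; split=> //=; rewrite in_itv.
    by apply: bigcupT_measurable => n; apply: sub_sigma_algebra; exists a, b, (- n.+1%:R)%R, n.+1%:R.
  exact: mfst.
have msnd : measurable_fun (setT : set S) (snd : S -> mR).
  apply: (measurability _ (RGenOpens.measurableE R)) => _ [_ [a [b ->]] <-].
  rewrite setTI (_ : _ @^-1` _ = \bigcup_n obox (- n.+1%:R)%R n.+1%:R a b); last first.
    apply/seteqP; split=> [p pab|p [n _ []//]].
    have [n Hn] := itvoo_nat p.1.
    by exists n => //; split=> //=; rewrite in_itv.
  by apply: bigcupT_measurable => n; apply: sub_sigma_algebra; exists (- n.+1%:R)%R, n.+1%:R, a, b.
exact: msnd.
Qed.

(** Open boxes generate the sigma-algebra, are stable under intersection and exhaust the plane, so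
    the uniqueness theorem for measures applies. *)
Lemma measure_boxes_unique (m1 m2 : {measure set (mR * mR) -> \bar R}) :
  (forall p q r s : R, m1 (obox p q r s) = m2 (obox p q r s)) ->
  (forall p q r s : R, m1 (obox p q r s) < +oo) ->
  forall X : set (R * R), measurable (X : set (mR * mR)) -> m1 X = m2 X.
Proof.
move=> E fin.
have := @measure_unique _ R (mR * mR)%type open_boxes
  (fun n => obox (- n.+1%:R)%R n.+1%:R (- n.+1%:R)%R n.+1%:R) measurable_open_boxes.
move=> H; apply: H.
- move=> _ _ [p [q [r [s ->]]]] [p' [q' [r' [s' ->]]]].
  exists (Num.max p p'), (Num.min q q'), (Num.max r r'), (Num.min s s').
  apply/predeqP => -[x y]; rewrite /= !in_itv /= !gt_max !lt_min.
  split=> [[[/andP[a1 a2] /andP[a3 a4]] [/andP[b1 b2] /andP[b3 b4]]]|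
    [/andP[/andP[a1 b1] /andP[a2 b2]] /andP[/andP[a3 b3] /andP[a4 b4]]]];
  by rewrite a1 a2 a3 a4 b1 b2 b3 b4.
- by move=> n; exists (- n.+1%:R)%R, n.+1%:R, (- n.+1%:R)%R, n.+1%:R.
- apply/seteqP; split=> // -[x y] _; exists (maxn (Num.truncn `|x|) (Num.truncn `|y|)) => //.
  split; rewrite /= in_itv /= -ltr_norml; apply: lt_le_trans (truncnS_gt _) _.
    by rewrite ler_nat ltnS leq_maxl.
  by rewrite ler_nat ltnS leq_maxr.
- by move=> _ [p [q [r [s ->]]]]; exact: E.
- by move=> n; exact: fin.
Qed.

End ProductIntegral.

(** * Continuity rules for proof search *)

Section ContinuityHints.
Context {R : realType}.
Implicit Types (f g : R * R -> R) (u v : R -> R).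

Lemma cont2D f g : continuous f -> continuous g -> continuous (fun p => f p + g p).
Proof. exact: contD. Qed.
Lemma cont2M f g : continuous f -> continuous g -> continuous (fun p => f p * g p).
Proof. exact: contM. Qed.
Lemma cont2N f : continuous f -> continuous (fun p => - f p).
Proof. exact: contN. Qed.
Lemma cont2X f n : continuous f -> continuous (fun p => f p ^+ n).
Proof. exact: contX. Qed.
Lemma cont2_cst (c : R) : continuous (fun _ : R * R => c).
Proof. exact: cont_cst. Qed.
Lemma cont2_fst : continuous (fun p : R * R => p.1).
Proof. exact: cont_fst. Qed.
Lemma cont2_snd : continuous (fun p : R * R => p.2).
Proof. exact: cont_snd. Qed.
Lemma cont1fst u : continuous u -> continuous (fun p : R * R => u p.1).
Proof. by move=> cu; apply: (cont_comp cu); exact: cont_fst. Qed.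
Lemma cont1snd u : continuous u -> continuous (fun p : R * R => u p.2).
Proof. by move=> cu; apply: (cont_comp cu); exact: cont_snd. Qed.
Lemma cont2_pair f g h : continuous f -> continuous g -> continuous h ->
  continuous (fun p : R * R => f (g p, h p)).
Proof. by move=> cf cg ch; apply: (cont_comp cf); exact: cont_pair. Qed.
Lemma cont_swap f : continuous f -> continuous (fun p : R * R => f (p.2, p.1)).
Proof. by move=> cf; apply: cont2_pair => //; [exact: cont_snd|exact: cont_fst]. Qed.
Lemma cont1D u v : continuous u -> continuous v -> continuous (fun p => u p + v p).
Proof. exact: contD. Qed.
Lemma cont1M u v : continuous u -> continuous v -> continuous (fun p => u p * v p).
Proof. exact: contM. Qed.
Lemma cont1Z (c : R) u : continuous u -> continuous (fun p => c * u p).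
Proof. by move=> cu; apply: cont1M; [exact: cst_continuous|exact: cu]. Qed.
Lemma cont1N u : continuous u -> continuous (fun p => - u p).
Proof. exact: contN. Qed.
Lemma cont1X u n : continuous u -> continuous (fun p => u p ^+ n).
Proof. exact: contX. Qed.
Lemma cont1_cst (c : R) : continuous (fun _ : R => c).
Proof. exact: cont_cst. Qed.
Lemma cont1_id : continuous (fun x : R => x).
Proof. exact: cont_id. Qed.
Lemma cont1_pair f u v : continuous f -> continuous u -> continuous v ->
  continuous (fun x : R => f (u x, v x)).
Proof. by move=> cf cu cv; apply: (cont_comp cf); exact: cont_pair. Qed.
Lemma smooth_partial_cont f i : smooth f -> continuous (partial i f).
Proof. by move=> sf; exact/smooth_cont/smooth_partial. Qed.

End ContinuityHints.

Create HintDb cont.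
#[export] Hint Resolve cont2D cont2M cont2N cont2X cont2_cst cont2_fst cont2_snd cont1fst
  cont1snd cont2_pair cont1D cont1M cont1N cont1X cont1_cst cont1_id cont1_pair : cont.
#[export] Hint Resolve cont_ctx cont_cty cont_cgx cont_cgy cont_ka smooth_cont
  smooth_partial_cont smooth1_cont : cont.
Ltac cts := auto 30 with cont.

Section Stokes.
Context {R : realType}.
Notation mu := (@lebesgue_measure R).

(** Along each line of constant [t] the term [Qs] integrates to zero because [Q] takes the same
    value at both ends; [Pt] is integrated in [t] first. *)
Lemma stokes_rectangle (P Q Pt Qs : R * R -> R) (l M : R) : 0 <= l -> 0 <= M ->
  (forall s t, is_deriv t (fun t => P (s, t)) (Pt (s, t))) -> continuous Pt ->
  (forall s t, is_deriv s (fun s => Q (s, t)) (Qs (s, t))) -> continuous Qs ->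
  (forall t, Q (0, t) = Q (l, t)) ->
  \int[mu]_(t in `[0, M]) \int[mu]_(s in `[0, l]) (Pt (s, t) - Qs (s, t)) =
  \int[mu]_(s in `[0, l]) (P (s, M) - P (s, 0)).
Proof.
move=> l0 M0 dP cP dQ cQ Qper.
have H t : \int[mu]_(s in `[0, l]) (Pt (s, t) - Qs (s, t)) = \int[mu]_(s in `[0, l]) Pt (s, t).
  rewrite intB; [|exact: cont_sec1|exact: cont_sec1].
  rewrite [X in _ - X](FTC l0 _ (fun s => dQ s t)); last exact: cont_sec1.
  by rewrite Qper subrr subr0.
rewrite (int_eq (fun t _ => H t)) -(int_swap 0 l 0 M cP).
by apply: int_eq => s _; apply: (FTC M0 _ (dP s)); exact: cont_sec2.
Qed.

End Stokes.

(** * Integration in normal coordinates *)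

Section ChangeOfVariables.
Context {R : realType} (Omega : set (R * R)) (K : convex_curve Omega).
Notation mu := (@lebesgue_measure R).
Notation L := (len K).
Notation gx := (gx K).
Notation gy := (gy K).
Notation tx := (tx K).
Notation ty := (ty K).
Notation ka := (ka K).
Implicit Types (s t r : R).

Lemma tx_per s : tx (s + L) = tx s.
Proof.
have H : is_deriv s (fun s => gx (s + L)) (tx (s + L)).
  apply: (ide_eq (@ide_comp _ gx (fun s => s + L) s _ _ (dgx K (s + L)) (ideD (ide_id s) (ide_cst L s)))).
  by rewrite addr0 mulr1.
apply: ide_uniq (dgx K s); apply: ide_near H.
by near=> u; rewrite gx_per.
Unshelve. all: by end_near. Qed.

Lemma ty_per s : ty (s + L) = ty s.
Proof.
have H : is_deriv s (fun s => gy (s + L)) (ty (s + L)).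
  apply: (ide_eq (@ide_comp _ gy (fun s => s + L) s _ _ (dgy K (s + L)) (ideD (ide_id s) (ide_cst L s)))).
  by rewrite addr0 mulr1.
apply: ide_uniq (dgy K s); apply: ide_near H.
by near=> u; rewrite gy_per.
Unshelve. all: by end_near. Qed.

Lemma gxL : gx L = gx 0. Proof. by rewrite -(gx_per K 0) add0r. Qed.
Lemma gyL : gy L = gy 0. Proof. by rewrite -(gy_per K 0) add0r. Qed.
Lemma txL : tx L = tx 0. Proof. by rewrite -(tx_per 0) add0r. Qed.
Lemma tyL : ty L = ty 0. Proof. by rewrite -(ty_per 0) add0r. Qed.

(** The tangent runs counterclockwise, so [(ty, - tx)] is the outward normal and [q.2] the signed
    distance along it. *)
Definition ncx (q : R * R) := gx q.1 + q.2 * ty q.1.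
Definition ncy (q : R * R) := gy q.1 - q.2 * tx q.1.

Lemma cont_ncx : continuous ncx. Proof. by rewrite /ncx; cts. Qed.
Lemma cont_ncy : continuous ncy. Proof. by rewrite /ncy; cts. Qed.

Lemma ncx_s s t : is_deriv s (fun s => ncx (s, t)) ((1 + ka s * t) * tx s).
Proof.
apply: ide_eq (ideD (dgx K s) (ideM (ide_cst t s) (dty K s))) _.
by rewrite /=; ring.
Qed.

Lemma ncy_s s t : is_deriv s (fun s => ncy (s, t)) ((1 + ka s * t) * ty s).
Proof.
apply: ide_eq (ideB (dgy K s) (ideM (ide_cst t s) (dtx K s))) _.
by rewrite /=; ring.
Qed.

Lemma ncx_t s t : is_deriv t (fun t => ncx (s, t)) (ty s).
Proof.
apply: ide_eq (ideD (ide_cst (gx s) t) (ideM (ide_id t) (ide_cst (ty s) t))) _.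
by rewrite /=; ring.
Qed.

Lemma ncy_t s t : is_deriv t (fun t => ncy (s, t)) (- tx s).
Proof.
apply: ide_eq (ideB (ide_cst (gy s) t) (ideM (ide_id t) (ide_cst (tx s) t))) _.
by rewrite /=; ring.
Qed.

Lemma nc0 s : (ncx (s, 0), ncy (s, 0)) = (gx s, gy s).
Proof. by rewrite /ncx /ncy !mul0r addr0 subr0. Qed.

Lemma ncL t : (ncx (0, t), ncy (0, t)) = (ncx (L, t), ncy (L, t)).
Proof. by rewrite /ncx /ncy /= gxL gyL txL tyL. Qed.

Hint Resolve cont_ncx cont_ncy : cont.

(** The component of the outward normal [(ty, - tx)] along the axis [i]. *)
Definition normal_part (i : 'I_2) s : R := (i == 0)%:R * ty s - (i == 1)%:R * tx s.

Let partialE (H : R * R -> R) (i : 'I_2) p :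
  partial i H p = (i == 0)%:R * partial 0 H p + (i == 1)%:R * partial 1 H p.
Proof. by have [->|->] := ord2 i; rewrite /= ?mul0r ?mul1r ?addr0 ?add0r. Qed.

Section Divergence.
Variables (H : R * R -> R) (M : R).
Hypotheses (sH : smooth H) (M0 : 0 <= M) (HM : forall s, H (ncx (s, M), ncy (s, M)) = 0).

Let Hn q := H (ncx q, ncy q).
Let dHt s t := smooth_chain sH (ncx_t s t) (ncy_t s t).
Let dHs s t := smooth_chain sH (ncx_s s t) (ncy_s s t).

(** The divergence theorem outside [Omega] for the field [H] times a coordinate vector, pulled back
    to a rectangle. The flux at the outer end vanishes with [H], the flux through the boundary
    remains. *)
Lemma exterior_div i :
  \int[mu]_(t in `[0, M]) \int[mu]_(s in `[0, L])
    (partial i H (ncx (s, t), ncy (s, t)) * (1 + ka s * t)) =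
  - \int[mu]_(s in `[0, L]) (H (gx s, gy s) * normal_part i s).
Proof.
rewrite /normal_part; have := partialE H i; move: ((i == 0)%:R) ((i == 1)%:R) => u v E.
(* [P] is the flux density through the curves of constant height and [- Q] the tangential component
   of the field. The terms from the derivatives of the Jacobian and of the frame cancel in
   [Pt - Qs]. *)
pose P q := Hn q * ((1 + ka q.1 * q.2) * (u * ty q.1 - v * tx q.1)).
pose Pt q := (partial 0 H (ncx q, ncy q) * ty q.1 + partial 1 H (ncx q, ncy q) * (- tx q.1)) *
   ((1 + ka q.1 * q.2) * (u * ty q.1 - v * tx q.1)) + Hn q * (ka q.1 * (u * ty q.1 - v * tx q.1)).
pose Q q := - (Hn q * (u * tx q.1 + v * ty q.1)).
pose Qs q := - ((partial 0 H (ncx q, ncy q) * ((1 + ka q.1 * q.2) * tx q.1) +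
   partial 1 H (ncx q, ncy q) * ((1 + ka q.1 * q.2) * ty q.1)) * (u * tx q.1 + v * ty q.1) +
   Hn q * (u * (- ka q.1 * ty q.1) + v * (ka q.1 * tx q.1))).
have cHn : continuous Hn by rewrite /Hn; cts.
have S := @stokes_rectangle R P Q Pt Qs L M (ltW (len_gt0 K)) M0.
transitivity (\int[mu]_(t in `[0, M]) \int[mu]_(s in `[0, L]) (Pt (s, t) - Qs (s, t))).
  apply: int_eq => t _; apply: int_eq => s _; rewrite E /Pt /Qs /= -[LHS]mulr1 -(unit_t K s).
  move: (partial 0 H _) (partial 1 H _) (Hn _) (ka s) (tx s) (ty s) => p q h k x y; ring.
apply: (etrans (S _ _ _ _ _)).
- move=> s t; apply: ide_eq (ideM (dHt s t) (ideM (ideD (ide_cst 1 t) (ideM (ide_cst (ka s) t) (ide_id t)))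
    (ide_cst (u * ty s - v * tx s) t))) _.
  rewrite /Pt /Hn /=; move: (partial 0 H _) (partial 1 H _) (H _) => p q h; ring.
- by rewrite /Pt; cts.
- move=> s t; apply: ide_eq (ideN (ideM (dHs s t) (ideD (ideM (ide_cst u s) (dtx K s)) (ideM (ide_cst v s) (dty K s))))) _.
  rewrite /Qs /Hn /=; move: (partial 0 H _) (partial 1 H _) (H _) => p q h; ring.
- by rewrite /Qs; cts.
- by move=> t; rewrite /Q /Hn ncL /= txL tyL.
- rewrite -[RHS]mulN1r -intZ; last by cts.
  apply: int_eq => s _; rewrite /P /Hn HM nc0 /=; move: (H _) => h; ring.
Qed.

End Divergence.

Variables (a b : R).

(** The map that shrinks the boundary towards the interior point [(a, b)]; its Jacobian is
    [r * sup_fun s]. *)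
Definition rcx (q : R * R) := a + q.2 * (gx q.1 - a).
Definition rcy (q : R * R) := b + q.2 * (gy q.1 - b).
(** The signed distance from [(a, b)] to the tangent at [s], that is, the support function of
    [Omega] seen from [(a, b)]. *)
Definition sup_fun s := (gx s - a) * ty s - (gy s - b) * tx s.

Lemma cont_rcx : continuous rcx. Proof. by rewrite /rcx; cts. Qed.
Lemma cont_rcy : continuous rcy. Proof. by rewrite /rcy; cts. Qed.
Lemma cont_sup_fun : continuous sup_fun. Proof. by rewrite /sup_fun; cts. Qed.
Hint Resolve cont_rcx cont_rcy cont_sup_fun : cont.

Let rcx_s s r : is_deriv s (fun s => rcx (s, r)) (r * tx s).
Proof.
apply: ide_eq (ideD (ide_cst a s) (ideM (ide_cst r s) (ideB (dgx K s) (ide_cst a s)))) _.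
by rewrite /=; ring.
Qed.

Let rcy_s s r : is_deriv s (fun s => rcy (s, r)) (r * ty s).
Proof.
apply: ide_eq (ideD (ide_cst b s) (ideM (ide_cst r s) (ideB (dgy K s) (ide_cst b s)))) _.
by rewrite /=; ring.
Qed.

Let rcx_r s r : is_deriv r (fun r => rcx (s, r)) (gx s - a).
Proof.
apply: ide_eq (ideD (ide_cst a r) (ideM (ide_id r) (ide_cst (gx s - a) r))) _.
by rewrite /=; ring.
Qed.

Let rcy_r s r : is_deriv r (fun r => rcy (s, r)) (gy s - b).
Proof.
apply: ide_eq (ideD (ide_cst b r) (ideM (ide_id r) (ide_cst (gy s - b) r))) _.
by rewrite /=; ring.
Qed.

Let rc1 s : (rcx (s, 1), rcy (s, 1)) = (gx s, gy s).
Proof. by rewrite /rcx /rcy /= !mul1r; congr (_, _); ring. Qed.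

Section InteriorDivergence.
Variables (H : R * R -> R) (sH : smooth H).
Let Hr q := H (rcx q, rcy q).
Let dHr s t := smooth_chain sH (rcx_r s t) (rcy_r s t).
Let dHs s t := smooth_chain sH (rcx_s s t) (rcy_s s t).

Lemma interior_div i :
  \int[mu]_(r in `[0, 1]) \int[mu]_(s in `[0, L])
    (partial i H (rcx (s, r), rcy (s, r)) * (r * sup_fun s)) =
  \int[mu]_(s in `[0, L]) (H (gx s, gy s) * normal_part i s).
Proof.
rewrite /normal_part; have := partialE H i; move: ((i == 0)%:R) ((i == 1)%:R) => u v E.
pose P q := Hr q * (q.2 * (u * ty q.1 - v * tx q.1)).
pose Pt q := (partial 0 H (rcx q, rcy q) * (gx q.1 - a) + partial 1 H (rcx q, rcy q) * (gy q.1 - b)) *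
   (q.2 * (u * ty q.1 - v * tx q.1)) + Hr q * (u * ty q.1 - v * tx q.1).
pose Q q := Hr q * (u * (gy q.1 - b) - v * (gx q.1 - a)).
pose Qs q := (partial 0 H (rcx q, rcy q) * (q.2 * tx q.1) +
   partial 1 H (rcx q, rcy q) * (q.2 * ty q.1)) * (u * (gy q.1 - b) - v * (gx q.1 - a)) +
   Hr q * (u * ty q.1 - v * tx q.1).
have cHr : continuous Hr by rewrite /Hr; cts.
have S := @stokes_rectangle R P Q Pt Qs L 1 (ltW (len_gt0 K)) ler01.
transitivity (\int[mu]_(t in `[0, 1]) \int[mu]_(s in `[0, L]) (Pt (s, t) - Qs (s, t))).
  apply: int_eq => t _; apply: int_eq => s _; rewrite E /Pt /Qs /sup_fun /=.
  move: (partial 0 H _) (partial 1 H _) (Hr _) => p q h; ring.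
apply: (etrans (S _ _ _ _ _)).
- move=> s t; apply: ide_eq (ideM (dHr s t) (ideM (ide_id t) (ide_cst (u * ty s - v * tx s) t))) _.
  rewrite /Pt /Hr /=; move: (partial 0 H _) (partial 1 H _) (H _) => p q h; ring.
- by rewrite /Pt; cts.
- move=> s t; apply: ide_eq (ideM (dHs s t) (ideB (ideM (ide_cst u s) (ideB (dgy K s) (ide_cst b s)))
    (ideM (ide_cst v s) (ideB (dgx K s) (ide_cst a s))))) _.
  rewrite /Qs /Hr /=; move: (partial 0 H _) (partial 1 H _) (H _) => p q h; ring.
- by rewrite /Qs; cts.
- by move=> t; rewrite /Q /Hr /rcx /rcy /= gxL gyL.
- apply: int_eq => s _; rewrite /P /Hr rc1 /=; move: (H _) => h; ring.
Qed.

End InteriorDivergence.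

(** Total integral against the Jacobians of the radial map of the interior and of
    the normal map of the exterior. By the divergence identities above it
    annihilates derivatives, so it is a multiple of the Lebesgue integral. *)
Definition polar_int (M : R) (f : R * R -> R) : R :=
  \int[mu]_(r in `[0, 1]) \int[mu]_(s in `[0, L]) (f (rcx (s, r), rcy (s, r)) * (r * sup_fun s)) +
  \int[mu]_(t in `[0, M]) \int[mu]_(s in `[0, L]) (f (ncx (s, t), ncy (s, t)) * (1 + ka s * t)).

(** The flux through the boundary enters once from each side, with opposite signs. *)
Lemma polar_int_partial (M : R) (H : R * R -> R) i : smooth H -> 0 <= M ->
  (forall s, H (ncx (s, M), ncy (s, M)) = 0) -> polar_int M (partial i H) = 0.
Proof.
by move=> sH M0 HM; rewrite /polar_int interior_div // exterior_div // subrr.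
Qed.

Lemma polar_intB (M : R) (f g : R * R -> R) (k : R) : continuous f -> continuous g ->
  polar_int M (fun p => f p - k * g p) = polar_int M f - k * polar_int M g.
Proof.
move=> cf cg; rewrite /polar_int.
have c1 : continuous (fun q => f (rcx q, rcy q) * (q.2 * sup_fun q.1)) by cts.
have c2 : continuous (fun q => g (rcx q, rcy q) * (q.2 * sup_fun q.1)) by cts.
have c3 : continuous (fun q => f (ncx q, ncy q) * (1 + ka q.1 * q.2)) by cts.
have c4 : continuous (fun q => g (ncx q, ncy q) * (1 + ka q.1 * q.2)) by cts.
have sw (h : R * R -> R) : continuous h -> continuous (fun q => h (q.2, q.1)).
  exact: cont_swap.
have E (h1 h2 : R * R -> R) (M1 : R) : continuous h1 -> continuous h2 ->
    \int[mu]_(t in `[0, M1]) \int[mu]_(s in `[0, L]) (h1 (s, t) - k * h2 (s, t)) =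
    \int[mu]_(t in `[0, M1]) \int[mu]_(s in `[0, L]) h1 (s, t) -
    k * \int[mu]_(t in `[0, M1]) \int[mu]_(s in `[0, L]) h2 (s, t).
  move=> ch1 ch2.
  have C1 : continuous (fun t => \int[mu]_(s in `[0, L]) h1 (s, t)) := @cont_int2 _ (fun q => h1 (q.2, q.1)) 0 L (sw _ ch1).
  have C2 : continuous (fun t => \int[mu]_(s in `[0, L]) h2 (s, t)) := @cont_int2 _ (fun q => h2 (q.2, q.1)) 0 L (sw _ ch2).
  rewrite -intZ // -intB //; last by cts.
  apply: int_eq => t _; rewrite -intZ ?intB //; try exact: cont_sec1.
  by apply: contM; [exact: cont_cst|exact: cont_sec1].
rewrite (_ : \int[mu]_(r in `[0, 1]) _ =
    \int[mu]_(r in `[0, 1]) \int[mu]_(s in `[0, L]) (f (rcx (s, r), rcy (s, r)) * (r * sup_fun s) -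
    k * (g (rcx (s, r), rcy (s, r)) * (r * sup_fun s)))); last first.
  by apply: int_eq => r _; apply: int_eq => s _; ring.
rewrite (_ : \int[mu]_(t in `[0, M]) _ =
    \int[mu]_(t in `[0, M]) \int[mu]_(s in `[0, L]) (f (ncx (s, t), ncy (s, t)) * (1 + ka s * t) -
    k * (g (ncx (s, t), ncy (s, t)) * (1 + ka s * t)))); last first.
  by apply: int_eq => r _; apply: int_eq => s _; ring.
apply: (etrans (congr2 +%R (E _ _ 1 c1 c2) (E _ _ M c3 c4))).
by rewrite mulrDr opprD addrACA.
Qed.

End ChangeOfVariables.

Lemma cont2_max {R : realType} (f g : R * R -> R) : continuous f -> continuous g ->
  continuous (fun p => Num.max (f p) (g p)).
Proof. exact: cont_max. Qed.

Hint Resolve cont2_max : cont.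

(** * Bump functions that determine measures *)

Section BumpUniqueness.
Context {R : realType}.
Notation mu := (@lebesgue_measure R).
Notation mR := (measurableTypeR R).
Local Notation obox p q r s := (`]p, q[%classic `*` `]r, s[%classic : set (R * R)).
Definition bump2 (k : nat) (p q r s : R) (x : R * R) : R := bump k p q x.1 * bump k r s x.2.

Lemma cont_bump2 k p q r s : continuous (bump2 k p q r s).
Proof.
rewrite /bump2; apply: contM.
  by apply: (@cont1fst R (bump k p q)); exact/smooth1_cont/smooth1_bump.
by apply: (@cont1snd R (bump k r s)); exact/smooth1_cont/smooth1_bump.
Qed.

Lemma bump2_ge0 k p q r s x : 0 <= bump2 k p q r s x.
Proof. by rewrite mulr_ge0 ?bump_ge0. Qed.

Lemma bump2_cvg p q r s x : (fun k => bump2 k p q r s x) @ \oo --> (\1_(obox p q r s) x : R).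
Proof.
rewrite indicE in_setX !mem_setE !in_itv /= -mulnb natrM.
by apply: cvgM; exact: bump_cvg.
Qed.

Lemma bump2_nd p q r s x : nondecreasing_seq (fun k => bump2 k p q r s x).
Proof. by move=> m n mn; rewrite ler_pM ?bump_ge0 ?bump_nd. Qed.

Lemma integral_bump2_cvg (m : {measure set (mR * mR) -> \bar R}) p q r s :
  (\int[m]_x (bump2 k p q r s x)%:E)%E @[k --> \oo] --> m (obox p q r s).
Proof.
have mB : measurable (obox p q r s : set (mR * mR)) by exact: measurableX.
rewrite -[X in m X]setIT -integral_indic //.
have -> : (\int[m]_x (\1_(obox p q r s) x)%:E)%E =
    (\int[m]_x (limn (fun k => (bump2 k p q r s x)%:E)))%E.
  apply: eq_integral => x _; apply/esym/cvg_lim => //.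
  by apply: cvg_EFin; [exact: nearW|exact: bump2_cvg].
apply: cvg_monotone_convergence => //.
- by move=> n; apply/measurable_EFinP; apply: cont_measurable2 => //; exact: cont_bump2.
- by move=> n x _; rewrite lee_fin bump2_ge0.
- by move=> x _ k n kn; rewrite lee_fin; exact: bump2_nd.
Qed.

(** The bumps of a box increase to its indicator, so their integrals give the measure of the box by
    monotone convergence. *)
Lemma measure_bump_unique (m1 m2 : {measure set (mR * mR) -> \bar R}) :
  (forall k p q r s, \int[m1]_x (bump2 k p q r s x)%:E = \int[m2]_x (bump2 k p q r s x)%:E)%E ->
  (forall p q r s : R, m2 (obox p q r s) < +oo)%E ->
  forall X : set (R * R), measurable (X : set (mR * mR)) -> m1 X = m2 X.
Proof.
move=> E fin.
have EB p q r s : m1 (obox p q r s) = m2 (obox p q r s).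
  have /cvg_lim <- // := @integral_bump2_cvg m1 p q r s.
  have /cvg_lim <- // := @integral_bump2_cvg m2 p q r s.
  by congr (limn _); apply/funext => k; exact: E.
by apply: measure_boxes_unique => // p q r s; rewrite EB.
Qed.

(** The zero integral makes the primitive vanish on both sides of the support. Functions with equal
    integrals thus differ by the derivative of a compactly supported function, and [polar_int]
    ignores such derivatives. *)
Lemma smooth_zero_primitive (f : R -> R) (S : R) : 0 <= S -> smooth1 f ->
  (forall x, ~~ (- S < x < S) -> f x = 0) -> \int[mu]_(x in `[- S, S]) f x = 0 ->
  exists A, [/\ smooth1 A, forall x, is_deriv x A (f x) &
    forall x, ~~ (- S < x < S) -> A x = 0].
Proof.
move=> S0 sf f0 If; have cf := smooth1_cont sf.
have [F dF] := antiderivative cf.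
pose A x := F x - F (- S).
have dA x : is_deriv x A (f x).
  by apply: (ide_eq (ideB (dF x) (ide_cst (F (- S)) x))); rewrite subr0.
exists A; split; [|exact: dA|].
  apply/smooth1P => -[//|k] x0; exists f; first by near=> x; exact: dA.
  by have /smooth1P := sf; apply.
have FS : F S = F (- S).
  by apply/eqP; rewrite -subr_eq0 -(FTC _ cf dF) ?If //; lra.
have Z u v : u <= v -> (forall x, u <= x <= v -> f x = 0) -> F v = F u.
  move=> uv Hz; apply/eqP; rewrite -subr_eq0 -(FTC uv cf dF).
  by rewrite (int_eq Hz) int_cst ?mul0r.
have cF := is_derive_cont dF.
move=> x; rewrite negb_and -!leNgt => /orP[xS|Sx]; rewrite /A.
  rewrite (Z x (- S)) ?subrr // => y /andP[xy yS].
  by apply: f0; rewrite negb_and -leNgt yS.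
rewrite (Z S x) ?FS ?subrr // => y /andP[Sy yx].
by apply: f0; rewrite negb_and -!leNgt Sy orbT.
Unshelve. all: by end_near.
Qed.

End BumpUniqueness.

Lemma ge0_integral_tail {R : realType} (a b : R) (f : R -> \bar R) :
  measurable_fun (setT : set (measurableTypeR R)) f -> (forall x, b < x -> f x = 0%E) ->
  (\int[@lebesgue_measure R]_(x in `]a, +oo[) f x = \int[@lebesgue_measure R]_(x in `[a, b]) f x)%E.
Proof.
move=> mf f0; rewrite -integral_itv_obnd_cbnd; last exact: measurable_funTS.
rewrite integral_mkcond [RHS]integral_mkcond; apply: eq_integral => x _.
rewrite /patch !mem_setE !in_itv /= andbT; case: (ltP a x) => //= ax; case: leP => // bx.
exact: f0.
Qed.

(** One integer serves all periodic functions, so position, tangent and curvature are reduced to the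
    same parameter. *)
Lemma periodic_reduce {R : realType} (l s : R) : 0 < l -> exists2 z : int, 0 <= s - l * z%:~R < l &
  forall f : R -> R, (forall x, f (x + l) = f x) -> f (s - l * z%:~R) = f s.
Proof.
move=> l0; pose z := Num.floor (s / l).
exists z.
  have := Num.Theory.floor_le (s / l); have := Num.Theory.floorD1_gt (s / l); rewrite -/z => h1 h2.
  move: h1 h2; rewrite intrD ltr_pdivrMr // ler_pdivlMr // => h1 h2; apply/andP; split; lra.
move=> f fl.
have N (n : nat) x : f (x + l * n%:R) = f x.
  elim: n x => [|n IH] x; first by rewrite mulr0 addr0.
  by rewrite -natr1 mulrDr mulr1 addrA fl IH.
case: z => n; first by rewrite -[in RHS](subrK (l * n%:R) s) N.
by rewrite NegzE mulrNz mulrN opprK; exact: N.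
Qed.

Section NormalCoordinates.
Context {R : realType} (Omega : set (R * R)) (K : convex_curve Omega).
Notation mu := (@lebesgue_measure R).
Notation mR := (measurableTypeR R).
Notation L := (len K).
Notation gx := (gx K).
Notation gy := (gy K).
Notation tx := (tx K).
Notation ty := (ty K).
Notation ka := (ka K).
Notation ncx := (ncx K).
Notation ncy := (ncy K).
Variables (a b : R).
Hypothesis (Oab : Omega (a, b)).
Hypothesis (cvx : segment_closed Omega).
Notation rcx := (rcx K a).
Notation rcy := (rcy K b).
Notation sup_fun := (sup_fun K a b).
Notation polar_int := (polar_int K a b).
Local Notation strip := (`[0, L]%classic `*` `]0, +oo[%classic : set (R * R)).
Local Notation disc := (`[0, L]%classic `*` `[0, 1]%classic : set (R * R)).
Implicit Types (s t : R).

Lemma sup_fun_gt0 s : 0 < sup_fun s.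
Proof. by have := support_lt K s Oab; rewrite /sup_fun /=; lra. Qed.

Lemma edist_nc s t : (ncx (s, t) - a) ^+ 2 + (ncy (s, t) - b) ^+ 2 =
  (gx s - a) ^+ 2 + (gy s - b) ^+ 2 + 2 * t * sup_fun s + t ^+ 2.
Proof.
apply/eqP; rewrite -subr_eq0; apply/eqP; rewrite /ncx /ncy /sup_fun /=.
transitivity (t ^+ 2 * (tx s ^+ 2 + ty s ^+ 2 - 1)); first by ring.
by rewrite unit_t subrr mulr0.
Qed.

(** By convexity [sup_fun] is positive, so [edist_nc] puts the point at height [t] at distance at
    least [t] from [(a, b)]. The bound on [t] is explicit and uniform in [s]. *)
Lemma nc_far (S s t : R) : 2 * (S + `|a| + `|b|) + 1 <= t ->
  ~~ ((- S < ncx (s, t) < S) && (- S < ncy (s, t) < S)).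
Proof.
move=> Mt; apply/negP => /andP[/andP[x1 x2] /andP[y1 y2]].
have S0 : 0 < S by lra.
have t0 : 0 < t by have := normr_ge0 a; have := normr_ge0 b; lra.
have p0 := sup_fun_gt0 s.
have : t ^+ 2 <= (ncx (s, t) - a) ^+ 2 + (ncy (s, t) - b) ^+ 2.
  rewrite edist_nc; have := sqr_ge0 (gx s - a); have := sqr_ge0 (gy s - b).
  by have := mulr_gt0 t0 p0; lra.
have Bx : `|ncx (s, t) - a| <= S + `|a|.
  by apply: le_trans (ler_normB _ _) _; rewrite lerD2r ler_norml; apply/andP; split; lra.
have By : `|ncy (s, t) - b| <= S + `|b|.
  by apply: le_trans (ler_normB _ _) _; rewrite lerD2r ler_norml; apply/andP; split; lra.
have Q (x c : R) : `|x| <= c -> x ^+ 2 <= c ^+ 2.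
  move=> xc; rewrite -[x ^+ 2]real_normK ?num_real // ler_pXn2r ?nnegrE //.
  exact: le_trans xc.
have := Q _ _ Bx; have := Q _ _ By; have := normr_ge0 a; have := normr_ge0 b.
by move: (`|a|) (`|b|) (ncx _) (ncy _) Mt => A B X Y *; nra.
Qed.

Hint Resolve cont_ncx cont_ncy cont_rcx cont_rcy cont_sup_fun cont_cgx cont_cgy cont_ctx cont_cty cont_ka : cont.

(** The Jacobians of the two maps, continued by means of the maximum so as to be continuous and
    nonnegative on the whole plane, as [density_pushforward] requires. *)
Let wi (q : R * R) : R := Num.max q.2 0 * sup_fun q.1.
Let we (q : R * R) : R := 1 + ka q.1 * Num.max q.2 0.

Let cont_wi : continuous wi.
Proof.
by rewrite /wi; cts.
Qed.

Let cont_we : continuous we.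
Proof.
by rewrite /we; cts.
Qed.

Let wi_ge0 q : 0 <= wi q.
Proof. by rewrite mulr_ge0 // ?le_max ?lexx ?orbT // ltW // sup_fun_gt0. Qed.

Let we_ge0 q : 0 <= we q.
Proof. by rewrite addr_ge0 // mulr_ge0 ?ka_ge0 // le_max lexx orbT. Qed.

Let Gi (q : R * R) := (rcx q, rcy q).
Let Ge (q : R * R) := (ncx q, ncy q).

Let mGi : measurable_fun (setT : set (mR * mR)) (Gi : mR * mR -> mR * mR).
Proof. by apply: measurable_fun_pair; apply: cont_measurable2 => //; cts. Qed.

Let mGe : measurable_fun (setT : set (mR * mR)) (Ge : mR * mR -> mR * mR).
Proof. by apply: measurable_fun_pair; apply: cont_measurable2 => //; cts. Qed.

Let mdisc : measurable (disc : set (mR * mR)). Proof. exact: measurableX. Qed.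
Let mstrip : measurable (strip : set (mR * mR)). Proof. exact: measurableX. Qed.

Lemma strip_integral (F : R * R -> \bar R) (h : R * R -> R) (M : R) : 0 <= M ->
  measurable_fun (setT : set (mR * mR)) F -> (forall q, 0 <= F q)%E -> continuous h ->
  (forall s t, 0 < t -> F (s, t) = (h (s, t))%:E) -> (forall s t, M <= t -> h (s, t) = 0) ->
  (\int[area R]_(q in strip) F q =
   (\int[mu]_(t in `[0%R, M]) \int[mu]_(s in `[0%R, L]) h (s, t))%:E)%E.
Proof.
move=> M0 mF F0 ch Fh h0.
have cH : continuous (fun t => \int[mu]_(s in `[0, L]) h (s, t)) :=
  @cont_int2 _ (fun q => h (q.2, q.1)) 0 L (cont_swap ch).
rewrite integral_prod21 //.
transitivity (\int[mu]_(t in `]0%R, +oo[) (\int[mu]_(s in `[0%R, L]) h (s, t))%:E)%E.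
  apply: eq_integral => t; rewrite inE /= in_itv /= andbT => t0.
  rewrite /Rintegral fineK; last first.
    by apply: integrable_fin_num => //; apply: cont_intgb; exact: cont_sec1.
  by apply: eq_integral => s _; exact: Fh.
rewrite (@ge0_integral_tail _ 0 M); last 2 first.
- by apply/measurable_EFinP; exact: continuous_measurable_fun.
- move=> t Mt; rewrite (int_eq (fun s _ => h0 s t (ltW Mt))) int_cst ?mul0r //.
  exact/ltW/len_gt0.
rewrite /Rintegral [RHS]fineK //.
apply: integrable_fin_num => //.
exact: (cont_intgb _ _ cH).
Qed.

Lemma polar_measure : exists nu : {measure set (mR * mR) -> \bar R},
  forall F : R * R -> \bar R, measurable_fun (setT : set (mR * mR)) F -> (forall q, 0 <= F q)%E ->
  (\int[nu]_q F q = \int[area R]_(q in disc) ((wi q)%:E * F (Gi q)) +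
                    \int[area R]_(q in strip) ((we q)%:E * F (Ge q)))%E.
Proof.
have [n1 E1] := density_pushforward (area R) mdisc (cont_measurable2 measurableT cont_wi) mGi wi_ge0.
have [n2 E2] := density_pushforward (area R) mstrip (cont_measurable2 measurableT cont_we) mGe we_ge0.
exists (measure_add n1 n2) => F mF F0.
by rewrite ge0_integral_measure_add // E1 // E2.
Qed.

Section PolarMeasure.
Variable nu : {measure set (mR * mR) -> \bar R}.
Hypothesis nuE : forall F : R * R -> \bar R,
  measurable_fun (setT : set (mR * mR)) F -> (forall q, 0 <= F q)%E ->
  (\int[nu]_q F q = \int[area R]_(q in disc) ((wi q)%:E * F (Gi q)) +
                    \int[area R]_(q in strip) ((we q)%:E * F (Ge q)))%E.

Lemma disc_integral (f : R * R -> R) : continuous f ->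
  (\int[area R]_(q in disc) ((wi q)%:E * (f (Gi q))%:E))%E =
  (\int[mu]_(r in `[0, 1]) \int[mu]_(s in `[0, L]) (f (rcx (s, r), rcy (s, r)) * (r * sup_fun s)))%:E.
Proof.
move=> cf; pose g (q : R * R) := f (rcx q, rcy q) * (q.2 * sup_fun q.1).
have cg : continuous g by rewrite /g; cts.
transitivity (\int[area R]_(q in disc) (g q)%:E)%E; last exact: area_box21.
apply: eq_integral => -[s r]; rewrite inE => -[_] /=; rewrite in_itv /= => /andP[r0 _].
by rewrite -EFinM mulrC /g /wi /= (max_idPl r0).
Qed.

Let strip_integrable (f : R * R -> R) (M : R) : 0 <= M -> continuous f -> (forall p, 0 <= f p) ->
  (forall s t, M <= t -> f (ncx (s, t), ncy (s, t)) = 0) ->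
  (\int[area R]_(q in strip) ((we q)%:E * (f (Ge q))%:E))%E =
  (\int[mu]_(t in `[0, M]) \int[mu]_(s in `[0, L]) (f (ncx (s, t), ncy (s, t)) * (1 + ka s * t)))%:E.
Proof.
move=> M0 cf f0 fM; pose g (q : R * R) := f (ncx q, ncy q) * (1 + ka q.1 * q.2).
have cfG : continuous (fun q : R * R => f (ncx q, ncy q)) by cts.
have cg : continuous g by rewrite /g; cts.
apply: (@strip_integral _ g M) => //.
- have cwG : continuous (fun q : R * R => we q * f (ncx q, ncy q)) by cts.
  by apply/measurable_EFinP; apply: (cont_measurable2 measurableT cwG).
- by move=> q; rewrite -EFinM lee_fin mulr_ge0.
- by move=> s t t0; rewrite -EFinM mulrC /g /we /= (max_idPl (ltW t0)).
- by move=> s t Mt; rewrite /g /= fM ?mul0r.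
Qed.

Lemma polar_measureE (f : R * R -> R) (M : R) : 0 <= M -> continuous f -> (forall p, 0 <= f p) ->
  (forall s t, M <= t -> f (ncx (s, t), ncy (s, t)) = 0) ->
  (\int[nu]_q (f q)%:E = (polar_int M f)%:E)%E.
Proof.
move=> M0 cf f0 fM; rewrite nuE; last 2 first.
- by apply/measurable_EFinP; apply: cont_measurable2.
- by move=> q; rewrite lee_fin.
by rewrite disc_integral // (strip_integrable M0) // -EFinD.
Qed.

(** Subtracting from [u] the multiple of [w] with the same integral leaves a derivative, and
    [polar_int] annihilates the resulting partial derivative of a product. This is done once in each
    variable. *)
Lemma polar_int_tensor (S M : R) (u v w : R -> R) : 0 <= S -> smooth1 u -> smooth1 v -> smooth1 w ->
  (forall x, ~~ (- S < x < S) -> u x = 0) -> (forall x, ~~ (- S < x < S) -> v x = 0) ->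
  (forall x, ~~ (- S < x < S) -> w x = 0) ->
  \int[mu]_(x in `[- S, S]) w x != 0 -> 2 * (S + `|a| + `|b|) + 1 <= M ->
  polar_int M (fun p => u p.1 * v p.2) =
  \int[mu]_(x in `[- S, S]) u x * \int[mu]_(x in `[- S, S]) v x /
  (\int[mu]_(x in `[- S, S]) w x) ^+ 2 * polar_int M (fun p => w p.1 * w p.2).
Proof.
move=> S0 su sv sw u0 v0 w0 w1 SM.
have M0 : 0 <= M by have := normr_ge0 a; have := normr_ge0 b; lra.
have ct (f g : R -> R) : smooth1 f -> smooth1 g -> continuous (fun p : R * R => f p.1 * g p.2).
  by move=> /smooth1_cont cf /smooth1_cont cg; cts.
have reduce f k : smooth1 f -> (forall x, ~~ (- S < x < S) -> f x = 0) ->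
    \int[mu]_(x in `[- S, S]) f x = k * \int[mu]_(x in `[- S, S]) w x ->
    exists A, [/\ smooth1 A, forall x, is_deriv x A (f x - k * w x) &
      forall x, ~~ (- S < x < S) -> A x = 0].
  move=> sf f0 If; apply: smooth_zero_primitive.
  - exact: S0.
  - apply/smooth1P => n x0; apply: smatB; first by move/smooth1P: sf.
    by apply: smatM; [exact: smat_cst|move/smooth1P: sw].
  - by move=> x xS; rewrite f0 ?w0 ?mulr0 ?subrr.
  - have [cf cw] := (smooth1_cont sf, smooth1_cont sw).
    have ckw : continuous (fun x : R => k * w x) by apply: cont1Z; exact: cw.
    rewrite (intB _ _ cf ckw).
    by rewrite (intZ _ _ _ cw) If subrr.
have far s : ~~ ((- S < ncx (s, M) < S) && (- S < ncy (s, M) < S)) by exact: nc_far.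
have [A [sA dA A0]] := reduce u _ su u0 (esym (mulfVK w1 _)).
have [B [sB dB B0]] := reduce v _ sv v0 (esym (mulfVK w1 _)).
set c1 := (_ / _) in dA; set c2 := (_ / _) in dB.
have E1 : polar_int M (fun p => u p.1 * v p.2) = c1 * polar_int M (fun p => w p.1 * v p.2).
  apply/eqP; rewrite -subr_eq0 -polar_intB; [|exact: ct..].
  rewrite -(@polar_int_partial _ _ K a b M (fun p => A p.1 * v p.2) 0 (smooth_tensor sA sv) M0); last first.
    by move=> s; have := far s; rewrite negb_and => /orP[/A0 -> |/v0 ->]; rewrite ?mul0r ?mulr0.
  apply/eqP; congr polar_int; apply/funext => -[x y].
  rewrite partial0_tensor // derive1E (@derive_val _ _ _ _ _ _ _ (dA _)); ring.
have E2 : polar_int M (fun p => w p.1 * v p.2) = c2 * polar_int M (fun p => w p.1 * w p.2).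
  apply/eqP; rewrite -subr_eq0 -polar_intB; [|exact: ct..].
  rewrite -(@polar_int_partial _ _ K a b M (fun p => w p.1 * B p.2) 1 (smooth_tensor sw sB) M0); last first.
    by move=> s; have := far s; rewrite negb_and => /orP[/w0 -> |/B0 ->]; rewrite ?mul0r ?mulr0.
  apply/eqP; congr polar_int; apply/funext => -[x y].
  rewrite partial1_tensor // derive1E (@derive_val _ _ _ _ _ _ _ (dB _)); ring.
by rewrite E1 E2 /c1 /c2; field.
Qed.

(** On a product of bumps the image measure sees only the two integrals, as Lebesgue measure does.
    Bumps determine measures, so the two are proportional; injectivity of the coordinates is not
    involved. *)
Lemma polar_measure_area : exists2 c : R, 0 <= c &
  forall X : set (R * R), measurable (X : set (mR * mR)) -> nu X = (c%:E * area R X)%E.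
Proof.
pose w := bump 0 (- 1 : R) 1; pose S1 := \int[mu]_(x in `[- 1, 1]) w x.
have sw : smooth1 w by exact: smooth1_bump.
have w0 S x : 1 <= S -> ~~ (- S < x < S) -> w x = 0.
  move=> S1' xS; apply: bump_out; apply: contra xS => /andP[? ?]; apply/andP; split; lra.
have cw := smooth1_cont sw.
have wS S : 1 <= S -> \int[mu]_(x in `[- S, S]) w x = S1.
  move=> S1'; rewrite (int_split (b := -1) cw); [|lra..].
  rewrite (int_split (a := -1) (b := 1) cw); [|lra..].
  have Z x : ~~ (-1 < x < 1) -> w x = 0 by exact: bump_out.
  rewrite [X in X + _](_ : _ = 0) ?add0r; last first.
    rewrite (@int_eq _ _ (fun=> 0)) ?int_cst ?mul0r //; first lra.
    by move=> x /andP[_ x1]; apply: Z; rewrite negb_and -leNgt x1.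
  rewrite [X in _ + X](_ : _ = 0) ?addr0 //.
  rewrite (@int_eq _ _ (fun=> 0)) ?int_cst ?mul0r //.
  by move=> x /andP[x1 _]; apply: Z; rewrite negb_and -!leNgt x1 orbT.
have S1_gt0 : 0 < S1.
  apply: (@int_gt0 _ w (-1) 1 0) => //; first (by move=> x _; exact: bump_ge0); try lra.
  by apply: bump_gt0; apply/andP; split; lra.
pose W (p : R * R) := w p.1 * w p.2.
have W_ge0 p : 0 <= W p by rewrite mulr_ge0 // bump_ge0.
have cW : continuous W by rewrite /W; cts.
pose Mof S := 2 * (S + `|a| + `|b|) + 1.
have Mof_ge0 S : 0 <= S -> 0 <= Mof S by rewrite /Mof; have := normr_ge0 a; have := normr_ge0 b; lra.
have WE S : 1 <= S -> (\int[nu]_p (W p)%:E = (polar_int (Mof S) W)%:E)%E.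
  move=> S_ge1; apply: polar_measureE => //; first by apply: Mof_ge0; lra.
  move=> s t /(nc_far (S := S) s); rewrite negb_and /W /= => /orP[|] /(w0 _ _ S_ge1) ->; by rewrite ?mul0r ?mulr0.
(* The ratio of the two measures on the reference bump [W], whose Lebesgue integral is [S1 ^+ 2]. *)
pose c := fine (\int[nu]_p (W p)%:E)%E / S1 ^+ 2.
have c0 : 0 <= c.
  by rewrite divr_ge0 ?exprn_ge0 ?(ltW S1_gt0) // fine_ge0 // integral_ge0 // => p _; rewrite lee_fin.
exists c => //.
pose cn := NngNum c0.
have fin p q r s : (area R (`]p, q[%classic `*` `]r, s[%classic : set (R * R)) < +oo)%E.
  have -> : (area R (`]p, q[%classic `*` `]r, s[%classic : set (R * R)) =
    mu (`]p, q[%classic : set R) * mu (`]r, s[%classic : set R))%E by exact: product_measure1E.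
  rewrite !lebesgue_measure_itv /=; case: ifP => _; case: ifP => _; rewrite ?mul0e ?mule0 //.
  by rewrite -!EFinB -EFinM ltry.
apply: (@measure_bump_unique R nu (mscale cn (area R))); last first.
  by move=> p q r s; rewrite /mscale /=; apply: lte_mul_pinfty; rewrite ?lee_fin.
move=> k p q r s; pose S := 1 + `|p| + `|q| + `|r| + `|s|.
have Np := normr_ge0 p; have Nq := normr_ge0 q; have Nr := normr_ge0 r; have Ns := normr_ge0 s.
have S_ge1 : 1 <= S by rewrite /S; lra.
have out (x y z : R) : `|x| <= S -> `|y| <= S -> ~~ (- S < z < S) -> bump k x y z = 0.
  move=> xS yS zS; apply: bump_out; apply: contra zS => /andP[xz zy].
  by move: xS yS; rewrite !ler_norml => /andP[? ?] /andP[? ?]; apply/andP; split; lra.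
have out1 z : ~~ (- S < z < S) -> bump k p q z = 0 by apply: out; rewrite /S; lra.
have out2 z : ~~ (- S < z < S) -> bump k r s z = 0 by apply: out; rewrite /S; lra.
have cb := @cont_bump2 R k p q r s.
rewrite (polar_measureE (Mof_ge0 S _) cb); last 3 first.
- by lra.
- by move=> x; exact: bump2_ge0.
- move=> s' t /(nc_far (S := S) s'); rewrite negb_and /bump2 /= => /orP[/out1|/out2] ->;
    by rewrite ?mul0r ?mulr0.
rewrite ge0_integral_mscale //; last 2 first.
- by apply/measurable_EFinP; exact: (cont_measurable2 measurableT cb).
- by move=> x _; rewrite lee_fin bump2_ge0.
have -> : (\int[area R]_x (bump2 k p q r s x)%:E =
    (\int[mu]_(x in `[(- S)%R, S]) bump k p q x * \int[mu]_(x in `[(- S)%R, S]) bump k r s x)%:E)%E.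
  transitivity (\int[area R]_(x in `[(- S)%R, S] `*` `[(- S)%R, S]) (bump2 k p q r s x)%:E)%E.
    rewrite [RHS]integral_mkcond; apply: eq_integral => -[x y] _; rewrite /patch in_setX !mem_setE.
    have [//|] := boolP (_ && _); rewrite negb_and !in_itv /= => /orP[H|H]; rewrite /bump2 /=.
      by rewrite out1 ?mul0r //; apply: contra H => /andP[/ltW-> /ltW->].
    by rewrite out2 ?mulr0 //; apply: contra H => /andP[/ltW-> /ltW->].
  rewrite (area_box12 _ _ _ _ cb); congr EFin.
  have c1 : continuous (bump k r s) by exact/smooth1_cont/smooth1_bump.
  have c2 : continuous (bump k p q) by exact/smooth1_cont/smooth1_bump.
  rewrite -(intZr _ _ _ c2); apply: int_eq => x _; rewrite -(intZ _ _ _ c1); exact: int_eq.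
rewrite -EFinM; congr EFin.
have S0 : 0 <= S by lra.
have wS0 : \int[mu]_(x in `[- S, S]) w x != 0 by rewrite wS // gt_eqF.
have w0S x : ~~ (- S < x < S) -> w x = 0 by exact: w0.
have sb1 : smooth1 (bump k p q) by exact: smooth1_bump.
have sb2 : smooth1 (bump k r s) by exact: smooth1_bump.
have T := polar_int_tensor S0 sb1 sb2 sw out1 out2 w0S wS0 (lexx (Mof S)).
rewrite [polar_int _ _]T.
have -> : cn%:num = c by [].
by rewrite wS // /c (WE S) //= /W; ring.
Qed.

End PolarMeasure.

(** * The Gaussian that fixes the factor *)

Section Gaussian.

Implicit Types (x : R).
(** The function [2 * (1 - exp (- x / 2)) / x], written as an integral so as to be smooth at 0. By
    [dhE] the field [h(rho)] times the position relative to [(a, b)] has divergence [2 * g]. *)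
Let h (x : R) : R := \int[mu]_(u in `[0, 1]) expR (- (x * u / 2)).
Let dh (x : R) : R := \int[mu]_(u in `[0, 1]) (- (u / 2) * expR (- (x * u / 2))).

Let cexp (f : R * R -> R) : continuous f -> continuous (fun q => expR (f q)).
Proof. by move=> cf; apply: (cont_comp _ cf); exact: continuous_expR. Qed.

Let ce : continuous (fun q : R * R => expR (- (q.1 * q.2 / 2))).
Proof. by apply: cexp; cts. Qed.

Let ide_h x : is_deriv x h (dh x).
Proof.
apply: (@ide_int R (fun q => expR (- (q.1 * q.2 / 2))) (fun q => - (q.2 / 2) * expR (- (q.1 * q.2 / 2)))) => //.
  have := ce; move: (fun q => expR _) => e ?; cts.
move=> x' y /=; have D := @is_derive_expR R (- (x' * y / 2)).
apply: (ide_eq (ide_comp D (df := _) (g := fun x => - (x * y / 2)) _)).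
by rewrite !scaler0 add0r add0r mulrC; congr (- _ * _); rewrite -[_ *: (y%:A)]/(2^-1 * (y * 1)); ring.
Qed.

Let cont_h : continuous h. Proof. exact: (is_derive_cont ide_h). Qed.

Let cont_dh : continuous dh.
Proof.
apply: (@cont_int2 R (fun q => - (q.2 / 2) * expR (- (q.1 * q.2 / 2)))).
by have := ce; move: (fun q => expR _) => e ?; cts.
Qed.

Let dhE x : x * dh x + h x = expR (- (x / 2)).
Proof.
have ce1 : continuous (fun u : R => expR (- (x * u / 2))) by exact: (@cont_sec2 R (fun q => expR (- (q.1 * q.2 / 2))) x ce).
have ce2 : continuous (fun u : R => - (u / 2) * expR (- (x * u / 2))).
  by apply: cont1M ce1; cts.
have ce3 : continuous (fun u : R => x * (- (u / 2) * expR (- (x * u / 2)))).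
  by apply: cont1M ce2; cts.
rewrite /dh -(intZ _ _ _ ce2) /h -(intD _ _ ce3 ce1).
have ce4 := contD ce3 ce1.
have D u : is_deriv u (fun u => u * expR (- (x * u / 2)))
    (x * (- (u / 2) * expR (- (x * u / 2))) + expR (- (x * u / 2))).
  have D := @is_derive_expR R (- (x * u / 2)).
  have D2 : is_deriv u (fun u => - (x * u / 2)) (- (x / 2)).
    by apply: (ide_eq (ideN (ideM (ideM (ide_cst x u) (ide_id u)) (ide_cst (2^-1) u)))); ring.
  by apply: (ide_eq (ideM (ide_id u) (@ide_comp R expR (fun u => - (x * u / 2)) u _ _ D D2))); ring.
rewrite (FTC ler01 ce4 D).
by rewrite mulr1 mul1r mul0r subr0.
Qed.

Let hE x : x * h x = 2 * (1 - expR (- (x / 2))).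
Proof.
have ce1 : continuous (fun u : R => expR (- (x * u / 2))) by exact: (@cont_sec2 R (fun q => expR (- (q.1 * q.2 / 2))) x ce).
have ce2 : continuous (fun u : R => x * expR (- (x * u / 2))) by apply: cont1M ce1; cts.
have D u : is_deriv u (fun u => - 2 * expR (- (x * u / 2))) (x * expR (- (x * u / 2))).
  have D := @is_derive_expR R (- (x * u / 2)).
  have D2 : is_deriv u (fun u => - (x * u / 2)) (- (x / 2)).
    by apply: (ide_eq (ideN (ideM (ideM (ide_cst x u) (ide_id u)) (ide_cst (2^-1) u)))); ring.
  by apply: (ide_eq (ideM (ide_cst (- 2) u) (@ide_comp R expR (fun u => - (x * u / 2)) u _ _ D D2))); field.
rewrite /h -(intZ _ _ _ ce1) (FTC ler01 ce2 D).
by rewrite mulr1 mulr0 mul0r oppr0 expR0; ring.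
Qed.

Let rho (p : R * R) := (p.1 - a) ^+ 2 + (p.2 - b) ^+ 2.
Let g (p : R * R) := expR (- (rho p / 2)).

Let cg : continuous g. Proof. by apply: cexp; rewrite /rho; cts. Qed.

Lemma plane_gauss : (\int[area R]_p (g p)%:E = (2 * pi)%:E)%E.
Proof.
have N m : (\int[mu]_x (normal_fun m 1 x)%:E = (Num.sqrt (2 * pi))%:E)%E.
  have s0 : (Num.sqrt (2 * pi) : R) != 0 by rewrite sqrtr_eq0 -ltNge mulr_gt0 // pi_gt0.
  have := @integral_normal_pdf R m 1; rewrite normal_pdfE ?oner_eq0 //=.
  under eq_integral do rewrite EFinM.
  rewrite ge0_integralZl //; last 3 first.
  - by apply/measurable_EFinP; exact: measurable_normal_fun.
  - by move=> x _; rewrite lee_fin normal_fun_ge0.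
  - by rewrite lee_fin normal_peak_ge0.
  rewrite /normal_peak expr1n mul1r -mulr_natl => E.
  have : ((Num.sqrt (2 * pi))%:E * ((Num.sqrt (2 * pi))^-1%:E * \int[mu]_x (normal_fun m 1 x)%:E) = (Num.sqrt (2 * pi))%:E * 1 :> \bar R)%E by rewrite E.
  by rewrite muleA -EFinM mulfV // mul1e mule1.
have G (x y : R) : g (x, y) = normal_fun a 1 x * normal_fun b 1 y.
  by rewrite /g /rho /normal_fun /= -expRD; congr expR; rewrite expr1n; field.
rewrite -setXTT integral_prod21 //; last 2 first.
- by apply/measurable_EFinP; exact: (cont_measurable2 measurableT cg).
- by move=> p; rewrite lee_fin expR_ge0.
under eq_integral do under eq_integral do rewrite G EFinM.
under eq_integral => y _.
  rewrite ge0_integralZr //; last 3 first.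
  - by apply/measurable_EFinP; exact: measurable_normal_fun.
  - by move=> x _; rewrite lee_fin normal_fun_ge0.
  - by rewrite lee_fin normal_fun_ge0.
  rewrite N; over.
rewrite ge0_integralZl //; last 2 first.
- by apply/measurable_EFinP; exact: measurable_normal_fun.
- by move=> x _; rewrite lee_fin normal_fun_ge0.
by rewrite N -EFinM -expr2 sqr_sqrtr // mulr_ge0 // pi_ge0.
Qed.

(** The tangential component of the position relative to [(a, b)]; the normal component at height
    [t] is [sup_fun s + t]. Below, [P] is the flux density of the field [h(rho)] times position
    through the parallel curves, and [- Q] its tangential component. *)
Let q s := (gx s - a) * tx s + (gy s - b) * ty s.
Let rh (z : R * R) := rho (ncx z, ncy z).
Let P (z : R * R) := h (rh z) * ((sup_fun z.1 + z.2) * (1 + ka z.1 * z.2)).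
Let Pt (z : R * R) := dh (rh z) * (2 * (sup_fun z.1 + z.2)) * ((sup_fun z.1 + z.2) * (1 + ka z.1 * z.2)) +
  h (rh z) * (1 + ka z.1 * z.2 + (sup_fun z.1 + z.2) * ka z.1).
Let Q (z : R * R) := - (h (rh z) * q z.1).
Let Qs (z : R * R) := - (dh (rh z) * (2 * q z.1 * (1 + ka z.1 * z.2)) * q z.1 + h (rh z) * (1 - ka z.1 * sup_fun z.1)).

Let cont_rh : continuous rh. Proof. by rewrite /rh /rho /=; cts. Qed.
Let cont_q : continuous q.
Proof. by rewrite /q; cts. Qed.
Let cont_hrh : continuous (fun z => h (rh z)). Proof. exact: (cont_comp cont_h cont_rh). Qed.
Let cont_dhrh : continuous (fun z => dh (rh z)). Proof. exact: (cont_comp cont_dh cont_rh). Qed.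

Let rhE s t : rh (s, t) = (sup_fun s + t) ^+ 2 + q s ^+ 2.
Proof.
rewrite /rh /rho /= edist_nc; apply/eqP; rewrite -subr_eq0; apply/eqP; rewrite /q /sup_fun.
transitivity (((gx s - a) ^+ 2 + (gy s - b) ^+ 2) * (1 - (tx s ^+ 2 + ty s ^+ 2))); first by ring.
by rewrite unit_t subrr mulr0.
Qed.

Let dP s t : is_deriv t (fun t => P (s, t)) (Pt (s, t)).
Proof.
have dr : is_deriv t (fun t => rh (s, t)) (2 * (sup_fun s + t)).
  have -> : (fun t => rh (s, t)) = (fun t => (sup_fun s + t) ^+ 2 + q s ^+ 2) by apply/funext => t'; rewrite rhE.
  by apply: (ide_eq (ideD (ideX 1 (ideD (ide_cst _ t) (ide_id t))) (ide_cst _ t))); ring.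
have D1 := @ide_comp R h (fun t => rh (s, t)) t _ _ (ide_h _) dr.
have D2 := ideM (ideD (ide_cst (sup_fun s) t) (ide_id t)) (ideD (ide_cst 1 t) (ideM (ide_cst (ka s) t) (ide_id t))).
have D := ideM D1 D2.
apply: (ide_eq D).
by rewrite /Pt /=; ring.
Qed.

Let dQ s t : is_deriv s (fun s => Q (s, t)) (Qs (s, t)).
Proof.
have dA := ideX 1 (ideB (ncx_s K s t) (ide_cst a s)).
have dB := ideX 1 (ideB (ncy_s K s t) (ide_cst b s)).
have dr := ideD dA dB.
have dq := ideD (ideM (ideB (dgx K s) (ide_cst a s)) (dtx K s)) (ideM (ideB (dgy K s) (ide_cst b s)) (dty K s)).
have D1 := @ide_comp R h (fun s => rh (s, t)) s _ _ (ide_h _) dr.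
have D2 := ideN (ideM D1 dq).
apply: (ide_eq D2).
rewrite /Qs /=; congr (- _).
have U := unit_t K s.
congr (_ * _ * _ + _ * _).
- rewrite !subr0 /ncx /ncy /q /= !expr1; ring.
- rewrite !subr0 /sup_fun; apply/eqP; rewrite -subr_eq0 -{1}U; apply/eqP; ring.
Qed.

Let divE s t : Pt (s, t) - Qs (s, t) = 2 * ((1 + ka s * t) * g (ncx (s, t), ncy (s, t))).
Proof.
have -> : g (ncx (s, t), ncy (s, t)) = expR (- (rh (s, t) / 2)) by [].
rewrite /Pt /Qs /= -dhE rhE; ring.
Qed.

Let cont_P2 M : continuous (fun s => P (s, M)).
Proof.
have c : continuous P by rewrite /P; apply: cont2M cont_hrh _; cts.
exact: (@cont_sec1 R P M c).
Qed.

Let cont_Pt : continuous Pt.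
Proof.
rewrite /Pt; apply: cont2D; apply: cont2M; last by cts.
- by apply: cont2M cont_dhrh _; cts.
- by cts.
- exact: cont_hrh.
Qed.

Let cont_Qs : continuous Qs.
Proof.
rewrite /Qs; apply: cont2N; apply: cont2D; apply: cont2M; last by cts.
- by apply: cont2M cont_dhrh _; cts.
- by cts.
- exact: cont_hrh.
Qed.

Let H t := \int[mu]_(s in `[0, L]) ((1 + ka s * t) * g (ncx (s, t), ncy (s, t))).
(** The flux through the parallel curve at height [t]; it grows at the rate [2 * H t]. *)
Let Phi t := \int[mu]_(s in `[0, L]) P (s, t).

Let cgn : continuous (fun z : R * R => (1 + ka z.1 * z.2) * g (ncx z, ncy z)).
Proof. by have := cg; cts. Qed.

Let dPhi t : is_deriv t Phi (2 * H t).
Proof.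
pose P' (z : R * R) := P (z.2, z.1); pose Pt' (z : R * R) := Pt (z.2, z.1).
have cP' : continuous P'.
  by apply: (@cont_swap R P); rewrite /P; apply: cont2M cont_hrh _; cts.
have cPt' : continuous Pt' by exact: (@cont_swap R Pt cont_Pt).
have D : is_deriv t Phi (\int[mu]_(s in `[0, L]) Pt (s, t)).
  by apply: (@ide_int R P' Pt' 0 L t cP' cPt') => x y; exact: dP.
apply: (ide_eq D); rewrite /H -intZ; last exact: (@cont_sec1 R _ t cgn).
rewrite -[LHS]subr0.
have {2}<- : \int[mu]_(s in `[0, L]) Qs (s, t) = 0.
  rewrite (FTC (ltW (len_gt0 K)) (@cont_sec1 R Qs t cont_Qs) (fun s => dQ s t)).
  have E := ncL K t; rewrite /Q /rh /= -E.
  by rewrite /q gxL gyL txL tyL subrr.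
rewrite -intB; [|exact: (@cont_sec1 R Pt t cont_Pt)|exact: (@cont_sec1 R Qs t cont_Qs)].
by apply: int_eq => s _; exact: divE.
Qed.

(** Since [rho * h(rho)] tends to 2, the flux density tends to [2 * ka s], with error at most a
    constant over [t]. The total curvature [2 * pi] gives the limit. *)
Let Phi_cvg : Phi t @[t --> +oo] --> (2 * (2 * pi) : R).
Proof.
have [C C0 HC] := @cont_box_bound R (fun z => ka z.1 + sup_fun z.1 + (sup_fun z.1 ^+ 2 + q z.1 ^+ 2)) 0 L 0 0 ltac:(cts).
pose B := 2 + 6 * C + 4 * C ^+ 2.
have B0 : 0 < B by have := exprn_gt0 2 C0; rewrite /B; lra.
have bd s t : 0 <= s <= L -> 1 <= t -> `|P (s, t) - 2 * ka s| <= B / t.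
  move=> sL t1; have t0 : 0 < t by lra.
  move: (HC s 0 sL); rewrite !lexx => /(_ isT); rewrite /= => /ler_normlW.
  have k0 := ka_ge0 K s; have p0 := sup_fun_gt0 s.
  have q0 := sqr_ge0 (q s); have p2 := sqr_ge0 (sup_fun s).
  have rE := rhE s t; have hr := hE (rh (s, t)).
  have e0 := expR_ge0 (- (rh (s, t) / 2)).
  have e1 : expR (- (rh (s, t) / 2)) * (1 + rh (s, t) / 2) <= 1.
    rewrite -[leRHS](expR0) -(addNr (rh (s, t) / 2)) expRD ler_wpM2l //.
    exact: expR_ge1Dx.
  rewrite /P /=.
  move: (ka s) (sup_fun s) (q s ^+ 2) (rh (s, t)) (h (rh (s, t))) (expR _) k0 p0 q0 p2 rE hr e0 e1.
  move=> k p q2 r hh e k0 p0 q0 p2 rE hr e0 e1 HC'.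
  have r1 : t ^+ 2 <= r by rewrite rE; nra.
  have t2 : 0 < t ^+ 2 by rewrite exprn_gt0.
  have r0 : 0 < r by lra.
  have h2 : `|hh| <= 2 / t ^+ 2.
    have h0 : 0 <= hh by rewrite -(pmulr_rge0 _ r0) hr; nra.
    rewrite ger0_norm // ler_pdivlMr // mulrC.
    have : r * hh <= 2 by rewrite hr; lra.
    by apply: le_trans; rewrite ler_wpM2r.
  have e2 : e <= 2 / t ^+ 2.
    rewrite ler_pdivlMr //; have : e * r <= 2 by lra.
    by apply: le_trans; rewrite ler_wpM2l.
  (* By [hE] the constant [2 * k] is [k * r * hh] up to an exponentially small term. This cancels
     the quadratic term in [t] and leaves a linear one against [hh <= 2 / t ^+ 2]. *)
  have -> : hh * ((p + t) * (1 + k * t)) - 2 * k =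
     hh * (p + t - k * p * t - k * (p ^+ 2 + q2)) - 2 * k * e.
    transitivity (hh * ((p + t) * (1 + k * t)) - (k * (r * hh) + 2 * k * e)); first by rewrite hr; ring.
    by rewrite rE; ring.
  apply: le_trans (ler_normB _ _) _; rewrite normrM.
  have X : `|p + t - k * p * t - k * (p ^+ 2 + q2)| <= (1 + C + 2 * C ^+ 2) * t.
    have kC : k <= C by lra.
    have pC : p <= C by lra.
    have aC : p ^+ 2 + q2 <= C by lra.
    have kp : 0 <= k * p <= C ^+ 2 by rewrite mulr_ge0 ?(ltW p0) //= expr2 ler_pM // ltW.
    have ka' : 0 <= k * (p ^+ 2 + q2) <= C ^+ 2.
      by rewrite mulr_ge0 ?addr_ge0 //= expr2 ler_pM // addr_ge0.
    move: (k * p) (k * (p ^+ 2 + q2)) kp ka' => u v /andP[u0 u1] /andP[v0 v1].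
    have C2 := ltW (exprn_gt0 2 C0).
    have ut : u * t <= C ^+ 2 * t by rewrite ler_pM2r.
    have u't : 0 <= u * t by rewrite mulr_ge0 // ltW.
    have Ct : C <= C * t by rewrite ler_peMr // ltW.
    have C2t : C ^+ 2 <= C ^+ 2 * t by rewrite ler_peMr.
    by rewrite ler_norml; apply/andP; split; lra.
  have Y : `|2 * k * e| <= 2 * C * (2 / t ^+ 2).
    rewrite ger0_norm ?mulr_ge0 //; apply: ler_pM => //; first by rewrite mulr_ge0.
    lra.
  have Z : `|hh| * `|p + t - k * p * t - k * (p ^+ 2 + q2)| <= 2 / t ^+ 2 * ((1 + C + 2 * C ^+ 2) * t).
    by apply: ler_pM.
  apply: le_trans (lerD Z Y) _.
  have -> : 2 / t ^+ 2 * ((1 + C + 2 * C ^+ 2) * t) = (2 * (1 + C + 2 * C ^+ 2)) / t by field; rewrite gt_eqF.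
  have -> : 2 * C * (2 / t ^+ 2) = 4 * C / t / t by field; rewrite gt_eqF.
  have : 4 * C / t / t <= 4 * C / t.
    rewrite ler_pdivrMr // ler_peMr // divr_ge0 ?(ltW t0) //; lra.
  have -> : B / t = (2 * (1 + C + 2 * C ^+ 2)) / t + 4 * C / t by rewrite /B; field; rewrite gt_eqF.
  lra.
apply/cvgrPdist_le => e e0; near=> t.
have t1 : 1 <= t by near: t; apply: nbhs_pinfty_ge; rewrite num_real.
have t2 : B * L / e <= t by near: t; apply: nbhs_pinfty_ge; rewrite num_real.
rewrite -(int_ka K) -(intZ _ _ _ (cont_ka (c := K))) distrC /Phi.
have c2 : continuous (fun s => 2 * ka s) by cts.
rewrite -(intB _ _ (@cont_P2 t) c2).
have := int_bound (contB (@cont_P2 t) c2) (ltW (len_gt0 K)) (fun s sL => bd s t sL t1).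
move/le_trans; apply; rewrite subr0.
have t0 : 0 < t by lra.
by move: t2; rewrite ler_pdivrMr // => t2; rewrite mulrAC ler_pdivrMr // [e * t]mulrC.
Unshelve. all: by end_near.
Qed.

(** Half of the flux at infinity minus the flux through the boundary. *)
Lemma strip_gauss : (\int[area R]_(z in strip) ((we z)%:E * (g (Ge z))%:E))%E =
  (2 * pi - Phi 0 / 2)%:E.
Proof.
have cwg : continuous (fun z : R * R => we z * g (ncx z, ncy z)) by have := cg; cts.
rewrite integral_prod21 //; last 2 first.
- by apply/measurable_EFinP; exact: (cont_measurable2 measurableT cwg).
- by move=> z; rewrite -EFinM lee_fin mulr_ge0 // expR_ge0.
have cH : continuous H.
  exact: (@cont_int2 R (fun z => (1 + ka z.2 * z.1) * g (ncx (z.2, z.1), ncy (z.2, z.1))) 0 L (cont_swap cgn)).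
transitivity (\int[mu]_(t in `]0%R, +oo[) (H t)%:E)%E.
  apply: eq_integral => t; rewrite inE /= in_itv /= andbT => t0.
  rewrite /H /Rintegral fineK; last first.
    by apply: integrable_fin_num => //; apply: cont_intgb; exact: (@cont_sec1 R _ t cgn).
  by apply: eq_integral => s _; rewrite -EFinM /we /= (max_idPl (ltW t0)).
rewrite integral_itv_obnd_cbnd; last first.
  apply: measurable_funTS; apply/measurable_EFinP; exact: continuous_measurable_fun.
have D t : is_deriv t (fun t => Phi t / 2) (H t).
  by apply: (ide_eq (ideM (dPhi t) (ide_cst (2^-1) t))); field.
rewrite (@ge0_continuous_FTC2y R H (fun t => Phi t / 2) 0 (2 * pi)).
- by rewrite EFinB.
- move=> t t0; apply: int_ge0 => s _; rewrite mulr_ge0 ?expR_ge0 //.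
  by rewrite addr_ge0 // mulr_ge0 // ka_ge0.
- exact: continuous_subspaceT.
- have -> : 2 * pi = 2 * (2 * pi) / 2 :> R by field.
  by apply: cvgM; [exact: Phi_cvg|exact: cvg_cst].
- by move=> t _; have [] := D t.
- apply: cvg_at_right_filter; exact: (is_derive_cont D).
- by move=> t _; rewrite derive1E; have [_ ->] := D t.
Qed.

(** Along a ray the integrand has the primitive [r ^+ 2 * h (r ^+ 2 * A) * (sup_fun s / 2)], by
    [dhE]; its value at [r = 1] is half of the flux density at the boundary. *)
Lemma disc_gauss : \int[mu]_(r in `[0, 1]) \int[mu]_(s in `[0, L])
  (g (rcx (s, r), rcy (s, r)) * (r * sup_fun s)) = Phi 0 / 2.
Proof.
have cf : continuous (fun z : R * R => g (rcx (z.2, z.1), rcy (z.2, z.1)) * (z.1 * sup_fun z.2)).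
  apply: (@cont_swap R (fun z => g (rcx z, rcy z) * (z.2 * sup_fun z.1))); apply: cont2M; last by cts.
  by apply: (cont_comp cg); apply: cont_pair; [exact: cont_rcx|exact: cont_rcy].
rewrite (@int_swap R (fun z => g (rcx (z.2, z.1), rcy (z.2, z.1)) * (z.1 * sup_fun z.2))) //.
rewrite /Phi -(intZr _ _ _ (@cont_P2 0)); apply: int_eq => s _ /=.
pose A := (gx s - a) ^+ 2 + (gy s - b) ^+ 2.
have gE r : g (rcx (s, r), rcy (s, r)) = expR (- (r ^+ 2 * A / 2)).
  by rewrite /g; congr (expR (- (_ / 2))); rewrite /rho /rcx /rcy /= /A; ring.
have D r : is_deriv r (fun r => r ^+ 2 * h (r ^+ 2 * A) * (sup_fun s / 2))
    (g (rcx (s, r), rcy (s, r)) * (r * sup_fun s)).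
  have d2 := ideX 1 (ide_id r).
  have dA := ideM d2 (ide_cst A r).
  have dH := @ide_comp R h (fun r => r ^+ 2 * A) r _ _ (ide_h _) dA.
  have := ideM (ideM d2 dH) (ide_cst (sup_fun s / 2) r).
  by move/ide_eq; apply; rewrite gE -dhE; field.
rewrite (FTC ler01 (@cont_sec2 R _ s (cont_swap cf)) D) /P /rh /rho /ncx /ncy /= /A.
by rewrite !expr1n expr0n /= !mul0r !mulr0 !addr0 !subr0 !mul1r mulr1 mulrA.
Qed.

(** The inner and the outer part of the Gaussian add up to [2 * pi], its integral over the plane, so
    the factor is 1. *)
Lemma polar_measure_gauss (nu : {measure set (mR * mR) -> \bar R}) :
  (forall F : R * R -> \bar R,
  measurable_fun (setT : set (mR * mR)) F -> (forall q, 0 <= F q)%E ->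
  (\int[nu]_q F q = \int[area R]_(q in disc) ((wi q)%:E * F (Gi q)) +
                    \int[area R]_(q in strip) ((we q)%:E * F (Ge q)))%E) ->
  forall X : set (R * R), measurable (X : set (mR * mR)) -> nu X = area R X.
Proof.
move=> nuE; have [c c0 nuX] := polar_measure_area nuE.
have mg : measurable_fun (setT : set (mR * mR)) (EFin \o g).
  by apply/measurable_EFinP; exact: (cont_measurable2 measurableT cg).
have g0 z : (0 <= (g z)%:E)%E by rewrite lee_fin expR_ge0.
have : (\int[nu]_z (g z)%:E = (2 * pi)%:E)%E.
  rewrite nuE // (disc_integral cg) disc_gauss strip_gauss -EFinD; congr EFin; ring.
have -> : (\int[nu]_z (g z)%:E = \int[mscale (NngNum c0) (area R)]_z (g z)%:E)%E.
  by apply: eq_measure_integral => X mX _; exact: nuX.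
rewrite ge0_integral_mscale // plane_gauss -EFinM /= => -[E].
have c1 : c = 1.
  apply: (@mulIf _ (2 * pi)); last by rewrite mul1r.
  by rewrite mulf_neq0 // gt_eqF // pi_gt0.
by move=> X /nuX ->; rewrite c1 mul1e.
Qed.

End Gaussian.

Lemma boundary_gamma s : boundary Omega (gx s, gy s).
Proof.
have [z s'L E] := periodic_reduce s (len_gt0 K).
rewrite (boundary_curve K); exists (s - L * z%:~R); first by rewrite /= in_itv.
by rewrite (E _ (gx_per K)) (E _ (gy_per K)).
Qed.

Lemma rc_closure (s t : R) : 0 <= t <= 1 -> closure Omega (rcx (s, t), rcy (s, t)).
Proof.
move=> t01; pose f (p : R * R) := (a + t * (p.1 - a), b + t * (p.2 - b)).
have c1 : continuous (fun p : R * R => a + t * (p.1 - a)) by cts.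
have c2 : continuous (fun p : R * R => b + t * (p.2 - b)) by cts.
have cf : continuous f := cont_pair c1 c2.
have sub : closure Omega `<=` f @^-1` closure Omega.
  have cl : closed (f @^-1` closure Omega) by apply: closed_comp => [z _|]; [exact: cf|exact: closed_closure].
  rewrite [X in _ `<=` X](closure_id _).1 //; apply: closure_subset => p Op.
  by apply: subset_closure; exact: (cvx Oab Op t01).
apply: (sub (gx s, gy s)).
suff [] : boundary Omega (gx s, gy s) by [].
exact: boundary_gamma.
Qed.

Lemma closure_support (s : R) p : closure Omega p -> (p.1 - gx s) * ty s - (p.2 - gy s) * tx s <= 0.
Proof.
pose f (p : R * R) := (p.1 - gx s) * ty s - (p.2 - gy s) * tx s.
have cf : continuous f by rewrite /f; cts.
have cl : closed (f @^-1` [set x | x <= 0]) by apply: closed_comp => [z _|]; [exact: cf|exact: closed_le].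
suff : closure Omega `<=` f @^-1` [set x | x <= 0] by apply.
rewrite [X in _ `<=` X](closure_id _).1 //; apply: closure_subset => z Oz.
exact/ltW/support_lt.
Qed.

Lemma nc_exterior (s t : R) : 0 < t -> exterior Omega (ncx (s, t), ncy (s, t)).
Proof.
move=> t0 /(closure_support s); rewrite /ncx /ncy /= leNgt => /negP; apply.
have -> : (gx s + t * ty s - gx s) * ty s - (gy s - t * tx s - gy s) * tx s = t * (tx s ^+ 2 + ty s ^+ 2) by ring.
by rewrite unit_t mulr1.
Qed.

Lemma open_exterior : open (exterior Omega).
Proof. by rewrite openC; exact: closed_closure. Qed.

(** The image measure is Lebesgue measure. Its inner part is carried by the closure of [Omega] and
    contributes nothing; its outer part is carried by the exterior. *)
Theorem exterior_integral (F : R * R -> \bar R) :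
  measurable_fun (setT : set (mR * mR)) F -> (forall q, 0 <= F q)%E ->
  (\int[area R]_(p in exterior Omega) F p =
   \int[area R]_(q in strip) ((1 + ka q.1 * q.2)%:E * F (ncx q, ncy q)))%E.
Proof.
move=> mF F0; have [nu nuE] := polar_measure.
have nuX := polar_measure_gauss nuE.
have mE : measurable (exterior Omega : set (mR * mR)) by apply: open_measurable2; exact: open_exterior.
have -> : (\int[area R]_(p in exterior Omega) F p = \int[nu]_(p in exterior Omega) F p)%E.
  by apply: eq_measure_integral => X mX _; exact/esym/nuX.
rewrite integral_mkcond nuE; last 2 first.
- by apply/(measurable_restrictT _ _).1 => //; exact: measurable_funTS.
- by move=> z; rewrite /patch; case: ifP.
rewrite [X in (X + _)%E]integral0_eq ?add0e; last first.
  move=> [s r] [_ /= r01]; rewrite /patch memNset ?mule0 //=.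
  by apply; apply: rc_closure; move: r01; rewrite in_itv.
apply: eq_integral => -[s t]; rewrite inE => -[_ /=]; rewrite in_itv /= andbT => t0.
have et : exterior Omega (ncx (s, t), ncy (s, t)) by exact: nc_exterior.
rewrite patchE mem_set //.
by rewrite /we /= (max_idPl (ltW t0)).
Qed.

End NormalCoordinates.

(** Two mean values split the increment of [f] along the graph of [y] into
    [A x * (x - x0) + B x * (y x - y x0) = 0]. Existence and continuity of [y] come from the caller,
    so only the formula for the derivative is at stake. *)
Lemma ide_implicit {R : realType} (f fx fy : R * R -> R) (y : R -> R) (x0 : R) :
  (forall x y, is_deriv x (fun x => f (x, y)) (fx (x, y))) ->
  (forall x y, is_deriv y (fun y => f (x, y)) (fy (x, y))) ->
  continuous fx -> continuous fy -> {for x0, continuous y} ->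
  (\forall x \near x0, f (x, y x) = 0) -> fy (x0, y x0) != 0 ->
  is_deriv x0 y (- (fx (x0, y x0) / fy (x0, y x0))).
Proof.
move=> ffx ffy cfx cfy cy f0 fy0.
have /choice[C HC] : forall x, exists c, `|c - x0| <= `|x - x0| /\
    f (x, y x) - f (x0, y x) = fx (c, y x) * (x - x0).
  by move=> x; have [c] := mean_value x0 x (fun x' => ffx x' (y x)); exists c.
have /choice[D HD] : forall x, exists c, `|c - y x0| <= `|y x - y x0| /\
    f (x0, y x) - f (x0, y x0) = fy (x0, c) * (y x - y x0).
  by move=> x; have [c] := mean_value (y x0) (y x) (fun y' => ffy x0 y'); exists c.
have near_cont (u : R -> R) (v : R -> R) : {for x0, continuous u} ->
    (forall x, `|v x - u x0| <= `|u x - u x0|) -> v x0 = u x0 /\ {for x0, continuous v}.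
  move=> cu uv.
  have v0 : v x0 = u x0 by apply/eqP; rewrite -subr_eq0 -normr_le0 (le_trans (uv _)) // subrr normr0.
  split=> //; rewrite /prop_for /continuous_at v0; apply/cvgrPdist_lt => e e0.
  have /cvgrPdist_lt /(_ e e0) := cu; apply: filterS => x Hx; rewrite distrC.
  by apply: le_lt_trans (uv x) _; rewrite distrC.
have cx : {for x0, continuous (fun x : R => x)} by exact: cont_id.
have [C0 cC] := near_cont (fun x => x) C cx (fun x => (HC x).1).
have [D0 cD] := near_cont y D cy (fun x => (HD x).1).
pose A x := fx (C x, y x); pose B x := fy (x0, D x).
have cA : {for x0, continuous A}.
  apply: (@continuous_comp _ _ _ (fun x => (C x, y x)) fx); last exact: cfx.
  exact: cont_pair_at.
have cB : {for x0, continuous B}.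
  apply: (@continuous_comp _ _ _ (fun x => (x0, D x)) fy); last exact: cfy.
  by apply: (@cont_pair_at _ _ _ (fun=> x0) D x0 _ cD); exact: cst_continuous.
have B0 : B x0 = fy (x0, y x0) by rewrite /B D0.
have fx00 := nbhs_singleton f0.
(* The Caratheodory slope must factor the increment of [y] at every [x]; where the implicit equation
   or [B x != 0] fails, the difference quotient is used. *)
pose h x := if (f (x, y x) == 0) && (B x != 0) then - (A x / B x) else (y x - y x0) / (x - x0).
have hx0 : h x0 = - (A x0 / B x0) by rewrite /h fx00 eqxx B0 fy0.
apply/is_derive1_caratheodory; exists h; split.
- move=> x; have [->|xx0] := eqVneq x x0; first by rewrite !subrr mulr0.
  rewrite /h; case: ifPn => [/andP[/eqP fx0' Bx]|_]; last by rewrite divfK // subr_eq0.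
  have E : A x * (x - x0) + B x * (y x - y x0) = 0.
    have [_ E1] := HC x; have [_ E2] := HD x.
    by rewrite /A /B -E1 -E2 fx0' fx00; ring.
  apply: (mulfI Bx); move/eqP: E; rewrite addrC addr_eq0 => /eqP ->; field.
  exact: Bx.
- have cAB : {for x0, continuous (fun x => - (A x / B x))}.
    apply: (@continuousN _ R^o); apply: continuousM => //.
    by apply: continuousV => //; rewrite B0.
  rewrite /prop_for /continuous_at hx0.
  apply: cvg_trans cAB; apply: near_eq_cvg.
  have Bn : \forall x \near x0, B x != 0.
    by apply: (cB (fun b => b != 0)); apply: open_nbhs_nbhs; split; [exact: open_neq|rewrite B0].
  near=> x; rewrite /h ifT //; apply/andP; split; last by near: x.
  by apply/eqP; near: x.
- by rewrite hx0 /A C0 B0.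
Unshelve. all: by end_near.
Qed.

(** Here [d] is the cosine of the angle between the two frames. The supporting inequalities become
    [r <= r' * d] and [r' <= r * d], and [d <= 1] forces equality throughout. *)
Lemma frame_eq {R : realType} (r r' a b a' b' : R) : 0 < r -> 0 < r' ->
  a ^+ 2 + b ^+ 2 = 1 -> a' ^+ 2 + b' ^+ 2 = 1 ->
  (r * b - r' * b') * b - (- (r * a) + r' * a') * a <= 0 ->
  (r' * b' - r * b) * b' - (- (r' * a') + r * a) * a' <= 0 -> [/\ r = r', a = a' & b = b'].
Proof.
move=> r0 r'0 U U' S1 S2; pose d := a * a' + b * b'.
have h1 := sqr_ge0 (a - a'); have h2 := sqr_ge0 (b - b').
have dE : (a - a') ^+ 2 + (b - b') ^+ 2 = 2 - 2 * d by rewrite /d; lra.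
have d1 : d <= 1 by lra.
have S1' : r <= r' * d.
  have -> : r' * d = r - ((r * b - r' * b') * b - (- (r * a) + r' * a') * a) + r * (a ^+ 2 + b ^+ 2 - 1) by rewrite /d; ring.
  by rewrite U subrr mulr0 addr0; lra.
have S2' : r' <= r * d.
  have -> : r * d = r' - ((r' * b' - r * b) * b' - (- (r' * a') + r * a) * a') + r' * (a' ^+ 2 + b' ^+ 2 - 1) by rewrite /d; ring.
  by rewrite U' subrr mulr0 addr0; lra.
have rr : r = r'.
  apply/eqP; rewrite eq_le; apply/andP; split.
    by apply: le_trans S1' _; rewrite ler_piMr // ltW.
  by apply: le_trans S2' _; rewrite ler_piMr // ltW.
have dd : d = 1.
  apply/eqP; rewrite eq_le d1 /= -(ler_pM2l r0) mulr1 {1}rr; exact: S2'.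
split=> //.
  have /eqP : (a - a') ^+ 2 = 0 by lra.
  by rewrite sqrf_eq0 subr_eq0 => /eqP.
have /eqP : (b - b') ^+ 2 = 0 by lra.
by rewrite sqrf_eq0 subr_eq0 => /eqP.
Qed.

(** * Test functions from normal coordinates *)

Section Tube.
Context {R : realType} (Omega : set (R * R)) (K : convex_curve Omega).
Notation L := (len K).
Notation gx := (gx K).
Notation gy := (gy K).
Notation tx := (tx K).
Notation ty := (ty K).
Notation ka := (ka K).
Notation ncx := (ncx K).
Notation ncy := (ncy K).
Notation ang := (ang K).
Implicit Types (s t : R).

Lemma ka_per s : ka (s + L) = ka s.
Proof.
have E : (fun s => ang (s + L)) = (fun s => ang s + 2 * pi) by apply/funext => x; rewrite ang_per.
have D1 := @ide_comp R ang (fun s => s + L) s _ _ (dang K (s + L)) (ideD (ide_id s) (ide_cst L s)).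
have D2 := ideD (dang K s) (ide_cst (2 * pi) s).
rewrite E in D1; have := ide_uniq D1 D2.
by rewrite !addr0 mulr1.
Qed.

Lemma ka_bounded : exists2 C, 0 < C & forall s, ka s <= C.
Proof.
have ck : continuous (fun q : R * R => ka q.1) by cts.
have [C C0 HC] := cont_box_bound 0 L 0 1 ck.
exists C => // s; have [z /andP[z0 zL] E] := periodic_reduce s (len_gt0 K).
rewrite -(E _ ka_per); apply: le_trans (ler_norm _) _.
by apply: (HC _ 0); rewrite ?lexx ?ler01 // z0 ltW.
Qed.

(** Half the reciprocal of a curvature bound, so that the Jacobian stays at least [1 / 2] down to
    height [- dl]. *)
Definition tube_width : R := (2 * xget 1 [set C | 0 < C /\ forall s, ka s <= C])^-1.
Notation dl := tube_width.

Lemma tube_widthP : 0 < dl /\ forall s, dl * ka s <= 2^-1.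
Proof.
rewrite /dl; case: xgetP => [C _ [C0 HC]|H]; last first.
  by have [C C0 HC] := ka_bounded; case: (H C).
split=> [|s]; first by rewrite invr_gt0 mulr_gt0.
rewrite invfM -mulrA ler_piMr ?invr_ge0 // mulrC ler_pdivrMr // mul1r.
exact: HC.
Qed.

Lemma tube_width_gt0 : 0 < dl. Proof. by have [] := tube_widthP. Qed.

(** The speed of the inner parallel curve [(cx, cy)] at distance [dl]. Measured from this curve, all
    heights above [- dl] are positive distances along outward normals. *)
Let w s := 1 - dl * ka s.
Let w_gt0 s : 0 < w s. Proof. by have [_ /(_ s)] := tube_widthP; rewrite /w; lra. Qed.
Let cx s := ncx (s, - dl).
Let cy s := ncy (s, - dl).

Let dcx s : is_deriv s cx (w s * tx s).
Proof. by apply: (ide_eq (ncx_s K s (- dl))); rewrite /w; ring. Qed.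

Let dcy s : is_deriv s cy (w s * ty s).
Proof. by apply: (ide_eq (ncy_s K s (- dl))); rewrite /w; ring. Qed.

Let cx_per s : cx (s + L) = cx s. Proof. by rewrite /cx /ncx /= gx_per ty_per. Qed.
Let cy_per s : cy (s + L) = cy s. Proof. by rewrite /cy /ncy /= gy_per tx_per. Qed.

Let cont_w : continuous w. Proof. by rewrite /w; cts. Qed.

Lemma ang_nd s s' : s <= s' -> ang s <= ang s'.
Proof.
move=> ss; rewrite -subr_ge0 -(FTC ss (@cont_ka R Omega K) (dang K)).
by apply: int_ge0 => u _; exact: ka_ge0.
Qed.

(* The inner parallel curve at distance [dl] is again convex: seen from the
   tangent at [s], it goes down while the angle increases by [pi], then up. *)
Lemma tube_support s s' : (cx s' - cx s) * ty s - (cy s' - cy s) * tx s <= 0.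
Proof.
pose H u := (cx u - cx s) * ty s - (cy u - cy s) * tx s.
pose dH u := - (w u * sin (ang u - ang s)).
have HdH u : is_deriv u H (dH u).
  have D := ideB (ideM (ideB (dcx u) (ide_cst (cx s) u)) (ide_cst (ty s) u))
    (ideM (ideB (dcy u) (ide_cst (cy s) u)) (ide_cst (tx s) u)).
  apply: (ide_eq D); rewrite /dH sinB /tx /ty; ring.
have cdH : continuous dH.
  have ca : continuous (fun u => ang u - ang s).
    by apply: contB; [apply: smooth1_cont; exact: smooth_ang|exact: cont_cst].
  have cs : continuous (fun u => sin (ang u - ang s)) by apply: (cont_comp _ ca); exact: continuous_sin.
  have cw := cont_w; rewrite /dH; exact: contN (contM cw cs).
have H0 : H s = 0 by rewrite /H !subrr !mul0r subrr.
have HL : H (s + L) = 0 by rewrite /H cx_per cy_per !subrr !mul0r subrr.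
have main u : s <= u <= s + L -> H u <= 0.
  move=> /andP[su uL]; have [A|A] := leP (ang u - ang s) pi.
    rewrite -H0 -subr_le0 -(FTC su cdH HdH) -oppr_ge0 -mulN1r -(intZ _ _ _ cdH).
    apply: int_ge0 => x /andP[sx xu]; rewrite mulN1r opprK mulr_ge0 ?(ltW (w_gt0 _)) //.
    apply: sin_ge0_pi; rewrite subr_ge0 ang_nd //= (le_trans _ A) // lerD2r; exact: ang_nd.
  rewrite -HL -subr_ge0 -(FTC uL cdH HdH); apply: int_ge0 => x /andP[ux xL].
  rewrite /dH -mulrN mulr_ge0 ?(ltW (w_gt0 _)) //.
  rewrite -sinDpi -[ang x]/(ang x) -sinD2pi.
  have -> : ang x - ang s + pi + pi *+ 2 = ang x - ang s - pi + pi *+ 2 + pi *+ 2 by ring.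
  rewrite !sinD2pi; apply: sin_ge0_pi; apply/andP; split.
    by have := ang_nd ux; lra.
  by have := ang_nd xL; rewrite ang_per; lra.
have [z z0 E] := periodic_reduce (s' - s) (len_gt0 K).
have Hper : forall x, H (s + (x + L)) = H (s + x) by move=> x; rewrite addrA /H cx_per cy_per.
rewrite -[X in X <= _]/(H s').
have := E (fun x => H (s + x)) Hper; rewrite [s + (s' - s)]addrC subrK => <-.
by apply: main; move: z0 => /andP[? ?]; apply/andP; split; lra.
Qed.

Let ncE s t : ncx (s, t) = cx s + (t + dl) * ty s /\ ncy (s, t) = cy s - (t + dl) * tx s.
Proof. by rewrite /cx /cy /ncx /ncy /=; split; ring. Qed.

(** Both coordinate pairs describe the point by a positive distance along a normal of the inner
    parallel curve, which is supported by its tangents; [frame_eq] identifies distances and frames.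
    Equality of the parameters modulo [L] is expressed through all periodic functions. *)
Lemma nc_periods_eq s s' t t' : - dl < t -> - dl < t' ->
  ncx (s, t) = ncx (s', t') -> ncy (s, t) = ncy (s', t') ->
  t = t' /\ forall f : R -> R, (forall x, f (x + L) = f x) -> f s = f s'.
Proof.
move=> t0 t'0 Ex Ey.
have [E1 E2] := ncE s t; have [E1' E2'] := ncE s' t'.
have S1 := tube_support s s'; have S2 := tube_support s' s.
have U := unit_t K s; have U' := unit_t K s'.
have X : cx s' - cx s = (t + dl) * ty s - (t' + dl) * ty s' by move: Ex; rewrite E1 E1'; lra.
have Y : cy s' - cy s = - ((t + dl) * tx s) + (t' + dl) * tx s' by move: Ey; rewrite E2 E2'; lra.
have X' : cx s - cx s' = (t' + dl) * ty s' - (t + dl) * ty s by lra.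
have Y' : cy s - cy s' = - ((t' + dl) * tx s') + (t + dl) * tx s by lra.
rewrite X Y in S1; rewrite X' Y' in S2.
have r0 : 0 < t + dl by lra.
have r'0 : 0 < t' + dl by lra.
have [rr ea eb] := frame_eq r0 r'0 U U' S1 S2.
have eg : gx s = gx s' /\ gy s = gy s'.
  move: X Y; rewrite -rr -ea -eb /cx /cy /ncx /ncy /= -ea -eb => X Y; split; lra.
split; first lra.
move=> f fper.
have [z z0 E] := periodic_reduce s (len_gt0 K); have [z' z'0 E'] := periodic_reduce s' (len_gt0 K).
rewrite -(E f fper) -(E' f fper); congr f; apply: (curve_inj (c := K)) => //.
- by rewrite (E _ (gx_per K)) (E' _ (gx_per K)); case: eg.
- by rewrite (E _ (gy_per K)) (E' _ (gy_per K)); case: eg.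
Qed.

Lemma nc_inj_near s s' t t' : - dl < t -> - dl < t' -> `|s - s'| < L ->
  ncx (s, t) = ncx (s', t') -> ncy (s, t) = ncy (s', t') -> s = s' /\ t = t'.
Proof.
move=> t0 t'0 ss Ex Ey; have [-> P] := nc_periods_eq t0 t'0 Ex Ey; split=> //.
have [z z0 E] := periodic_reduce s (len_gt0 K); have [z' z'0 E'] := periodic_reduce s' (len_gt0 K).
have L0 := len_gt0 K.
have e : s - L * z%:~R = s' - L * z'%:~R.
  apply: (curve_inj (c := K)) => //.
  - by rewrite (E _ (gx_per K)) (E' _ (gx_per K)); exact: P (gx_per K).
  - by rewrite (E _ (gy_per K)) (E' _ (gy_per K)); exact: P (gy_per K).
have ez : s - s' = L * (z - z')%:~R by rewrite intrB mulrBr; lra.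
move: ss; rewrite ez normrM gtr0_norm // gtr_pMr // -intr_norm ltrz1 => zz.
have /eqP : (`|z - z'| = 0)%R by lia.
rewrite normr_eq0 => /eqP zz0; apply/eqP; rewrite -subr_eq0 ez zz0 mulr0 //.
Qed.

(** The tangential and, next, the normal coordinate of [x] in the frame of the inner curve at [s].
    The point lies on the normal line at [s] exactly when [F x s = 0]. *)
Let F (x : R * R) s := (x.1 - cx s) * tx s + (x.2 - cy s) * ty s.
Let Rr (x : R * R) s := (x.1 - cx s) * ty s - (x.2 - cy s) * tx s.

Let dF x s : is_deriv s (F x) (- (w s + ka s * Rr x s)).
Proof.
have D := ideD (ideM (ideB (ide_cst x.1 s) (dcx s)) (dtx K s)) (ideM (ideB (ide_cst x.2 s) (dcy s)) (dty K s)).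
apply: (ide_eq D); have U := unit_t K s; rewrite /Rr; move: U; move: (tx s) (ty s) => a b U.
transitivity (- (w s * (a ^+ 2 + b ^+ 2)) - ka s * ((x.1 - cx s) * b - (x.2 - cy s) * a)); first by ring.
by rewrite U; ring.
Qed.

Let Fnc s t : F (ncx (s, t), ncy (s, t)) s = 0 /\ Rr (ncx (s, t), ncy (s, t)) s = t + dl.
Proof.
have [E1 E2] := ncE s t; rewrite /F /Rr /= E1 E2; split; first by ring.
by rewrite -[RHS]mulr1 -(unit_t K s); ring.
Qed.

Let nc_of_F x s : F x s = 0 -> x = (ncx (s, Rr x s - dl), ncy (s, Rr x s - dl)).
Proof.
move=> F0; have [-> ->] := ncE s (Rr x s - dl); rewrite subrK /Rr.
rewrite [LHS]surjective_pairing; congr pair.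
  transitivity (cx s + (x.1 - cx s) * (tx s ^+ 2 + ty s ^+ 2)); first by rewrite unit_t; ring.
  by transitivity (cx s + ((x.1 - cx s) * ty s - (x.2 - cy s) * tx s) * ty s + F x s * tx s);
    [rewrite /F; ring|rewrite F0; ring].
transitivity (cy s + (x.2 - cy s) * (tx s ^+ 2 + ty s ^+ 2)); first by rewrite unit_t; ring.
by transitivity (cy s - ((x.1 - cx s) * ty s - (x.2 - cy s) * tx s) * tx s + F x s * ty s);
  [rewrite /F; ring|rewrite F0; ring].
Qed.

Let cont_cx : continuous cx. Proof. exact: (is_derive_cont dcx). Qed.
Let cont_cy : continuous cy. Proof. exact: (is_derive_cont dcy). Qed.

Let cont3 : [/\ continuous (fun z : (R * R) * R => z.1.1), continuous (fun z : (R * R) * R => z.1.2) &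
  continuous (fun z : (R * R) * R => z.2)].
Proof.
have c0 : continuous (fun z : (R * R) * R => z.1) by exact: cont_fst.
split; last exact: cont_snd.
- by apply: (cont_comp (f := fun p : R * R => p.1) _ c0); exact: cont_fst.
- by apply: (cont_comp (f := fun p : R * R => p.2) _ c0); exact: cont_snd.
Qed.

Let contF : continuous (fun z : (R * R) * R => F z.1 z.2).
Proof.
have [c1 c2 c3] := cont3.
exact: (contD (contM (contB c1 (cont_comp cont_cx c3)) (cont_comp (@cont_ctx R Omega K) c3))
  (contM (contB c2 (cont_comp cont_cy c3)) (cont_comp (@cont_cty R Omega K) c3))).
Qed.

Let contR : continuous (fun z : (R * R) * R => Rr z.1 z.2).
Proof.
have [c1 c2 c3] := cont3.
exact: (contB (contM (contB c1 (cont_comp cont_cx c3)) (cont_comp (@cont_cty R Omega K) c3))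
  (contM (contB c2 (cont_comp cont_cy c3)) (cont_comp (@cont_ctx R Omega K) c3))).
Qed.

(** While the normal coordinate is positive, [F x] is strictly decreasing in [s]. Its signs at
    [s0 - eta1] and [s0 + eta1] persist for [x] near the given point, and the intermediate value
    theorem yields a foot point close to [s0]. *)
Lemma nc_chart s0 t0 (e : R) : - dl < t0 -> 0 < e ->
  \forall x \near (ncx (s0, t0), ncy (s0, t0)), exists s t,
    [/\ `|s - s0| < e, `|t - t0| < e & x = (ncx (s, t), ncy (s, t))].
Proof.
move=> t0dl e0; set x0 := (_, _).
have [F0 R0] := Fnc s0 t0; rewrite -/x0 in F0 R0.
have e10 : 0 < Num.min e (t0 + dl) by rewrite lt_min e0; lra.
have /cvgrPdist_lt /(_ _ e10) := @contR (x0, s0).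
rewrite /= R0 => -[[A B] /= [nA nB] AB].
have [eta /= eta0 etaB] := nB.
pose eta1 := Num.min (eta / 2) (e / 2).
have eta10 : 0 < eta1 by rewrite lt_min !divr_gt0.
have AB' x s : A x -> `|s - s0| <= eta1 -> `|Rr x s - (t0 + dl)| < e /\ 0 < Rr x s.
  move=> Ax ss; have : B s.
    apply: etaB; rewrite /ball /= distrC; apply: le_lt_trans ss _.
    by rewrite gt_min; apply/orP; left; lra.
  move=> Bs; have := AB (x, s) (conj Ax Bs); rewrite /= lt_min distrC => /andP[H1 H2]; split=> //.
  by move: H2; rewrite ltr_norml => /andP[? _]; lra.
have Ax0 : A x0 by exact: nbhs_singleton nA.
have dneg x s : A x -> `|s - s0| <= eta1 -> - (w s + ka s * Rr x s) < 0.
  move=> Ax ss; rewrite oppr_lt0 ltr_pwDl ?w_gt0 // mulr_ge0 ?ka_ge0 //.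
  by have [_ /ltW] := AB' x s Ax ss.
have sgn (h : R) : `|h| = eta1 -> F x0 (s0 + h) * h < 0.
  move=> hE; have [c hc] := mean_value s0 (s0 + h) (dF x0).
  have -> : s0 + h - s0 = h by ring.
  rewrite F0 subr0 => ->; rewrite -mulrA pmulr_llt0.
    apply: dneg => //; rewrite (le_trans hc) //.
    have -> : s0 + h - s0 = h by ring.
    by rewrite hE.

  by rewrite -expr2 lt_neqAle sqr_ge0 andbT eq_sym sqrf_eq0 -normr_eq0 hE gt_eqF.
have cFx s : continuous (fun x => F x s).
  move=> x; have := @contF (x, s).
  have cp : {for x, continuous (fun x : R * R => (x, s))} by apply: cont_pair_at; [exact: cont_id|exact: cst_continuous].
  by move=> cF; exact: (@continuous_comp _ _ _ (fun x : R * R => (x, s)) (fun z => F z.1 z.2) x cp cF).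
have Np : \forall x \near x0, 0 < F x (s0 - eta1).
  apply: (cFx (s0 - eta1) x0 [set r | 0 < r]); apply: lt_nbhsr.
  have := sgn (- eta1); rewrite normrN gtr0_norm // => /(_ erefl).
  by rewrite mulrN oppr_lt0 pmulr_lgt0.
have Nn : \forall x \near x0, F x (s0 + eta1) < 0.
  apply: (cFx (s0 + eta1) x0 [set r | r < 0]); apply: lt_nbhsl.
  have := sgn eta1; rewrite gtr0_norm // => /(_ erefl).
  by rewrite pmulr_llt0.
near=> x.
have [s] : exists2 s, s \in `[s0 - eta1, s0 + eta1] & F x s = 0.
  apply: IVT; first lra.
    by apply: continuous_subspaceT; exact: (is_derive_cont (dF x)).
  have x1 : 0 < F x (s0 - eta1) by near: x.
  have x2 : F x (s0 + eta1) < 0 by near: x.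
  by rewrite ge_min le_max (ltW x1) (ltW x2) /= orbT.
rewrite in_itv /= => /andP[s1 s2] Fs.
have ss : `|s - s0| <= eta1 by rewrite ler_norml; apply/andP; split; lra.
have Ax : A x by near: x.
have [H1 _] := AB' x s Ax ss.
exists s, (Rr x s - dl); split; last exact: nc_of_F.
- apply: le_lt_trans ss _; rewrite gt_min; apply/orP; right; lra.
- by have -> : Rr x s - dl - t0 = Rr x s - (t0 + dl) by ring.
Unshelve. all: by end_near.
Qed.

(** A function of the plane prescribed in normal coordinates and 0 off the tube. The choice of
    coordinates is immaterial for periodic [Phi], by [nc_liftE]. *)
Definition nc_lift (Phi : R * R -> R) (x : R * R) : R :=
  match pselect (exists q : R * R, - dl < q.2 /\ x = (ncx q, ncy q)) with
  | left P => Phi (sval (cid P))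
  | right _ => 0
  end.

Lemma nc_liftE Phi s t : (forall s t, Phi (s + L, t) = Phi (s, t)) -> - dl < t ->
  nc_lift Phi (ncx (s, t), ncy (s, t)) = Phi (s, t).
Proof.
move=> Pper tdl; rewrite /nc_lift; case: pselect => [P|]; last by case; exists (s, t).
case: (cid P) => -[s' t'] /= [t'dl [Ex Ey]].
have [-> H] := nc_periods_eq tdl t'dl Ex Ey.
by rewrite (H (fun s => Phi (s, t'))).
Qed.

(** A class of coordinate expressions stable under partial derivatives of the lift, which introduce
    powers of the inverse Jacobian. Support in heights above [- dl / 2] keeps the lift zero near the
    inner edge of the tube. *)
Inductive nc_term (M : R) : (R * R -> R) -> Prop :=
| NcTerm a b j : smooth1 a -> (forall s, a (s + L) = a s) -> smooth1 b ->
    (forall t, ~~ (- (dl / 2) <= t <= M) -> b t = 0) ->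
    nc_term M (fun q => a q.1 * b q.2 * (1 + ka q.1 * q.2)^-1 ^+ j)
| NcSum P Q : nc_term M P -> nc_term M Q -> nc_term M (fun q => P q + Q q).

Lemma smooth_tangent : [/\ smooth1 (fun s => tx s), smooth1 (fun s => ty s) & smooth1 (fun s => - tx s)].
Proof.
have sa : smooth1 ang by exact: smooth_ang.
have stx : smooth1 (fun s => tx s).
  apply/smooth1P => k y; have [_ sc] := smat_sincos k (ang y).
  by apply: (@smat_comp R k cos ang y sc); move/smooth1P: sa.
split; first exact: stx.
  apply/smooth1P => k y; have [sc _] := smat_sincos k (ang y).
  by apply: (@smat_comp R k sin ang y sc); move/smooth1P: sa.
by apply/smooth1P => k y; apply: smatN; move/smooth1P: stx.
Qed.

Section Lift.
Variable M : R.

Lemma nc_term_per Phi s t : nc_term M Phi -> Phi (s + L, t) = Phi (s, t).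
Proof.
by elim=> [a b j _ ap _ _|P Q _ IH1 _ IH2] /=; [rewrite ap ka_per|rewrite IH1 IH2].
Qed.

Lemma nc_term_out Phi s t : nc_term M Phi -> ~~ (- (dl / 2) <= t <= M) -> Phi (s, t) = 0.
Proof.
move=> + tM; elim=> [a b j _ _ _ b0|P Q _ IH1 _ IH2] /=; last by rewrite IH1 IH2 addr0.
by rewrite b0 // mulr0 mul0r.
Qed.

Lemma nc_term_mul a0 Phi : smooth1 a0 -> (forall s, a0 (s + L) = a0 s) -> nc_term M Phi ->
  nc_term M (fun q => a0 q.1 * Phi q).
Proof.
move=> sa0 a0p; elim=> [a b j sa ap sb b0|P Q _ IH1 _ IH2].
  have -> : (fun q : R * R => a0 q.1 * (a q.1 * b q.2 * (1 + ka q.1 * q.2)^-1 ^+ j)) =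
      (fun q => (fun s => a0 s * a s) q.1 * b q.2 * (1 + ka q.1 * q.2)^-1 ^+ j).
    by apply/funext => q; rewrite !mulrA.
  apply: (@NcTerm M (fun s => a0 s * a s) b j _ _ sb b0); last by move=> s; rewrite a0p ap.
  by apply/smooth1P => k x; apply: smatM; [move/smooth1P: sa0|move/smooth1P: sa].
have -> : (fun q : R * R => a0 q.1 * (P q + Q q)) = (fun q => a0 q.1 * P q + a0 q.1 * Q q).
  by apply/funext => q; rewrite mulrDr.
exact: NcSum.
Qed.

Lemma nc_term_div Phi : nc_term M Phi -> nc_term M (fun q => Phi q / (1 + ka q.1 * q.2)).
Proof.
elim=> [a b j sa ap sb b0|P Q _ IH1 _ IH2].
  have -> : (fun q : R * R => a q.1 * b q.2 * (1 + ka q.1 * q.2)^-1 ^+ j / (1 + ka q.1 * q.2)) =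
      (fun q => a q.1 * b q.2 * (1 + ka q.1 * q.2)^-1 ^+ j.+1).
    by apply/funext => q; rewrite exprSr !mulrA.
  exact: (@NcTerm M a b j.+1 sa ap sb b0).
have -> : (fun q : R * R => (P q + Q q) / (1 + ka q.1 * q.2)) = (fun q => P q / (1 + ka q.1 * q.2) + Q q / (1 + ka q.1 * q.2)).
  by apply/funext => q; rewrite mulrDl.
exact: NcSum.
Qed.

Lemma derive1_out (b : R -> R) (p q : R) : smooth1 b -> (forall t, ~~ (p <= t <= q) -> b t = 0) ->
  forall t, ~~ (p <= t <= q) -> derive1 b t = 0.
Proof.
move=> sb b0 t tpq; apply: (ide_uniq (smooth1_ide sb t)).
apply: (ide_near _ (ide_cst 0 t)).
have : \forall u \near t, ~~ (p <= u <= q).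
  move: tpq; rewrite negb_and -!ltNge => /orP[tp|qt].
    by near=> u; rewrite negb_and -!ltNge; apply/orP; left; near: u; exact: lt_nbhsl.
  by near=> u; rewrite negb_and -!ltNge; apply/orP; right; near: u; exact: lt_nbhsr.
by apply: filterS => u Hu; rewrite b0.
Unshelve. all: by end_near.
Qed.

Lemma derive1_per (a : R -> R) : smooth1 a -> (forall s, a (s + L) = a s) ->
  forall s, derive1 a (s + L) = derive1 a s.
Proof.
move=> sa ap s.
have E : (fun s => a (s + L)) = a by apply/funext => x; rewrite ap.
have D1 := @ide_comp R a (fun s => s + L) s _ _ (smooth1_ide sa (s + L)) (ideD (ide_id s) (ide_cst L s)).
by rewrite E in D1; have := ide_uniq D1 (smooth1_ide sa s); rewrite addr0 mulr1.
Qed.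

Lemma ide_expr (f : R -> R) n x df : is_deriv x f df ->
  is_deriv x (fun t => f t ^+ n) (n%:R * f x ^+ n.-1 * df).
Proof.
case: n => [|n] D; last exact: ideX.
by rewrite mul0r mul0r; exact: ide_cst.
Qed.

Lemma nc_term_derive Phi : nc_term M Phi -> exists Ps Pt,
  [/\ nc_term M Ps, nc_term M Pt & forall (u v : R -> R) h u' v',
    is_deriv h u u' -> is_deriv h v v' -> 1 + ka (u h) * v h != 0 ->
    is_deriv h (fun h => Phi (u h, v h)) (Ps (u h, v h) * u' + Pt (u h, v h) * v')].
Proof.
have smoothM (f g : R -> R) : smooth1 f -> smooth1 g -> smooth1 (fun x => f x * g x).
  by move=> sf sg; apply/smooth1P => k x; apply: smatM; [move/smooth1P: sf|move/smooth1P: sg].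
elim=> [a b j sa ap sb b0|P Q _ [Ps [Pt [nPs nPt dPP]]] _ [Qs [Qt [nQs nQt dQQ]]]]; last first.
  exists (fun q => Ps q + Qs q), (fun q => Pt q + Qt q); split; [exact: NcSum..|].
  move=> u v h u' v' du dv J0; apply: (ide_eq (ideD (dPP _ _ _ _ _ du dv J0) (dQQ _ _ _ _ _ du dv J0))); ring.
pose k1 := derive1 ka.
have sk : smooth1 ka := @smooth_ka R Omega K.
have sk1 : smooth1 k1 := smooth1_derive sk.
have k1p : forall s, k1 (s + L) = k1 s := derive1_per sk ka_per.
have sc : smooth1 (fun=> - j%:R : R) by apply/smooth1P => k x; exact: smat_cst.
have sid : smooth1 (fun t : R => t) by apply/smooth1P => k x; exact: smat_id.
exists (fun q => derive1 a q.1 * b q.2 * (1 + ka q.1 * q.2)^-1 ^+ j +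
   ((- j%:R * (a q.1 * k1 q.1)) * (q.2 * b q.2)) * (1 + ka q.1 * q.2)^-1 ^+ j.+1),
  (fun q => a q.1 * derive1 b q.2 * (1 + ka q.1 * q.2)^-1 ^+ j +
   ((- j%:R * (a q.1 * ka q.1)) * b q.2) * (1 + ka q.1 * q.2)^-1 ^+ j.+1).
split.
- apply: NcSum.
    exact: (@NcTerm M (derive1 a) b j (smooth1_derive sa) (derive1_per sa ap) sb b0).
  apply: (@NcTerm M (fun s => - j%:R * (a s * k1 s)) (fun t => t * b t) j.+1).
  + exact: (smoothM _ _ sc (smoothM _ _ sa sk1)).
  + by move=> s; rewrite ap k1p.
  + exact: smoothM.
  + by move=> t /b0 ->; rewrite mulr0.
- apply: NcSum.
    exact: (@NcTerm M a (derive1 b) j sa ap (smooth1_derive sb) (derive1_out sb b0)).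
  apply: (@NcTerm M (fun s => - j%:R * (a s * ka s)) b j.+1 _ _ sb b0).
  + exact: (smoothM _ _ sc (smoothM _ _ sa sk)).
  + by move=> s; rewrite ap ka_per.
- move=> u v h u' v' du dv J0.
  have da := @ide_comp R a u h _ _ (smooth1_ide sa (u h)) du.
  have db := @ide_comp R b v h _ _ (smooth1_ide sb (v h)) dv.
  have dk := @ide_comp R ka u h _ _ (smooth1_ide sk (u h)) du.
  have dJ := ideD (ide_cst 1 h) (ideM dk dv).
  have dI := ide_expr j (@ideV R (fun t => 1 + ka (u t) * v t) h _ J0 dJ).
  apply: (ide_eq (ideM (ideM da db) dI)) => /=.
  rewrite -/k1; case: j {sc dI} => [|j] /=; rewrite ?expr0 ?exprS; last by field.
  by rewrite !mul0r; ring.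
Qed.

Lemma nc_jac_gt0 s t : - dl < t -> 0 < 1 + ka s * t.
Proof.
move=> tdl; have [_ /(_ s) H] := tube_widthP; have k0 := ka_ge0 K s.
have : 0 <= ka s * (t + dl) by rewrite mulr_ge0 //; lra.
lra.
Qed.

Section Line.
Variables (Phi Ps Pt : R * R -> R) (s0 t0 e1 e2 : R).
Hypothesis nPhi : nc_term M Phi.
Hypothesis dPhi : forall (u v : R -> R) h u' v',
    is_deriv h u u' -> is_deriv h v v' -> 1 + ka (u h) * v h != 0 ->
    is_deriv h (fun h => Phi (u h, v h)) (Ps (u h, v h) * u' + Pt (u h, v h) * v').
Hypothesis t0dl : - dl < t0.

Let x0 := (ncx (s0, t0), ncy (s0, t0)).
Let X (h : R) : R * R := (x0.1 + h * e1, x0.2 + h * e2).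

(** Along a line the coordinates of the moving point are differentiable functions of the line
    parameter: the foot point is an implicit function and the height is explicit in it. The chain
    rule in [dPhi] then applies. *)
Lemma nc_lift_line : is_deriv (0 : R) (fun h => nc_lift Phi (X h))
  (Ps (s0, t0) * ((tx s0 * e1 + ty s0 * e2) / (1 + ka s0 * t0)) + Pt (s0, t0) * (e1 * ty s0 - e2 * tx s0)).
Proof.
have X0 : X 0 = x0 by rewrite /X !mul0r !addr0.
have cX1 : continuous (fun h : R => x0.1 + h * e1) by cts.
have cX2 : continuous (fun h : R => x0.2 + h * e2) by cts.
have cX : continuous X := cont_pair cX1 cX2.
have L0 := len_gt0 K.
(* Two parameters within [L / 2] of [s0] differ by less than a period, and heights within [t0 + dl]
   of [t0] stay above [- dl]: coordinates in this window are unique. *)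
pose e := Num.min (L / 2) (t0 + dl).
have e0 : 0 < e by rewrite /e lt_min divr_gt0 //= -ltrBlDr sub0r.
pose good e' h := exists s t, [/\ `|s - s0| < e', `|t - t0| < e' & X h = (ncx (s, t), ncy (s, t))].
have near_good e' : 0 < e' -> \forall h \near (0 : R), good e' h.
  move=> e'0; have := nc_chart s0 t0dl e'0.
  by rewrite -/x0 -X0; exact: (cX 0).
have /choice[st Hst] : forall h, exists q : R * R, good e h ->
    [/\ `|q.1 - s0| < e, `|q.2 - t0| < e & X h = (ncx q, ncy q)].
  move=> h; have [[s [t H]]|] := pselect (good e h); last by exists (0, 0).
  by exists (s, t).
have tgood q2 : `|q2 - t0| < e -> - dl < q2.
  by rewrite lt_min => /andP[_]; rewrite ltr_norml => /andP[? _]; lra.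
have uniq e' h s t : e' <= e -> `|s - s0| < e' -> `|t - t0| < e' -> X h = (ncx (s, t), ncy (s, t)) -> good e h ->
    (st h) = (s, t).
  move=> e'e se te Xh /Hst[q1 q2 Xq].
  have te' : `|t - t0| < e by apply: lt_le_trans te _.
  have se' : `|s - s0| < e by apply: lt_le_trans se _.
  have [] := @nc_inj_near (st h).1 s (st h).2 t (tgood _ q2) (tgood _ te').
  - move: q1 se'; rewrite !lt_min => /andP[q1 _] /andP[q1' _].
    have -> : (st h).1 - s = ((st h).1 - s0) - (s - s0) by ring.
    by apply: le_lt_trans (ler_normB _ _) _; lra.
  - by rewrite -surjective_pairing; move: Xq; rewrite Xh => -[-> _].
  - by rewrite -surjective_pairing; move: Xq; rewrite Xh => -[_ ->].
  by move=> <- <-; rewrite -surjective_pairing.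
have good0 e' : 0 < e' -> good e' 0 by move=> /near_good /nbhs_singleton.
have st0 : st 0 = (s0, t0).
  by apply: (uniq e 0) => //; rewrite ?subrr ?normr0 //; exact: good0.
pose sg h := (st h).1.
have sg0 : sg 0 = s0 by rewrite /sg st0.
have csg : {for 0, continuous sg}.
  rewrite /prop_for /continuous_at sg0; apply/cvgrPdist_lt => e' e'0.
  have m0 : 0 < Num.min e' e by rewrite lt_min e'0.
  near=> h; have [s [t [H1 H2 H3]]] : good (Num.min e' e) h by near: h; exact: near_good.
  have gh : good e h by near: h; exact: near_good.
  have me : Num.min e' e <= e by rewrite ge_min lexx orbT.
  rewrite /sg (uniq _ _ _ _ me H1 H2 H3 gh) /= distrC.
  by move: H1; rewrite lt_min => /andP[].
have near_st : \forall h \near (0 : R), X h = (ncx (st h), ncy (st h)) /\ - dl < (st h).2.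
  by apply: filterS (near_good e e0) => h /Hst[_ H1 H2]; split=> //; exact: tgood.
(* The foot point solves [f (h, sg h) = 0]. Its continuity at 0 follows from uniqueness of
   coordinates together with [nc_chart] at small radii. *)
pose f (z : R * R) := F (X z.1) z.2.
pose fx (z : R * R) := tx z.2 * e1 + ty z.2 * e2.
pose fy (z : R * R) := - (w z.2 + ka z.2 * Rr (X z.1) z.2).
have ffx (h s : R) : is_deriv h (fun h => f (h, s)) (fx (h, s)).
  have D := ideD (ideM (ideB (ideD (ide_cst x0.1 h) (ideM (ide_id h) (ide_cst e1 h))) (ide_cst (cx s) h)) (ide_cst (tx s) h))
    (ideM (ideB (ideD (ide_cst x0.2 h) (ideM (ide_id h) (ide_cst e2 h))) (ide_cst (cy s) h)) (ide_cst (ty s) h)).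
  by apply: (ide_eq D); rewrite /fx /=; ring.
have ffy (h s : R) : is_deriv s (fun s => f (h, s)) (fy (h, s)) := dF (X h) s.
have cfx : continuous fx by rewrite /fx; cts.
have cfy : continuous fy.
  have cw2 : continuous (fun z : R * R => w z.2) by have := cont_w; cts.
  have cR2 : continuous (fun z : R * R => Rr (X z.1) z.2).
    have c1 : continuous (fun z : R * R => (X z.1, z.2)).
      apply: cont_pair; last exact: cont_snd.
      by move=> z; apply: (@continuous_comp _ _ _ (fun z : R * R => z.1) X); [exact: cont_fst|exact: cX].
    by move=> z; apply: (@continuous_comp _ _ _ (fun z : R * R => (X z.1, z.2)) (fun z => Rr z.1 z.2)); [exact: c1|exact: contR].
  by have := cR2; have := cw2; rewrite /fy; move: (fun z => Rr _ _) (fun z => w _) => r1 r2 ? ?; cts.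
have [F0 R0] := Fnc s0 t0; rewrite -/x0 in F0 R0.
have J0 := nc_jac_gt0 s0 t0dl.
have fy0E : fy (0, sg 0) = - (1 + ka s0 * t0).
  by rewrite /fy /= X0 sg0 R0 /w; ring.
have fy0 : fy (0, sg 0) != 0 by rewrite fy0E oppr_eq0 gt_eqF.
have f0 : \forall h \near (0 : R), f (h, sg h) = 0.
  apply: filterS near_st => h [Xh _]; rewrite /f /= Xh.
  by have [] := Fnc (st h).1 (st h).2; rewrite -surjective_pairing.
have dsg := ide_implicit ffx ffy cfx cfy csg f0 fy0.
pose tt h := Rr (X h) (sg h) - dl.
have tt0 : tt 0 = t0 by rewrite /tt X0 sg0 R0; ring.
have dtt : is_deriv (0 : R) tt (e1 * ty s0 - e2 * tx s0).
  have dcx' := @ide_comp R cx sg 0 _ _ (dcx (sg 0)) dsg.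
  have dcy' := @ide_comp R cy sg 0 _ _ (dcy (sg 0)) dsg.
  have dtx' := @ide_comp R tx sg 0 _ _ (dtx K (sg 0)) dsg.
  have dty' := @ide_comp R ty sg 0 _ _ (dty K (sg 0)) dsg.
  have D := ideB (ideB (ideM (ideB (ideD (ide_cst x0.1 0) (ideM (ide_id (0 : R)) (ide_cst e1 0))) dcx') dty')
    (ideM (ideB (ideD (ide_cst x0.2 0) (ideM (ide_id (0 : R)) (ide_cst e2 0))) dcy') dtx')) (ide_cst dl 0).
  apply: (ide_eq D); rewrite sg0; move: (- (_ / _)) => d.
  move: F0; rewrite /F; move: (x0.1) (x0.2) (cx s0) (cy s0) (tx s0) (ty s0) (ka s0) (w s0) => p q c c' a b k ww F0.
  transitivity (e1 * b - e2 * a + k * d * ((p - c) * a + (q - c') * b)); first by ring.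
  by rewrite F0; ring.
have D : is_deriv (0 : R) (fun h => Phi (sg h, tt h)) (Ps (s0, t0) * ((tx s0 * e1 + ty s0 * e2) / (1 + ka s0 * t0)) + Pt (s0, t0) * (e1 * ty s0 - e2 * tx s0)).
  have J0' : 1 + ka (sg 0) * tt 0 != 0 by rewrite sg0 tt0 gt_eqF.
  apply: (ide_eq (dPhi dsg dtt J0')); rewrite fy0E tt0 sg0 /fx /=; congr (_ * _ + _).
  by rewrite invrN mulrN opprK.
apply: ide_near D; apply: filterS near_st => h [Xh hdl].
have [_ Rh] := Fnc (st h).1 (st h).2; rewrite -surjective_pairing in Rh.
have -> : tt h = (st h).2 by rewrite /tt Xh /sg Rh; ring.
have hE := @nc_liftE Phi (st h).1 (st h).2 (fun s t => nc_term_per s t nPhi) hdl.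
by rewrite -surjective_pairing in hE; rewrite Xh hE -surjective_pairing.
Unshelve. all: by end_near.
Qed.

End Line.

Definition nc_image : set (R * R) :=
  (fun q => (ncx q, ncy q)) @` (`[0, L]%classic `*` `[- (dl / 2), M]%classic).

Lemma compact_nc_image : compact nc_image.
Proof.
apply: continuous_compact; last exact: compact_box.
by apply: continuous_subspaceT; apply: cont_pair; [exact: cont_ncx|exact: cont_ncy].
Qed.

Lemma nc_lift_out Phi x : nc_term M Phi -> ~ nc_image x -> nc_lift Phi x = 0.
Proof.
move=> nPhi xI; rewrite /nc_lift; case: pselect => // P; case: (cid P) => -[s t] /= [tdl xE].
apply: (nc_term_out _ nPhi); apply/negP => tM; apply: xI.
have [z z0 E] := periodic_reduce s (len_gt0 K).
exists (s - L * z%:~R, t).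
  by split; rewrite /= in_itv //=; move: z0 => /andP[-> /ltW ->].
rewrite xE /ncx /ncy /= (E _ (gx_per K)) (E _ (gy_per K)) (E _ (@ty_per R Omega K)) (E _ (@tx_per R Omega K)).
by [].
Qed.

(** Off the open tube a point misses the compact image of the supporting strip, so the lift vanishes
    on a whole neighbourhood. This settles regularity at the edge of the tube. *)
Lemma nc_lift_near0 Phi x : nc_term M Phi -> ~ (exists q : R * R, - dl < q.2 /\ x = (ncx q, ncy q)) ->
  ~ nc_image x /\ \forall z \near x, nc_lift Phi z = 0.
Proof.
move=> nPhi xU; have xI : ~ nc_image x.
  by move=> [q [_ /=]]; rewrite in_itv /= => /andP[q1 _] qx; apply: xU; exists q; split=> //; have := tube_width_gt0; lra.
split=> //; have op : open (~` nc_image) by rewrite openC; apply: compact_closed; [exact: norm_hausdorff|exact: compact_nc_image].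
by have : \forall z \near x, (~` nc_image) z; [exact: open_nbhs_nbhs|apply: filterS => z; exact: nc_lift_out].
Qed.

(** The components of the coordinate vector [i] along the tangent and along the outward normal. *)
Definition nc_dir (i : 'I_2) (s : R) : R * R :=
  if i == 0 then (tx s, ty s) else (ty s, - tx s).

Lemma nc_term_gradient i Ps Pt : nc_term M Ps -> nc_term M Pt ->
  nc_term M (fun q => (nc_dir i q.1).1 * (Ps q / (1 + ka q.1 * q.2)) + (nc_dir i q.1).2 * Pt q).
Proof.
move=> nPs nPt; have [stx sty sntx] := smooth_tangent.
have px : forall s, - tx (s + L) = - tx s by move=> s; rewrite tx_per.
apply: (@NcSum M (fun q => (nc_dir i q.1).1 * (Ps q / (1 + ka q.1 * q.2))) (fun q => (nc_dir i q.1).2 * Pt q)).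
  apply: (@nc_term_mul (fun s => (nc_dir i s).1) (fun q => Ps q / (1 + ka q.1 * q.2))) (nc_term_div nPs).
    by rewrite /nc_dir; case: (i == 0); [exact: stx|exact: sty].
  by rewrite /nc_dir => s; case: (i == 0) => /=; rewrite ?tx_per ?ty_per.
apply: (@nc_term_mul (fun s => (nc_dir i s).2) Pt) nPt.
  by rewrite /nc_dir; case: (i == 0); [exact: sty|exact: sntx].
by rewrite /nc_dir => s; case: (i == 0) => /=; rewrite ?tx_per ?ty_per.
Qed.

(* Gradients in normal coordinates: [d_s / (1 + ka t)] along the tangent and
   [d_t] along the normal. *)
Lemma nc_lift_partial Phi : nc_term M Phi -> exists Ps Pt,
  [/\ nc_term M Ps, nc_term M Pt,
  forall (u v : R -> R) h u' v',
    is_deriv h u u' -> is_deriv h v v' -> 1 + ka (u h) * v h != 0 ->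
    is_deriv h (fun h => Phi (u h, v h)) (Ps (u h, v h) * u' + Pt (u h, v h) * v') &
  forall i (x : R * R), is_derive x (unit_vec i) (nc_lift Phi)
    (nc_lift (fun q => (nc_dir i q.1).1 * (Ps q / (1 + ka q.1 * q.2)) + (nc_dir i q.1).2 * Pt q) x)].
Proof.
move=> nPhi; have [Ps [Pt [nPs nPt dP]]] := nc_term_derive nPhi.
exists Ps, Pt; split=> // i x.
have nQ := nc_term_gradient i nPs nPt.
have [[[s t] /= [tdl xE]]|xU] := pselect (exists q : R * R, - dl < q.2 /\ x = (ncx q, ncy q)); last first.
  have [xI Z] := nc_lift_near0 nPhi xU; rewrite (nc_lift_out nQ xI); exact: near0_partial.
rewrite {2}xE nc_liftE //; last by move=> s' t'; apply: (nc_term_per _ _ nQ).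
have line := fun e1 e2 => @nc_lift_line Phi Ps Pt s t e1 e2 nPhi dP tdl.
have D (e1 e2 : R) : forall y : R, is_deriv y (fun h => nc_lift Phi (ncx (s, t) + (h - y) * e1, ncy (s, t) + (h - y) * e2))
    (Ps (s, t) * ((tx s * e1 + ty s * e2) / (1 + ka s * t)) + Pt (s, t) * (e1 * ty s - e2 * tx s)).
  move=> y; have dy := ideB (ide_id y) (ide_cst y y).
  have l := line e1 e2; rewrite -(subrr y) in l.
  by apply: (ide_eq (@ide_comp R _ (fun h => h - y) y _ _ l dy)); rewrite subr0 mulr1.
rewrite xE; have [i0|i1] := ord2 i; subst i.
- apply/is_partial0 => /=.
  have D1 := D 1 0 (ncx (s, t)); apply: (ide_near _ (ide_eq D1 _)).
    by exists 1 => /= [|h _]; [exact: ltr01|congr (nc_lift _ (_, _)); ring].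
  by rewrite /nc_dir /=; ring.
- apply/is_partial1 => /=.
  have D1 := D 0 1 (ncy (s, t)); apply: (ide_near _ (ide_eq D1 _)).
    by exists 1 => /= [|h _]; [exact: ltr01|congr (nc_lift _ (_, _)); ring].
  by rewrite /nc_dir /=; ring.
Qed.

Lemma nc_lift_cont Phi : nc_term M Phi -> continuous (nc_lift Phi).
Proof.
move=> nPhi x.
have [[[s t] /= [tdl xE]]|xU] := pselect (exists q : R * R, - dl < q.2 /\ x = (ncx q, ncy q)); last first.
  have [_ Z] := nc_lift_near0 nPhi xU.
  exact: (@near_cst_continuous (R * R)%type R 0 (nc_lift Phi) x Z).
have cPhi : {for (s, t), continuous Phi}.
  elim: nPhi => [a b j sa _ sb _|P Q _ IH1 _ IH2]; last exact: (@continuousD _ R^o).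
  apply: continuousM; first apply: continuousM.
  - exact: (@cont1fst R a (smooth1_cont sa)).
  - exact: (@cont1snd R b (smooth1_cont sb)).
  - apply: (@continuous_comp _ _ _ (fun q : R * R => (1 + ka q.1 * q.2)^-1) (fun x => x ^+ j)); last exact: exprn_continuous.
    apply: continuousV; first by rewrite /= gt_eqF // nc_jac_gt0.
    have c : continuous (fun q : R * R => 1 + ka q.1 * q.2) by cts.
    exact: c.
have per := fun s t => nc_term_per s t nPhi.
rewrite /continuous_at {2}xE (nc_liftE _ per) //; apply/cvgrPdist_lt => e e0.
have /cvgrPdist_lt /(_ e e0) [[A B] /= [nA nB] AB] := cPhi.
have [ea /= ea0 eaA] := nA; have [eb /= eb0 ebB] := nB.
have m0 : 0 < Num.min (Num.min ea eb) (t + dl) by rewrite !lt_min ea0 eb0 /=; lra.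
rewrite xE; apply: filterS (nc_chart s tdl m0) => z [s' [t' [H1 H2 ->]]].
move: H1 H2; rewrite !lt_min => /andP[/andP[H1 _] _] /andP[/andP[_ H2] H3].
rewrite (nc_liftE _ per) //; last by move: H3; rewrite ltr_norml => /andP[? _]; lra.
by apply: (AB (s', t')); split; [apply: eaA|apply: ebB]; rewrite /ball /= distrC.
Qed.

Lemma nc_lift_smooth Phi : nc_term M Phi -> smooth (nc_lift Phi).
Proof.
move=> nPhi k; elim: k Phi nPhi => [|k IH] Phi nPhi; first exact: nc_lift_cont.
have [Ps [Pt [nPs nPt _ D]]] := nc_lift_partial nPhi.
move=> i; split=> [p|]; first by have [] := D i p.
have -> : partial i (nc_lift Phi) = nc_lift (fun q => (nc_dir i q.1).1 * (Ps q / (1 + ka q.1 * q.2)) + (nc_dir i q.1).2 * Pt q).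
  by apply/funext => p; have [_ <-] := D i p.
exact/IH/nc_term_gradient.
Qed.

Section Tensor.
Variables a b : R -> R.
Hypotheses (sa : smooth1 a) (ap : forall s, a (s + L) = a s) (sb : smooth1 b).
Hypothesis b0 : forall t, ~~ (- (dl / 2) <= t <= M) -> b t = 0.

Definition nc_tensor := nc_lift (fun q => a q.1 * b q.2).

Let nab : nc_term M (fun q => a q.1 * b q.2).
Proof.
have -> : (fun q : R * R => a q.1 * b q.2) = (fun q => a q.1 * b q.2 * (1 + ka q.1 * q.2)^-1 ^+ 0).
  by apply/funext => q; rewrite expr0 mulr1.
exact: NcTerm.
Qed.

Lemma nc_tensorE s t : - dl < t -> nc_tensor (ncx (s, t), ncy (s, t)) = a s * b t.
Proof. by move=> tdl; rewrite /nc_tensor nc_liftE // => s' t'; rewrite /= ap. Qed.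

Lemma nc_tensor_test : test_function setT nc_tensor.
Proof.
split; first exact: nc_lift_smooth nab.
exists nc_image; split=> //; first exact: compact_nc_image.
by move=> p; exact: nc_lift_out nab.
Qed.

Lemma nc_tensor_partial i s t : - dl < t -> partial i nc_tensor (ncx (s, t), ncy (s, t)) =
  (nc_dir i s).1 * (derive1 a s * b t / (1 + ka s * t)) + (nc_dir i s).2 * (a s * derive1 b t).
Proof.
move=> tdl; have [Ps [Pt [nPs nPt dP D]]] := nc_lift_partial nab.
have J0 : 1 + ka s * t != 0 by rewrite gt_eqF // nc_jac_gt0.
have [_ E] := D i (ncx (s, t), ncy (s, t)).
rewrite /partial /nc_tensor E nc_liftE //; last by move=> s' t'; rewrite (nc_term_per _ _ (nc_term_gradient i nPs nPt)).
(* The coefficients [Ps] and [Pt] are only known to exist; differentiating along the two coordinate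
   lines identifies them. *)
have Es := dP id (fun=> t) s 1 0 (ide_id s) (ide_cst t s) J0.
have Et := dP (fun=> s) id t 0 1 (ide_cst s t) (ide_id t) J0.
have Es' := ideM (smooth1_ide sa s) (ide_cst (b t) s).
have Et' := ideM (ide_cst (a s) t) (smooth1_ide sb t).
have E1 : Ps (s, t) = derive1 a s * b t.
  by have := ide_uniq Es Es'; rewrite !mulr0 mulr1 !addr0.
have E2 : Pt (s, t) = a s * derive1 b t.
  by have := ide_uniq Et Et'; rewrite mulr0 mulr1 mul0r !add0r.
by rewrite /= E1 E2.
Qed.

End Tensor.

End Lift.
End Tube.

(** * Weak derivatives *)

Section SquareNorm.
Context d (T : measurableType d) (R : realType) (mu : {measure set T -> \bar R}).
Variable D : set T.
Hypothesis mD : measurable D.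
Implicit Types (f g : T -> R).

(** The squared norm of L2, extended real so as to make sense for every [f]. [L2P] and [cvg_L2P]
    restate membership and convergence in these terms. *)
Definition sqn f : \bar R := (\int[mu]_(x in D) (f x ^+ 2)%:E)%E.

Lemma sqn_ge0 f : (0 <= sqn f)%E.
Proof. by apply: integral_ge0 => x _; rewrite lee_fin sqr_ge0. Qed.

Lemma sqn_eq f g : (forall x, D x -> f x = g x) -> sqn f = sqn g.
Proof. by move=> fg; apply: eq_integral => x; rewrite inE => /fg ->. Qed.

Let Lnorm_sqn f : 'N[mu]_2%:E [EFin \o (f \_ D)]%E = (sqn f `^ 2^-1)%E.
Proof.
rewrite unlock; congr (_ `^ _)%E; rewrite /sqn [RHS]integral_mkcond.
apply: eq_integral => x _; rewrite /= /patch; case: ifP => _.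
  by rewrite powR_mulrn // real_normK ?num_real.
by rewrite normr0 powR0.
Qed.

Let sqn_Lnorm f : ('N[mu]_2%:E [EFin \o (f \_ D)] `^ 2)%E = sqn f.
Proof. by rewrite Lnorm_sqn -poweRrM mulVf // poweRe1 // sqn_ge0. Qed.

Lemma L2P f : L2 mu D f <-> measurable_fun D f /\ (sqn f < +oo)%E.
Proof.
rewrite /L2; split.
  rewrite inE => /andP[]; rewrite inE /= => mf; rewrite inE /= /finite_norm => nf.
  split; first by apply/(measurable_restrictT _ mD).
  by rewrite -sqn_Lnorm poweR_lty.
move=> [mf nf]; rewrite inE; apply/andP; split; rewrite inE /=.
  by apply/(measurable_restrictT _ mD).1.
by rewrite /finite_norm Lnorm_sqn poweR_lty.
Qed.

Lemma cvge0P (u : (\bar R)^nat) : (forall n, 0 <= u n)%E ->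
  u @ \oo --> 0%E <-> forall e : R, 0 < e -> \forall n \near \oo, (u n < e%:E)%E.
Proof.
move=> u0; split=> [cu e e0|H].
  apply: (cu [set x | (x < e%:E)%E]); apply: open_nbhs_nbhs; split; first exact: open_ereal_lt_ereal.
  by rewrite /= lte_fin.
apply/fine_cvgP; split.
  have := H 1 ltr01; apply: filterS => n un.
  by rewrite ge0_fin_numE // (lt_trans un) // ltry.
apply/cvgrPdist_lt => e e0; have := H e e0; apply: filterS => n un.
rewrite /= sub0r normrN ger0_norm ?fine_ge0 //.
by rewrite -lte_fin fineK // ge0_fin_numE // (lt_trans un) // ltry.
Qed.

Lemma cvg_L2P (f_ : (T -> R)^nat) f :
  cvg_L2 mu D f_ f <-> (fun n => sqn (fun x => f_ n x - f x)) @ \oo --> 0%E.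
Proof.
rewrite /cvg_L2; split=> /cvge0P H; (apply/cvge0P => [n|e e0]).
- exact: sqn_ge0.
- have s0 : 0 < Num.sqrt e by rewrite sqrtr_gt0.
  move: s0 (esym (sqr_sqrtr (ltW e0))); move: (Num.sqrt e) => s s0 eE.
  have := H (fun n => Lnorm_ge0 _ _ _) _ s0; apply: filterS => n.
  rewrite -sqn_Lnorm eE.
  have := Lnorm_ge0 mu 2%:E (EFin \o ((f_ n \- f) \_ D)).
  case: Lnorm => [r| |] //; rewrite lee_fin lte_fin => r0 rs.
  by rewrite poweR_EFin powR_mulrn // lte_fin ltr_pXn2r // nnegrE ltW.
- exact: Lnorm_ge0.
- have s0 : 0 < e ^+ 2 by rewrite exprn_gt0.
  have := H (fun n => sqn_ge0 _) _ s0; apply: filterS => n.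
  rewrite -sqn_Lnorm.
  have := Lnorm_ge0 mu 2%:E (EFin \o ((f_ n \- f) \_ D)).
  case: Lnorm => [r| |] // r0; last by rewrite poweRyr // pnatr_eq0.
  rewrite poweR_EFin powR_mulrn // !lte_fin => H'; rewrite lee_fin in r0.
  by rewrite -(@ltr_pXn2r _ 2) // ?nnegrE // ltW.
Qed.

Lemma cvg_L2_cst f : cvg_L2 mu D (fun=> f) f.
Proof.
apply/cvg_L2P; rewrite (_ : (fun _ => _) = fun=> 0%E); first exact: cvg_cst.
by apply/funext => n; apply: integral0_eq => x _; rewrite subrr expr0n.
Qed.

(** Young's inequality with a free [e] in the role of the triangle inequality: [e = 1] gives crude
    bounds, small [e] the continuity of the squared norm. *)
Lemma sqn_delta f g (e : R) : 0 < e -> measurable_fun D f -> measurable_fun D g ->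
  (sqn g <= (1 + e)%:E * sqn f + (1 + e^-1)%:E * sqn (fun x => (g x - f x)%R))%E.
Proof.
move=> e0 mf mg.
have e1 : 0 < e^-1 by rewrite invr_gt0.
have mfg : measurable_fun D (fun x => g x - f x) by exact: measurable_funB.
have m2 (h : T -> R) : measurable_fun D h -> measurable_fun D (fun x => (h x ^+ 2)%:E).
  by move=> mh; apply/measurable_EFinP; exact: measurable_funX.
rewrite -!ge0_integralZl //; try (exact: m2); try (by move=> x _; rewrite lee_fin sqr_ge0);
  try (by rewrite lee_fin addr_ge0 // ltW).
rewrite -ge0_integralD //; try (by move=> x _; rewrite mule_ge0 // lee_fin ?sqr_ge0 // addr_ge0 // ltW);
  try (by apply: measurable_funeM; exact: m2).
apply: ge0_le_integral => //.
- by move=> x _; rewrite lee_fin sqr_ge0.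
- exact: m2.
- by apply: emeasurable_funD; apply: measurable_funeM; exact: m2.
move=> x _; rewrite -!EFinM -EFinD lee_fin.
have -> : g x = f x + (g x - f x) by ring.
move: (f x) (g x - f x) => a b.
have -> : a + b - a = b by ring.
rewrite -subr_ge0.
have -> : (1 + e) * a ^+ 2 + (1 + e^-1) * b ^+ 2 - (a + b) ^+ 2 = (e * a - b) ^+ 2 * e^-1.
  by field; rewrite gt_eqF.
by rewrite mulr_ge0 ?sqr_ge0 // ltW.
Qed.

Lemma sqnD f g : measurable_fun D f -> measurable_fun D g ->
  (sqn (fun x => f x + g x)%R <= 2%:E * sqn f + 2%:E * sqn g)%E.
Proof.
move=> mf mg; have := sqn_delta ltr01 mf (measurable_funD mf mg).
rewrite invr1 (@sqn_eq (fun x => _ - _) g) //.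
by move=> x _ /=; ring.
Qed.

Lemma sqnN f : sqn (fun x => - f x) = sqn f.
Proof. by apply: eq_integral => x _; rewrite sqrrN. Qed.

Lemma sqnZ (k : R) f : measurable_fun D f -> sqn (fun x => k * f x) = ((k ^+ 2)%:E * sqn f)%E.
Proof.
move=> mf; rewrite /sqn -ge0_integralZl //.
- by apply: eq_integral => x _; rewrite -EFinM exprMn.
- by apply/measurable_EFinP; exact: measurable_funX.
- by move=> x _; rewrite lee_fin sqr_ge0.
- by rewrite lee_fin sqr_ge0.
Qed.

Lemma sqn_eq0 f g : measurable_fun D f -> measurable_fun D g -> sqn (fun x => f x - g x) = 0%E ->
  {ae mu, forall x, D x -> f x = g x}.
Proof.
move=> mf mg E.
have mh : measurable_fun D (fun x => ((f x - g x) ^+ 2)%:E).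
  by apply/measurable_EFinP; apply: measurable_funX; exact: measurable_funB.
have : ae_eq mu D (fun x => ((f x - g x) ^+ 2)%:E) (cst 0%E).
  apply/(ae_eq_integral_abs _ mD mh); rewrite -[RHS]E; apply: eq_integral => x _.
  by rewrite gee0_abs // lee_fin sqr_ge0.
apply: filterS => x /[apply] /= -[] /eqP; rewrite sqrf_eq0 subr_eq0 => /eqP //.
Qed.

Lemma sqn_ae f g : measurable_fun D f -> measurable_fun D g -> {ae mu, forall x, D x -> f x = g x} ->
  sqn f = sqn g.
Proof.
move=> mf mg fg; apply: ge0_ae_eq_integral => //.
- by apply/measurable_EFinP; exact: measurable_funX.
- by apply/measurable_EFinP; exact: measurable_funX.
- by move=> x _; rewrite lee_fin sqr_ge0.
- by move=> x _; rewrite lee_fin sqr_ge0.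
- by apply: filterS fg => x /[apply] ->.
Qed.

Lemma sqn_cvg (f_ : (T -> R)^nat) f : L2 mu D f -> (forall n, measurable_fun D (f_ n)) ->
  cvg_L2 mu D f_ f -> (fine \o (fun n => sqn (f_ n))) @ \oo --> fine (sqn f).
Proof.
move=> /L2P[mf ff] mf_ /cvg_L2P c; apply: fine_cvg; rewrite fineK ?ge0_fin_numE ?sqn_ge0 //.
have fE : sqn f \is a fin_num by rewrite ge0_fin_numE ?sqn_ge0.
have c0 := (cvge0P (fun n => sqn_ge0 _)).1 c.
rewrite -[X in _ --> X](fineK fE); apply/fine_cvgP; split.
  have := c0 1 ltr01; apply: filterS => n H; rewrite ge0_fin_numE ?sqn_ge0 //.
  apply: le_lt_trans (sqn_delta ltr01 mf (mf_ n)) _.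
  by rewrite lte_add_pinfty // lte_mul_pinfty ?lee_fin ?addr_ge0 ?invr_ge0 // (lt_trans H) // ltry.
apply/cvgrPdist_le => e e0.
set N := fine (sqn f); have N0 : 0 <= N by rewrite fine_ge0 // sqn_ge0.
(* In [sqn_delta] the factor [1 + de] costs at most about [e / 3], and the threshold [eta] below
   keeps the other term, with factor [1 + de^-1], under [de]. *)
pose de := Num.min 1 (e / (3 * (N + 1))).
have de0 : 0 < de by rewrite lt_min ltr01 divr_gt0 // mulr_gt0 // ltr_wpDl.
have de1 : de <= 1 by rewrite ge_min lexx.
have deN : de * (N + 1) <= e / 3.
  rewrite -ler_pdivlMr ?ltr_wpDl // -mulrA -invfM.
  by rewrite ge_min lexx orbT.
pose eta := de / (1 + de^-1).
have k0 : 0 < 1 + de^-1 by rewrite addr_gt0 // invr_gt0.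
have eta0 : 0 < eta by rewrite divr_gt0.
have := c0 eta eta0; apply: filterS => n H.
have Hfin : sqn (fun x => f_ n x - f x) \is a fin_num by rewrite ge0_fin_numE ?sqn_ge0 // (lt_trans H) // ltry.
have fnE : sqn (f_ n) \is a fin_num.
  rewrite ge0_fin_numE ?sqn_ge0 //; apply: le_lt_trans (sqn_delta ltr01 mf (mf_ n)) _.
  by rewrite lte_add_pinfty // lte_mul_pinfty ?lee_fin ?addr_ge0 ?invr_ge0 // (lt_trans H) // ltry.
have S1 := sqn_delta de0 mf (mf_ n).
have S2 := sqn_delta de0 (mf_ n) mf.
have E2 : sqn (fun x => f x - f_ n x) = sqn (fun x => f_ n x - f x).
  by rewrite -sqnN; apply: sqn_eq => x _; ring.
rewrite E2 in S2; move: S1 S2 H; rewrite -(fineK fE) -(fineK fnE) -(fineK Hfin) -/N -!EFinM -!EFinD !lee_fin lte_fin /=.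
have := sqn_ge0 (fun x => f_ n x - f x); rewrite -(fineK Hfin) lee_fin /=.
have := sqn_ge0 (f_ n); rewrite -(fineK fnE) lee_fin /=.
move: (fine (sqn (f_ n))) (fine (sqn (fun x => f_ n x - f x))) => a b a0 b0 S1 S2 H.
have kb : (1 + de^-1) * b <= de by move: H; rewrite /eta ltr_pdivlMr // mulrC => /ltW.
have aN : a <= N + e / 3 by nra.
have Na : N <= a + (de * a + de) by nra.
have : de * a <= de * (2 * N + 1) by rewrite ler_pM2l //; nra.
rewrite ler_norml => H3; apply/andP; split; nra.
Qed.

End SquareNorm.

Lemma L2_mul_integrable d (T : measurableType d) (R : realType) (m : {measure set T -> \bar R})
  (D : set T) (f g : T -> R) : measurable D -> L2 m D f -> L2 m D g ->
  m.-integrable D (fun x => (f x * g x)%:E).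
Proof.
move=> mD; move=> /(L2P m mD)[mf ff] /(L2P m mD)[mg fg].
have m2 (h : T -> R) : measurable_fun D h -> measurable_fun D (fun x => (h x ^+ 2)%:E).
  by move=> mh; apply/measurable_EFinP; exact: measurable_funX.
apply/integrableP; split.
  by apply/measurable_EFinP; exact: measurable_funM.
apply: (@le_lt_trans _ _ (sqn m D f + sqn m D g)%E); last by rewrite lte_add_pinfty.
rewrite -ge0_integralD //; try (exact: m2); try (by move=> x _; rewrite lee_fin sqr_ge0).
apply: ge0_le_integral => //.
- by apply: measurableT_comp => //; apply/measurable_EFinP; exact: measurable_funM.
- by apply: emeasurable_funD; exact: m2.
move=> x _; rewrite lee_fin normrM.
rewrite -[X in _ <= X + _]real_normK ?num_real // -[X in _ <= _ + X]real_normK ?num_real //.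
have := sqr_ge0 (`|f x| - `|g x|); have := normr_ge0 (f x); have := normr_ge0 (g x).
by move: `|f x| `|g x| => a b b0 a0; rewrite sqrrB; nra.
Qed.

(** * The fundamental lemma and weak derivatives in the plane *)

Section Plane.
Context {R : realType}.
Notation mu := (@lebesgue_measure R).
Notation mR := (measurableTypeR R).
Local Notation obox p q r s := (`]p, q[%classic `*` `]r, s[%classic : set (R * R)).
Implicit Types (U : set (R * R)) (f g : R * R -> R).

Lemma supported_integral U (h : R * R -> \bar R) :
  (forall p, ~ U p -> h p = 0%E) -> (\int[area R]_(p in U) h p = \int[area R]_p h p)%E.
Proof.
move=> h0; rewrite integral_mkcond; apply: eq_integral => p _; rewrite /patch.
by case: ifPn => // /negP pU; rewrite h0 //; move=> Up; apply: pU; rewrite inE.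
Qed.

Lemma supported_Rintegral U h : (forall p, ~ U p -> h p = 0) ->
  \int[area R]_(p in U) h p = \int[area R]_p h p.
Proof. by move=> h0; congr fine; apply: supported_integral => p /h0 ->. Qed.

Lemma boxed_integrable f M : continuous f ->
  (forall x y, ~~ ((- M <= x <= M) && (- M <= y <= M)) -> f (x, y) = 0) ->
  (area R).-integrable setT (EFin \o f).
Proof.
move=> cf f0; have mB : measurable (`[- M, M] `*` `[- M, M] : set (mR * mR)) by exact: measurableX.
have -> : EFin \o f = (EFin \o f) \_ (`[- M, M]%classic `*` `[- M, M]%classic).
  apply/funext => -[x y]; rewrite /patch in_setX !mem_setE !in_itv /=.
  by case: ifPn => // /f0 ->.
by apply/(integrable_mkcond _ mB); exact: cont_box_intgb.
Qed.

Lemma boxed_integral21 f M : continuous f ->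
  (forall x y, ~~ ((- M <= x <= M) && (- M <= y <= M)) -> f (x, y) = 0) ->
  \int[area R]_p f p = \int[mu]_(y in `[- M, M]) \int[mu]_(x in `[- M, M]) f (x, y).
Proof.
move=> cf f0; rewrite -(@supported_Rintegral (`[- M, M]%classic `*` `[- M, M]%classic)).
  by rewrite /Rintegral (area_box21 _ _ _ _ cf).
move=> [x y] /= H; apply: f0; apply/negP => /andP[H1 H2]; apply: H.
by rewrite /= !in_itv.
Qed.

Lemma boxed_integral12 f M : continuous f ->
  (forall x y, ~~ ((- M <= x <= M) && (- M <= y <= M)) -> f (x, y) = 0) ->
  \int[area R]_p f p = \int[mu]_(x in `[- M, M]) \int[mu]_(y in `[- M, M]) f (x, y).
Proof.
move=> cf f0; rewrite (boxed_integral21 cf f0).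
exact: (@int_swap R (fun p => f (p.2, p.1)) _ _ _ _ (cont_swap cf)).
Qed.

(** The box is enlarged because [integral_partial0] integrates the partial derivative over it and
    needs [f] to vanish on its sides. *)
Lemma boxed_partial i f M :
  (forall x y : R, ~~ ((- M <= x <= M) && (- M <= y <= M)) -> f (x, y) = 0) ->
  forall x y : R, ~~ ((- (M + 1) <= x <= M + 1) && (- (M + 1) <= y <= M + 1)) -> partial i f (x, y) = 0.
Proof.
move=> f0 x y H; suff /(near0_partial i)[] : \forall p \near (x, y), f p = 0 by [].
have : nbhs ((x, y) : R * R) (~` (`[- M, M] `*` `[- M, M])).
  apply: open_nbhs_nbhs; split.
    by rewrite openC; apply: compact_closed; [exact: norm_hausdorff|exact: compact_box].
  move=> [/=]; rewrite !in_itv /= => /andP[? ?] /andP[? ?]; move/negP: H; apply.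
  by apply/andP; split; apply/andP; split; lra.
apply: filterS => -[u v] /= H2; apply: f0; apply/negP => H3; apply: H2.
by rewrite !in_itv /=; move/andP: H3.
Qed.

Lemma integral_partial0 i f : test_function setT f -> \int[area R]_p partial i f p = 0.
Proof.
move=> tf; have [sf _] := tf; have [M M0 f0] := test_function_support tf.
have cp : continuous (partial i f) by exact: smooth_partial_cont.
have p0 := boxed_partial i f0; have M1 : - (M + 1) <= M + 1 by lra.
have [i0|i1] := ord2 i; subst i.
- have d x y : is_deriv x (fun x => f (x, y)) (partial 0 f (x, y)) by exact: smooth_ide0.
  rewrite (boxed_integral21 cp p0) (@int_eq _ _ (fun=> 0)) ?int_cst ?mul0r //.
  move=> y _; rewrite (FTC M1 (cont_sec1 (y := y) cp) (fun x => d x y)) !f0 ?subrr //.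
    by rewrite !negb_and -!ltNge; apply/orP; left; apply/orP; left; lra.
  by rewrite !negb_and -!ltNge; apply/orP; left; apply/orP; right; lra.
- have d x y : is_deriv y (fun y => f (x, y)) (partial 1 f (x, y)) by exact: smooth_ide1.
  rewrite (boxed_integral12 cp p0) (@int_eq _ _ (fun=> 0)) ?int_cst ?mul0r //.
  move=> x _; rewrite (FTC M1 (cont_sec2 (x := x) cp) (fun y => d x y)) !f0 ?subrr //.
    by rewrite !negb_and -!ltNge; apply/orP; right; apply/orP; left; lra.
  by rewrite !negb_and -!ltNge; apply/orP; right; apply/orP; right; lra.
Qed.

Lemma boxed_L2 U f M : measurable (U : set (mR * mR)) -> continuous f ->
  (forall x y, ~~ ((- M <= x <= M) && (- M <= y <= M)) -> f (x, y) = 0) -> L2 (area R) U f.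
Proof.
move=> mU cf f0; apply/(L2P _ mU); split; first exact: cont_measurable2.
have c2 : continuous (fun p => f p ^+ 2) by exact: cont2X.
have f20 x y : ~~ ((- M <= x <= M) && (- M <= y <= M)) -> f (x, y) ^+ 2 = 0 by move=> /f0 ->; rewrite expr0n.
have I := integrableS measurableT mU (@subsetT _ U) (boxed_integrable c2 f20).
rewrite /sqn; have /integrableP[_] := I; apply: le_lt_trans.
by apply: ge0_le_integral => //; [by move=> x _; rewrite lee_fin sqr_ge0|
  by apply/measurable_EFinP; exact: cont_measurable2|
  by apply: measurableT_comp => //; apply/measurable_EFinP; exact: cont_measurable2|
  by move=> x _; rewrite /= lee_fin ler_norm].
Qed.

Lemma CkD k f g : Ck k f -> Ck k g -> Ck k (fun p => f p + g p).
Proof.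
elim: k f g => [|k IH] f g kf kg; first exact: contD.
apply: (@is_partial_Ck _ _ _ (fun p => partial 0 f p + partial 0 g p) (fun p => partial 1 f p + partial 1 g p)).
- by move=> x y; apply: ideD; apply: Ck_ide0; [exact: kf|exact: kg].
- by move=> x y; apply: ideD; apply: Ck_ide1; [exact: kf|exact: kg].
- by apply: IH; [have [] := kf 0|have [] := kg 0].
- by apply: IH; [have [] := kf 1|have [] := kg 1].
Qed.

Lemma smoothM f g : smooth f -> smooth g -> smooth (fun p => f p * g p).
Proof.
move=> sf sg k; elim: k f g sf sg => [|k IH] f g sf sg.
  by apply: contM; exact: smooth_cont.
apply: (@is_partial_Ck _ _ _ (fun p => partial 0 f p * g p + f p * partial 0 g p)
    (fun p => partial 1 f p * g p + f p * partial 1 g p)).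
- by move=> x y; apply: ideM; exact: smooth_ide0.
- by move=> x y; apply: ideM; exact: smooth_ide1.
- by apply: CkD; apply: IH => //; exact: smooth_partial.
- by apply: CkD; apply: IH => //; exact: smooth_partial.
Qed.

Lemma partialM i f g p : smooth f -> smooth g ->
  partial i (fun p => f p * g p) p = partial i f p * g p + f p * partial i g p.
Proof.
move=> sf sg; case: p => x y; have [->|->] := ord2 i.
- by apply: partial0E; apply: ideM; exact: smooth_ide0.
- by apply: partial1E; apply: ideM; exact: smooth_ide1.
Qed.

Lemma test_partial_out i U f p : test_function U f -> ~ U p -> partial i f p = 0.
Proof.
move=> [sf [A [cA AU f0]]] Up.
have op : open (~` A) by rewrite openC; apply: compact_closed; [exact: norm_hausdorff|].
suff /(near0_partial i)[] : \forall q \near p, f q = 0 by [].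
have : nbhs (p : R * R) (~` A) by apply: open_nbhs_nbhs; split=> // /AU.
by apply: filterS => q; exact: f0.
Qed.

Lemma test_out U f p : test_function U f -> ~ U p -> f p = 0.
Proof. by move=> [_ [A [_ AU f0]]] Up; apply: f0 => /AU. Qed.

Lemma test_functionT U f : test_function U f -> test_function setT f.
Proof. by move=> [sf [A [cA _ f0]]]; split=> //; exists A. Qed.

Lemma test_L2 U f : measurable (U : set (mR * mR)) -> test_function setT f ->
  L2 (area R) U f /\ forall i, L2 (area R) U (partial i f).
Proof.
move=> mU tf; have [sf _] := tf; have [M M0 f0] := test_function_support tf; split.
  by apply: (boxed_L2 mU _ f0); exact: smooth_cont.
by move=> i; apply: (boxed_L2 mU _ (boxed_partial i f0)); exact: smooth_partial_cont.
Qed.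

Lemma test_weak_partial U i f : measurable (U : set (mR * mR)) -> test_function setT f ->
  is_weak_partial U i f (partial i f).
Proof.
move=> mU tf; have [Lf Lpf] := test_L2 mU tf; split=> // g tg.
have tgT := test_functionT tg; have [Lg Lpg] := test_L2 mU tgT.
have tfg : test_function setT (fun p => f p * g p).
  have [sf _] := tf; have [sg [A [cA AU g0]]] := tg.
  split; first exact: smoothM.
  by exists A; split=> // p /g0 ->; rewrite mulr0.
apply/eqP; rewrite -addr_eq0; apply/eqP.
rewrite -(RintegralD mU (L2_mul_integrable mU Lf (Lpg i)) (L2_mul_integrable mU (Lpf i) Lg)).
rewrite supported_Rintegral; last first.
  by move=> p Up; rewrite (test_partial_out i tg Up) (test_out tg Up) !mulr0 addr0.
rewrite -(integral_partial0 i tfg); congr (Rintegral _ _ _).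
apply/funext => p; have [sf _] := tf; have [sg _] := tg.
by rewrite partialM // addrC.
Qed.

Lemma box_sub (p q r s p' q' r' s' : R) : `]p, q[%classic `*` `]r, s[%classic `&` (`]p', q'[%classic `*` `]r', s'[%classic) =
  obox (Num.max p p') (Num.min q q') (Num.max r r') (Num.min s s').
Proof.
apply/seteqP; split=> -[x y] /=; rewrite !in_itv /= !gt_max !lt_min.
  by move=> [[/andP[-> ->] /andP[-> ->]] [/andP[-> ->] /andP[-> ->]]].
by move=> [/andP[/andP[-> ->] /andP[-> ->]] /andP[/andP[-> ->] /andP[-> ->]]].
Qed.

(* The positive and the negative part of [g] have the same integral against the
   bump functions of every subbox, so they are densities of the same measure. *)
Lemma fundamental_box U g p q r s : measurable (U : set (mR * mR)) -> L2 (area R) U g ->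
  (forall f, test_function U f -> \int[area R]_(x in U) (g x * f x) = 0) ->
  (forall x y, p <= x <= q -> r <= y <= s -> U (x, y)) ->
  {ae area R, forall x, obox p q r s x -> g x = 0}.
Proof.
move=> mU Lg Hg BU.
have mB : measurable (obox p q r s : set (mR * mR)) by exact: measurableX.
have BsU : obox p q r s `<=` U.
  by move=> [x y] [/= + +]; rewrite !in_itv /= => /andP[/ltW px /ltW xq] /andP[/ltW ry /ltW ys]; apply: BU; apply/andP.
have [mg gfin] := (L2P _ mU g).1 Lg.
have mgB : measurable_fun (obox p q r s : set (mR * mR)) g by exact: measurable_funS mg.
pose gB := g \_ (obox p q r s).
have mgBT : measurable_fun (setT : set (mR * mR)) gB := (measurable_restrictT g mB).1 mgB.
have areaB : (area R (obox p q r s) < +oo)%E.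
  have -> : (area R (obox p q r s) = mu (`]p, q[%classic : set R) * mu (`]r, s[%classic : set R))%E by exact: product_measure1E.
  rewrite !lebesgue_measure_itv /=; case: ifP => _; case: ifP => _; rewrite ?mul0e ?mule0 //.
  by rewrite -!EFinB -EFinM ltry.
have Ig : (area R).-integrable (obox p q r s) (EFin \o g).
  apply/integrableP; split; first exact/measurable_EFinP.
  apply: (@le_lt_trans _ _ (\int[area R]_(x in obox p q r s) (1 + (g x) ^+ 2)%:E)%E).
    apply: ge0_le_integral => //.
    - by apply: measurableT_comp => //; exact/measurable_EFinP.
    - by apply/measurable_EFinP; apply: measurable_funD => //; exact: measurable_funX.
    - move=> x _; rewrite lee_fin -[(g x) ^+ 2]real_normK ?num_real //.
      by have := sqr_ge0 (`|g x| - 1); have := normr_ge0 (g x); move: `|g x| => u; rewrite sqrrB1; nra.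
  under eq_integral do rewrite EFinD.
  rewrite ge0_integralD //; last 2 first.
  - by move=> x _; rewrite lee_fin sqr_ge0.
  - by apply/measurable_EFinP; exact: measurable_funX.
  rewrite integral_cst // mul1e lte_add_pinfty //.
  apply: le_lt_trans gfin; apply: ge0_subset_integral => //.
  - by apply/measurable_EFinP; exact: measurable_funX.
  - by move=> x _; rewrite lee_fin sqr_ge0.
pose gp x := Num.max (gB x) 0; pose gn x := Num.max (- gB x) 0.
have mgp : measurable_fun (setT : set (mR * mR)) gp by exact: measurable_maxr.
have mgn : measurable_fun (setT : set (mR * mR)) gn by apply: measurable_maxr => //; exact: measurable_funN.
have gp0 x : 0 <= gp x by rewrite le_max lexx orbT.
have gn0 x : 0 <= gn x by rewrite le_max lexx orbT.
have mid : measurable_fun (setT : set (mR * mR)) (@id (mR * mR)) by exact: measurable_id.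
have [np Enp] := density_pushforward (area R) mB mgp mid gp0.
have [nn Enn] := density_pushforward (area R) mB mgn mid gn0.
have Nset (n : {measure set (mR * mR) -> \bar R}) (w : mR * mR -> R) : measurable_fun (setT : set (mR * mR)) w -> (forall x, 0 <= w x) ->
    (forall F : mR * mR -> \bar R, measurable_fun setT F -> (forall x, 0 <= F x)%E ->
     \int[n]_x F x = \int[area R]_(x in obox p q r s) ((w x)%:E * F x))%E ->
    forall X : set (R * R), measurable (X : set (mR * mR)) -> (n X = \int[area R]_(x in X `&` obox p q r s) (w x)%:E)%E.
  move=> mw w0 En X mX; rewrite -[X in n X]setIT -integral_indic // En; last 2 first.
  - by apply/measurable_EFinP; exact: measurable_indic.
  - by move=> x; rewrite lee_fin.
  rewrite [in RHS]integral_mkcondl; apply: eq_integral => x _.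
  by rewrite /patch indicE; case: ifP => _; rewrite ?mule1 ?mule0.
have NpE := Nset np gp mgp gp0 Enp; have NnE := Nset nn gn mgn gn0 Enn.
have fin (w : mR * mR -> R) : measurable_fun (setT : set (mR * mR)) w -> (forall x, 0 <= w x <= `|gB x|) ->
    (\int[area R]_(x in obox p q r s) (w x)%:E < +oo)%E.
  move=> mw w0; have /integrableP[_] := Ig; apply: le_lt_trans; apply: ge0_le_integral => //.
  - by move=> x _; have /andP[] := w0 x; rewrite lee_fin.
  - by apply/measurable_EFinP; exact: measurable_funTS.
  - by apply: measurableT_comp => //; exact/measurable_EFinP.
  - move=> x Bx; have /andP[_] := w0 x; rewrite lee_fin /gB patchE mem_set //.
have gpb x : 0 <= gp x <= `|gB x| by rewrite gp0 /gp ge_max ler_norm normr_ge0.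
have gnb x : 0 <= gn x <= `|gB x| by rewrite gn0 /gn ge_max -normrN ler_norm normr_ge0.
have finp := fin gp mgp gpb; have finn := fin gn mgn gnb.
have finX (w : mR * mR -> R) X : measurable_fun (setT : set (mR * mR)) w -> (forall x, 0 <= w x) -> measurable (X : set (mR * mR)) ->
   (\int[area R]_(x in obox p q r s) (w x)%:E < +oo)%E -> (\int[area R]_(x in X `&` obox p q r s) (w x)%:E < +oo)%E.
  move=> mw w0 mX; apply: le_lt_trans; apply: ge0_subset_integral => //; first exact: measurableI.
    by apply/measurable_EFinP; exact: measurable_funTS.
  by move=> x _; rewrite lee_fin.
(* Testing [g] with the bumps of the subbox gives equal integrals of the two parts, and the bumps
   increase to the indicator. *)
have sub p' q' r' s' : p <= p' -> q' <= q -> r <= r' -> s' <= s -> np (obox p' q' r' s') = nn (obox p' q' r' s').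
  move=> pp qq rr ss.
  have /cvg_lim <- // := @integral_bump2_cvg R np p' q' r' s'.
  have /cvg_lim <- // := @integral_bump2_cvg R nn p' q' r' s'.
  congr (limn _); apply/funext => k.
  have cb := @cont_bump2 R k p' q' r' s'.
  have mb : measurable_fun (setT : set (mR * mR)) (EFin \o bump2 k p' q' r' s').
    by apply/measurable_EFinP; exact: cont_measurable2.
  have b0 x : (0 <= (bump2 k p' q' r' s' x)%:E)%E by rewrite lee_fin bump2_ge0.
  rewrite Enp // Enn //.
  have tb : test_function U (bump2 k p' q' r' s').
    apply: (@test_function_tensor R U (bump k p' q') (bump k r' s') p' q' r' s').
    - exact: smooth1_bump.
    - exact: smooth1_bump.
    - by move=> x H; apply: bump_out; apply: contra H => /andP[/ltW -> /ltW ->].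
    - by move=> x H; apply: bump_out; apply: contra H => /andP[/ltW -> /ltW ->].
    - by clear -pp qq rr ss BU => x y /andP[? ?] /andP[? ?]; apply: BU; apply/andP; split; lra.
  have b1 x : bump2 k p' q' r' s' x <= 1 by rewrite mulr_ile1 ?bump_ge0 ?bump_le1.
  have := Hg _ tb; rewrite /Rintegral integralE.
  have bout x : ~ obox p q r s x -> bump2 k p' q' r' s' x = 0.
    move=> H; rewrite /bump2; have [H1|H1] := boolP (p' < x.1 < q'); last by rewrite bump_out ?mul0r.
    have [H2|H2] := boolP (r' < x.2 < s'); last by rewrite [X in _ * X]bump_out ?mulr0.
    by case: H; rewrite /= !in_itv /=; clear -pp qq rr ss H1 H2; move: H1 H2 => /andP[? ?] /andP[? ?]; split; apply/andP; split; lra.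
  have part (h : R * R -> R) (w : R * R -> R) : (forall x, 0 <= h x) ->
     (forall x, obox p q r s x -> w x * bump2 k p' q' r' s' x = h x) -> (forall x, ~ obox p q r s x -> h x = 0) ->
     (\int[area R]_(x in U) (h x)%:E = \int[area R]_(x in obox p q r s) ((w x)%:E * (bump2 k p' q' r' s' x)%:E))%E.
    move=> h0 hw hout; rewrite supported_integral; last by move=> x /(contra_not (BsU x)) /hout ->.
    rewrite -(@supported_integral (obox p q r s)); last by move=> x /hout ->.
    by apply: eq_integral => x; rewrite inE => Bx; rewrite -EFinM hw.
  have E1 : (\int[area R]_(x in U) (fun x => (g x * bump2 k p' q' r' s' x)%:E)^\+ x =
      \int[area R]_(x in obox p q r s) ((gp x)%:E * (bump2 k p' q' r' s' x)%:E))%E.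
    rewrite -(part (fun x => Num.max (g x * bump2 k p' q' r' s' x) 0) gp).
    - by apply: eq_integral => x _; rewrite funeposE EFin_max.
    - by move=> x; rewrite le_max lexx orbT.
    - by move=> x Bx; rewrite /gp /gB patchE mem_set // maxr_pMl ?bump2_ge0 // mul0r.
    - by move=> x /bout ->; rewrite mulr0 maxxx.
  have E2 : (\int[area R]_(x in U) (fun x => (g x * bump2 k p' q' r' s' x)%:E)^\- x =
      \int[area R]_(x in obox p q r s) ((gn x)%:E * (bump2 k p' q' r' s' x)%:E))%E.
    rewrite -(part (fun x => Num.max (- (g x * bump2 k p' q' r' s' x)) 0) gn).
    - by apply: eq_integral => x _; rewrite funenegE EFin_max.
    - by move=> x; rewrite le_max lexx orbT.
    - by move=> x Bx; rewrite /gn /gB patchE mem_set // maxr_pMl ?bump2_ge0 // mul0r mulNr.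
    - by move=> x /bout ->; rewrite mulr0 oppr0 maxxx.
  rewrite E1 E2.
  have finw (w : R * R -> R) : measurable_fun (setT : set (mR * mR)) w -> (forall x, 0 <= w x) ->
     (\int[area R]_(x in obox p q r s) (w x)%:E < +oo)%E ->
     (\int[area R]_(x in obox p q r s) ((w x)%:E * (bump2 k p' q' r' s' x)%:E))%E \is a fin_num.
    move=> mw w0 wf; rewrite ge0_fin_numE; last by apply: integral_ge0 => x _; rewrite mule_ge0 ?lee_fin ?bump2_ge0.
    apply: le_lt_trans wf; apply: ge0_le_integral => //.
    - by move=> x _; rewrite mule_ge0 ?lee_fin ?bump2_ge0.
    - by apply: emeasurable_funM; [apply/measurable_EFinP; exact: measurable_funTS|exact: measurable_funTS].
    - by apply/measurable_EFinP; exact: measurable_funTS.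
    - by move=> x _; rewrite -EFinM lee_fin ler_piMr.
  rewrite fineB; [|exact: finw|exact: finw].
  by move/eqP; rewrite subr_eq0 => /eqP H; rewrite -(fineK (finw _ mgp gp0 finp)) H fineK // finw.
(* Neither measure charges the complement of the box, so an arbitrary box is replaced by its
   intersection with it. *)
have eqX X : measurable (X : set (mR * mR)) -> np X = nn X.
  apply: measure_boxes_unique => [p' q' r' s'|p' q' r' s'].
    have mO : measurable (obox p' q' r' s' : set (mR * mR)) by exact: measurableX.
    have mI := measurableI _ _ mO mB.
    have I1 : np (obox p' q' r' s') = np (obox p' q' r' s' `&` obox p q r s) by rewrite !NpE // -setIA setIid.
    have I2 : nn (obox p' q' r' s') = nn (obox p' q' r' s' `&` obox p q r s) by rewrite !NnE // -setIA setIid.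
    by rewrite I1 I2 box_sub; apply: sub; rewrite ?le_max ?ge_min lexx ?orbT.
  have mO : measurable (obox p' q' r' s' : set (mR * mR)) by exact: measurableX.
  by rewrite NpE //; exact: finX.
have mEgn : measurable_fun (obox p q r s : set (mR * mR)) (EFin \o gn) by apply/measurable_EFinP; exact: measurable_funTS.
have Igp : (area R).-integrable (obox p q r s) (EFin \o gp).
  apply/integrableP; split; first by apply/measurable_EFinP; exact: measurable_funTS.
  by under eq_integral do rewrite gee0_abs ?lee_fin //.
have := @integral_ae_eq _ _ _ (area R) _ mB (EFin \o gn) (EFin \o gp) Igp mEgn.
have H E : E `<=` obox p q r s -> measurable (E : set (mR * mR)) ->
    (\int[area R]_(x in E) (EFin \o gp) x = \int[area R]_(x in E) (EFin \o gn) x)%E.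
  move=> EB mE; have := eqX E mE; rewrite NpE // NnE //.
  by rewrite (setIidl EB).
move=> /(_ H); apply: filterS => x H1 Bx; have [] := H1 Bx; rewrite /gp /gn /gB patchE mem_set //.
by clear; case: (leP (g x) 0); case: (leP (- g x) 0) => *; lra.
Qed.

(** Countably many rational squares whose closed versions lie in [U] cover [U], and each carries a
    negligible exceptional set. *)
Lemma fundamental U g : open U -> L2 (area R) U g ->
  (forall f, test_function U f -> \int[area R]_(x in U) (g x * f x) = 0) ->
  {ae area R, forall x, U x -> g x = 0}.
Proof.
move=> oU Lg Hg; have mU := open_measurable2 oU.
pose box (z : rat * rat * rat) : set (R * R) :=
  obox (ratr z.1.1 - ratr z.2) (ratr z.1.1 + ratr z.2) (ratr z.1.2 - ratr z.2) (ratr z.1.2 + ratr z.2).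
pose inside (z : rat * rat * rat) := forall x y : R, ratr z.1.1 - ratr z.2 <= x <= ratr z.1.1 + ratr z.2 ->
  ratr z.1.2 - ratr z.2 <= y <= ratr z.1.2 + ratr z.2 -> U (x, y).
pose bad n : set (R * R) := if unpickle n is Some z then [set x | inside z /\ box z x /\ g x != 0] else set0.
have Nbad n : (area R).-negligible (bad n : set (mR * mR)).
  rewrite /bad; case: unpickle => [z|]; last exact: negligible_set0.
  have [Iz|Iz] := pselect (inside z); last first.
    by apply: negligibleS (negligible_set0 _) => x [].
  apply: negligibleS (fundamental_box mU Lg Hg Iz) => x /= [_ [Bx gx]] H.
  by move: gx; rewrite H ?eqxx.
apply: negligibleS (negligible_bigcup Nbad) => x /= /not_implyP[Ux gx].
have /= := open_nbhs_nbhs (conj oU Ux); rewrite -nbhs_ballE => -[e /= e0 eU].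
have [h] : exists h : rat, ratr h \in `]e / 4, e / 2[%R.
  by apply: rat_in_itvoo; lra.
rewrite in_itv /= => /andP[h1 h2].
have [c1] : exists c : rat, ratr c \in `]x.1 - ratr h, x.1 + ratr h[%R by apply: rat_in_itvoo; lra.
have [c2] : exists c : rat, ratr c \in `]x.2 - ratr h, x.2 + ratr h[%R by apply: rat_in_itvoo; lra.
rewrite !in_itv /= => /andP[d1 d2] /andP[d3 d4].
have [n En] : exists n, unpickle n = Some ((c1, c2), h) by exists (pickle ((c1, c2), h)); exact: pickleK.
exists n; first by [].
rewrite /bad En; split; last first.
  split; last exact/eqP.
  by rewrite /box /= !in_itv /=; split; apply/andP; split; lra.
move=> u v /= /andP[u1 u2] /andP[v1 v2]; apply: eU; split; rewrite /ball /= ltr_norml; apply/andP; split; lra.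
Qed.

Lemma weak_partial_uniq U i u g g' : open U ->
  is_weak_partial U i u g -> is_weak_partial U i u g' -> {ae area R, forall x, U x -> g x = g' x}.
Proof.
move=> oU [Lg Hg] [Lg' Hg']; have mU := open_measurable2 oU.
have [mg fg] := (L2P (area R) mU g).1 Lg; have [mg' fg'] := (L2P (area R) mU g').1 Lg'.
have Lgg : L2 (area R) U (fun x => g x - g' x).
  apply/(L2P _ mU); split; first exact: measurable_funB.
  have := sqnD (area R) mU mg (measurable_funN mg').
  move/le_lt_trans; apply; rewrite sqnN lte_add_pinfty // lte_mul_pinfty //.
have H : forall f, test_function U f -> \int[area R]_(x in U) ((g x - g' x) * f x) = 0.
  move=> f tf; have [Lf _] := test_L2 mU (test_functionT tf).
  have E : (fun x => (g x - g' x) * f x) = (fun x => g x * f x - g' x * f x) by apply/funext => x; rewrite mulrBl.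
  rewrite E (RintegralB mU (L2_mul_integrable mU Lg Lf) (L2_mul_integrable mU Lg' Lf)).
  by have := Hg f tf; rewrite (Hg' f tf) => /oppr_inj ->; rewrite subrr.
apply: negligibleS (fundamental oU Lgg H) => x /= H1 H2; apply: H1 => Ux.
by apply/eqP; rewrite -subr_eq0; apply/eqP; exact: H2.
Qed.

Lemma weak_partialP U i u : (exists g, is_weak_partial U i u g) -> is_weak_partial U i u (weak_partial U i u).
Proof. by move=> [g Hg]; rewrite /weak_partial; exact: (getPex (P := is_weak_partial U i u)) (ex_intro _ g Hg). Qed.

(** [weak_partial] selects some weak derivative; by uniqueness almost everywhere its norm may be
    computed from any other. *)
Lemma sqn_weak_partial U i u g : open U -> is_weak_partial U i u g ->
  sqn (area R) U (weak_partial U i u) = sqn (area R) U g.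
Proof.
move=> oU Hg; have mU := open_measurable2 oU.
have Hw := weak_partialP (ex_intro _ g Hg).
have [mg _] := (L2P (area R) mU _).1 (proj1 Hg); have [mw _] := (L2P (area R) mU _).1 (proj1 Hw).
exact: (sqn_ae mU mw mg (weak_partial_uniq oU Hw Hg)).
Qed.

Lemma is_weak_partial_lin U i u v g h (a b : R) : measurable (U : set (mR * mR)) -> L2 (area R) U u -> L2 (area R) U v ->
  is_weak_partial U i u g -> is_weak_partial U i v h ->
  is_weak_partial U i (a \*o u \+ b \*o v) (fun x => a * g x + b * h x).
Proof.
move=> mU Lu Lv [Lg Hg] [Lh Hh].
have [mg fg] := (L2P (area R) mU g).1 Lg; have [mh fh] := (L2P (area R) mU h).1 Lh.
have mag : measurable_fun U (fun x => a * g x) by exact: measurable_funM.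
have mbh : measurable_fun U (fun x => b * h x) by exact: measurable_funM.
split.
  apply/(L2P _ mU); split; first exact: measurable_funD.
  apply: le_lt_trans (sqnD (area R) mU mag mbh) _.
  have Z (k : R) (w : R * R -> R) : measurable_fun U w -> (sqn (area R) U w < +oo)%E -> (2%:E * sqn (area R) U (fun x => (k * w x)%R) < +oo)%E.
    move=> mw fw; rewrite (sqnZ (area R) mU k mw); apply: lte_mul_pinfty; rewrite ?lee_fin //.
    by apply: lte_mul_pinfty; rewrite ?lee_fin ?sqr_ge0.
  by rewrite lte_add_pinfty // Z.
move=> f tf; have [Lf Lpf] := test_L2 mU (test_functionT tf).
have Z w w' k : L2 (area R) U w -> L2 (area R) U w' -> (area R).-integrable U (fun x => (k * (w x * w' x))%:E).
  move=> Lw Lw'; exact: (integrableZl mU k (L2_mul_integrable mU Lw Lw')).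
have lin w1 w2 w' : L2 (area R) U w1 -> L2 (area R) U w2 -> L2 (area R) U w' ->
   \int[area R]_(p in U) ((a * w1 p + b * w2 p) * w' p) =
   a * \int[area R]_(p in U) (w1 p * w' p) + b * \int[area R]_(p in U) (w2 p * w' p).
  move=> L1 L2' L3; rewrite -(RintegralZl a mU (L2_mul_integrable mU L1 L3)) -(RintegralZl b mU (L2_mul_integrable mU L2' L3)).
  rewrite -(RintegralD mU (Z _ _ a L1 L3) (Z _ _ b L2' L3)); congr (Rintegral _ _ _).
  by apply/funext => p; ring.
rewrite (lin u v _ Lu Lv (Lpf i)) (lin g h _ Lg Lh Lf) (Hg f tf) (Hh f tf); ring.
Qed.

End Plane.

Lemma smooth1_primitive {R : realType} (f f' : R -> R) :
  (forall x, is_deriv x f (f' x)) -> smooth1 f' -> smooth1 f.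
Proof.
move=> D sf'; apply/smooth1P => -[//|n] x; exists f'; last exact: ((smooth1P _).1 sf').
by exists 1 => //= t _; exact: D.
Qed.

Section TestAlgebra.
Context {R : realType}.
Implicit Types (f g : R * R -> R).

Lemma smooth_cst (c : R) : smooth (fun _ : R * R => c).
Proof.
move=> k; elim: k c => [|k IH] c; first exact: cont_cst.
by apply: (@is_partial_Ck _ _ _ (fun=> 0) (fun=> 0)) => // x y; exact: ide_cst.
Qed.

Lemma test_lin f g (a b : R) : test_function setT f -> test_function setT g ->
  test_function setT (fun p => a * f p + b * g p).
Proof.
move=> [sf [A [cA _ f0]]] [sg [B [cB _ g0]]]; split.
  by apply: smoothD; apply: smoothM => //; exact: smooth_cst.
exists (A `|` B); split=> //; first exact: compactU.
by move=> p /not_orP[/f0 -> /g0 ->]; rewrite !mulr0 addr0.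
Qed.

Lemma partial_lin i f g (a b : R) p : smooth f -> smooth g ->
  partial i (fun p => a * f p + b * g p) p = a * partial i f p + b * partial i g p.
Proof.
move=> sf sg; case: p => x y; have [->|->] := ord2 i.
- apply: partial0E.
  apply: (ide_eq (ideD (ideM (ide_cst a x) (smooth_ide0 x y sf)) (ideM (ide_cst b x) (smooth_ide0 x y sg)))).
  by rewrite !mul0r !add0r.
- apply: partial1E.
  apply: (ide_eq (ideD (ideM (ide_cst a y) (smooth_ide1 x y sf)) (ideM (ide_cst b y) (smooth_ide1 x y sg)))).
  by rewrite !mul0r !add0r.
Qed.

End TestAlgebra.

Lemma lee_all_gt0 {R : realType} (x : \bar R) (c : R) : (0 <= x)%E -> 0 <= c ->
  (forall e, 0 < e -> (x <= (c * e)%:E)%E) -> x = 0%E.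
Proof.
move=> x0 c0 H; apply/eqP; rewrite eq_le x0 andbT.
have c1 : 0 < c + 1 by lra.
apply/lee_addgt0Pr => e e0; rewrite add0e; apply: le_trans (H (e / (c + 1)) _) _; first by rewrite divr_gt0.
rewrite lee_fin mulrA ler_pdivrMr // mulrC ler_pM2l //; lra.
Qed.

(** * Traces and trial planes *)

Section ExteriorForms.
Context {R : realType} (Omega : set (R * R)) (K : convex_curve Omega).
Notation mu := (@lebesgue_measure R).
Notation mR := (measurableTypeR R).
Notation L := (len K).
Notation gx := (gx K).
Notation gy := (gy K).
Notation tx := (tx K).
Notation ty := (ty K).
Notation ka := (ka K).
Notation ncx := (ncx K).
Notation ncy := (ncy K).
Notation dl := (tube_width K).
Notation hm := (@arclength R).
Notation ext := (exterior Omega).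
Notation bd := (boundary Omega).
Notation hT := (caratheodory_type (hausdorff_outer R)).
Variables (a b : R).
Hypothesis (Oab : Omega (a, b)).
Hypothesis (cvx : segment_closed Omega).
Implicit Types (f h : R * R -> R) (A : R -> R) (s t : R).

Lemma measurable_ext : measurable (ext : set (mR * mR)).
Proof. by apply: open_measurable2; exact: open_exterior. Qed.

Definition far (M : R) f := forall s t, M <= t -> f (ncx (s, t), ncy (s, t)) = 0.

Lemma test_far f : test_function setT f -> exists2 M, 0 < M & far M f /\ forall i, far M (partial i f).
Proof.
move=> tf; have [S S0 f0] := test_function_support tf.
exists (2 * (S + 2 + `|a| + `|b|) + 1).
  by have := normr_ge0 a; have := normr_ge0 b; lra.
have far_of (h : R * R -> R) : (forall x y : R, ~~ ((- (S + 1) <= x <= S + 1) && (- (S + 1) <= y <= S + 1)) -> h (x, y) = 0) ->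
    far (2 * (S + 2 + `|a| + `|b|) + 1) h.
  move=> h0 s t Mt; apply: h0; apply: contra (nc_far K Oab s Mt) => /andP[/andP[x1 x2] /andP[y1 y2]].
  by apply/andP; split; apply/andP; split; lra.
split; last by move=> i; apply: far_of; exact: boxed_partial.
apply: far_of => x y H; apply: f0; apply: contra H => /andP[/andP[x1 x2] /andP[y1 y2]].
by apply/andP; split; apply/andP; split; lra.
Qed.

Lemma ext_integral (h : R * R -> R) (M : R) : 0 <= M -> continuous h -> (forall p, 0 <= h p) -> far M h ->
  (\int[area R]_(p in ext) (h p)%:E =
   (\int[mu]_(t in `[0%R, M]) \int[mu]_(s in `[0%R, L]) (h (ncx (s, t), ncy (s, t)) * (1 + ka s * t)))%:E)%E.
Proof.
move=> M0 ch h0 hM.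
rewrite (exterior_integral K Oab cvx); last 2 first.
- by apply/measurable_EFinP; exact: cont_measurable2.
- by move=> p; rewrite lee_fin.
have chn : continuous (fun q : R * R => h (ncx q, ncy q)) by have := cont_ncx (K := K); have := cont_ncy (K := K); cts.
pose g (q : R * R) := h (ncx q, ncy q) * (1 + ka q.1 * q.2).
have cg : continuous g by rewrite /g; cts.
pose F (q : R * R) := ((Num.max 0 (1 + ka q.1 * q.2))%:E * (h (ncx q, ncy q))%:E)%E.
transitivity (\int[area R]_(q in (`[0%R, L]%classic `*` `]0%R, +oo[%classic)) F q)%E.
  apply: eq_integral => -[s t]; rewrite inE => -[_ /=]; rewrite in_itv /= andbT => t0.
  by rewrite /F /= (max_idPr _) // addr_ge0 // mulr_ge0 ?ka_ge0 // ltW.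
apply: (@strip_integral R Omega K F g M) => //.
- have c1 : continuous (fun q : R * R => Num.max 0 (1 + ka q.1 * q.2) * h (ncx q, ncy q)).
    by apply: cont2M => //; apply: cont2_max; cts.
  by apply/measurable_EFinP; exact: (cont_measurable2 measurableT c1).
- by move=> q; rewrite /F -EFinM lee_fin mulr_ge0 // le_max lexx.
- move=> s t t0; rewrite /F /g -EFinM mulrC /= (max_idPr _) //.
  by rewrite addr_ge0 // mulr_ge0 ?ka_ge0 // ltW.
- by move=> s t Mt; rewrite /g /= hM ?mul0r.
Qed.

Lemma bd_sqn f : continuous f -> measurable_fun (bd : set hT) f /\
  sqn hm (bd : set hT) f = (\int[mu]_(s in `[0%R, L]) (f (gx s, gy s) ^+ 2))%:E.
Proof.
move=> cf; have cfg : continuous (fun s => f (gx s, gy s)) by cts.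
have cfg2 : continuous (fun s => f (gx s, gy s) ^+ 2) by cts.
split; first exact: (@cara_measurable_fun R Omega K f _ cfg).
by apply: (@boundary_integral R Omega K (fun p => f p ^+ 2) _ cfg2) => // s; exact: sqr_ge0.
Qed.

Definition grad2 f p := partial 0 f p ^+ 2 + partial 1 f p ^+ 2.

(** Integrate [- 2 f f'] along each outward normal and use [2 |f f'| <= f ^ 2 + f' ^ 2]. The
    Jacobian [1 + ka t] is at least 1 because the boundary is convex, so the plane integral
    dominates. *)
Lemma trace_ineq f : test_function setT f ->
  (sqn hm (bd : set hT) f <= sqn (area R) ext f + (sqn (area R) ext (partial 0%R f) + sqn (area R) ext (partial 1%R f)))%E.
Proof.
move=> tf; have [sf _] := tf; have [M M0 [fM pM]] := test_far tf.
have cf := smooth_cont sf; have c0 := smooth_partial_cont (i := 0) sf; have c1 := smooth_partial_cont (i := 1) sf.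
have [_ ->] := bd_sqn cf.
have m2 (h : R * R -> R) : continuous h -> measurable_fun (ext : set (mR * mR)) (fun x => (h x ^+ 2)%:E).
  move=> ch; apply/measurable_EFinP; apply: cont_measurable2; first exact: measurable_ext.
  exact: cont2X.
have p2 (h : R * R -> R) x : ext x -> (0 <= (h x ^+ 2)%:E)%E by rewrite lee_fin sqr_ge0.
rewrite /sqn -(ge0_integralD _ measurable_ext (p2 _) (m2 _ c0) (p2 _) (m2 _ c1)).
rewrite -(ge0_integralD _ measurable_ext (p2 _) (m2 _ cf)); last 2 first.
- by move=> x Ex; rewrite adde_ge0 ?p2.
- by apply: emeasurable_funD; exact: m2.
pose h p := f p ^+ 2 + grad2 f p.
have ch : continuous h by rewrite /h /grad2; cts.
have -> : (\int[area R]_(x in ext) ((f x ^+ 2)%:E + ((partial 0 f x ^+ 2)%:E + (partial 1 f x ^+ 2)%:E)) = \int[area R]_(x in ext) (h x)%:E)%E.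
  by apply: eq_integral => x _; rewrite -!EFinD.
rewrite (ext_integral (ltW M0) ch); last 2 first.
- by move=> p; rewrite /h /grad2 !addr_ge0 ?sqr_ge0.
- by move=> s t Mt; rewrite /h /grad2 fM // pM // pM // expr0n !addr0.
rewrite lee_fin.
have chn : continuous (fun q : R * R => h (ncx q, ncy q)) by have := cont_ncx (K := K); have := cont_ncy (K := K); cts.
have cj : continuous (fun q : R * R => 1 + ka q.1 * q.2) by cts.
have chj : continuous (fun q : R * R => h (ncx q, ncy q) * (1 + ka q.1 * q.2)) := cont2M chn cj.
rewrite (@int_swap R (fun q => h (ncx (q.2, q.1), ncy (q.2, q.1)) * (1 + ka q.2 * q.1)) _ _ _ _ (cont_swap chj)) /=.
apply: int_le; first by cts.
  exact: (@cont_int2 R (fun q => h (ncx q, ncy q) * (1 + ka q.1 * q.2)) 0 M chj).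
move=> s _.
pose G t := f (ncx (s, t), ncy (s, t)); pose Gn t := partial 0 f (ncx (s, t), ncy (s, t)) * ty s + partial 1 f (ncx (s, t), ncy (s, t)) * (- tx s).
have dG t : is_deriv t G (Gn t) by exact: (smooth_chain sf (ncx_t K s t) (ncy_t K s t)).
have dG2 t : is_deriv t (fun t => G t ^+ 2) (2 * G t * Gn t).
  by apply: (ide_eq (ideX 1 (dG t))).
have cG : continuous G := is_derive_cont dG.
have cp i : smooth f -> continuous (fun t => partial i f (ncx (s, t), ncy (s, t))).
  move=> sf'; have cpp : continuous (fun q : R * R => partial i f (ncx q, ncy q)).
    by apply: cont2_pair; [exact: smooth_partial_cont|exact: cont_ncx|exact: cont_ncy].
  exact: (@cont_sec2 R _ s cpp).
have cGn : continuous Gn.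
  by apply: cont1D; apply: cont1M; [exact: cp 0 sf|exact: cont1_cst|exact: cp 1 sf|exact: cont1_cst].
have cGG : continuous (fun t => 2 * G t * Gn t) by cts.
have E : f (gx s, gy s) ^+ 2 = \int[mu]_(t in `[0, M]) (-1 * (2 * G t * Gn t)).
  rewrite (intZ _ _ _ cGG) (FTC (ltW M0) cGG dG2) /G fM // nc0 expr0n /=; ring.
rewrite E; apply: int_le; [by cts|exact: (@cont_sec2 R _ s chj)|].
move=> t /andP[t0 _]; rewrite /h /grad2 -/(G t) /Gn.
move: (partial 0 f _) (partial 1 f _) (G t) (tx s) (ty s) (unit_t K s) (ka_ge0 K s) => p q g x y U k0.
have n2 : (p * y + q * - x) ^+ 2 <= p ^+ 2 + q ^+ 2.
  rewrite -subr_ge0; have -> : p ^+ 2 + q ^+ 2 - (p * y + q * - x) ^+ 2 = (p * x + q * y) ^+ 2 + (1 - (x ^+ 2 + y ^+ 2)) * (p ^+ 2 + q ^+ 2) by ring.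
  by rewrite U subrr mul0r addr0 sqr_ge0.
move: (p * y + q * - x) (p ^+ 2 + q ^+ 2) n2 => n G2 n2.
have H0 : -1 * (2 * g * n) <= g ^+ 2 + G2 by have := sqr_ge0 (g + n); nra.
apply: le_trans H0 _; rewrite ler_peMr //; last by rewrite lerDl mulr_ge0.
by rewrite addr_ge0 ?sqr_ge0 // (le_trans _ n2) ?sqr_ge0.
Qed.

Lemma L2_measurable d (T : measurableType d) (m : {measure set T -> \bar R}) (D : set T) (f : T -> R) :
  measurable D -> L2 m D f -> measurable_fun D f.
Proof. by move=> mD /(L2P m mD)[]. Qed.

Lemma test_bd_L2 f : test_function setT f -> L2 hm (bd : set hT) f.
Proof.
move=> [sf _]; have [mf E] := bd_sqn (smooth_cont sf).
by apply/(L2P hm (cara_boundary K)); split=> //; rewrite E ltry.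
Qed.

(* The trace inequality makes the restriction to the boundary continuous, so two
   approximating sequences have the same limit there. *)
Lemma trace_uniq (u t t' : R * R -> R) : H1 ext u -> is_trace Omega u t -> is_trace Omega u t' ->
  {ae hm, forall p, (bd : set hT) p -> t p = t' p}.
Proof.
move=> [Lu wu] [Lt [f [tf fu pfu ft]]] [Lt' [f' [tf' fu' pfu' ft']]].
have mE := measurable_ext; have mB := cara_boundary K.
have mt := L2_measurable mB Lt; have mt' := L2_measurable mB Lt'.
have mu' := L2_measurable mE Lu.
have mw i : measurable_fun (ext : set (mR * mR)) (weak_partial ext i u).
  by have [Lw _] := weak_partialP (wu i); exact: L2_measurable Lw.
have mtest h : test_function setT h -> [/\ measurable_fun (bd : set hT) h, measurable_fun (ext : set (mR * mR)) h &
    forall i, measurable_fun (ext : set (mR * mR)) (partial i h)].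
  move=> th; have [Lh Lp] := test_L2 mE th; split.
  - exact: L2_measurable (test_bd_L2 th).
  - exact: L2_measurable Lh.
  - by move=> i; exact: L2_measurable (Lp i).
apply: (sqn_eq0 mB mt mt').
(* The estimates below accumulate [54 * e]: [12 * e] from the trace inequality, then two
   applications of the doubling in [diff]. *)
apply: (@lee_all_gt0 _ _ 60) => //; first exact: sqn_ge0.
move=> e e0.
have small d (T : measurableType d) (m : {measure set T -> \bar R}) (D : set T) (g_ : (T -> R)^nat) g :
    measurable D -> cvg_L2 m D g_ g -> \forall n \near \oo, (sqn m D (fun x => (g_ n x - g x)%R) <= e%:E)%E.
  move=> mD /cvg_L2P /(cvge0P (fun n => sqn_ge0 _ _ _)) /(_ e e0).
  by apply: filterS => n /ltW.
have [n [A1 A2 B0 B0' [B1 B1' C C']]] : exists n, [/\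
    (sqn (area R) ext (fun x => (f n x - u x)%R) <= e%:E)%E, (sqn (area R) ext (fun x => (f' n x - u x)%R) <= e%:E)%E,
    (sqn (area R) ext (fun x => (partial 0 (f n) x - weak_partial ext 0 u x)%R) <= e%:E)%E,
    (sqn (area R) ext (fun x => (partial 0 (f' n) x - weak_partial ext 0 u x)%R) <= e%:E)%E &
    [/\ (sqn (area R) ext (fun x => (partial 1 (f n) x - weak_partial ext 1 u x)%R) <= e%:E)%E,
    (sqn (area R) ext (fun x => (partial 1 (f' n) x - weak_partial ext 1 u x)%R) <= e%:E)%E,
    (sqn hm (bd : set hT) (fun x => (f n x - t x)%R) <= e%:E)%E & (sqn hm (bd : set hT) (fun x => (f' n x - t' x)%R) <= e%:E)%E]].
  have N1 := small _ _ _ _ _ _ mE fu; have N2 := small _ _ _ _ _ _ mE fu'.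
  have N3 := small _ _ _ _ _ _ mE (pfu 0); have N4 := small _ _ _ _ _ _ mE (pfu' 0).
  have N5 := small _ _ _ _ _ _ mE (pfu 1); have N6 := small _ _ _ _ _ _ mE (pfu' 1).
  have N7 := small _ _ _ _ _ _ mB ft; have N8 := small _ _ _ _ _ _ mB ft'.
  have := filterI (filterI (filterI N1 N2) (filterI N3 N4)) (filterI (filterI N5 N6) (filterI N7 N8)).
  by move=> [N _ /(_ N (leqnn N)) [[[? ?] [? ?]] [[? ?] [? ?]]]]; exists N.
have [mf mfe mfp] := mtest _ (tf n); have [mf' mfe' mfp'] := mtest _ (tf' n).
have diff d (T : measurableType d) (m : {measure set T -> \bar R}) (D : set T) (g g' h : T -> R) (c c' : R) : measurable D ->
    measurable_fun D g -> measurable_fun D g' -> measurable_fun D h ->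
    (sqn m D (fun x => (g x - h x)%R) <= c%:E)%E -> (sqn m D (fun x => (g' x - h x)%R) <= c'%:E)%E ->
    (sqn m D (fun x => (g x - g' x)%R) <= (2 * c + 2 * c')%:E)%E.
  move=> mD mg mg' mh H H'.
  have := sqnD m mD (measurable_funB mg mh) (measurable_funN (measurable_funB mg' mh)).
  rewrite sqnN (@sqn_eq _ _ _ m D _ (fun x => g x - g' x)); last by move=> x _ /=; ring.
  move=> S2; apply: le_trans S2 _; rewrite [X in (_ <= X)%E]EFinD.
  by apply: leeD; rewrite [X in (_ <= X)%E]EFinM; apply: lee_pmul => //; exact: sqn_ge0.
have D1 := diff _ _ (area R) ext (f n) (f' n) u e e mE mfe mfe' mu' A1 A2.
have D2 := diff _ _ (area R) ext _ _ _ e e mE (mfp 0) (mfp' 0) (mw 0) B0 B0'.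
have D3 := diff _ _ (area R) ext _ _ _ e e mE (mfp 1) (mfp' 1) (mw 1) B1 B1'.
have td := test_lin 1 (-1) (tf n) (tf' n).
have [sfn _] := tf n; have [sfn' _] := tf' n.
have D4 : (sqn hm (bd : set hT) (fun x => (f n x - f' n x)%R) <= (12 * e)%:E)%E.
  have := trace_ineq td.
  rewrite (@sqn_eq _ _ _ hm _ _ (fun x => f n x - f' n x)); last by move=> x _; ring.
  rewrite (@sqn_eq _ _ _ (area R) _ _ (fun x => f n x - f' n x)); last by move=> x _; ring.
  have pe i : sqn (area R) ext (partial i (fun p => (1 * f n p + -1 * f' n p)%R)) = sqn (area R) ext (fun x => (partial i (f n) x - partial i (f' n) x)%R).
    by apply: sqn_eq => x _; rewrite (partial_lin i 1 (-1) x sfn sfn'); ring.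
  rewrite !pe.
  move/le_trans; apply; have -> : 12 * e = (2 * e + 2 * e) + ((2 * e + 2 * e) + (2 * e + 2 * e)) by ring.
  exact: (leeD D1 (leeD D2 D3)).
have C2 : (sqn hm (bd : set hT) (fun x => (t x - f n x)%R) <= e%:E)%E.
  by rewrite -sqnN (@sqn_eq _ _ _ hm _ _ (fun x => f n x - t x)) // => x _; ring.
have C2' : (sqn hm (bd : set hT) (fun x => (t' x - f' n x)%R) <= e%:E)%E.
  by rewrite -sqnN (@sqn_eq _ _ _ hm _ _ (fun x => f' n x - t' x)) // => x _; ring.
have D4' : (sqn hm (bd : set hT) (fun x => (f' n x - f n x)%R) <= (12 * e)%:E)%E.
  by rewrite -sqnN (@sqn_eq _ _ _ hm _ _ (fun x => f n x - f' n x)) // => x _; ring.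
have E1 : (sqn hm (bd : set hT) (fun x => (f n x - t' x)%R) <= (2 * (12 * e) + 2 * e)%:E)%E.
  apply: (diff _ _ hm _ _ _ (f' n) _ _ mB mf mt' mf' D4).
  exact: C2'.
have E2 : (sqn hm (bd : set hT) (fun x => (t' x - f n x)%R) <= (2 * (12 * e) + 2 * e)%:E)%E.
  by rewrite -sqnN (@sqn_eq _ _ _ hm _ _ (fun x => f n x - t' x)) // => x _; ring.
have := diff _ _ hm _ _ _ (f n) _ _ mB mt mt' mf C2 E2.
by move/le_trans; apply; rewrite lee_fin; lra.
Qed.

Lemma test_H1 f : test_function setT f -> H1 ext f.
Proof.
move=> tf; have [Lf _] := test_L2 measurable_ext tf; split=> // i.
by exists (partial i f); apply: test_weak_partial => //; exact: measurable_ext.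
Qed.

Lemma test_trace f : test_function setT f -> is_trace Omega f f.
Proof.
move=> tf; have mE := measurable_ext; split; first exact: test_bd_L2.
exists (fun=> f); split=> //.
- exact: cvg_L2_cst.
- move=> i; apply/cvg_L2P.
  have wf := test_weak_partial i mE tf.
  have ww := weak_partialP (ex_intro _ _ wf).
  have [mp mw] := (L2_measurable mE (proj1 wf), L2_measurable mE (proj1 ww)).
  rewrite (_ : (fun _ => _) = fun=> 0%E); first exact: cvg_cst.
  apply/funext => n.
  rewrite (@sqn_ae _ _ _ (area R) ext mE _ (fun=> 0)); last 3 first.
  + exact: measurable_funB.
  + exact: measurable_cst.
  + apply: negligibleS (weak_partial_uniq (open_exterior (Omega := Omega)) wf ww) => x /= H1 H2; apply: H1 => Ex.
    by apply/eqP; rewrite subr_eq0; apply/eqP; exact: H2.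
  by apply: integral0_eq => x _; rewrite expr0n.
- exact: cvg_L2_cst.
Qed.

(** The quotient does not depend on which weak gradient and which trace were selected, so it may be
    computed from any witnesses. *)
Lemma rayleighE alpha (w g0 g1 t : R * R -> R) : H1 ext w -> is_weak_partial ext 0 w g0 -> is_weak_partial ext 1 w g1 ->
  is_trace Omega w t ->
  rayleigh Omega alpha w = (fine (sqn (area R) ext g0) + fine (sqn (area R) ext g1) +
    alpha * fine (sqn hm (bd : set hT) t)) / fine (sqn (area R) ext w).
Proof.
move=> Hw W0 W1 Wt; have mE := measurable_ext; have mB := cara_boundary K.
have oE : open ext by exact: open_exterior.
have [P0 P1] := (weak_partialP (ex_intro _ _ W0), weak_partialP (ex_intro _ _ W1)).
have Lfin (g : R * R -> R) : L2 (area R) ext g -> sqn (area R) ext g \is a fin_num.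
  by move=> /(L2P _ mE)[_ ?]; rewrite ge0_fin_numE // sqn_ge0.
rewrite /rayleigh; congr ((_ + _ * _) / _).
  rewrite -fineD; [|exact: Lfin (proj1 W0)|exact: Lfin (proj1 W1)].
  rewrite -(sqn_weak_partial oE W0) -(sqn_weak_partial oE W1) /sqn /Rintegral; congr fine.
  rewrite -ge0_integralD //.
  - by apply: eq_integral => x _; rewrite big_ord_recl big_ord1.
  - by move=> x _; rewrite lee_fin sqr_ge0.
  - by apply/measurable_EFinP; apply: measurable_funX; exact: L2_measurable (proj1 P0).
  - by move=> x _; rewrite lee_fin sqr_ge0.
  - by apply/measurable_EFinP; apply: measurable_funX; exact: L2_measurable (proj1 P1).
have Ht : is_trace Omega w (trace Omega w).
  by rewrite /trace; exact: (getPex (P := is_trace Omega w)) (ex_intro _ t Wt).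
rewrite /Rintegral; congr fine.
have mt := L2_measurable mB (proj1 Wt); have mt' := L2_measurable mB (proj1 Ht).
exact: (sqn_ae mB mt' mt (trace_uniq Hw Ht Wt)).
Qed.

(** Without a trace the selection falls back on the zero function and the boundary term disappears.
    A function of negative quotient therefore has a trace. *)
Lemma rayleigh_no_trace alpha (w : R * R -> R) : ~ (exists t : R * R -> R, is_trace Omega w t) -> 0 <= rayleigh Omega alpha w.
Proof.
move=> nt; rewrite /rayleigh divr_ge0 ?addr_ge0 //.
- by apply: fine_ge0; apply: integral_ge0 => x _; rewrite lee_fin sumr_ge0 // => i _; rewrite sqr_ge0.
- rewrite [Rintegral _ _ _](_ : _ = 0) ?mulr0 // /trace /Rintegral integral0_eq // => x _.
  rewrite getPN ?expr0n //; last by move=> t Ht; apply: nt; exists t.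
- by apply: fine_ge0; apply: integral_ge0 => x _; rewrite lee_fin sqr_ge0.
Qed.

Lemma null_sqn (w : R * R -> R) : L2 (area R) ext w -> null ext w <-> sqn (area R) ext w = 0%E.
Proof.
move=> Lw; have mE := measurable_ext; have mw := L2_measurable mE Lw.
have m0 : measurable_fun (ext : set (mR * mR)) (fun=> 0 : R) by exact: measurable_cst.
split=> [nw|E].
  rewrite (sqn_ae mE mw m0 nw); apply: integral0_eq => x _; by rewrite expr0n.
apply: (sqn_eq0 mE mw m0); rewrite -[RHS]E; apply: sqn_eq => x _; by rewrite subr0.
Qed.

(* Jacobian of the normal coordinates, extended by 1 to [t < 0] *)
Definition jac (q : R * R) : R := 1 + ka q.1 * Num.max q.2 0.

Lemma jac_ge1 q : 1 <= jac q.
Proof. by rewrite lerDl mulr_ge0 ?ka_ge0 // le_max lexx orbT. Qed.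

Lemma cont_jac : continuous jac.
Proof.
have c1 : continuous (fun q : R * R => ka q.1) by cts.
have c2 : continuous (fun q : R * R => Num.max q.2 0) by apply: cont2_max; cts.
by rewrite /jac; apply: cont2D; [exact: cont2_cst|exact: (cont2M c1 c2)].
Qed.

Lemma cont_jacV : continuous (fun q => (jac q)^-1).
Proof. by apply: contV => [q|]; [rewrite gt_eqF // (lt_le_trans _ (jac_ge1 q))|exact: cont_jac]. Qed.

(** The density in [t] of gradient term minus [lam] times mass for [A(s) k(t)] after integration
    over [s]: [P] and [P1] are the integrals of [A ^ 2] and [A ^ 2 * ka], and [D] is the tangential
    energy of [A]. *)
Definition form_dens (k : R -> R) (lam P P1 : R) (D : R -> R) (t : R) : R :=
  (derive1 k t ^+ 2 - lam * k t ^+ 2) * (P + t * P1) + k t ^+ 2 * D t.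

Lemma test_grad_integral h (M : R) : test_function setT h -> 0 <= M ->
  (forall s t i, M <= t -> partial i h (ncx (s, t), ncy (s, t)) = 0) ->
  fine (sqn (area R) ext (partial 0 h)) + fine (sqn (area R) ext (partial 1 h)) =
  \int[mu]_(t in `[0, M]) \int[mu]_(s in `[0, L]) ((partial 0 h (ncx (s, t), ncy (s, t)) ^+ 2 +
    partial 1 h (ncx (s, t), ncy (s, t)) ^+ 2) * (1 + ka s * t)).
Proof.
move=> th M0 far.
have mE : measurable (ext : set (mR * mR)) by exact: measurable_ext.
have [_ Lp] := test_L2 mE th.
have fin i : sqn (area R) ext (partial i h) \is a fin_num.
  by have [_ ?] := (L2P _ mE _).1 (Lp i); rewrite ge0_fin_numE // sqn_ge0.
have c i : continuous (partial i h) by apply: smooth_partial_cont; exact: proj1 th.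
rewrite -fineD // /sqn -ge0_integralD //; last 4 first.
- by move=> x _; rewrite lee_fin sqr_ge0.
- by apply/measurable_EFinP; apply: cont_measurable2 => //; exact: cont2X.
- by move=> x _; rewrite lee_fin sqr_ge0.
- by apply/measurable_EFinP; apply: cont_measurable2 => //; exact: cont2X.
under eq_integral do rewrite -EFinD.
have cs : continuous (fun p => partial 0 h p ^+ 2 + partial 1 h p ^+ 2) := cont2D (cont2X (n := 2) (c 0)) (cont2X (n := 2) (c 1)).
rewrite (ext_integral M0 cs) //=; first by move=> p; rewrite addr_ge0 ?sqr_ge0.
by move=> s t Mt; rewrite !far // expr0n addr0.
Qed.

(** * The form on products of an amplitude and a profile *)

Section Form.
Variables (phi : R -> R) (M0 M : R).
Hypotheses (sphi : smooth1 phi) (M0M : M0 < M) (M_gt0 : 0 < M).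
Hypothesis phi0 : forall t, ~~ (- (dl / 2) <= t <= M0) -> phi t = 0.

(** The Dirichlet energy of [A] on the parallel curve at height [t]: derivatives are divided by the
    Jacobian, length is multiplied by it. *)
Definition tang A (t : R) : R := \int[mu]_(s in `[0, L]) (derive1 A s ^+ 2 / jac (s, t)).

Lemma cont_tang A : smooth1 A -> continuous (tang A).
Proof.
move=> sA; have cA : continuous (derive1 A) by apply: smooth1_cont; exact: smooth1_derive.
have c1 : continuous (fun q : R * R => derive1 A q.2 ^+ 2) by apply: cont2X; exact: cont1snd.
have c2 := cont_swap cont_jacV.
exact: (@cont_int2 R (fun q => derive1 A q.2 ^+ 2 / jac (q.2, q.1)) 0 L (cont2M c1 c2)).
Qed.

Let cphi : continuous phi. Proof. exact: smooth1_cont. Qed.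
Let cphi' : continuous (derive1 phi). Proof. by apply: smooth1_cont; exact: smooth1_derive. Qed.

Lemma phi_far t : M <= t -> phi t = 0 /\ derive1 phi t = 0.
Proof.
move=> Mt; have H : ~~ (- (dl / 2) <= t <= M0).
  by rewrite negb_and -!ltNge; apply/orP; right; exact: lt_le_trans M0M Mt.
by split; [exact: phi0|exact: (derive1_out sphi phi0)].
Qed.

Section Amplitude.
Variable A : R -> R.
Hypotheses (sA : smooth1 A) (pA : forall s, A (s + L) = A s).
Notation w := (nc_tensor K A phi).

Let cA : continuous A. Proof. exact: smooth1_cont. Qed.
Let cA' : continuous (derive1 A). Proof. by apply: smooth1_cont; exact: smooth1_derive. Qed.
Let P := \int[mu]_(s in `[0, L]) A s ^+ 2.
Let P1 := \int[mu]_(s in `[0, L]) (A s ^+ 2 * ka s).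

Let tw : test_function setT w. Proof. exact: nc_tensor_test sA pA sphi phi0. Qed.
Let dlt t : 0 <= t -> - dl < t. Proof. by have := tube_width_gt0 K; lra. Qed.

Let cA2 : continuous (fun s => A s ^+ 2). Proof. exact: cont1X. Qed.
Let cA2k : continuous (fun s => A s ^+ 2 * ka s). Proof. by apply: cont1M; [exact: cA2|exact: cont_ka]. Qed.

Let cAj t : continuous (fun s => A s ^+ 2 * (1 + ka s * t)).
Proof.
apply: cont1M => //; apply: cont1D; first exact: cont1_cst.
by apply: cont1M; [exact: cont_ka|exact: cont1_cst].
Qed.

Let intA t : \int[mu]_(s in `[0, L]) (A s ^+ 2 * (1 + ka s * t)) = P + t * P1.
Proof.
have c1 : continuous (fun s => t * (A s ^+ 2 * ka s)) by apply: cont1Z; exact: cA2k.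
rewrite /P /P1 -(intZ _ _ _ cA2k) -(intD _ _ cA2 c1).
by apply: int_eq => s _; ring.
Qed.

Lemma tensor_mass : fine (sqn (area R) ext w) =
  \int[mu]_(t in `[0, M]) (phi t ^+ 2 * (P + t * P1)).
Proof.
have cw := smooth_cont (proj1 tw).
rewrite /sqn (ext_integral (ltW M_gt0) (cont2X (n := 2) cw)) /=; last 2 first.
- by move=> p; exact: sqr_ge0.
- move=> s t Mt; rewrite (nc_tensorE phi pA) ?(phi_far Mt).1 ?mulr0 ?expr0n //.
  by apply: dlt; exact: le_trans (ltW M_gt0) Mt.
apply: int_eq => t /andP[t0 _]; rewrite -intA -(intZ _ _ _ (@cAj t)).
apply: int_eq => s _; rewrite (nc_tensorE phi pA) ?dlt //; ring.
Qed.

Lemma tensor_grad : fine (sqn (area R) ext (partial 0 w)) + fine (sqn (area R) ext (partial 1 w)) =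
  \int[mu]_(t in `[0, M]) (derive1 phi t ^+ 2 * (P + t * P1) + phi t ^+ 2 * tang A t).
Proof.
have E s t : 0 <= t -> partial 0 w (ncx (s, t), ncy (s, t)) ^+ 2 + partial 1 w (ncx (s, t), ncy (s, t)) ^+ 2 =
    (derive1 A s * phi t / (1 + ka s * t)) ^+ 2 + (A s * derive1 phi t) ^+ 2.
  move=> t0; rewrite !(nc_tensor_partial sA pA sphi phi0) ?dlt // /nc_dir /=.
  move: (_ / (1 + ka s * t)) (A s * _) => X Y.
  transitivity ((X ^+ 2 + Y ^+ 2) * (tx s ^+ 2 + ty s ^+ 2)); first by ring.
  by rewrite unit_t mulr1.
rewrite (test_grad_integral tw (ltW M_gt0)); last first.
  move=> s t i Mt; have t0 : 0 <= t by exact: le_trans (ltW M_gt0) Mt.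
  by rewrite (nc_tensor_partial sA pA sphi phi0) ?dlt // (phi_far Mt).1 (phi_far Mt).2 !(mulr0, mul0r) addr0.
apply: int_eq => t /andP[t0 _].
have cj : continuous (fun s => (jac (s, t))^-1) := cont_sec1 (y := t) cont_jacV.
have cd2 : continuous (fun s => derive1 A s ^+ 2 / jac (s, t)) := cont1M (cont1X (n := 2) cA') cj.
have e1 : continuous (fun s => derive1 phi t ^+ 2 * (A s ^+ 2 * (1 + ka s * t))).
  by apply: cont1Z; exact: cAj.
have e2 : continuous (fun s => phi t ^+ 2 * (derive1 A s ^+ 2 / jac (s, t))).
  by apply: cont1Z; exact: cd2.
rewrite -intA /tang -(intZ _ _ _ (@cAj t)) -(intZ _ _ _ cd2) -(intD _ _ e1 e2).
apply: int_eq => s _; rewrite E // /jac /= (max_idPl t0).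
have J0 : 1 + ka s * t != 0 by rewrite gt_eqF // nc_jac_gt0 // dlt.
by field.
Qed.

Lemma tensor_trace : fine (sqn hm (bd : set hT) w) = P * phi 0 ^+ 2.
Proof.
have cw := smooth_cont (proj1 tw); have [_ ->] := bd_sqn cw.
rewrite /= /P -(intZr _ _ _ cA2); apply: int_eq => s _.
by rewrite -nc0 (nc_tensorE phi pA) ?dlt // exprMn.
Qed.

Lemma tensor_form alpha lam :
  fine (sqn (area R) ext (partial 0 w)) + fine (sqn (area R) ext (partial 1 w)) +
  alpha * fine (sqn hm (bd : set hT) w) - lam * fine (sqn (area R) ext w) =
  \int[mu]_(t in `[0, M]) form_dens phi lam P P1 (tang A) t + alpha * (P * phi 0 ^+ 2).
Proof.
rewrite tensor_grad tensor_trace tensor_mass.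
have cP : continuous (fun t : R => P + t * P1).
  by apply: cont1D; [exact: cont1_cst|apply: cont1M; [exact: cont1_id|exact: cont1_cst]].
have cD := cont_tang sA.
have c1 : continuous (fun t => phi t ^+ 2 * (P + t * P1)) := cont1M (cont1X (n := 2) cphi) cP.
have c2 : continuous (fun t => derive1 phi t ^+ 2 * (P + t * P1) + phi t ^+ 2 * tang A t).
  exact: cont1D (cont1M (cont1X (n := 2) cphi') cP) (cont1M (cont1X (n := 2) cphi) cD).
rewrite addrAC -(intZ _ _ _ c1) -(intB _ _ c2); last by apply: cont1Z; exact: c1.
by congr (_ + _); apply: int_eq => t _; rewrite /form_dens; ring.
Qed.

End Amplitude.

Lemma nc_tensor_lin A1 A2 (x y : R) : nc_tensor K (fun s => x * A1 s + y * A2 s) phi =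
  x \*o nc_tensor K A1 phi \+ y \*o nc_tensor K A2 phi.
Proof.
apply/funext => p; rewrite /nc_tensor /nc_lift /=; case: pselect => [P|_]; first by ring.
by rewrite !mulr0 addr0.
Qed.

Definition curvature_mean t : R := \int[mu]_(s in `[0, L]) (ka s ^+ 2 / jac (s, t)).

(** All four integrands are derivatives of periodic functions up to sign. The relations make the
    components of the normal orthogonal to constants on every parallel curve. *)
Lemma int_tangent : [/\ \int[mu]_(s in `[0, L]) tx s = 0, \int[mu]_(s in `[0, L]) ty s = 0,
  \int[mu]_(s in `[0, L]) (tx s * ka s) = 0 & \int[mu]_(s in `[0, L]) (ty s * ka s) = 0].
Proof.
have L0 := ltW (len_gt0 K).
have ctx : continuous (fun s => tx s) by cts.
have cty : continuous (fun s => ty s) by cts.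
have ck : continuous (fun s => ka s) by cts.
have P (f : R -> R) : (forall s, f (s + L) = f s) -> f L - f 0 = 0 by move=> pf; have := pf 0; rewrite add0r => ->; exact: subrr.
split.
- by rewrite (FTC L0 ctx (dgx K)) P //; exact: gx_per.
- by rewrite (FTC L0 cty (dgy K)) P //; exact: gy_per.
- have c : continuous (fun s => tx s * ka s) by exact: cont1M.
  have D s : is_deriv s (fun s => ty s) (tx s * ka s) by apply: (ide_eq (dty K s)); rewrite mulrC.
  by rewrite (FTC L0 c D) P //; exact: ty_per.
- have c : continuous (fun s => ty s * ka s) by exact: cont1M.
  have D s : is_deriv s (fun s => - tx s) (ty s * ka s) by apply: (ide_eq (ideN (dtx K s))); ring.
  by rewrite (FTC L0 c D) (P (fun s => - tx s)) // => s; rewrite tx_per.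
Qed.

(** With the weight [ka] the two integrals are equal, since their difference integrates the
    derivative of [tx * ty], and they add up to [2 * pi]. A bound on the curvature removes the
    weight. *)
Lemma int_tangent_sqr : 0 < \int[mu]_(s in `[0, L]) (tx s ^+ 2) /\ 0 < \int[mu]_(s in `[0, L]) (ty s ^+ 2).
Proof.
have L0 := ltW (len_gt0 K).
have ctx : continuous (fun s => tx s) by cts.
have cty : continuous (fun s => ty s) by cts.
have ck : continuous (fun s => ka s) by cts.
have cx : continuous (fun s => tx s ^+ 2) by exact: cont1X.
have cy : continuous (fun s => ty s ^+ 2) by exact: cont1X.
have cxk : continuous (fun s => ka s * tx s ^+ 2) by exact: cont1M.
have cyk : continuous (fun s => ka s * ty s ^+ 2) by exact: cont1M.
have E1 : \int[mu]_(s in `[0, L]) (ka s * tx s ^+ 2) - \int[mu]_(s in `[0, L]) (ka s * ty s ^+ 2) = 0.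
  have c : continuous (fun s => ka s * tx s ^+ 2 - ka s * ty s ^+ 2) by exact: contB.
  have D s : is_deriv s (fun s => tx s * ty s) (ka s * tx s ^+ 2 - ka s * ty s ^+ 2).
    by apply: (ide_eq (ideM (dtx K s) (dty K s))); ring.
  rewrite -(intB _ _ cxk cyk) (FTC L0 c D).
  by have := tx_per K 0; have := ty_per K 0; rewrite !add0r => -> ->; exact: subrr.
have E2 : \int[mu]_(s in `[0, L]) (ka s * tx s ^+ 2) + \int[mu]_(s in `[0, L]) (ka s * ty s ^+ 2) = 2 * pi.
  rewrite -(intD _ _ cxk cyk) -(int_ka K); apply: int_eq => s _.
  by rewrite -mulrDr unit_t mulr1.
have pi0 := pi_gt0 R.
have [B B0 HB] := ka_bounded K.
have key (f : R -> R) : continuous f -> (forall s, 0 <= f s) -> 0 < \int[mu]_(s in `[0, L]) (ka s * f s) ->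
    0 < \int[mu]_(s in `[0, L]) f s.
  move=> cf f0 I0; have cBf : continuous (fun s => B * f s) by apply: cont1M => //; exact: cont1_cst.
  have ckf : continuous (fun s => ka s * f s) by exact: cont1M.
  have : \int[mu]_(s in `[0, L]) (ka s * f s) <= \int[mu]_(s in `[0, L]) (B * f s).
    by apply: int_le => // s _; rewrite ler_wpM2r.
  rewrite (intZ _ _ _ cf) => H; have H2 := lt_le_trans I0 H.
  by rewrite pmulr_rgt0 in H2.
by split; apply: key => // [s|]; rewrite ?sqr_ge0 //; lra.
Qed.

Section Pair.
Variable n : R -> R.
Hypotheses (sn : smooth1 n) (pn : forall s, n (s + L) = n s).
Hypotheses (n0 : \int[mu]_(s in `[0, L]) n s = 0) (nk0 : \int[mu]_(s in `[0, L]) (n s * ka s) = 0).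
Variables x y : R.
Notation A := (fun s => x * 1 + y * n s).
Let cn : continuous n. Proof. exact: smooth1_cont. Qed.
Let ck : continuous (fun s => ka s). Proof. exact: cont_ka. Qed.
Let cZ (c : R) (f : R -> R) : continuous f -> continuous (fun s => c * f s).
Proof. by move=> cf; apply: cont1Z; exact: cf. Qed.
Let cn2 : continuous (fun s => n s ^+ 2). Proof. exact: cont1X. Qed.
Let cnk : continuous (fun s => n s * ka s). Proof. exact: cont1M. Qed.
Let cn2k : continuous (fun s => n s ^+ 2 * ka s). Proof. exact: cont1M. Qed.

Lemma pair_smooth : smooth1 A.
Proof.
apply/smooth1P => k s; apply: smatD; first exact: smat_cst.
by apply: smatM; [exact: smat_cst|exact: ((smooth1P n).1 sn)].
Qed.

Lemma pair_derive s : derive1 A s = y * derive1 n s.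
Proof.
have H : is_deriv s A (y * derive1 n s).
  by apply: (ide_eq (ideD (ide_cst (x * 1) s) (ideM (ide_cst y s) (smooth1_ide sn s)))); ring.
by rewrite derive1E; exact: derive_val.
Qed.

Lemma pair_mass : \int[mu]_(s in `[0, L]) A s ^+ 2 = x ^+ 2 * L + y ^+ 2 * \int[mu]_(s in `[0, L]) n s ^+ 2.
Proof.
have c1 : continuous (fun s => x ^+ 2 + 2 * x * y * n s) by apply: cont1D; [exact: cont1_cst|exact: cZ].
rewrite (_ : \int[mu]_(s in _) _ = \int[mu]_(s in `[0, L]) ((x ^+ 2 + 2 * x * y * n s) + y ^+ 2 * n s ^+ 2)).
  rewrite (intD _ _ c1 (@cZ _ _ cn2)) (intZ _ _ _ cn2) (intD _ _ (@cont1_cst R (x ^+ 2)) (@cZ _ _ cn)) (intZ _ _ _ cn) n0.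
  by rewrite int_cst ?subr0 ?mulr0 ?addr0 // ltW // len_gt0.
by apply: int_eq => s _; ring.
Qed.

Lemma pair_mass_ka : \int[mu]_(s in `[0, L]) (A s ^+ 2 * ka s) =
  x ^+ 2 * (2 * pi) + y ^+ 2 * \int[mu]_(s in `[0, L]) (n s ^+ 2 * ka s).
Proof.
have c1 : continuous (fun s => x ^+ 2 * ka s + 2 * x * y * (n s * ka s)) by apply: cont1D; exact: cZ.
rewrite (_ : \int[mu]_(s in _) _ = \int[mu]_(s in `[0, L])
    ((x ^+ 2 * ka s + 2 * x * y * (n s * ka s)) + y ^+ 2 * (n s ^+ 2 * ka s))).
  rewrite (intD _ _ c1 (@cZ _ _ cn2k)) (intZ _ _ _ cn2k) (intD _ _ (@cZ _ _ ck) (@cZ _ _ cnk)) (intZ _ _ _ cnk) nk0.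
  by rewrite (intZ _ _ _ ck) int_ka mulr0 addr0.
by apply: int_eq => s _; ring.
Qed.

Lemma pair_tang t : tang A t = y ^+ 2 * tang n t.
Proof.
have cn' : continuous (derive1 n) by apply: smooth1_cont; exact: smooth1_derive.
have cj : continuous (fun s => (jac (s, t))^-1) := cont_sec1 (y := t) cont_jacV.
have c : continuous (fun s => derive1 n s ^+ 2 / jac (s, t)) := cont1M (cont1X (n := 2) cn') cj.
by rewrite /tang -(intZ _ _ _ c); apply: int_eq => s _; rewrite pair_derive; ring.
Qed.

(** The form minus [lam] times the mass at amplitude times profile, as computed by [tensor_form];
    linear in the data [P], [P1], [D] of the amplitude. *)
Definition pair_energy (alpha lam P P1 : R) D : R :=
  \int[mu]_(t in `[0, M]) form_dens phi lam P P1 D t + alpha * (P * phi 0 ^+ 2).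

Lemma cont_form_dens (lam P P1 : R) D : continuous D -> continuous (form_dens phi lam P P1 D).
Proof.
move=> cD; have cP : continuous (fun t : R => P + t * P1).
  by apply: cont1D; [exact: cont1_cst|apply: cont1M; [exact: cont1_id|exact: cont1_cst]].
apply: cont1D; apply: cont1M; [|exact: cP|exact: cont1X|exact: cD].
by apply: contB; [exact: cont1X|apply: cZ; exact: cont1X].
Qed.

(** The zero means of [n] and [n * ka] remove the cross terms, so the form is diagonal on the trial
    plane. *)
Lemma pair_form alpha lam :
  pair_energy alpha lam (\int[mu]_(s in `[0, L]) A s ^+ 2) (\int[mu]_(s in `[0, L]) (A s ^+ 2 * ka s)) (tang A) =
  x ^+ 2 * pair_energy alpha lam L (2 * pi) (fun=> 0) +
  y ^+ 2 * pair_energy alpha lam (\int[mu]_(s in `[0, L]) n s ^+ 2) (\int[mu]_(s in `[0, L]) (n s ^+ 2 * ka s)) (tang n).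
Proof.
rewrite pair_mass pair_mass_ka /pair_energy.
set P := \int[mu]_(s in `[0, L]) n s ^+ 2; set P1 := \int[mu]_(s in `[0, L]) (n s ^+ 2 * ka s).
have c1 := @cont_form_dens lam L (2 * pi) (fun=> 0) (@cont1_cst R 0).
have c2 := @cont_form_dens lam P P1 (tang n) (cont_tang sn).
rewrite [x ^+ 2 * (_ + _)]mulrDr [y ^+ 2 * (_ + _)]mulrDr -(intZ _ _ _ c1) -(intZ _ _ _ c2) addrACA -(intD _ _ (@cZ _ _ c1) (@cZ _ _ c2)).
congr (_ + _); last by ring.
by apply: int_eq => t _; rewrite /form_dens pair_tang; ring.
Qed.

End Pair.

(** The sum of the energies of the two components of the tangent, by [pair_energy_tangent]: their
    squares add up to 1, which puts [L] and [2 * pi] in place of [P] and [P1]. *)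
Definition trial_energy alpha lam : R := pair_energy alpha lam L (2 * pi) curvature_mean.

Lemma tang_tangent t : tang (fun s => tx s) t + tang (fun s => ty s) t = curvature_mean t.
Proof.
have [stx sty _] := smooth_tangent K.
have cj : continuous (fun s => (jac (s, t))^-1) := cont_sec1 (y := t) cont_jacV.
have cT n : smooth1 n -> continuous (fun s => derive1 n s ^+ 2 / jac (s, t)).
  move=> sn; have cn' : continuous (derive1 n) by apply: smooth1_cont; exact: smooth1_derive.
  exact: cont1M (cont1X (n := 2) cn') cj.
rewrite /tang /curvature_mean -(intD _ _ (@cT _ stx) (@cT _ sty)).
apply: int_eq => s _.
have -> : derive1 (fun s => tx s) s = - ka s * ty s by rewrite derive1E; have D := dtx K s; exact: derive_val.
have -> : derive1 (fun s => ty s) s = ka s * tx s by rewrite derive1E; have D := dty K s; exact: derive_val.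
by rewrite -[ka s ^+ 2]mulr1 -(unit_t K s); ring.
Qed.

Lemma cont_curvature_mean : continuous curvature_mean.
Proof.
have [stx sty _] := smooth_tangent K.
rewrite (_ : curvature_mean = fun t => tang (fun s => tx s) t + tang (fun s => ty s) t).
  exact: cont1D (cont_tang stx) (cont_tang sty).
by apply/funext => t; rewrite tang_tangent.
Qed.

Lemma pair_energyD alpha lam P P1 (D : R -> R) P' P1' (D' : R -> R) : continuous D -> continuous D' ->
  pair_energy alpha lam P P1 D + pair_energy alpha lam P' P1' D' =
  pair_energy alpha lam (P + P') (P1 + P1') (fun t => D t + D' t).
Proof.
move=> cD cD'; have c1 := @cont_form_dens lam P P1 _ cD; have c2 := @cont_form_dens lam P' P1' _ cD'.
rewrite /pair_energy addrACA -(intD _ _ c1 c2); congr (_ + _); last by ring.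
by apply: int_eq => t _; rewrite /form_dens; ring.
Qed.

Lemma pair_energy_tangent alpha lam :
  pair_energy alpha lam (\int[mu]_(s in `[0, L]) tx s ^+ 2) (\int[mu]_(s in `[0, L]) (tx s ^+ 2 * ka s)) (tang (fun s => tx s)) +
  pair_energy alpha lam (\int[mu]_(s in `[0, L]) ty s ^+ 2) (\int[mu]_(s in `[0, L]) (ty s ^+ 2 * ka s)) (tang (fun s => ty s)) =
  trial_energy alpha lam.
Proof.
have [stx sty _] := smooth_tangent K.
have ctx : continuous (fun s => tx s) by exact: smooth1_cont.
have cty : continuous (fun s => ty s) by exact: smooth1_cont.
have cx : continuous (fun s => tx s ^+ 2) by exact: cont1X.
have cy : continuous (fun s => ty s ^+ 2) by exact: cont1X.
have cxk : continuous (fun s => tx s ^+ 2 * ka s) by apply: cont1M => //; exact: cont_ka.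
have cyk : continuous (fun s => ty s ^+ 2 * ka s) by apply: cont1M => //; exact: cont_ka.
have EP : \int[mu]_(s in `[0, L]) tx s ^+ 2 + \int[mu]_(s in `[0, L]) ty s ^+ 2 = L.
  rewrite -(intD _ _ cx cy) (_ : \int[mu]_(s in _) _ = \int[mu]_(s in `[0, L]) (1:R)).
    by rewrite int_cst ?subr0 ?mul1r // ltW // len_gt0.
  by apply: int_eq => s _; exact: unit_t.
have EP1 : \int[mu]_(s in `[0, L]) (tx s ^+ 2 * ka s) + \int[mu]_(s in `[0, L]) (ty s ^+ 2 * ka s) = 2 * pi.
  by rewrite -(intD _ _ cxk cyk) -(int_ka K); apply: int_eq => s _; rewrite -mulrDl unit_t mul1r.
rewrite (pair_energyD _ _ _ _ _ _ (cont_tang stx) (cont_tang sty)) EP EP1.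
by congr pair_energy; apply/funext => t; exact: tang_tangent.
Qed.

Lemma trial_energy_ge alpha lam : pair_energy alpha lam L (2 * pi) (fun=> 0) <= trial_energy alpha lam.
Proof.
rewrite /trial_energy /pair_energy lerD2r; apply: int_le.
- by apply: cont_form_dens; exact: cont1_cst.
- by apply: cont_form_dens; exact: cont_curvature_mean.
- move=> t _; rewrite /form_dens lerD2l mulr0 mulr_ge0 ?sqr_ge0 //.
  by apply: int_ge0 => s _; rewrite divr_ge0 ?sqr_ge0 // (le_trans ler01) // jac_ge1.
Qed.

(** Both diagonal entries are nonpositive, so the quotient is at most [lam] on the plane spanned by
    [phi] and [n * phi]. The point [c] with [phi c != 0] makes the plane two-dimensional. *)
Lemma pair_trial n alpha lam c : smooth1 n -> (forall s, n (s + L) = n s) ->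
  \int[mu]_(s in `[0, L]) n s = 0 -> \int[mu]_(s in `[0, L]) (n s * ka s) = 0 ->
  0 < \int[mu]_(s in `[0, L]) n s ^+ 2 ->
  pair_energy alpha lam (\int[mu]_(s in `[0, L]) n s ^+ 2) (\int[mu]_(s in `[0, L]) (n s ^+ 2 * ka s)) (tang n) <= 0 ->
  pair_energy alpha lam L (2 * pi) (fun=> 0) <= 0 -> 0 < c < M -> phi c != 0 ->
  (lambda2 alpha Omega <= lam%:E)%E.
Proof.
move=> sn pn n0 nk0 p0 qn q0 /andP[c0 cM] phic.
have s1 : smooth1 (fun _ : R => 1 : R) by apply/smooth1P => k s; exact: smat_cst.
have p1 : forall s : R, (fun _ : R => 1 : R) (s + L) = 1 by [].
pose A x y s : R := x * 1 + y * n s.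
pose w x y := nc_tensor K (A x y) phi.
have sA x y : smooth1 (A x y) by exact: pair_smooth.
have pA x y s : A x y (s + L) = A x y s by rewrite /A pn.
have tw x y : test_function setT (w x y) := nc_tensor_test (sA x y) (pA x y) sphi phi0.
have Ew x y : x \*o nc_tensor K (fun=> 1) phi \+ y \*o nc_tensor K n phi = w x y.
  by rewrite -nc_tensor_lin.
have mE : measurable (ext : set (mR * mR)) by exact: measurable_ext.
have nul x y : null ext (w x y) <-> fine (sqn (area R) ext (w x y)) = 0.
  have [L2w _] := test_L2 mE (tw x y); rewrite (null_sqn L2w).
  have fin : sqn (area R) ext (w x y) \is a fin_num.
    by have [_ ?] := (L2P _ mE _).1 L2w; rewrite ge0_fin_numE // sqn_ge0.
  by split=> [->//|H]; rewrite -(fineK fin) H.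
apply: (@le_trans _ _ (ereal_sup [set (rayleigh Omega alpha u)%:E
    | u in [set v | exists x y : R, v = w x y] `\` null ext])).
  apply: ereal_inf_lbound; exists [set v | exists x y : R, v = w x y] => //.
  exists (nc_tensor K (fun=> 1) phi), (nc_tensor K n phi); split.
  - by apply: test_H1; exact: nc_tensor_test s1 p1 sphi phi0.
  - by apply: test_H1; exact: nc_tensor_test sn pn sphi phi0.
  - move=> x y; rewrite Ew => /nul; rewrite (tensor_mass (sA x y) (pA x y)) (pair_mass sn n0).
    rewrite (pair_mass_ka sn nk0) => I0.
    have cn : continuous n by exact: smooth1_cont.
    set P1 := \int[mu]_(s in `[0, L]) (n s ^+ 2 * ka s) in I0.
    have P10 : 0 <= P1 by apply: int_ge0 => s _; rewrite mulr_ge0 ?sqr_ge0 ?ka_ge0.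
    have L0 := len_gt0 K; have pi0 := pi_gt0 R.
    set p := \int[mu]_(s in `[0, L]) n s ^+ 2 in p0 I0.
    have x2 := sqr_ge0 x; have y2 := sqr_ge0 y.
    have Q0 : 0 <= x ^+ 2 * (2 * pi) + y ^+ 2 * P1 by rewrite addr_ge0 // mulr_ge0 // mulr_ge0 // ltW.
    (* A combination with a nonzero amplitude has positive mass near the height [c]; a null
       combination thus has zero coefficients. *)
    case: (ltP 0 (x ^+ 2 * L + y ^+ 2 * p)) => [P0|].
      have : 0 < \int[mu]_(t in `[0, M]) (phi t ^+ 2 * ((x ^+ 2 * L + y ^+ 2 * p) + t * (x ^+ 2 * (2 * pi) + y ^+ 2 * P1))).
        apply: (@int_gt0 _ _ _ _ c) => //.
        + apply: cont1M; first exact: cont1X.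
          by apply: cont1D; [exact: cont1_cst|apply: cont1M; [exact: cont1_id|exact: cont1_cst]].
        + by move=> t /andP[t0 _]; rewrite mulr_ge0 ?sqr_ge0 // addr_ge0 ?(ltW P0) // mulr_ge0.
        + by rewrite mulr_gt0 ?exprn_even_gt0 // ltr_wpDr // mulr_ge0 // ltW.
      by rewrite I0 ltxx.
    move=> P0; have e1 : x ^+ 2 * L = 0.
      by apply/eqP; rewrite eq_le mulr_ge0 ?(ltW L0) // andbT (le_trans _ P0) // lerDl mulr_ge0 // ltW.
    have e2 : y ^+ 2 * p = 0.
      by apply/eqP; rewrite eq_le mulr_ge0 ?(ltW p0) // andbT (le_trans _ P0) // lerDr mulr_ge0 // ltW.
    split; apply/eqP; rewrite -sqrf_eq0.
      by move/eqP: e1; rewrite mulf_eq0 (gt_eqF L0) orbF.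
    by move/eqP: e2; rewrite mulf_eq0 (gt_eqF p0) orbF.
  - by apply/seteqP; split=> v [x [y ->]]; exists x, y; rewrite Ew.
apply: ge_ereal_sup => _ [_ [[x [y ->]] nn] <-]; rewrite lee_fin.
rewrite (rayleighE alpha (test_H1 (tw x y)) (test_weak_partial 0 mE (tw x y))
  (test_weak_partial 1 mE (tw x y)) (test_trace (tw x y))).
have m0 : 0 < fine (sqn (area R) ext (w x y)).
  rewrite lt_neqAle fine_ge0 ?sqn_ge0 // andbT eq_sym; apply/eqP => H; exact/nn/nul.
rewrite ler_pdivrMr // -subr_le0.
rewrite (tensor_form (sA x y) (pA x y)) -/(pair_energy _ _ _ _ _) (pair_form sn n0 nk0).
by rewrite -[leRHS]addr0 lerD // mulr_ge0_le0 ?sqr_ge0.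
Qed.

(** The energies of the two components add up to a nonpositive number, so one of them is
    nonpositive. The constant amplitude has no tangential energy and is dominated by the same
    sum. *)
Lemma trial alpha lam c : trial_energy alpha lam <= 0 -> 0 < c < M -> phi c != 0 ->
  (lambda2 alpha Omega <= lam%:E)%E.
Proof.
move=> Q c0M phic; have q0 := le_trans (trial_energy_ge alpha lam) Q.
have [stx sty _] := smooth_tangent K; have [x0 y0 xk yk] := int_tangent; have [px py] := int_tangent_sqr.
have := pair_energy_tangent alpha lam.
case: (leP (pair_energy alpha lam (\int[mu]_(s in `[0, L]) tx s ^+ 2)
  (\int[mu]_(s in `[0, L]) (tx s ^+ 2 * ka s)) (tang (fun s => tx s))) 0) => [q1 _|q1 E].
  exact: (pair_trial stx (@tx_per _ _ K) x0 xk px q1 q0 c0M phic).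
have q2 : pair_energy alpha lam (\int[mu]_(s in `[0, L]) ty s ^+ 2)
    (\int[mu]_(s in `[0, L]) (ty s ^+ 2 * ka s)) (tang (fun s => ty s)) <= 0.
  by move: Q; rewrite -E => Q; rewrite (le_trans _ Q) // lerDr ltW.
exact: (pair_trial sty (@ty_per _ _ K) y0 yk py q2 q0 c0M phic).
Qed.

End Form.

(** Gradient and trace are separate arguments, so the same expression covers Sobolev functions with
    chosen weak derivatives and test functions with classical ones. *)
Definition energy (alpha lam : R) (w g0 g1 tr : R * R -> R) : R :=
  fine (sqn (area R) ext g0) + fine (sqn (area R) ext g1) +
  alpha * fine (sqn hm (bd : set hT) tr) - lam * fine (sqn (area R) ext w).

Definition nc h (q : R * R) : R := h (ncx q, ncy q).
(** The derivative along the outward normal and, next, along the tangent, at the point with the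
    given normal coordinates. *)
Definition nc_n h (q : R * R) : R := nc (partial 0 h) q * ty q.1 - nc (partial 1 h) q * tx q.1.
Definition nc_t h (q : R * R) : R := nc (partial 0 h) q * tx q.1 + nc (partial 1 h) q * ty q.1.

Lemma cont_nc h : continuous h -> continuous (nc h).
Proof. by move=> ch; apply: cont2_pair; [exact: ch|exact: cont_ncx|exact: cont_ncy]. Qed.

Lemma cont_nc_n h : smooth h -> continuous (nc_n h).
Proof.
move=> sh; have c0 := cont_nc (smooth_partial_cont (i := 0) sh).
have c1 := cont_nc (smooth_partial_cont (i := 1) sh).
apply: cont2D; first by apply: cont2M; [exact: c0|apply: cont1fst; exact: cont_cty].
by apply: cont2N; apply: cont2M; [exact: c1|apply: cont1fst; exact: cont_ctx].
Qed.

Lemma cont_nc_t h : smooth h -> continuous (nc_t h).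
Proof.
move=> sh; have c0 := cont_nc (smooth_partial_cont (i := 0) sh).
have c1 := cont_nc (smooth_partial_cont (i := 1) sh).
apply: cont2D; first by apply: cont2M; [exact: c0|apply: cont1fst; exact: cont_ctx].
by apply: cont2M; [exact: c1|apply: cont1fst; exact: cont_cty].
Qed.

Lemma nc_ide_t h s t : smooth h -> is_deriv t (fun t => nc h (s, t)) (nc_n h (s, t)).
Proof.
by move=> sh; apply: (ide_eq (smooth_chain sh (ncx_t K s t) (ncy_t K s t))); rewrite /nc_n /nc /=; ring.
Qed.

Lemma nc_ide_s h s t : smooth h -> is_deriv s (fun s => nc h (s, t)) ((1 + ka s * t) * nc_t h (s, t)).
Proof.
by move=> sh; apply: (ide_eq (smooth_chain sh (ncx_s K s t) (ncy_s K s t))); rewrite /nc_t /nc /=; ring.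
Qed.

Lemma nc_smooth_t h s : smooth h -> smooth1 (fun t => nc h (s, t)).
Proof.
move=> sh; apply/smooth1P => k t; apply: (smat_pair sh); rewrite /ncx /ncy /=.
  by apply: smatD; [exact: smat_cst|apply: smatM; [exact: smat_id|exact: smat_cst]].
by apply: smatB; [exact: smat_cst|apply: smatM; [exact: smat_id|exact: smat_cst]].
Qed.

Lemma nc_smooth_s h t : smooth h -> smooth1 (fun s => nc h (s, t)).
Proof.
move=> sh; have [stx sty _] := smooth_tangent K.
have sgx : smooth1 (fun s => gx s) := smooth1_primitive (dgx K) stx.
have sgy : smooth1 (fun s => gy s) := smooth1_primitive (dgy K) sty.
apply/smooth1P => k s; apply: (smat_pair sh); rewrite /ncx /ncy /=.
  apply: smatD; first exact: ((smooth1P _).1 sgx).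
  by apply: smatM; [exact: smat_cst|exact: ((smooth1P _).1 sty)].
apply: smatB; first exact: ((smooth1P _).1 sgy).
by apply: smatM; [exact: smat_cst|exact: ((smooth1P _).1 stx)].
Qed.

Lemma nc_perE h s t : nc h (s + L, t) = nc h (s, t).
Proof. by rewrite /nc /ncx /ncy /= gx_per gy_per tx_per ty_per. Qed.

(** The margin of 1 between the support and [M] leaves room for the strict inequality [M0 < M] that
    is imposed on radial profiles. *)
Lemma energy_nc h : test_function setT h -> exists2 M : R, 1 < M &
  (forall s t, M - 1 <= t -> nc h (s, t) = 0) /\
  forall alpha lam, energy alpha lam h (partial 0 h) (partial 1 h) h =
    \int[mu]_(t in `[0, M]) \int[mu]_(s in `[0, L])
      ((nc_n h (s, t) ^+ 2 + nc_t h (s, t) ^+ 2 - lam * nc h (s, t) ^+ 2) * (1 + ka s * t)) +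
    alpha * \int[mu]_(s in `[0, L]) nc h (s, 0) ^+ 2.
Proof.
move=> th; have sh := proj1 th.
have [M1 M10 [hM dM]] := test_far th.
pose M := M1 + 1; have M0 : 0 < M by rewrite /M; lra.
have far1 t : M <= t -> M1 <= t by rewrite /M; lra.
exists M; first by rewrite /M; lra.
split=> [s t|alpha lam]; first by rewrite /M addrK; exact: hM.
have ch := smooth_cont sh.
have G : fine (sqn (area R) ext (partial 0 h)) + fine (sqn (area R) ext (partial 1 h)) =
    \int[mu]_(t in `[0, M]) \int[mu]_(s in `[0, L]) ((nc_n h (s, t) ^+ 2 + nc_t h (s, t) ^+ 2) * (1 + ka s * t)).
  rewrite (test_grad_integral th (ltW M0)); last by move=> s t i /far1 Mt; exact: dM.
  apply: int_eq => t _; apply: int_eq => s _; congr (_ * _).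
  rewrite /nc_n /nc_t /nc /=; move: (partial 0 h _) (partial 1 h _) => X Y.
  by rewrite -[LHS]mulr1 -(unit_t K s); ring.
have N : fine (sqn (area R) ext h) =
    \int[mu]_(t in `[0, M]) \int[mu]_(s in `[0, L]) (nc h (s, t) ^+ 2 * (1 + ka s * t)).
  rewrite /sqn (ext_integral (ltW M0) (cont2X (n := 2) ch)) //=.
    by move=> p; exact: sqr_ge0.
  by move=> s t /far1 Mt; rewrite hM // expr0n.
have T : fine (sqn hm (bd : set hT) h) = \int[mu]_(s in `[0, L]) nc h (s, 0) ^+ 2.
  have [_ ->] := bd_sqn ch; rewrite /=; apply: int_eq => s _; by rewrite /nc nc0.
rewrite /energy G N T addrAC; congr (_ + _).
have cj : continuous (fun q : R * R => 1 + ka q.1 * q.2).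
  apply: cont2D; first exact: cont2_cst.
  by apply: cont2M; [apply: cont1fst; exact: cont_ka|exact: cont2_snd].
have d1 : continuous (fun q => nc h q ^+ 2 * (1 + ka q.1 * q.2)) by apply: cont2M => //; apply: cont2X; exact: cont_nc.
have d2 : continuous (fun q => (nc_n h q ^+ 2 + nc_t h q ^+ 2) * (1 + ka q.1 * q.2)).
  by apply: cont2M => //; apply: cont2D; apply: cont2X; [exact: cont_nc_n|exact: cont_nc_t].
have e1 : continuous (fun t => \int[mu]_(s in `[0, L]) (nc h (s, t) ^+ 2 * (1 + ka s * t))).
  exact: (@cont_int2 R (fun q => nc h (q.2, q.1) ^+ 2 * (1 + ka q.2 * q.1)) 0 L (cont_swap d1)).
have e2 : continuous (fun t => \int[mu]_(s in `[0, L]) ((nc_n h (s, t) ^+ 2 + nc_t h (s, t) ^+ 2) * (1 + ka s * t))).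
  exact: (@cont_int2 R (fun q => (nc_n h (q.2, q.1) ^+ 2 + nc_t h (q.2, q.1) ^+ 2) * (1 + ka q.2 * q.1)) 0 L (cont_swap d2)).
have e3 : continuous (fun t => lam * \int[mu]_(s in `[0, L]) (nc h (s, t) ^+ 2 * (1 + ka s * t))).
  by apply: cont1Z; exact: e1.
rewrite -(intZ _ _ _ e1) -(intB _ _ e2 e3); apply: int_eq => t _.
have f1 : continuous (fun s => nc h (s, t) ^+ 2 * (1 + ka s * t)) := cont_sec1 (y := t) d1.
have f2 : continuous (fun s => (nc_n h (s, t) ^+ 2 + nc_t h (s, t) ^+ 2) * (1 + ka s * t)) := cont_sec1 (y := t) d2.
have f3 : continuous (fun s => lam * (nc h (s, t) ^+ 2 * (1 + ka s * t))).
  by apply: cont1Z; exact: f1.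
by rewrite -(intZ _ _ _ f1) -(intB _ _ f2 f3); apply: int_eq => s _; ring.
Qed.

End ExteriorForms.

(** * The radial form *)

Section RadialForm.
Context {R : realType}.
Notation mu := (@lebesgue_measure R).
Implicit Types (phi : R -> R) (k t : R).

(** A normalized primitive of a bump on the negative side. Profiles are thereby continued into the
    tube inside [Omega] without any change at nonnegative heights. *)
Lemma left_cutoff (d : R) : 0 < d -> exists th : R -> R,
  [/\ smooth1 th, forall t, t <= - d -> th t = 0 & forall t, 0 <= t -> th t = 1 /\ derive1 th t = 0].
Proof.
move=> d0; have sb := @smooth1_bump R 0 (- d) 0; have cb := smooth1_cont sb.
have [F DF] := antiderivative cb.
have F0 : 0 < F 0 - F (- d).
  rewrite -(FTC _ cb DF); last by lra.
  by apply: (@int_gt0 _ _ _ _ (- d / 2)) => //; [move=> x _; exact: bump_ge0|lra|lra|apply: bump_gt0; lra].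
have Fz (x y : R) : x <= y -> (forall z, x <= z <= y -> ~~ (- d < z < 0)) -> F x = F y.
  move=> xy H; apply/esym/eqP; rewrite -subr_eq0 -(FTC xy cb DF) (@int_eq _ _ (fun=> 0)).
    by rewrite int_cst // mul0r.
  by move=> z /H; exact: bump_out.
pose th t := (F 0 - F (- d))^-1 * (F t - F (- d)).
have Dth t : is_deriv t th ((F 0 - F (- d))^-1 * bump 0 (- d) 0 t).
  by apply: (ide_eq (ideM (ide_cst _ t) (ideB (DF t) (ide_cst (F (- d)) t)))); ring.
exists th; split.
- apply/smooth1P => -[//|n] x; exists (fun t => (F 0 - F (- d))^-1 * bump 0 (- d) 0 t).
    by exists 1 => //= t _; exact: Dth.
  by apply: smatM; [exact: smat_cst|exact: ((smooth1P _).1 sb)].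
- move=> t td; rewrite /th (Fz t (- d) td) ?subrr ?mulr0 // => z zt.
  by apply/negP => /andP[]; lra.
- move=> t t0; split.
    rewrite /th -(Fz 0 t t0) ?mulVf ?gt_eqF // => z zt; by apply/negP => /andP[]; lra.
  have -> : derive1 th t = (F 0 - F (- d))^-1 * bump 0 (- d) 0 t.
    by rewrite derive1E; have D := Dth t; exact: derive_val.
  by rewrite bump_out ?mulr0 //; apply/negP => /andP[]; lra.
Qed.

Lemma pair_energy_ext phi psi M alpha lam P P1 (D : R -> R) : 0 <= M ->
  (forall t, 0 <= t -> phi t = psi t /\ derive1 phi t = derive1 psi t) ->
  pair_energy phi M alpha lam P P1 D = pair_energy psi M alpha lam P P1 D.
Proof.
move=> M0 H; rewrite /pair_energy (H 0 (lexx 0)).1; congr (_ + _).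
by apply: int_eq => t /andP[t0 _]; rewrite /form_dens (H t t0).1 (H t t0).2.
Qed.

(** The Jacobian of the normal coordinates of a circle of curvature [k], continued by 1 to negative
    heights. *)
Definition radius_jac k t : R := 1 + k * Num.max t 0.

Lemma radius_jac_gt0 k t : 0 <= k -> 0 < radius_jac k t.
Proof.
by move=> k0; rewrite (lt_le_trans ltr01) // lerDl mulr_ge0 // le_max lexx orbT.
Qed.

Lemma cont_radius_jac k : continuous (radius_jac k).
Proof.
apply: cont1D; first exact: cont1_cst.
by apply: cont1M; [exact: cont1_cst|apply: cont_max; [exact: cont1_id|exact: cont1_cst]].
Qed.

Lemma cont_radius_jacV k (c : R) : 0 <= k -> continuous (fun t => c / radius_jac k t).
Proof.
move=> k0; apply: cont1M; first exact: cont1_cst.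
by apply: contV => [t|]; [rewrite gt_eqF // radius_jac_gt0|exact: cont_radius_jac].
Qed.

(** The form on [phi] times the first angular harmonic of a circle of curvature [k], divided by the
    mass of that harmonic on the circle: its tangential energy at height [t] is
    [k ^+ 2 / (1 + k t)]. *)
Definition radial_energy k phi M alpha lam : R :=
  pair_energy phi M alpha lam 1 k (fun t => k ^+ 2 / radius_jac k t).

(* [2 k phi phi'] integrates to [- k phi(0) ^ 2], which completes the square. *)
Lemma radial_energyE k phi M (alpha lam : R) : 0 <= k -> 0 <= M -> smooth1 phi -> phi M = 0 ->
  radial_energy k phi M alpha lam =
  \int[mu]_(t in `[0, M]) (radius_jac k t * (derive1 phi t + phi t * (k / radius_jac k t)) ^+ 2 -
    lam * (phi t ^+ 2 * radius_jac k t)) + (k + alpha) * phi 0 ^+ 2.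
Proof.
move=> k0 M0 sphi phiM.
have cphi := smooth1_cont sphi; have cphi' := smooth1_cont (smooth1_derive sphi).
have cg : continuous (fun t => - k * (2 * phi t * derive1 phi t)).
  apply: cont1M; first exact: cont1_cst.
  by apply: cont1M; [apply: cont1Z; exact: cphi|exact: cphi'].
have D t : is_deriv t (fun t => - k * phi t ^+ 2) (- k * (2 * phi t * derive1 phi t)).
  by apply: (ide_eq (ideM (ide_cst (- k) t) (ideX 1 (smooth1_ide sphi t)))); rewrite expr1; ring.
have := FTC M0 cg D; rewrite phiM expr0n mulr0 sub0r => E.
have cd : continuous (form_dens phi lam 1 k (fun t => k ^+ 2 / radius_jac k t)).
  by apply: cont_form_dens => //; exact: cont_radius_jacV.
have -> : (k + alpha) * phi 0 ^+ 2 = - (- k * phi 0 ^+ 2) + alpha * (1 * phi 0 ^+ 2) by ring.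
rewrite addrA -E; congr (_ + _).
have cs : continuous (fun t => radius_jac k t * (derive1 phi t + phi t * (k / radius_jac k t)) ^+ 2 -
    lam * (phi t ^+ 2 * radius_jac k t)).
  have cr := @cont_radius_jac k.
  apply: contB; first apply: cont1M => //; first apply: cont1X.
    by apply: cont1D => //; apply: cont1M => //; exact: cont_radius_jacV.
  by apply: cont1M; [exact: cont1_cst|apply: cont1M => //; exact: cont1X].
rewrite -(intD _ _ cs cg); apply: int_eq => t /andP[t0 _].
rewrite /form_dens; have := radius_jac_gt0 t k0.
rewrite /radius_jac (max_idPl t0) [t * k]mulrC => r0.
by field; rewrite gt_eqF.
Qed.

Lemma radial_energy_ge0 k phi M (alpha lam : R) : 0 <= k -> 0 <= M -> smooth1 phi -> phi M = 0 ->
  - k <= alpha -> lam <= 0 -> 0 <= radial_energy k phi M alpha lam.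
Proof.
move=> k0 M0 sphi phiM ak l0; rewrite radial_energyE // addr_ge0 //; last first.
  by rewrite mulr_ge0 ?sqr_ge0 //; lra.
apply: int_ge0 => t _; have r0 := ltW (radius_jac_gt0 t k0).
have H1 : 0 <= radius_jac k t * (derive1 phi t + phi t * (k / radius_jac k t)) ^+ 2 by rewrite mulr_ge0 ?sqr_ge0.
have H2 : 0 <= - lam * (phi t ^+ 2 * radius_jac k t) by rewrite mulr_ge0 ?oppr_ge0 // mulr_ge0 ?sqr_ge0.
by rewrite mulNr in H2; exact: addr_ge0.
Qed.

Lemma bounded_on_interval phi (x y : R) : continuous phi -> exists2 C : R, 0 < C & forall t, x <= t <= y -> `|phi t| <= C.
Proof.
move=> cf; have c2 : continuous (fun q : R * R => phi q.1) by exact: cont1fst.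
have [C C0 H] := cont_box_bound x y 0 0 c2; exists C => // t xty.
by apply: (H t 0 xty); rewrite lexx.
Qed.

(* The radial profile is a cut-off multiple of the threshold solution [1 / (1 + k t)]. *)
Lemma radial_energy_lt0 k (alpha : R) : 0 <= k -> alpha < - k -> exists (phi : R -> R) (M0 M lam : R),
  [/\ smooth1 phi, forall t, M0 <= t -> phi t = 0, 0 < M0 < M, lam < 0 & radial_energy k phi M alpha lam < 0].
Proof.
move=> k0 ak; pose eta := bump 0 (- (1:R)) 1.
have seta : smooth1 eta by exact: smooth1_bump.
have e0 : 0 < eta 0 by apply: bump_gt0; lra.
have [C C0 HC] := bounded_on_interval 0 2 (smooth1_cont (smooth1_derive seta)).
(* [g] is the gain of the boundary term. The stretch [m] keeps the square term under [g / 2], and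
   [lam] is taken so small that the mass costs at most [g / 4]. *)
pose g := - (k + alpha) * eta 0 ^+ 2.
have g0 : 0 < g by rewrite mulr_gt0 ?exprn_gt0 //; lra.
pose m := 1 + 4 * C ^+ 2 / g.
have m1 : 1 <= m by rewrite /m lerDl; apply: divr_ge0; [apply: mulr_ge0; [lra|exact: sqr_ge0]|exact: ltW].
have m0 : 0 < m by exact: lt_le_trans ltr01 m1.
have mg : 2 * C ^+ 2 / m <= g / 2.
  rewrite ler_pdivrMr // /m mulrDr mulr1 (_ : g / 2 * (4 * C ^+ 2 / g) = 2 * C ^+ 2); last by field; rewrite gt_eqF.
  by rewrite lerDr divr_ge0 // ltW.
have kk : 0 < k + 1 by lra.
(* Down to the height [- 1 / (k + 1)] the denominator [1 + k * t] stays positive; the profile is cut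
   off there. *)
have d0 : 0 < (k + 1)^-1 by rewrite invr_gt0.
have [th [sth th0 th1]] := left_cutoff d0.
pose phi t := th t * eta (m^-1 * t) / (1 + k * t).
have schi : smooth1 (fun t => th t * eta (m^-1 * t)).
  apply/smooth1P => n x; apply: smatM; first exact: ((smooth1P _).1 sth).
  apply: (@smat_comp _ n eta (fun t => m^-1 * t)); first exact: ((smooth1P _).1 seta).
  by apply: smatM; [exact: smat_cst|exact: smat_id].
have sphi : smooth1 phi.
  apply/smooth1P => n x; case: (ltP x (- (k + 1)^-1)) => xd.
    apply: (@smat_near _ n (fun=> 0)); last exact: smat_cst.
    exists (- (k + 1)^-1 - x) => [/=|t /=]; first by rewrite subr_gt0.
    by rewrite /ball_ /= ltr_norml => /andP[H1 _]; rewrite /phi th0 ?mul0r //; lra.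
  apply: smatM; first exact: ((smooth1P _).1 schi).
  apply: smatV; last by apply: smatD; [exact: smat_cst|apply: smatM; [exact: smat_cst|exact: smat_id]].
  rewrite gt_eqF //; have : - (k * (k + 1)^-1) <= k * x by rewrite -mulrN ler_wpM2l.
  have : k * (k + 1)^-1 < 1 by rewrite ltr_pdivrMr //; lra.
  lra.
have phi_far t : m <= t -> phi t = 0.
  move=> mt; rewrite /phi /eta bump_out ?mulr0 ?mul0r //.
  by apply/negP => /andP[_]; rewrite mulrC ltr_pdivrMr // mul1r ltNge mt.
have M0 : 0 <= m + 1 by lra.
pose J := \int[mu]_(t in `[0, m + 1]) (phi t ^+ 2 * radius_jac k t).
have J0 : 0 <= J by apply: int_ge0 => t _; rewrite mulr_ge0 ?sqr_ge0 // ltW // radius_jac_gt0.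
exists phi, m, (m + 1), (- (g / (4 * (J + 1)))); split => //.
- by rewrite m0 ltrDl ltr01.
- by rewrite oppr_lt0 divr_gt0 // mulr_gt0 //; lra.
have J1 : 0 < J + 1 by lra.
rewrite radial_energyE //; last by apply: phi_far; lra.
set lam := - (g / _).
have cphi := smooth1_cont sphi; have cphi' := smooth1_cont (smooth1_derive sphi).
have cr := @cont_radius_jac k.
have c1 : continuous (fun t => phi t ^+ 2 * radius_jac k t) by apply: cont1M => //; exact: cont1X.
have c2 : continuous (fun t => radius_jac k t * (derive1 phi t + phi t * (k / radius_jac k t)) ^+ 2).
  apply: cont1M => //; apply: cont1X.
  by apply: cont1D => //; apply: cont1M => //; exact: cont_radius_jacV.
have c3 : continuous (fun t => lam * (phi t ^+ 2 * radius_jac k t)) by apply: cont1M => //; exact: cont1_cst.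
rewrite (intB _ _ c2 c3) (intZ _ _ _ c1) -/J.
have phi00 : phi 0 = eta 0 by rewrite /phi (th1 0 (lexx 0)).1 !mulr0 addr0 divr1 mul1r.
have I1 : \int[mu]_(t in `[0, m + 1]) (radius_jac k t * (derive1 phi t + phi t * (k / radius_jac k t)) ^+ 2) <=
    \int[mu]_(t in `[0, m + 1]) (C ^+ 2 / m ^+ 2).
  apply: int_le => //; first exact: cont1_cst.
  move=> t /andP[t0 tm]; have := radius_jac_gt0 t k0.
  have kt0 : 0 <= k * t by rewrite mulr_ge0.
  rewrite /radius_jac (max_idPl t0) => r0.
  have D1 : is_deriv t (fun t => phi t * (1 + k * t)) (derive1 phi t * (1 + k * t) + phi t * k).
    by apply: (ide_eq (ideM (smooth1_ide sphi t) (ideD (ide_cst 1 t) (ideM (ide_cst k t) (ide_id t))))); ring.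
  have D2 : is_deriv t (fun t => phi t * (1 + k * t)) (m^-1 * derive1 eta (m^-1 * t)).
    have D3 := ideM (smooth1_ide sth t) (@ide_comp R eta (fun t => m^-1 * t) t _ _ (smooth1_ide seta _) (ideM (ide_cst m^-1 t) (ide_id t))).
    apply: (@ide_near _ (fun t => th t * eta (m^-1 * t))); last first.
      by apply: (ide_eq D3); rewrite (th1 t t0).1 (th1 t t0).2; ring.
    have rN : \forall u \near t, 1 + k * u != 0.
      exists (k + 1)^-1 => [//|u /=]; rewrite /ball_ /= ltr_norml => /andP[_ H1].
      rewrite gt_eqF //; have : - (k * (k + 1)^-1) <= k * u by rewrite -mulrN ler_wpM2l //; lra.
      have : k * (k + 1)^-1 < 1 by rewrite ltr_pdivrMr //; lra.
      lra.
    by near=> u; rewrite /phi mulfVK //; near: u.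
  have E := ide_uniq D1 D2.
  have E2 : (1 + k * t) * (derive1 phi t + phi t * (k / (1 + k * t))) ^+ 2 =
      (m^-1 * derive1 eta (m^-1 * t)) ^+ 2 / (1 + k * t).
    by rewrite -E; field; rewrite gt_eqF.
  rewrite E2 ler_pdivrMr // exprMn exprVn [C ^+ 2 / _]mulrC -mulrA ler_pM2l ?invr_gt0 ?exprn_gt0 //.
  have HH : derive1 eta (m^-1 * t) ^+ 2 <= C ^+ 2.
    have : `|derive1 eta (m^-1 * t)| <= C.
      apply: HC; apply/andP; split; first by rewrite mulr_ge0 // invr_ge0 ltW.
      by rewrite mulrC ler_pdivrMr //; lra.
    move: (derive1 eta _) => X; rewrite ler_norml => /andP[X1 X2].
    by rewrite -subr_ge0 subr_sqr mulr_ge0 //; lra.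
  by apply: (le_trans HH); rewrite ler_peMr ?sqr_ge0 // lerDl.
have I2 : \int[mu]_(t in `[0, m + 1]) (C ^+ 2 / m ^+ 2) <= 2 * C ^+ 2 / m.
  have -> : 2 * C ^+ 2 / m = C ^+ 2 / m ^+ 2 * (2 * m) by field; rewrite gt_eqF.
  rewrite int_cst // subr0 ler_wpM2l ?divr_ge0 ?sqr_ge0 //; lra.
have I3 : - (lam * J) <= g / 4.
  have -> : - (lam * J) = g / 4 * (J / (J + 1)) by rewrite /lam; field; rewrite gt_eqF.
  by rewrite ler_piMr ?divr_ge0 ?(ltW g0) // ler_pdivrMr // mul1r lerDl.
have I4 : (k + alpha) * phi 0 ^+ 2 = - g by rewrite phi00 /g mulNr opprK.
rewrite I4; move: I1 I2 I3 mg; lra.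
Unshelve. all: by end_near. Qed.

End RadialForm.

(** * Trial functions from radial profiles *)

Section RadialTrial.
Context {R : realType} (Omega : set (R * R)) (K : convex_curve Omega).
Notation mu := (@lebesgue_measure R).
Notation L := (len K).
Notation ka := (ka K).
Notation dl := (tube_width K).
Variables (a b : R).
Hypothesis (Oab : Omega (a, b)).
Hypothesis (cvx : segment_closed Omega).
Implicit Types (phi : R -> R) (s t : R).

Let ck : continuous (fun s => ka s). Proof. exact: cont_ka. Qed.
Let ck2 : continuous (fun s => ka s ^+ 2). Proof. exact: cont1X. Qed.
Let cZ (c : R) (f : R -> R) : continuous f -> continuous (fun s => c * f s).
Proof. by move=> cf; apply: cont1Z; exact: cf. Qed.

(* Tangent line of the concave function [x / (1 + x t)] at [x = k]. *)
Lemma curvature_mean_le (k t : R) : 0 < k -> 0 <= t ->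
  \int[mu]_(s in `[0, L]) (ka s ^+ 2) = 2 * pi * k ->
  curvature_mean K t <= 2 * pi * k / (1 + k * t).
Proof.
move=> k0 t0 Ek; have r0 : 0 < 1 + k * t by rewrite ltr_wpDr // mulr_ge0 // ltW.
(* The slope of the tangent line. The line is multiplied by [ka] before integration: this is
   Jensen's inequality for the measure [ka ds], of total mass [2 * pi] and mean curvature value
   [k]. *)
pose c := (1 + k * t)^-1 ^+ 2.
have c0 : 0 <= c by exact: sqr_ge0.
apply: (@le_trans _ _ (\int[mu]_(s in `[0, L]) (c * ka s ^+ 2 + (k * t * c * k) * ka s))).
  apply: int_le.
  - have cj : continuous (fun s => (jac K (s, t))^-1) := cont_sec1 (y := t) (@cont_jacV _ _ K).
    exact: cont1M.
  - by apply: cont1D; exact: cZ.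
  - move=> s _; rewrite /jac /= (max_idPl t0); have k1 := ka_ge0 K s.
    have j0 : 0 < 1 + ka s * t by rewrite ltr_wpDr // mulr_ge0.
    rewrite ler_pdivrMr // -subr_ge0.
    have -> : (c * ka s ^+ 2 + k * t * c * k * ka s) * (1 + ka s * t) - ka s ^+ 2 =
        c * (ka s * t * (ka s - k) ^+ 2).
      by rewrite /c; field; rewrite gt_eqF.
    by rewrite mulr_ge0 // mulr_ge0 ?sqr_ge0 // mulr_ge0.
rewrite (intD _ _ (@cZ _ _ ck2) (@cZ _ _ ck)) (intZ _ _ _ ck2) (intZ _ _ _ ck) Ek int_ka.
by rewrite le_eqVlt; apply/orP; left; apply/eqP; rewrite /c; field; rewrite gt_eqF.
Qed.

(** The variance of the curvature about its mean [2 * pi / L] is nonnegative. *)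
Lemma length_ge (k : R) : 0 < k -> \int[mu]_(s in `[0, L]) (ka s ^+ 2) = 2 * pi * k -> 2 * pi <= L * k.
Proof.
move=> k0 Ek; have L0 := len_gt0 K; have pi0 := pi_gt0 R.
have : 0 <= \int[mu]_(s in `[0, L]) (ka s - 2 * pi / L) ^+ 2 by apply: int_ge0 => s _; exact: sqr_ge0.
pose e := 2 * pi / L.
have c1 : continuous (fun s => ka s ^+ 2 + (- 2 * e) * ka s) by apply: cont1D => //; exact: cZ.
rewrite (_ : \int[mu]_(s in _) _ = \int[mu]_(s in `[0, L]) ((ka s ^+ 2 + (- 2 * e) * ka s) + e ^+ 2)).
  rewrite (intD _ _ c1 (@cont1_cst R (e ^+ 2))) (intD _ _ ck2 (@cZ _ _ ck)) (intZ _ _ _ ck) Ek int_ka int_cst ?subr0; last exact: ltW.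
  have -> : 2 * pi * k + - 2 * e * (2 * pi) + e ^+ 2 * L = (2 * pi / L) * (L * k - 2 * pi).
    by rewrite /e; field; rewrite gt_eqF.
  by rewrite pmulr_rge0 ?subr_ge0 // divr_gt0 // mulr_gt0.
by apply: int_eq => s _; rewrite /e; ring.
Qed.

(** Both uses of [2 * pi <= L * k] go in the same direction: in the Jacobian, where the factor
    [phi' ^ 2 - lam * phi ^ 2] is nonnegative because [lam <= 0], and in the tangential term after
    [curvature_mean_le]. *)
Lemma trial_energy_radial k phi (M alpha lam : R) : 0 < k -> lam <= 0 -> smooth1 phi -> 0 <= M ->
  \int[mu]_(s in `[0, L]) (ka s ^+ 2) = 2 * pi * k ->
  trial_energy K phi M alpha lam <= L * radial_energy k phi M alpha lam.
Proof.
move=> k0 l0 sphi M_ge0 Ek; have Lk := length_ge k0 Ek; have k0' := ltW k0.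
have c1 : continuous (form_dens phi lam L (2 * pi) (curvature_mean K)).
  by apply: cont_form_dens => //; exact: cont_curvature_mean.
have c2 : continuous (form_dens phi lam 1 k (fun t => k ^+ 2 / radius_jac k t)).
  by apply: cont_form_dens => //; exact: cont_radius_jacV.
rewrite /trial_energy /radial_energy /pair_energy [leRHS]mulrDr -(intZ _ _ _ c2).
have -> : L * (alpha * (1 * phi 0 ^+ 2)) = alpha * (L * phi 0 ^+ 2) by ring.
rewrite lerD2r; apply: int_le => //; first exact: cZ.
move=> t /andP[t0 _]; rewrite /form_dens /radius_jac (max_idPl t0).
have r0 : 0 < 1 + k * t by rewrite ltr_wpDr // mulr_ge0.
have J := curvature_mean_le k0 t0 Ek.
rewrite [leRHS]mulrDr; apply: lerD.
  rewrite [leRHS]mulrCA; apply: ler_wpM2l.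
    by have := sqr_ge0 (derive1 phi t); have := mulr_ge0 (_ : 0 <= - lam) (sqr_ge0 (phi t)); rewrite oppr_ge0 => /(_ l0); lra.
  by rewrite [leRHS]mulrDr mulr1 lerD2l [leRHS]mulrCA ler_wpM2l.
rewrite [leRHS]mulrCA ler_wpM2l ?sqr_ge0 // (le_trans J) // mulrA ler_wpM2r ?invr_ge0 ?(ltW r0) //.
by rewrite expr2 mulrA ler_wpM2r.
Qed.

Lemma cutoff_profile phi (M0 : R) : smooth1 phi -> (forall t, M0 <= t -> phi t = 0) -> exists psi : R -> R,
  [/\ smooth1 psi, forall t, ~~ (- (dl / 2) <= t <= M0) -> psi t = 0 &
      forall t, 0 <= t -> psi t = phi t /\ derive1 psi t = derive1 phi t].
Proof.
move=> sphi phi0; have d0 : 0 < dl / 2 by rewrite divr_gt0 // tube_width_gt0.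
have [th [sth th0 th1]] := left_cutoff d0; exists (fun t => th t * phi t); split.
- by apply/smooth1P => n x; apply: smatM; [exact: ((smooth1P _).1 sth)|exact: ((smooth1P _).1 sphi)].
- move=> t; rewrite negb_and -!ltNge => /orP[H|H]; first by rewrite th0 ?mul0r // ltW.
  by rewrite phi0 ?mulr0 // ltW.
- move=> t t0; rewrite (th1 t t0).1 mul1r; split=> //.
  have D := ideM (smooth1_ide sth t) (smooth1_ide sphi t).
  rewrite (th1 t t0).1 (th1 t t0).2 mul0r add0r mul1r in D.
  by rewrite derive1E; exact: derive_val.
Qed.

Lemma radial_trial (k : R) phi (M0 M alpha lam : R) : 0 < k -> lam <= 0 -> smooth1 phi -> 0 < M0 < M ->
  (forall t, M0 <= t -> phi t = 0) ->
  \int[mu]_(s in `[0, L]) (ka s ^+ 2) = 2 * pi * k ->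
  radial_energy k phi M alpha lam < 0 -> (lambda2 alpha Omega <= lam%:E)%E.
Proof.
move=> k0 l0 sphi /andP[M00 M0M] phi0 Ek Q0; have M0' := lt_trans M00 M0M.
have [psi [spsi psi0 psiE]] := cutoff_profile sphi phi0.
(* A profile that vanishes on all of []0, M[] vanishes at 0 by continuity, and its energy would not
   be negative. *)
have [c /andP[c0 cM] phic] : exists2 c : R, 0 < c < M & phi c != 0.
  apply/not_exists2P => H; move: Q0; apply/negP; rewrite -leNgt.
  have H0 (c : R) : 0 < c < M -> phi c = 0.
    by move=> cM; apply/eqP; have [//|] := H c; rewrite ?cM //; move/negP; rewrite negbK.
  have phi00 : phi 0 = 0.
    apply/eqP/negPn/negP => /= H1.
    have n0 : 0 < `|phi 0| by rewrite normr_gt0.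
    have [d /= d0 Hd] := @smooth1_cont R phi sphi (0 : R) _ (nbhsx_ballx (phi 0) `|phi 0| n0).
    have m0 : 0 < Num.min d M by rewrite lt_min d0.
    have md : Num.min d M <= d by rewrite ge_min lexx.
    have mM : Num.min d M <= M by rewrite ge_min lexx orbT.
    have P : 0 < Num.min d M / 2 < M by lra.
    have Hb : `|0 - Num.min d M / 2| < d by rewrite sub0r normrN gtr0_norm; lra.
    have := Hd _ Hb; rewrite /ball /= (H0 _ P) subr0 ltxx //.
  rewrite /radial_energy /pair_energy phi00 expr0n /= !mulr0 addr0; apply: int_ge0 => t /andP[t0 _].
  rewrite /form_dens; have r0 := radius_jac_gt0 t (ltW k0).
  rewrite addr_ge0 //; last by rewrite mulr_ge0 ?sqr_ge0 // divr_ge0 ?sqr_ge0 // ltW.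
  rewrite mulr_ge0 //; last by rewrite addr_ge0 // mulr_ge0 // ltW.
  by have := sqr_ge0 (derive1 phi t); have := mulr_ge0 (_ : 0 <= - lam) (sqr_ge0 (phi t)); rewrite oppr_ge0 => /(_ l0); lra.
apply: (trial Oab cvx spsi M0M M0' psi0 (c := c)); last first.
- by rewrite (psiE c (ltW c0)).1.
- by rewrite c0.
rewrite /trial_energy (pair_energy_ext _ _ _ _ _ (ltW M0') psiE) -/(trial_energy K phi M alpha lam).
apply: (le_trans (trial_energy_radial alpha k0 l0 sphi (ltW M0') Ek)).
by rewrite mulr_ge0_le0 // ltW // len_gt0.
Qed.

(* Spreading a fixed profile over [N, 2N] makes the energy arbitrarily small relative to the mass. *)
Lemma lambda2_le0 (alpha : R) : (lambda2 alpha Omega <= 0)%E.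
Proof.
apply/lee_addgt0Pr => e e0; rewrite add0e.
have pi0 := pi_gt0 R; have L0 := len_gt0 K.
pose be := bump 0 (1:R) 2.
have sbe : smooth1 be by exact: smooth1_bump.
have cbe := smooth1_cont sbe; have cbe' := smooth1_cont (smooth1_derive sbe).
have cb2 : continuous (fun x => be x ^+ 2) by exact: cont1X.
have cb2' : continuous (fun x => derive1 be x ^+ 2) by exact: cont1X.
pose A := \int[mu]_(x in `[0, 3]) (derive1 be x ^+ 2).
pose B := \int[mu]_(x in `[0, 3]) (be x ^+ 2).
have A0 : 0 <= A by apply: int_ge0 => x _; exact: sqr_ge0.
have B0 : 0 < B.
  apply: (@int_gt0 _ _ _ _ (3 / 2) cb2); [by move=> x _; exact: sqr_ge0|lra|lra|].
  by rewrite exprn_gt0 // bump_gt0 //; lra.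
(* After the substitution [x = t / N] the gradient and curvature terms contribute at most [D], while
   the term in [e] subtracts [N * (e * N * B)]; [N] is chosen so that [e * N * B >= D] and
   [N >= 1]. *)
pose D := (L + 4 * pi) * A + 2 * pi * B.
have D0 : 0 <= D by rewrite addr_ge0 // mulr_ge0 //; [lra|lra|exact: ltW].
pose N := 1 + D / (e * B).
have N1 : 1 <= N by rewrite /N lerDl divr_ge0 // mulr_ge0 // ltW.
have N0 : 0 < N := lt_le_trans ltr01 N1.
have eND : D <= e * N * B.
  have -> : e * N * B = e * B + D by rewrite /N; field; rewrite !gt_eqF.
  by rewrite lerDr mulr_ge0 // ltW.
pose phi t := be (N^-1 * t).
have sphi : smooth1 phi.
  apply/smooth1P => n x; apply: (@smat_comp _ n be (fun t => N^-1 * t)); first exact: ((smooth1P _).1 sbe).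
  by apply: smatM; [exact: smat_cst|exact: smat_id].
have Dphi t : derive1 phi t = N^-1 * derive1 be (N^-1 * t).
  have D1 : is_deriv t phi (N^-1 * derive1 be (N^-1 * t)).
    by apply: (ide_eq (@ide_comp R be (fun t => N^-1 * t) t _ _ (smooth1_ide sbe _) (ideM (ide_cst N^-1 t) (ide_id t)))); ring.
  by rewrite derive1E; exact: derive_val.
have phi0 t : ~~ (- (dl / 2) <= t <= 2 * N) -> phi t = 0.
  move=> H; rewrite /phi /be bump_out //; apply: contra H => /andP[H1 H2].
  have t0 : N < t by move: H1; rewrite mulrC ltr_pdivlMr // mul1r.
  have t2 : t < 2 * N by move: H2; rewrite mulrC ltr_pdivrMr.
  by have := tube_width_gt0 K; lra.
have M03 : 2 * N < 3 * N by lra.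
have M00 : 0 < 3 * N by lra.
apply: (trial Oab cvx sphi M03 M00 phi0 (c := 3 / 2 * N)); last first.
- by rewrite /phi mulrC mulfK ?gt_eqF //; apply: bump_gt0; lra.
- lra.
have phi00 : phi 0 = 0 by rewrite /phi mulr0 /be bump_out //; apply/negP => /andP[]; lra.
rewrite /trial_energy /pair_energy phi00 expr0n /= !mulr0 addr0.
pose g x := (L + 4 * pi) / N * derive1 be x ^+ 2 + (2 * pi / N - e * N) * be x ^+ 2.
have cg : continuous g by apply: cont1D; exact: cZ.
have [G DG] := antiderivative cg.
have cgN : continuous (fun t => g (N^-1 * t)).
  by apply: (cont_comp cg); apply: cZ; exact: cont1_id.
have DGN t : is_deriv t (fun t => N * G (N^-1 * t)) (g (N^-1 * t)).
  apply: (ide_eq (ideM (ide_cst N t) (@ide_comp R G (fun t => N^-1 * t) t _ _ (DG _) (ideM (ide_cst N^-1 t) (ide_id t))))).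
  by field; rewrite gt_eqF.
have le1 : \int[mu]_(t in `[0, 3 * N]) form_dens phi e L (2 * pi) (curvature_mean K) t <=
    \int[mu]_(t in `[0, 3 * N]) g (N^-1 * t).
  apply: int_le => //; first by apply: cont_form_dens => //; exact: cont_curvature_mean.
  move=> t /andP[t0 _]; rewrite /form_dens /g Dphi /phi.
  have be0 x : ~~ (1 <= x <= 2) -> be x = 0.
    by move=> H; apply: bump_out; apply: contra H => /andP[H1 H2]; rewrite !ltW.
  case: (boolP (1 <= N^-1 * t <= 2)) => [/andP[H1 H2]|H]; last first.
    have E0 := be0 _ H; have E1 := derive1_out sbe be0 H.
    by rewrite E0 E1; move: (curvature_mean K t) => c; rewrite le_eqVlt; apply/orP; left; apply/eqP; ring.
  have Nt : N <= t by move: H1; rewrite mulrC ler_pdivlMr // mul1r.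
  have t2 : t <= 2 * N by move: H2; rewrite mulrC ler_pdivrMr.
  have tp : 0 < t by lra.
  (* On the support [t >= N], so [ka ^ 2 / (1 + ka t)] is at most [ka / N], and the total curvature
     is [2 * pi]. *)
  have Cm : curvature_mean K t <= 2 * pi / N.
    apply: (@le_trans _ _ (\int[mu]_(s in `[0, L]) (N^-1 * ka s))).
      apply: int_le; last 1 first.
      - move=> s _; rewrite /jac /= (max_idPl t0); have k1 := ka_ge0 K s.
        have j0 : 0 < 1 + ka s * t by rewrite ltr_wpDr // mulr_ge0.
        rewrite ler_pdivrMr // expr2 -mulrA mulrCA ler_wpM2l // mulrDr mulr1.
        rewrite mulrCA -[leLHS]add0r lerD ?invr_ge0 ?(ltW N0) // ler_peMr // mulrC ler_pdivlMr // mul1r ltW //.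
      - have cj : continuous (fun s => (jac K (s, t))^-1) := cont_sec1 (y := t) (@cont_jacV _ _ K).
        exact: cont1M.
      - exact: cZ.
    by rewrite (intZ _ _ _ ck) int_ka mulrC.
  set X := derive1 be _; set Y := be _.
  have y2 := sqr_ge0 Y; have x2 := sqr_ge0 X.
  have P2 : L + t * (2 * pi) <= (L + 4 * pi) * N.
    have : L <= L * N by rewrite ler_peMr // ltW.
    have : t * (2 * pi) <= 2 * N * (2 * pi) by rewrite ler_wpM2r //; lra.
    by lra.
  have P1 : N <= L + t * (2 * pi).
    have : 1 <= 2 * (pi : R) by have := pi_ge2 R; lra.
    by move=> p1; apply: (le_trans Nt); rewrite -[leLHS]add0r lerD ?(ltW L0) // ler_peMr.
  rewrite mulrBl -addrA; apply: lerD.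
    rewrite exprMn exprVn.
    have -> : (L + 4 * pi) / N * X ^+ 2 = N ^- 2 * X ^+ 2 * ((L + 4 * pi) * N) by field; rewrite gt_eqF.
    by rewrite ler_wpM2l // mulr_ge0 // invr_ge0 sqr_ge0.
  have i1 : Y ^+ 2 * curvature_mean K t <= Y ^+ 2 * (2 * pi / N) by rewrite ler_wpM2l.
  have i2 : e * Y ^+ 2 * N <= e * Y ^+ 2 * (L + t * (2 * pi)) by rewrite ler_wpM2l // mulr_ge0 // ltW.
  by move: i1 i2; move: (curvature_mean K t) (2 * pi / N) => c1 c2; lra.
apply: (le_trans le1); rewrite (FTC (ltW M00) cgN DGN) mulr0 -mulrBr.
rewrite (_ : N^-1 * (3 * N) = 3); last by field; rewrite gt_eqF.
rewrite -(FTC _ cg DG); last by lra.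
rewrite (intD _ _ (@cZ _ _ cb2') (@cZ _ _ cb2)) (intZ _ _ _ cb2) (intZ _ _ _ cb2') -/A -/B.
have -> : N * ((L + 4 * pi) / N * A + (2 * pi / N - e * N) * B) = D - N * (e * N * B).
  by rewrite /D; field; rewrite gt_eqF.
by rewrite subr_le0 (le_trans eND) // ler_peMl // mulr_ge0 ?(ltW B0) // mulr_ge0 ?(ltW e0) ?(ltW N0).
Qed.

End RadialTrial.

(** * The lower bound for disks *)

Section Wirtinger.
Context {R : realType}.
Notation mu := (@lebesgue_measure R).
Implicit Types (f : R -> R) (x y m : R).

Lemma ide_le f (f' : R -> R) (x y : R) : x <= y -> (forall z, x <= z <= y -> is_deriv z f (f' z)) ->
  (forall z, x <= z <= y -> 0 <= f' z) -> f x <= f y.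
Proof.
rewrite le_eqVlt => /orP[/eqP ->//|xy] D f0.
have Dz z : z \in `]x, y[%R -> is_deriv z f (f' z).
  by rewrite in_itv /= => /andP[z1 z2]; apply: D; rewrite !ltW.
have [|c] := MVT xy Dz.
  apply: derivable_within_continuous => z; rewrite in_itv /= => zxy.
  by have H := D z zxy; exact: ex_derive.
rewrite in_itv /= => /andP[c1 c2] E.
by rewrite -subr_ge0 E mulr_ge0 ?subr_ge0 ?(ltW xy) // f0 // !ltW.
Qed.

Lemma int_periodic_shift f (l x : R) : continuous f -> 0 <= l -> (forall y, f (y + l) = f y) ->
  \int[mu]_(y in `[x, x + l]) f y = \int[mu]_(y in `[0, l]) f y.
Proof.
move=> cf l0 pf; have [F DF] := antiderivative cf.
have xl : x <= x + l by rewrite lerDl.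
rewrite (FTC xl cf DF) (FTC l0 cf DF).
have D z : is_deriv z (fun z => F (z + l) - F z) 0.
  apply: (ide_eq (ideB (@ide_comp R F (fun z => z + l) z _ _ (DF _) (ideD (ide_id z) (ide_cst l z))) (DF z))).
  by rewrite pf; ring.
have := @mean_value R (fun z => F (z + l) - F z) (fun=> 0) 0 x D.
by move=> [c _]; rewrite mul0r add0r => /eqP; rewrite subr_eq0 => /eqP ->.
Qed.

(* Compare with the positive solution [cos (m (x - mid))] of [psi'' = - m ^ 2 psi]. *)
Lemma wirtinger_dirichlet_sub f (p q m : R) : smooth1 f -> p < q -> f p = 0 -> f q = 0 ->
  0 <= m -> m * (q - p) < pi ->
  m ^+ 2 * \int[mu]_(x in `[p, q]) f x ^+ 2 <= \int[mu]_(x in `[p, q]) derive1 f x ^+ 2.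
Proof.
move=> sf pq fp fq m0 mpi; have cf := smooth1_cont sf; have cf' := smooth1_cont (smooth1_derive sf).
pose g x := derive1 f x ^+ 2 - m ^+ 2 * f x ^+ 2.
have c1 : continuous (fun x => derive1 f x ^+ 2) by exact: cont1X.
have c2 : continuous (fun x => f x ^+ 2) by exact: cont1X.
have c3 : continuous (fun x => m ^+ 2 * f x ^+ 2) by apply: cont1Z; exact: c2.
have cg : continuous g by exact: contB.
have [A DA] := antiderivative cg.
rewrite -(intZ _ _ _ c2) -subr_ge0 -(intB _ _ c1 c3) (FTC (ltW pq) cg DA) subr_ge0.
pose mid := (p + q) / 2; pose th x := m * (x - mid).
have Dth x : is_deriv x th m.
  by apply: (ide_eq (ideM (ide_cst m x) (ideB (ide_id x) (ide_cst mid x)))); ring.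
have Dc x := @ide_comp R cos th x _ _ (is_derive_cos (th x)) (Dth x).
have Ds x := @ide_comp R sin th x _ _ (is_derive_sin (th x)) (Dth x).
have cpos x : p <= x <= q -> 0 < cos (th x).
  move=> /andP[px xq]; have i1 : m * (p - mid) <= th x by rewrite ler_wpM2l //; lra.
  have i2 : th x <= m * (q - mid) by rewrite ler_wpM2l //; lra.
  move: i1 i2; rewrite /mid.
  have -> : m * (p - (p + q) / 2) = - (m * (q - p) / 2) by field.
  have -> : m * (q - (p + q) / 2) = m * (q - p) / 2 by field.
  move=> i1 i2; apply: cos_gt0_pihalf; apply/andP; split; lra.
(* Picone's identity: adding this term, which vanishes at both ends together with [f], turns the
   integrand into a perfect square. *)
pose B x := A x + m * f x ^+ 2 * (sin (th x) / cos (th x)).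
have DB x : p <= x <= q -> is_deriv x B ((derive1 f x + m * f x * (sin (th x) / cos (th x))) ^+ 2).
  move=> xpq; have c0 := cpos x xpq.
  have c0' : cos (th x) != 0 by rewrite gt_eqF.
  apply: (ide_eq (ideD (DA x) (ideM (ideM (ide_cst m x) (ideX 1 (smooth1_ide sf x))) (ideM (Ds x) (ideV c0' (Dc x)))))).
  by rewrite /g expr1; field.
have := ide_le (ltW pq) DB (fun z _ => sqr_ge0 _).
by rewrite /B fp fq expr0n /= !mulr0 !mul0r !addr0.
Qed.

(** At the sharp frequency the comparison solution vanishes at the ends, so the frequency is lowered
    slightly and a strict violation is contradicted. *)
Lemma wirtinger_dirichlet f (p q : R) : smooth1 f -> p < q -> f p = 0 -> f q = 0 ->
  (pi / (q - p)) ^+ 2 * \int[mu]_(x in `[p, q]) f x ^+ 2 <= \int[mu]_(x in `[p, q]) derive1 f x ^+ 2.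
Proof.
move=> sf pq fp fq; have l0 : 0 < q - p by rewrite subr_gt0.
have pi0 := pi_gt0 R.
set I := \int[mu]_(x in _) f x ^+ 2; set J := \int[mu]_(x in _) _.
have I0 : 0 <= I by apply: int_ge0 => x _; exact: sqr_ge0.
pose m := pi / (q - p); have m0 : 0 < m by exact: divr_gt0.
rewrite -/m leNgt; apply/negP => JI.
have I1 : 0 < I.
  rewrite lt_neqAle I0 andbT eq_sym; apply/eqP => E; move: JI; rewrite E mulr0 ltNge => /negP; apply.
  by apply: int_ge0 => x _; exact: sqr_ge0.
pose mI := m ^+ 2 * I.
have mI0 : 0 < mI by rewrite mulr_gt0 ?exprn_gt0.
(* Lowering the frequency by the factor [1 - d] loses at most [2 * mI * d], half of the assumed gap
   [mI - J]. *)
pose d := (mI - J) / (4 * mI).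
have JI' : 0 < mI - J by rewrite subr_gt0.
have d0 : 0 < d by apply: divr_gt0 => //; rewrite mulr_gt0.
have J0 : 0 <= J by apply: int_ge0 => x _; exact: sqr_ge0.
have mI4 : 0 < 4 * mI by exact: mulr_gt0.
have d1 : d < 1 by rewrite /d ltr_pdivrMr //; lra.
have H : m * (1 - d) * (q - p) < pi.
  have -> : m * (1 - d) * (q - p) = pi - pi * d by rewrite /m; field; rewrite gt_eqF.
  by rewrite gtrBl mulr_gt0.
have md0 : 0 <= m * (1 - d) by rewrite mulr_ge0 ?(ltW m0) //; lra.
have := wirtinger_dirichlet_sub sf pq fp fq md0 H; rewrite -/I -/J.
have -> : (m * (1 - d)) ^+ 2 * I = mI * (1 - d) ^+ 2 by rewrite /mI; ring.
have dE : mI * d = (mI - J) / 4 by rewrite /d; field; rewrite gt_eqF.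
have : 0 <= mI * d ^+ 2 by rewrite mulr_ge0 ?sqr_ge0 // ltW.
have -> : mI * (1 - d) ^+ 2 = mI - 2 * (mI * d) + mI * d ^+ 2 by ring.
rewrite dE -/mI in JI *; move: JI; rewrite -/mI; lra.
Qed.

(* Cut the period at two opposite points with equal values. *)
Lemma wirtinger f (l : R) : smooth1 f -> 0 < l -> (forall x, f (x + l) = f x) ->
  (2 * pi / l) ^+ 2 * (l * \int[mu]_(x in `[0, l]) f x ^+ 2 - (\int[mu]_(x in `[0, l]) f x) ^+ 2) <=
  l * \int[mu]_(x in `[0, l]) derive1 f x ^+ 2.
Proof.
move=> sf l0 pf; have cf := smooth1_cont sf; have cf' := smooth1_cont (smooth1_derive sf).
have pi0 := pi_gt0 R.
pose h := l / 2; have h0 : 0 < h by rewrite /h; lra.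
pose g x := f (x + h) - f x.
have ch : continuous (fun x => x + h) by apply: cont1D; [exact: cont1_id|exact: cont1_cst].
have cg : continuous g by apply: contB; [exact: (cont_comp cf ch)|exact: cf].
have gh : g h = - g 0.
  have -> : g h = f (0 + l) - f h by rewrite /g /h; congr (f _ - _); field.
  by rewrite pf /g add0r; ring.
have [c _ gc] : exists2 c, c \in `[0, h]%R & g c = 0.
  apply: IVT; [exact: ltW|exact: continuous_subspaceT|].
  rewrite gh ge_min le_max oppr_le0 oppr_ge0.
  by case/orP: (le_total (g 0) 0) => ->; rewrite ?orbT.
(* Subtracting the common value gives a function that vanishes at both cuts. Compared with
   subtracting the mean, the error is the square that closes the proof. *)
pose v := f c.
have fch : f (c + h) = v by move/eqP: gc; rewrite subr_eq0 => /eqP.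
pose F x := f x - v.
have sF : smooth1 F.
  by apply/smooth1P => n x; apply: smatB; [exact: ((smooth1P f).1 sf)|exact: smat_cst].
have DF x : derive1 F x = derive1 f x.
  have D : is_deriv x F (derive1 f x).
    by apply: (ide_eq (ideB (smooth1_ide sf x) (ide_cst v x))); ring.
  by rewrite derive1E; exact: derive_val.
have cF := smooth1_cont sF; have cF2 : continuous (fun x => F x ^+ 2) by exact: cont1X.
have cf2 : continuous (fun x => f x ^+ 2) by exact: cont1X.
have cf'2 : continuous (fun x => derive1 f x ^+ 2) by exact: cont1X.
have cF'2 : continuous (fun x => derive1 F x ^+ 2).
  by apply: cont1X; apply: smooth1_cont; exact: smooth1_derive.
have H1 : c < c + h by rewrite ltrDl.
have H2 : c + h < c + l by rewrite ltrD2l /h; lra.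
have F0 : F c = 0 by rewrite /F subrr.
have F1 : F (c + h) = 0 by rewrite /F fch subrr.
have F2 : F (c + l) = 0 by rewrite /F pf subrr.
have W1 := wirtinger_dirichlet sF H1 F0 F1; have W2 := wirtinger_dirichlet sF H2 F1 F2.
have e1 : pi / (c + h - c) = 2 * pi / l by rewrite /h; field; rewrite ?gt_eqF.
have e2 : pi / (c + l - (c + h)) = 2 * pi / l.
  by rewrite (_ : c + l - (c + h) = l / 2); [field; rewrite gt_eqF|rewrite /h; field].
rewrite e1 in W1; rewrite e2 in W2.
have W : (2 * pi / l) ^+ 2 * \int[mu]_(x in `[0, l]) F x ^+ 2 <= \int[mu]_(x in `[0, l]) derive1 f x ^+ 2.
  rewrite -(int_periodic_shift c cF2 (ltW l0)); last by move=> y; rewrite /F pf.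
  rewrite (int_split cF2 (ltW H1) (ltW H2)) mulrDr; apply: (le_trans (lerD W1 W2)).
  rewrite -(int_split cF'2 (ltW H1) (ltW H2)) (int_periodic_shift c cF'2 (ltW l0)).
    by rewrite le_eqVlt; apply/orP; left; apply/eqP; apply: int_eq => x _; rewrite DF.
  move=> y; rewrite !DF; congr (_ ^+ 2).
  have D1 := @ide_comp R f (fun x => x + l) y _ _ (smooth1_ide sf (y + l)) (ideD (ide_id y) (ide_cst l y)).
  have D2 : is_deriv y (fun x => f (x + l)) (derive1 f y).
    by apply: (ide_near _ (smooth1_ide sf y)); exists 1 => //= z _; rewrite pf.
  by rewrite -(ide_uniq D1 D2); ring.
apply: (@le_trans _ _ (l * ((2 * pi / l) ^+ 2 * \int[mu]_(x in `[0, l]) F x ^+ 2))); last by rewrite ler_pM2l.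
rewrite mulrCA ler_wpM2l ?sqr_ge0 //.
have c4 : continuous (fun x => (- 2 * v) * f x) by apply: cont1Z; exact: cf.
have c5 : continuous (fun x => f x ^+ 2 + (- 2 * v) * f x) by apply: cont1D; [exact: cf2|exact: c4].
have -> : \int[mu]_(x in `[0, l]) F x ^+ 2 = \int[mu]_(x in `[0, l]) ((f x ^+ 2 + (- 2 * v) * f x) + v ^+ 2).
  by apply: int_eq => x _; rewrite /F; ring.
rewrite (intD _ _ c5 (@cont1_cst R (v ^+ 2))) (intD _ _ cf2 c4) (intZ _ _ _ cf) int_cst ?(ltW l0) // subr0.
set X := \int[mu]_(x in _) f x; set Y := \int[mu]_(x in _) _.
rewrite -subr_ge0 (_ : _ - _ = (X - v * l) ^+ 2) ?sqr_ge0 //; ring.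
Qed.

End Wirtinger.

(** * Variances along the parallel circles *)

Section Variance.
Context {R : realType} (L M : R).
Notation mu := (@lebesgue_measure R).
Hypotheses (L0 : 0 <= L).
Implicit Types (x : R * R -> R) (c y : R -> R) (s t : R).

Definition slice_mean x t : R := \int[mu]_(s in `[0, L]) x (s, t).

(** [L ^+ 2] times the variance of [x] along the circle at height [t]; this normalization avoids
    divisions. *)
Definition variance x t : R := L * slice_mean (fun q => x q ^+ 2) t - slice_mean x t ^+ 2.

Lemma cont_slice_mean x : continuous x -> continuous (slice_mean x).
Proof. by move=> cx; exact: (@cont_int2 R (fun q => x (q.2, q.1)) 0 L (cont_swap cx)). Qed.

Lemma cont_variance x : continuous x -> continuous (variance x).
Proof.
move=> cx; have c1 := cont_slice_mean (cont2X (n := 2) cx); have c2 := cont_slice_mean cx.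
by apply: contB; [apply: cont1Z; exact: c1|exact: cont1X].
Qed.

Lemma int_sqr_diff y (v : R) : continuous y ->
  \int[mu]_(s in `[0, L]) (v - y s) ^+ 2 =
  L * v ^+ 2 - 2 * v * \int[mu]_(s in `[0, L]) y s + \int[mu]_(s in `[0, L]) y s ^+ 2.
Proof.
move=> cy; have cy2 : continuous (fun s => y s ^+ 2) by exact: cont1X.
have c1 : continuous (fun s => (- 2 * v) * y s) by apply: cont1Z; exact: cy.
have c2 : continuous (fun s => (- 2 * v) * y s + y s ^+ 2) by exact: cont1D.
have -> : \int[mu]_(s in `[0, L]) (v - y s) ^+ 2 = \int[mu]_(s in `[0, L]) (v ^+ 2 + ((- 2 * v) * y s + y s ^+ 2)).
  by apply: int_eq => s _; ring.
rewrite (intD _ _ (@cont1_cst R (v ^+ 2)) c2) (intD _ _ c1 cy2) (intZ _ _ _ cy) int_cst // subr0.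
ring.
Qed.

Let dens c x (q : R * R) : R :=
  c q.2 * (L * x q ^+ 2 - 2 * x q * slice_mean x q.2 + slice_mean (fun q => x q ^+ 2) q.2).

Let cont_dens c x : continuous c -> continuous x -> continuous (dens c x).
Proof.
move=> cc cx.
have c1 : continuous (fun q : R * R => slice_mean x q.2) := cont1snd (cont_slice_mean cx).
have c2 : continuous (fun q : R * R => slice_mean (fun q => x q ^+ 2) q.2) := cont1snd (cont_slice_mean (cont2X (n := 2) cx)).
have c3 : continuous (fun q : R * R => c q.2) := cont1snd cc.
apply: cont2M; first exact: c3.
apply: cont2D; last exact: c2.
apply: cont2D; first by apply: cont2M; [exact: cont2_cst|exact: cont2X].
apply: cont2N; apply: cont2M; last exact: c1.
by apply: cont2M; [exact: cont2_cst|exact: cx].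
Qed.

Lemma diff_inner c x s : continuous c -> continuous x ->
  \int[mu]_(s' in `[0, L]) \int[mu]_(t in `[0, M]) (c t * (x (s, t) - x (s', t)) ^+ 2) =
  \int[mu]_(t in `[0, M]) dens c x (s, t).
Proof.
move=> cc cx.
have c3 : continuous (fun q : R * R => c q.2) := cont1snd cc.
have c4 : continuous (fun q : R * R => x (s, q.2)) := cont1snd (cont_sec2 (x := s) cx).
have cD : continuous (fun q : R * R => c q.2 * (x (s, q.2) - x q) ^+ 2).
  by apply: cont2M; [exact: c3|apply: cont2X; apply: cont2D; [exact: c4|exact: cont2N]].
have -> := @int_swap R (fun q : R * R => c q.2 * (x (s, q.2) - x q) ^+ 2) 0 L 0 M cD.
apply: int_eq => t _; rewrite /dens /=.
have cy : continuous (fun s' => x (s', t)) := cont_sec1 (y := t) cx.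
have cy2 : continuous (fun s' => (x (s, t) - x (s', t)) ^+ 2).
  by apply: cont1X; apply: contB; [exact: cont1_cst|exact: cy].
by rewrite (intZ _ _ _ cy2) (int_sqr_diff (x (s, t)) cy).
Qed.

Lemma cont_diff_inner c x : continuous c -> continuous x ->
  continuous (fun s => \int[mu]_(s' in `[0, L]) \int[mu]_(t in `[0, M]) (c t * (x (s, t) - x (s', t)) ^+ 2)).
Proof.
move=> cc cx.
rewrite (_ : (fun s => _) = fun s => \int[mu]_(t in `[0, M]) dens c x (s, t)).
  exact: cont_int2 (cont_dens cc cx).
by apply/funext => s; exact: diff_inner.
Qed.

(** The variance as an average over pairs of points. An inequality for functions of [t] alone,
    applied to the difference of [x] between two parameters, becomes an inequality for variances. *)
Lemma diff_double c x : continuous c -> continuous x ->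
  \int[mu]_(s in `[0, L]) \int[mu]_(s' in `[0, L]) \int[mu]_(t in `[0, M]) (c t * (x (s, t) - x (s', t)) ^+ 2) =
  2 * \int[mu]_(t in `[0, M]) (c t * variance x t).
Proof.
move=> cc cx.
rewrite (_ : \int[mu]_(s in _) _ = \int[mu]_(s in `[0, L]) \int[mu]_(t in `[0, M]) dens c x (s, t)); last first.
  by apply: int_eq => s _; exact: diff_inner.
rewrite (int_swap _ _ _ _ (cont_dens cc cx)).
have cv : continuous (fun t => c t * variance x t) by apply: cont1M => //; exact: cont_variance.
rewrite -(intZ _ _ _ cv); apply: int_eq => t _; rewrite /dens /=.
set X := slice_mean x t; set Y := slice_mean _ t.
have cy : continuous (fun s' => x (s', t)) := cont_sec1 (y := t) cx.
have cy2 : continuous (fun s' => x (s', t) ^+ 2) by exact: cont1X.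
have -> : \int[mu]_(s in `[0, L]) (c t * (L * x (s, t) ^+ 2 - 2 * x (s, t) * X + Y)) =
    \int[mu]_(s in `[0, L]) ((c t * L * x (s, t) ^+ 2 + (- 2 * c t * X) * x (s, t)) + c t * Y).
  by apply: int_eq => s _; ring.
have c1 : continuous (fun s => c t * L * x (s, t) ^+ 2) by apply: cont1Z; exact: cy2.
have c2 : continuous (fun s => (- 2 * c t * X) * x (s, t)) by apply: cont1Z; exact: cy.
have c12 : continuous (fun s => c t * L * x (s, t) ^+ 2 + (- 2 * c t * X) * x (s, t)) by exact: cont1D.
rewrite (intD _ _ c12 (@cont1_cst R (c t * Y))) (intD _ _ c1 c2) (intZ _ _ _ cy2) (intZ _ _ _ cy) int_cst // subr0.
by rewrite -/(slice_mean x t) -/(slice_mean (fun q => x q ^+ 2) t) -/X -/Y /variance -/X -/Y; ring.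
Qed.

End Variance.

Section ConstantCurvature.
Context {R : realType} (Omega : set (R * R)) (K : convex_curve Omega).
Notation mu := (@lebesgue_measure R).
Notation L := (len K).
Notation ka := (ka K).
Notation nc := (nc K).
Notation nc_n := (nc_n K).
Notation nc_t := (nc_t K).
Variables (a b : R).
Hypothesis (Oab : Omega (a, b)).
Hypothesis (cvx : segment_closed Omega).
Variable k : R.
Hypotheses (k0 : 0 < k) (kaE : forall s, ka s = k).
Implicit Types (h : R * R -> R) (s t : R).

Let kL : k * L = 2 * pi.
Proof.
rewrite -(int_ka K) (_ : \int[mu]_(s in _) _ = \int[mu]_(s in `[0, L]) k).
  by rewrite int_cst ?subr0 // ltW // len_gt0.
by apply: int_eq => s _; exact: kaE.
Qed.

Lemma nc_wirtinger h t : smooth h -> 0 <= t ->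
  k ^+ 2 * variance L (nc h) t <= L * ((1 + k * t) ^+ 2 * slice_mean L (fun q => nc_t h q ^+ 2) t).
Proof.
move=> sh t0; have L0 := len_gt0 K.
have W := wirtinger (@nc_smooth_s R Omega K h t sh) L0 (fun s => nc_perE K h s t).
have e : 2 * pi / L = k by rewrite -kL mulfK // gt_eqF.
rewrite e in W; apply: (le_trans W); rewrite ler_pM2l //.
have ct : continuous (fun s => nc_t h (s, t) ^+ 2) by apply: cont1X; exact: cont_sec1 (cont_nc_t sh).
rewrite /slice_mean -(intZ _ _ _ ct) le_eqVlt; apply/orP; left; apply/eqP; apply: int_eq => s _.
have -> : derive1 (fun s => nc h (s, t)) s = (1 + ka s * t) * nc_t h (s, t).
  by rewrite derive1E; have D := nc_ide_s K s t sh; exact: derive_val.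
by rewrite kaE exprMn.
Qed.

(** The hypothesis is applied to [t |-> nc h (s, t) - nc h (s', t)] and averaged over [s] and [s'],
    which gives it for variances. Wirtinger's inequality bounds the angular variance term by the
    tangential energy. What the means add is nonnegative, except for the boundary mean, which is
    moved to the left. *)
Lemma energy_ge (alpha lam : R) h : lam <= 0 ->
  (forall phi (M0 M : R), smooth1 phi -> (forall t, M0 <= t -> phi t = 0) -> 0 < M0 < M ->
    0 <= radial_energy k phi M alpha lam) ->
  test_function setT h ->
  alpha * (\int[mu]_(s in `[0, L]) nc h (s, 0)) ^+ 2 <=
    L * energy Omega alpha lam h (partial 0 h) (partial 1 h) h.
Proof.
move=> l0 rad th; have sh := proj1 th; have L0 := len_gt0 K; have L0' := ltW L0.
have [M M1 [hM E]] := energy_nc K Oab cvx th.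
have M0 : 0 < M by lra.
have k0' := ltW k0.
pose r := radius_jac k.
have r0 t : 0 < r t := radius_jac_gt0 t k0'.
have cr : continuous r by exact: cont_radius_jac.
pose c2 t := - lam * r t + k ^+ 2 / r t.
have cc2 : continuous c2.
  by apply: cont1D; [apply: cont1Z; exact: cr|exact: cont_radius_jacV].
have cH : continuous (nc h) by exact: cont_nc (smooth_cont sh).
have cN : continuous (nc_n h) by exact: cont_nc_n.
have cT : continuous (nc_t h) by exact: cont_nc_t.
pose H0 (q : R * R) := nc h (q.1, 0).
have cH0 : continuous H0 by exact: cont1fst (cont_sec1 (y := 0) cH).
have c1 : continuous (fun _ : R => 1 : R) by exact: cont1_cst.
pose A s s' := \int[mu]_(t in `[0, M]) (r t * (nc_n h (s, t) - nc_n h (s', t)) ^+ 2).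
pose B s s' := \int[mu]_(t in `[0, M]) (c2 t * (nc h (s, t) - nc h (s', t)) ^+ 2).
(* The integral over [[0, 1]] of a function constant in [t] brings the boundary term under the same
   identity [diff_double]. *)
pose C s s' := \int[mu]_(t in `[0, 1]) (1 * (H0 (s, t) - H0 (s', t)) ^+ 2).
have cD (c : R -> R) (x : R * R -> R) s : continuous c -> continuous x ->
    continuous (fun q : R * R => c q.2 * (x (s, q.2) - x q) ^+ 2).
  move=> cc cx; apply: cont2M; first exact: cont1snd.
  by apply: cont2X; apply: cont2D; [exact: cont1snd (cont_sec2 (x := s) cx)|exact: cont2N].
have pos s s' : 0 <= A s s' + B s s' + alpha * C s s'.
  pose phi t := nc h (s, t) - nc h (s', t).
  have sphi : smooth1 phi.
    have s1 := @nc_smooth_t R Omega K h s sh; have s2 := @nc_smooth_t R Omega K h s' sh.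
    by apply/smooth1P => n t; apply: smatB; [exact: ((smooth1P _).1 s1)|exact: ((smooth1P _).1 s2)].
  have Dphi t : derive1 phi t = nc_n h (s, t) - nc_n h (s', t).
    by have D := ideB (nc_ide_t K s t sh) (nc_ide_t K s' t sh); rewrite derive1E; exact: derive_val.
  have phi0 t : M - 1 <= t -> phi t = 0 by move=> Mt; rewrite /phi !hM // subrr.
  have M01 : 0 < M - 1 < M by lra.
  have := rad phi (M - 1) M sphi phi0 M01; rewrite /radial_energy /pair_energy mul1r.
  have -> : C s s' = phi 0 ^+ 2.
    rewrite /C (@int_eq _ _ (fun=> phi 0 ^+ 2)); last by move=> t _; rewrite mul1r.
    by rewrite int_cst ?ler01 // subr0 mulr1.
  have cA : continuous (fun t => r t * (nc_n h (s, t) - nc_n h (s', t)) ^+ 2) := cont_sec2 (x := s') (@cD _ _ s cr cN).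
  have cB : continuous (fun t => c2 t * (nc h (s, t) - nc h (s', t)) ^+ 2) := cont_sec2 (x := s') (@cD _ _ s cc2 cH).
  rewrite /A /B -(intD _ _ cA cB) (_ : \int[mu]_(t in _) _ = \int[mu]_(t in `[0, M])
    (r t * (nc_n h (s, t) - nc_n h (s', t)) ^+ 2 + c2 t * (nc h (s, t) - nc h (s', t)) ^+ 2)) //.
  apply: int_eq => t /andP[t0 _]; rewrite /form_dens Dphi /c2 /phi -/(r t).
  have -> : 1 + t * k = r t by rewrite /r /radius_jac (max_idPl t0) mulrC.
  by ring.
have posI : 0 <= \int[mu]_(t in `[0, M]) (r t * variance L (nc_n h) t) +
    \int[mu]_(t in `[0, M]) (c2 t * variance L (nc h) t) + alpha * variance L H0 0.
  have cA s : continuous (A s) := @cont_int2 R _ 0 M (@cD _ _ s cr cN).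
  have cB s : continuous (B s) := @cont_int2 R _ 0 M (@cD _ _ s cc2 cH).
  have cC s : continuous (C s) := @cont_int2 R _ 0 1 (@cD _ _ s c1 cH0).
  have dA : continuous (fun s => \int[mu]_(s' in `[0, L]) A s s') := @cont_diff_inner R L M L0' _ _ cr cN.
  have dB : continuous (fun s => \int[mu]_(s' in `[0, L]) B s s') := @cont_diff_inner R L M L0' _ _ cc2 cH.
  have dC : continuous (fun s => \int[mu]_(s' in `[0, L]) C s s') := @cont_diff_inner R L 1 L0' _ _ c1 cH0.
  have eA := @diff_double R L M L0' _ _ cr cN; rewrite -/A in eA.
  have eB := @diff_double R L M L0' _ _ cc2 cH; rewrite -/B in eB.
  have eC := @diff_double R L 1 L0' _ _ c1 cH0; rewrite -/C in eC.
  have v1 : \int[mu]_(t in `[0, 1]) (1 * variance L H0 t) = variance L H0 0.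
    rewrite (_ : \int[mu]_(t in _) _ = \int[mu]_(t in `[0, 1]) variance L H0 0).
      by rewrite int_cst ?ler01 // subr0 mulr1.
    by apply: int_eq => t _; rewrite mul1r.
  rewrite v1 in eC.
  have : \int[mu]_(s in `[0, L]) \int[mu]_(s' in `[0, L]) A s s' = 2 * \int[mu]_(t in `[0, M]) (r t * variance L (nc_n h) t) := eA.
  have : \int[mu]_(s in `[0, L]) \int[mu]_(s' in `[0, L]) B s s' = 2 * \int[mu]_(t in `[0, M]) (c2 t * variance L (nc h) t) := eB.
  have : \int[mu]_(s in `[0, L]) \int[mu]_(s' in `[0, L]) C s s' = 2 * variance L H0 0 := eC.
  clear eA eB eC.
  move: (\int[mu]_(t in `[0, M]) (r t * variance L (nc_n h) t)) (\int[mu]_(t in `[0, M]) (c2 t * variance L (nc h) t))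
    (variance L H0 0) => VA VB VC eC eB eA.
  clearbody A B C.
  have P : 0 <= \int[mu]_(s in `[0, L]) \int[mu]_(s' in `[0, L]) (A s s' + B s s' + alpha * C s s').
    by apply: int_ge0 => s _; apply: int_ge0 => s' _; exact: pos.
  have cAB s : continuous (fun s' => A s s' + B s s') := cont1D (@cA s) (@cB s).
  have caC s : continuous (fun s' => alpha * C s s').
    by apply: cont1Z; exact: cC.
  have E1 : \int[mu]_(s in `[0, L]) \int[mu]_(s' in `[0, L]) (A s s' + B s s' + alpha * C s s') =
      \int[mu]_(s in `[0, L]) (\int[mu]_(s' in `[0, L]) A s s' + \int[mu]_(s' in `[0, L]) B s s' +
        alpha * \int[mu]_(s' in `[0, L]) C s s').
    apply: int_eq => s _.
    by rewrite (intD _ _ (@cAB s) (@caC s)) (intD _ _ (@cA s) (@cB s)) (intZ _ _ _ (@cC s)).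
  have dAB : continuous (fun s => \int[mu]_(s' in `[0, L]) A s s' + \int[mu]_(s' in `[0, L]) B s s') := cont1D dA dB.
  have daC : continuous (fun s => alpha * \int[mu]_(s' in `[0, L]) C s s').
    by apply: cont1Z; exact: dC.
  move: P; rewrite E1 (intD _ _ dAB daC) (intD _ _ dA dB) (intZ _ _ _ dC) eA eB eC.
  by rewrite (mulrCA alpha) -!mulrDr pmulr_rge0.
rewrite E.
have cvN := @cont_variance R L _ cN; have cvH := @cont_variance R L _ cH.
have eN : continuous (fun t => r t * variance L (nc_n h) t) := cont1M cr cvN.
have eH : continuous (fun t => c2 t * variance L (nc h) t) := cont1M cc2 cvH.
have mN2 := @cont_slice_mean R L _ (cont2X (n := 2) cN).
have mH2 := @cont_slice_mean R L _ (cont2X (n := 2) cH).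
have mT2 := @cont_slice_mean R L _ (cont2X (n := 2) cT).
pose D t := r t * (slice_mean L (fun q => nc_n h q ^+ 2) t + slice_mean L (fun q => nc_t h q ^+ 2) t -
  lam * slice_mean L (fun q => nc h q ^+ 2) t).
have cDD : continuous D.
  apply: cont1M; first exact: cr.
  apply: contB; first exact: cont1D.
  by apply: cont1Z; exact: mH2.
have -> : \int[mu]_(t in `[0, M]) \int[mu]_(s in `[0, L])
      ((nc_n h (s, t) ^+ 2 + nc_t h (s, t) ^+ 2 - lam * nc h (s, t) ^+ 2) * (1 + ka s * t)) =
    \int[mu]_(t in `[0, M]) D t.
  apply: int_eq => t /andP[t0 _]; rewrite /D /slice_mean.
  have sN : continuous (fun s => nc_n h (s, t) ^+ 2) by apply: cont1X; exact: cont_sec1.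
  have sT : continuous (fun s => nc_t h (s, t) ^+ 2) by apply: cont1X; exact: cont_sec1.
  have sH : continuous (fun s => nc h (s, t) ^+ 2) by apply: cont1X; exact: cont_sec1.
  have slH : continuous (fun s => lam * nc h (s, t) ^+ 2) by apply: cont1Z; exact: sH.
  have sNT : continuous (fun s => nc_n h (s, t) ^+ 2 + nc_t h (s, t) ^+ 2) by exact: cont1D.
  have sA : continuous (fun s => nc_n h (s, t) ^+ 2 + nc_t h (s, t) ^+ 2 - lam * nc h (s, t) ^+ 2) by exact: contB.
  rewrite -(intZ _ _ _ sH) -(intD _ _ sN sT) -(intB _ _ sNT slH) -(intZ _ _ _ sA).
  by apply: int_eq => s _; rewrite kaE /r /radius_jac (max_idPl t0) mulrC.
(* Pointwise in [t], the difference of the two sides is a sum of the squared means, with nonnegative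
   weights because [lam <= 0], and of the deficit in Wirtinger's inequality. *)
have key : \int[mu]_(t in `[0, M]) (r t * variance L (nc_n h) t + c2 t * variance L (nc h) t) <=
    \int[mu]_(t in `[0, M]) (L * D t).
  apply: int_le; [exact: cont1D|by apply: cont1Z; exact: cDD|].
  move=> t /andP[t0 _]; have W := nc_wirtinger sh t0.
  have rE : 1 + k * t = r t by rewrite /r /radius_jac (max_idPl t0).
  rewrite rE in W; have rt := r0 t; rewrite /D /c2.
  move: W; rewrite /variance.
  move: (slice_mean L (fun q => nc_n h q ^+ 2) t) (slice_mean L (fun q => nc_t h q ^+ 2) t)
    (slice_mean L (fun q => nc h q ^+ 2) t) (slice_mean L (nc_n h) t) (slice_mean L (nc h) t) => N2 T2 H2 mN mH W.
  rewrite -subr_ge0.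
  have -> : L * (r t * (N2 + T2 - lam * H2)) - (r t * (L * N2 - mN ^+ 2) + (- lam * r t + k ^+ 2 / r t) * (L * H2 - mH ^+ 2)) =
      r t * mN ^+ 2 + - lam * r t * mH ^+ 2 + (L * (r t ^+ 2 * T2) - k ^+ 2 * (L * H2 - mH ^+ 2)) / r t.
    by field; rewrite gt_eqF.
  apply: addr_ge0; last by apply: divr_ge0; [rewrite subr_ge0|exact: ltW].
  by apply: addr_ge0; rewrite mulr_ge0 ?sqr_ge0 ?(ltW rt) // mulr_ge0 ?(ltW rt) // oppr_ge0.
rewrite (intD _ _ eN eH) (intZ _ _ _ cDD) in key.
rewrite mulrDr.
have -> : L * (alpha * \int[mu]_(s in `[0, L]) nc h (s, 0) ^+ 2) =
    alpha * variance L H0 0 + alpha * (\int[mu]_(s in `[0, L]) nc h (s, 0)) ^+ 2.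
  by rewrite /variance /slice_mean /H0 /=; ring.
by rewrite addrA lerDr; apply: (le_trans posI); rewrite lerD2r; exact: key.
Qed.

End ConstantCurvature.

Section SquareNormForm.
Context d (T : measurableType d) (R : realType) (m : {measure set T -> \bar R}).
Variable D : set T.
Hypothesis mD : measurable D.
Implicit Types (f g : T -> R) (x y : R).

Lemma L2_lin f g x y : L2 m D f -> L2 m D g -> L2 m D (fun p => x * f p + y * g p).
Proof.
move=> /(L2P m mD)[mf ff] /(L2P m mD)[mg fg].
have mxf : measurable_fun D (fun p => x * f p) by exact: measurable_funM.
have myg : measurable_fun D (fun p => y * g p) by exact: measurable_funM.
apply/(L2P m mD); split; first exact: measurable_funD.
apply: le_lt_trans (sqnD m mD mxf myg) _.
have Z (k : R) (w : T -> R) : measurable_fun D w -> (sqn m D w < +oo)%E -> (2%:E * sqn m D (fun p => (k * w p)%R) < +oo)%E.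
  move=> mw fw; rewrite (sqnZ m mD k mw); apply: lte_mul_pinfty; rewrite ?lee_fin //.
  by apply: lte_mul_pinfty; rewrite ?lee_fin ?sqr_ge0.
by apply: lte_add_pinfty; exact: Z.
Qed.

Lemma sqn_quad f g : L2 m D f -> L2 m D g -> exists B : R, forall x y,
  fine (sqn m D (fun p => x * f p + y * g p)) =
  x ^+ 2 * fine (sqn m D f) + 2 * x * y * B + y ^+ 2 * fine (sqn m D g).
Proof.
move=> Lf Lg; exists (\int[m]_(p in D) (f p * g p)) => x y.
have i1 := L2_mul_integrable mD Lf Lf; have i2 := L2_mul_integrable mD Lf Lg.
have i3 := L2_mul_integrable mD Lg Lg.
have Z (c : R) (h : T -> R) : m.-integrable D (EFin \o h) -> m.-integrable D (EFin \o (fun p => c * h p)).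
  by move=> ih; have := integrableZl mD c ih; apply: eq_integrable => // p _; rewrite /= EFinM.
have E h : fine (sqn m D h) = \int[m]_(p in D) (h p * h p) by [].
rewrite !E -(RintegralZl _ mD i1) // -(RintegralZl _ mD i2) // -(RintegralZl _ mD i3) //.
have j12 : m.-integrable D (EFin \o (fun p => x ^+ 2 * (f p * f p) + 2 * x * y * (f p * g p))).
  by have := integrableD mD (Z (x ^+ 2) _ i1) (Z (2 * x * y) _ i2); apply: eq_integrable => // p _; rewrite /= EFinD.
rewrite -(RintegralD mD (Z _ _ i1) (Z _ _ i2)) -(RintegralD mD j12 (Z _ _ i3)).
by apply: eq_Rintegral => p _; ring.
Qed.

Lemma cvg_L2_lin (f_ g_ : (T -> R)^nat) f g x y :
  (forall n, measurable_fun D (f_ n)) -> (forall n, measurable_fun D (g_ n)) ->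
  measurable_fun D f -> measurable_fun D g ->
  cvg_L2 m D f_ f -> cvg_L2 m D g_ g ->
  cvg_L2 m D (fun n p => x * f_ n p + y * g_ n p) (fun p => x * f p + y * g p).
Proof.
move=> mf_ mg_ mf mg /cvg_L2P F /cvg_L2P G; apply/cvg_L2P.
apply/cvge0P => [n|e e0]; first exact: sqn_ge0.
pose C := 2 * (x ^+ 2 + y ^+ 2) + 1.
have x2 := sqr_ge0 x; have y2 := sqr_ge0 y.
have C0 : 0 < C by rewrite /C; lra.
have eC : 0 < e / C by exact: divr_gt0.
have F1 := (cvge0P (fun n => sqn_ge0 m D _)).1 F _ eC.
have G1 := (cvge0P (fun n => sqn_ge0 m D _)).1 G _ eC.
near=> n.
have Fn : (sqn m D (fun p => (f_ n p - f p)%R) < (e / C)%:E)%E by near: n.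
have Gn : (sqn m D (fun p => (g_ n p - g p)%R) < (e / C)%:E)%E by near: n.
have mdf : measurable_fun D (fun p => f_ n p - f p) by exact: measurable_funB.
have mdg : measurable_fun D (fun p => g_ n p - g p) by exact: measurable_funB.
rewrite (@sqn_eq _ _ _ m D _ (fun p => x * (f_ n p - f p) + y * (g_ n p - g p))); last by move=> p _; ring.
apply: le_lt_trans (sqnD m mD _ _) _; [exact: measurable_funM|exact: measurable_funM|].
rewrite (sqnZ m mD x mdf) (sqnZ m mD y mdg).
apply: (@le_lt_trans _ _ (2%:E * ((x ^+ 2)%:E * (e / C)%:E) + 2%:E * ((y ^+ 2)%:E * (e / C)%:E))%E).
  by apply: leeD; apply: lee_wpmul2l; rewrite ?lee_fin //; apply: lee_wpmul2l; rewrite ?lee_fin //; exact: ltW.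
rewrite -!EFinM -EFinD lte_fin (_ : _ + _ = e - e / C); last by rewrite /C; field; rewrite gt_eqF.
by rewrite gtrBl.
Unshelve. all: by end_near. Qed.

End SquareNormForm.

(** Sylvester's criterion. Its strict inequalities survive small perturbations of the entries, so
    negative definiteness passes from Sobolev functions to approximating test functions. *)
Lemma neg_def_form {R : realFieldType} (a b c : R) :
  (forall x y, (x, y) != (0, 0) -> x ^+ 2 * a + 2 * x * y * b + y ^+ 2 * c < 0) <-> a < 0 /\ 0 < a * c - b ^+ 2.
Proof.
split=> [H|[a0 d0] x y xy].
  have a0 : a < 0 by have := H 1 0; rewrite xpair_eqE oner_eq0 => /(_ isT); lra.
  split=> //; have := H (- b) a; rewrite xpair_eqE (lt_eqF a0) andbF => /(_ isT).
  have -> : (- b) ^+ 2 * a + 2 * (- b) * a * b + a ^+ 2 * c = a * (a * c - b ^+ 2) by ring.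
  by rewrite nmulr_rlt0.
rewrite -(nmulr_rgt0 _ a0).
have -> : a * (x ^+ 2 * a + 2 * x * y * b + y ^+ 2 * c) = (a * x + b * y) ^+ 2 + (a * c - b ^+ 2) * y ^+ 2 by ring.
case: (eqVneq y 0) xy => [->|y0 _].
  rewrite xpair_eqE eqxx andbT => x0.
  by rewrite expr0n mulr0 mulr0 !addr0 exprn_even_gt0 //= mulf_neq0 // lt_eqF.
by rewrite ltr_wpDl ?sqr_ge0 // mulr_gt0 // exprn_even_gt0.
Qed.

Section SobolevLinear.
Context {R : realType} (Omega : set (R * R)) (K : convex_curve Omega).
Notation mR := (measurableTypeR R).
Notation ext := (exterior Omega).
Notation bd := (boundary Omega).
Notation hT := (caratheodory_type (hausdorff_outer R)).
Implicit Types (u v : R * R -> R).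

Lemma H1_lin u v (x y : R) : H1 ext u -> H1 ext v -> H1 ext (x \*o u \+ y \*o v).
Proof.
have mE : measurable (ext : set (mR * mR)) by exact: measurable_ext.
move=> [Lu Du] [Lv Dv]; split; first exact: (L2_lin mE x y Lu Lv).
move=> i; have [g Hg] := Du i; have [h Hh] := Dv i.
by exists (fun p => x * g p + y * h p); exact: is_weak_partial_lin.
Qed.

Lemma cvg_L2_ae d (T : measurableType d) (m : {measure set T -> \bar R}) (D : set T) (f_ : (T -> R)^nat) (f g : T -> R) :
  measurable D -> (forall n, measurable_fun D (f_ n)) -> measurable_fun D f -> measurable_fun D g ->
  {ae m, forall p, D p -> f p = g p} -> cvg_L2 m D f_ f -> cvg_L2 m D f_ g.
Proof.
move=> mD mf_ mf mg fg /cvg_L2P H; apply/cvg_L2P; rewrite (_ : (fun n => _) = (fun n => sqn m D (fun x => f_ n x - f x))) //.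
apply/funext => n; apply: (sqn_ae mD); [exact: measurable_funB|exact: measurable_funB|].
by apply: negligibleS fg => p /= H1 H2; apply: H1 => Dp; rewrite H2.
Qed.

Lemma trace_lin u v (t t' : R * R -> R) (x y : R) : H1 ext u -> H1 ext v ->
  is_trace Omega u t -> is_trace Omega v t' ->
  is_trace Omega (x \*o u \+ y \*o v) (fun p => x * t p + y * t' p).
Proof.
move=> Hu Hv [Lt [f_ [tf fu df ft]]] [Lt' [g_ [tg gv dg gt]]].
have mE : measurable (ext : set (mR * mR)) by exact: measurable_ext.
have mB := cara_boundary K; have oE : open ext by exact: open_exterior.
split; first exact: L2_lin.
have tw n : test_function setT (fun p => x * f_ n p + y * g_ n p) by exact: test_lin.
have mfE (f : R * R -> R) : test_function setT f -> measurable_fun (ext : set (mR * mR)) f.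
  by move=> Tf; exact: L2_measurable (proj1 (test_L2 mE Tf)).
have mdE (f : R * R -> R) i : test_function setT f -> measurable_fun (ext : set (mR * mR)) (partial i f).
  by move=> Tf; exact: L2_measurable ((proj2 (test_L2 mE Tf)) i).
have mfB (f : R * R -> R) : test_function setT f -> measurable_fun (bd : set hT) f.
  by move=> Tf; exact: L2_measurable (test_bd_L2 K Tf).
exists (fun n p => x * f_ n p + y * g_ n p); split; first exact: tw.
- apply: cvg_L2_lin => //; [by move=> n; exact: mfE|by move=> n; exact: mfE| |].
    exact: L2_measurable (proj1 Hu).
  exact: L2_measurable (proj1 Hv).
- move=> i; have Wu := weak_partialP ((proj2 Hu) i); have Wv := weak_partialP ((proj2 Hv) i).
  have W := is_weak_partial_lin x y mE (proj1 Hu) (proj1 Hv) Wu Wv.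
  have W' := weak_partialP (ex_intro _ _ W).
  have mW := L2_measurable mE (proj1 W); have mW' := L2_measurable mE (proj1 W').
  apply: (cvg_L2_ae mE _ mW mW'); first by move=> n; exact: mdE.
    exact: weak_partial_uniq oE W W'.
  rewrite (_ : (fun n => _) = (fun n p => x * partial i (f_ n) p + y * partial i (g_ n) p)); last first.
    by apply/funext => n; apply/funext => p; rewrite partial_lin //; [exact: proj1 (tf n)|exact: proj1 (tg n)].
  apply: cvg_L2_lin => //; [by move=> n; exact: mdE|by move=> n; exact: mdE| |].
    exact: L2_measurable (proj1 Wu).
  exact: L2_measurable (proj1 Wv).
- apply: cvg_L2_lin => //; [by move=> n; exact: mfB|by move=> n; exact: mfB| |].
    exact: L2_measurable mB Lt.
  exact: L2_measurable mB Lt'.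
Qed.

End SobolevLinear.

(** * From planes of negative energy to radial profiles *)

Section DiskConverse.
Context {R : realType} (Omega : set (R * R)) (K : convex_curve Omega).
Notation mu := (@lebesgue_measure R).
Notation mR := (measurableTypeR R).
Notation L := (len K).
Notation ka := (ka K).
Notation nc := (nc K).
Notation hm := (@arclength R).
Notation ext := (exterior Omega).
Notation bd := (boundary Omega).
Notation hT := (caratheodory_type (hausdorff_outer R)).
Variables (a b : R).
Hypothesis (Oab : Omega (a, b)).
Hypothesis (cvx : segment_closed Omega).
Variable k : R.
Hypotheses (k0 : 0 < k) (kaE : forall s, ka s = k).
Variables (alpha lam : R).
Hypothesis lam0 : lam <= 0.
Implicit Types (u v f g : R * R -> R).

Let mE : measurable (ext : set (mR * mR)). Proof. exact: measurable_ext. Qed.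
Let mB := cara_boundary K.

Lemma energy_quad u v u0 v0 u1 v1 t t' :
  L2 (area R) ext u -> L2 (area R) ext v -> L2 (area R) ext u0 -> L2 (area R) ext v0 ->
  L2 (area R) ext u1 -> L2 (area R) ext v1 -> L2 hm (bd : set hT) t -> L2 hm (bd : set hT) t' ->
  exists B : R, forall x y : R,
    energy Omega alpha lam (fun p => x * u p + y * v p) (fun p => x * u0 p + y * v0 p)
      (fun p => x * u1 p + y * v1 p) (fun p => x * t p + y * t' p) =
    x ^+ 2 * energy Omega alpha lam u u0 u1 t + 2 * x * y * B + y ^+ 2 * energy Omega alpha lam v v0 v1 t'.
Proof.
move=> Lu Lv Lu0 Lv0 Lu1 Lv1 Lt Lt'.
have [B E] := sqn_quad mE Lu Lv; have [B0 E0] := sqn_quad mE Lu0 Lv0.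
have [B1 E1] := sqn_quad mE Lu1 Lv1; have [Bt Et] := sqn_quad mB Lt Lt'.
exists (B0 + B1 + alpha * Bt - lam * B) => x y; rewrite /energy E E0 E1 Et; ring.
Qed.

Lemma test_energy_quad f g : test_function setT f -> test_function setT g ->
  exists B : R, forall x y : R, let h p := x * f p + y * g p in
    energy Omega alpha lam h (partial 0 h) (partial 1 h) h =
    x ^+ 2 * energy Omega alpha lam f (partial 0 f) (partial 1 f) f + 2 * x * y * B +
    y ^+ 2 * energy Omega alpha lam g (partial 0 g) (partial 1 g) g.
Proof.
move=> tf tg; have [Lf Df] := test_L2 mE tf; have [Lg Dg] := test_L2 mE tg.
have [B H] := energy_quad Lf Lg (Df 0) (Dg 0) (Df 1) (Dg 1) (test_bd_L2 K tf) (test_bd_L2 K tg).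
exists B => x y /=; rewrite -H; congr energy; apply/funext => p.
  by rewrite partial_lin //; [exact: proj1 tf|exact: proj1 tg].
by rewrite partial_lin //; [exact: proj1 tf|exact: proj1 tg].
Qed.

Definition bd_mean f : R := \int[mu]_(s in `[0, L]) nc f (s, 0).

Lemma bd_mean_lin f g (x y : R) : smooth f -> smooth g ->
  bd_mean (fun p => x * f p + y * g p) = x * bd_mean f + y * bd_mean g.
Proof.
move=> sf sg; have cf : continuous (fun s => nc f (s, 0)) := cont_sec1 (y := 0) (@cont_nc R Omega K _ (smooth_cont sf)).
have cg : continuous (fun s => nc g (s, 0)) := cont_sec1 (y := 0) (@cont_nc R Omega K _ (smooth_cont sg)).
have cxf : continuous (fun s => x * nc f (s, 0)) by apply: cont1Z; exact: cf.
have cyg : continuous (fun s => y * nc g (s, 0)) by apply: cont1Z; exact: cg.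
by rewrite /bd_mean -(intZ _ _ _ cf) -(intZ _ _ _ cg) -(intD _ _ cxf cyg).
Qed.

(* Apply [energy_ge] to a nonzero combination with zero mean on the boundary. *)
Lemma test_energy_not_neg f g :
  (forall phi (M0 M : R), smooth1 phi -> (forall t, M0 <= t -> phi t = 0) -> 0 < M0 < M ->
    0 <= radial_energy k phi M alpha lam) ->
  test_function setT f -> test_function setT g ->
  exists x y : R, (x, y) != (0, 0) /\ let h p := x * f p + y * g p in
    0 <= energy Omega alpha lam h (partial 0 h) (partial 1 h) h.
Proof.
move=> rad tf tg.
have [x [y [xy Exy]]] : exists x y : R, (x, y) != (0, 0) /\ x * bd_mean f + y * bd_mean g = 0.
  case: (eqVneq (bd_mean f) 0) => [E|E]; last first.
    exists (bd_mean g), (- bd_mean f); split; last by ring.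
    by rewrite xpair_eqE oppr_eq0 (negbTE E) andbF.
  by exists 1, 0; rewrite xpair_eqE oner_eq0 E; split=> //; ring.
exists x, y; split=> //=.
have th : test_function setT (fun p => x * f p + y * g p) by exact: test_lin.
have := energy_ge Oab cvx k0 kaE lam0 rad th.
rewrite -/(bd_mean _) bd_mean_lin ?Exy; [|exact: proj1 tf|exact: proj1 tg].
by rewrite expr0n mulr0 pmulr_rge0 // len_gt0.
Qed.

Lemma energy_cvg (f_ : (R * R -> R)^nat) (u u0 u1 t : R * R -> R) : (forall n, test_function setT (f_ n)) ->
  L2 (area R) ext u -> L2 (area R) ext u0 -> L2 (area R) ext u1 -> L2 hm (bd : set hT) t ->
  cvg_L2 (area R) ext f_ u -> cvg_L2 (area R) ext (fun n => partial 0 (f_ n)) u0 ->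
  cvg_L2 (area R) ext (fun n => partial 1 (f_ n)) u1 -> cvg_L2 hm (bd : set hT) f_ t ->
  (fun n => energy Omega alpha lam (f_ n) (partial 0 (f_ n)) (partial 1 (f_ n)) (f_ n)) @ \oo -->
    energy Omega alpha lam u u0 u1 t.
Proof.
move=> tf Lu Lu0 Lu1 Lt fu fu0 fu1 ft.
have mf n : measurable_fun (ext : set (mR * mR)) (f_ n).
  by exact: L2_measurable (proj1 (test_L2 mE (tf n))).
have md i n : measurable_fun (ext : set (mR * mR)) (partial i (f_ n)).
  by exact: L2_measurable ((proj2 (test_L2 mE (tf n))) i).
have mb n : measurable_fun (bd : set hT) (f_ n).
  by exact: L2_measurable (test_bd_L2 K (tf n)).
have C := sqn_cvg mE Lu mf fu; have C0 := sqn_cvg mE Lu0 (md 0) fu0.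
have C1 := sqn_cvg mE Lu1 (md 1) fu1; have Ct := sqn_cvg mB Lt mb ft.
rewrite /energy; apply: cvgB; last exact: cvgMl_tmp C.
by apply: cvgD; [exact: cvgD C0 C1|exact: cvgMl_tmp Ct].
Qed.

(** On a plane with quotients below [lam] the energy is negative definite, and it stays so on the
    span of test functions close to a basis. By [test_energy_not_neg] that is impossible if all
    radial energies are nonnegative. *)
Lemma disk_converse : (lambda2 alpha Omega < lam%:E)%E ->
  exists phi (M0 M : R), [/\ smooth1 phi, forall t, M0 <= t -> phi t = 0, 0 < M0 < M &
    radial_energy k phi M alpha lam < 0].
Proof.
move=> /ereal_inf_lt[_ [P [u [v [Hu Hv indep ->]]] <-] supP].
apply: contrapT => nrad.
have rad phi (M0 M : R) : smooth1 phi -> (forall t, M0 <= t -> phi t = 0) -> 0 < M0 < M ->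
    0 <= radial_energy k phi M alpha lam.
  move=> s1 s2 s3; rewrite leNgt; apply/negP => H; apply: nrad; exists phi, M0, M; by split.
have nonnull (x y : R) : (x, y) != (0, 0) -> ~ null ext (x \*o u \+ y \*o v).
  by move=> xy /indep[x0 y0]; move: xy; rewrite x0 y0 eqxx.
have ray (x y : R) : (x, y) != (0, 0) -> rayleigh Omega alpha (x \*o u \+ y \*o v) < lam.
  move=> xy; rewrite -lte_fin; apply: le_lt_trans supP; apply: ereal_sup_ubound.
  exists (x \*o u \+ y \*o v) => //; split; last exact: nonnull.
  by exists x, y.
(* A quotient below [lam <= 0] is negative, which cannot happen without a trace. *)
have tr w : rayleigh Omega alpha w < lam -> exists t, is_trace Omega w t.
  move=> H; apply: contrapT => nt; by have := rayleigh_no_trace alpha nt; rewrite leNgt (lt_le_trans H lam0).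
have [tu Htu] : exists t, is_trace Omega u t.
  apply: tr; have := ray 1 0; rewrite xpair_eqE oner_eq0 => /(_ isT).
  by rewrite (_ : 1 \*o u \+ 0 \*o v = u) //; apply/funext => p /=; ring.
have [tv Htv] : exists t, is_trace Omega v t.
  apply: tr; have := ray 0 1; rewrite xpair_eqE oner_eq0 andbF => /(_ isT).
  by rewrite (_ : 0 \*o u \+ 1 \*o v = v) //; apply/funext => p /=; ring.
have Wu i := weak_partialP ((proj2 Hu) i); have Wv i := weak_partialP ((proj2 Hv) i).
have [Ltu [f_ [tf fu df ft]]] := Htu; have [Ltv [g_ [tg gv dg gt]]] := Htv.
have [B EB] := energy_quad (proj1 Hu) (proj1 Hv) (proj1 (Wu 0)) (proj1 (Wv 0)) (proj1 (Wu 1)) (proj1 (Wv 1)) Ltu Ltv.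
set qa := energy _ _ _ u _ _ _ in EB; set qc := energy _ _ _ v _ _ _ in EB.
have [qa0 qd0] : qa < 0 /\ 0 < qa * qc - B ^+ 2.
  apply/neg_def_form => x y xy; rewrite -EB.
  have Hw := H1_lin x y Hu Hv; have Tw := trace_lin K x y Hu Hv Htu Htv.
  have W i := is_weak_partial_lin x y mE (proj1 Hu) (proj1 Hv) (Wu i) (Wv i).
  have := ray x y xy; rewrite (rayleighE K Oab cvx alpha Hw (W 0) (W 1) Tw).
  have N0 : 0 < fine (sqn (area R) ext (x \*o u \+ y \*o v)).
    have [_ finw] := (L2P _ mE _).1 (proj1 Hw).
    have finw' : sqn (area R) ext (x \*o u \+ y \*o v) \is a fin_num by rewrite ge0_fin_numE // sqn_ge0.
    rewrite lt_neqAle fine_ge0 ?sqn_ge0 // andbT eq_sym; apply/eqP => H; apply: (nonnull x y xy).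
    by apply/(null_sqn (proj1 Hw)); rewrite -(fineK finw') H.
  by rewrite ltr_pdivrMr // -subr_lt0.
pose En (x y : R) n := let h p := x * f_ n p + y * g_ n p in energy Omega alpha lam h (partial 0 h) (partial 1 h) h.
have mfE (f : R * R -> R) : L2 (area R) ext f -> measurable_fun (ext : set (mR * mR)) f by exact: L2_measurable.
have mfB (f : R * R -> R) : L2 hm (bd : set hT) f -> measurable_fun (bd : set hT) f by exact: L2_measurable.
have Tf n := test_L2 mE (tf n); have Tg n := test_L2 mE (tg n).
have En_cvg x y : En x y @ \oo --> x ^+ 2 * qa + 2 * x * y * B + y ^+ 2 * qc.
  rewrite -EB; apply: energy_cvg.
  - by move=> n; exact: test_lin.
  - exact: L2_lin (proj1 Hu) (proj1 Hv).
  - exact: L2_lin (proj1 (Wu 0)) (proj1 (Wv 0)).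
  - exact: L2_lin (proj1 (Wu 1)) (proj1 (Wv 1)).
  - exact: L2_lin Ltu Ltv.
  - apply: (cvg_L2_lin mE _ _ _ _ (mfE _ (proj1 Hu)) (mfE _ (proj1 Hv)) fu gv).
      by move=> n; exact: mfE (proj1 (Tf n)).
    by move=> n; exact: mfE (proj1 (Tg n)).
  - rewrite (_ : (fun n => _) = (fun n p => x * partial 0 (f_ n) p + y * partial 0 (g_ n) p)); last first.
      by apply/funext => n; apply/funext => p; rewrite partial_lin //; [exact: proj1 (tf n)|exact: proj1 (tg n)].
    apply: (cvg_L2_lin mE _ _ _ _ (mfE _ (proj1 (Wu 0))) (mfE _ (proj1 (Wv 0))) (df 0) (dg 0)).
      by move=> n; exact: mfE (proj2 (Tf n) 0).
    by move=> n; exact: mfE (proj2 (Tg n) 0).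
  - rewrite (_ : (fun n => _) = (fun n p => x * partial 1 (f_ n) p + y * partial 1 (g_ n) p)); last first.
      by apply/funext => n; apply/funext => p; rewrite partial_lin //; [exact: proj1 (tf n)|exact: proj1 (tg n)].
    apply: (cvg_L2_lin mE _ _ _ _ (mfE _ (proj1 (Wu 1))) (mfE _ (proj1 (Wv 1))) (df 1) (dg 1)).
      by move=> n; exact: mfE (proj2 (Tf n) 1).
    by move=> n; exact: mfE (proj2 (Tg n) 1).
  - apply: (cvg_L2_lin mB _ _ _ _ (mfB _ Ltu) (mfB _ Ltv) ft gt).
      by move=> n; exact: mfB (test_bd_L2 K (tf n)).
    by move=> n; exact: mfB (test_bd_L2 K (tg n)).
have quad n : exists Bn : R, forall x y, En x y n = x ^+ 2 * En 1 0 n + 2 * x * y * Bn + y ^+ 2 * En 0 1 n.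
  have [Bn HB] := test_energy_quad (tf n) (tg n); exists Bn => x y; rewrite /En !HB; ring.
(* Polarization recovers the cross coefficient from values of the form, so its convergence follows
   from that of the energies. *)
pose bn n := (En 1 1 n - En 1 0 n - En 0 1 n) / 2.
have c10 := En_cvg 1 0; have c01 := En_cvg 0 1; have c11 := En_cvg 1 1.
have e10 : 1 ^+ 2 * qa + 2 * 1 * 0 * B + 0 ^+ 2 * qc = qa by ring.
have e01 : 0 ^+ 2 * qa + 2 * 0 * 1 * B + 1 ^+ 2 * qc = qc by ring.
rewrite e10 in c10; rewrite e01 in c01.
have cb : bn @ \oo --> B.
  have -> : B = (1 ^+ 2 * qa + 2 * 1 * 1 * B + 1 ^+ 2 * qc - qa - qc) / 2 by field.
  exact: cvgM (cvgB (cvgB c11 c10) c01) (cvg_cst _).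
have cd : (fun n => En 1 0 n * En 0 1 n - bn n ^+ 2) @ \oo --> qa * qc - B ^+ 2.
  exact: cvgB (cvgM c10 c01) (cvgM cb cb).
have n1 := cvgr_lt qa c10 0 qa0; have n2 := cvgr_gt _ cd 0 qd0.
have [N1 _ /= H1] := n1 _; have [N2 _ /= H2] := n2 _.
pose N := maxn N1 N2.
have HN : En 1 0 N < 0 /\ 0 < En 1 0 N * En 0 1 N - bn N ^+ 2.
  by split; [apply: H1|apply: H2]; rewrite /N /= ?leq_maxl ?leq_maxr.
have [Bn HB] := quad N.
have bnE : bn N = Bn by rewrite /bn HB; field.
rewrite bnE in HN; have [x [y [xy E0]]] := test_energy_not_neg rad (tf N) (tg N).
have := (neg_def_form (En 1 0 N) Bn (En 0 1 N)).2 HN x y xy; rewrite -HB.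
by rewrite ltNge => /negP; apply; exact: E0.
Qed.

End DiskConverse.

Lemma ide_sign {R : realType} (f : R -> R) (x d e : R) : is_deriv x f d -> 0 < e ->
  (forall t, x < t < x + e -> f t <= f x) -> d <= 0.
Proof.
move=> D e0 H; rewrite leNgt; apply/negP => d0.
have [h [hE ch hx]] := (is_derive1_caratheodory f x d).1 D.
have /nbhs_ballP[r /= r0 Hr] : \forall t \near x, 0 < h t.
  by apply: (cvgr_gt (h x) ch); rewrite hx.
pose t := x + Num.min r e / 2.
have m0 : 0 < Num.min r e by rewrite lt_min r0 e0.
have [mr me] : Num.min r e <= r /\ Num.min r e <= e by rewrite !ge_min !lexx orbT.
have xt : x < t by rewrite /t; lra.
have te : t < x + e by rewrite /t; lra.
have := H t; rewrite xt te => /(_ isT); rewrite -subr_le0 hE leNgt => /negP; apply.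
rewrite mulr_gt0 ?subr_gt0 //; apply: Hr; rewrite /ball /= distrC gtr0_norm ?subr_gt0 //.
by rewrite /t addrAC subrr add0r; lra.
Qed.

Lemma polar_coordinates {R : realType} (u v : R) : exists r w : R, [/\ 0 <= r, u = r * cos w & v = r * sin w].
Proof.
pose r := Num.sqrt (u ^+ 2 + v ^+ 2).
have r2 : r ^+ 2 = u ^+ 2 + v ^+ 2 by rewrite sqr_sqrtr // addr_ge0 ?sqr_ge0.
have r0 : 0 <= r by exact: sqrtr_ge0.
case: (eqVneq r 0) => [rz|rn].
  exists 0, 0; rewrite lexx !mul0r.
  have := sqr_ge0 u; have := sqr_ge0 v; move: r2; rewrite rz expr0n /= => E v2 u2.
  have uz : u ^+ 2 = 0 by lra.
  have vz : v ^+ 2 = 0 by lra.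
  by split=> //; apply/eqP; rewrite -sqrf_eq0 ?uz ?vz.
have rp : 0 < r by rewrite lt_neqAle eq_sym rn r0.
pose c := u / r; pose s := v / r.
have cs : c ^+ 2 + s ^+ 2 = 1 by rewrite /c /s !expr_div_n -mulrDl -r2 divff // expf_neq0.
have c1 : -1 <= c <= 1.
  by rewrite -ler_norml -(@ler_pXn2r _ 2) ?nnegrE // real_normK ?num_real // expr1n -cs lerDl sqr_ge0.
have sn : sin (acos c) = `|s|.
  by rewrite sin_acos // -cs addrAC subrr add0r sqrtr_sqr.
exists r, (if 0 <= s then acos c else - acos c); split => //.
  by case: ifP => _; rewrite ?cosN acosK ?in_itv // /c mulrC divfK.
case: ifPn => [s0|s0]; rewrite ?sinN sn; first by rewrite ger0_norm // /s mulrC divfK.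
by rewrite ltr0_norm ?ltNge // opprK /s mulrC divfK.
Qed.

Lemma smat_atan {R : realType} k (x0 : R) : smat k atan x0.
Proof.
case: k => // k; exists (fun x => (1 + x ^+ 2)^-1).
  by exists 1 => //= t _; exact: is_derive1_atan.
apply: smatV; first by rewrite gt_eqF // ltr_wpDr ?sqr_ge0.
apply: smatD; first exact: smat_cst.
rewrite (_ : (fun x => _) = (fun x : R => x * x)); last by apply/funext => x; rewrite expr2.
by apply: smatM; exact: smat_id.
Qed.

(** The lower bound on [f'] makes [f] onto and its inverse Lipschitz. Smoothness is then
    bootstrapped from the formula for the derivative of the inverse. *)
Lemma smooth_inverse {R : realType} (f f' : R -> R) (d : R) : 0 < d ->
  (forall x, is_deriv x f (f' x)) -> smooth1 f' -> (forall x, d <= f' x) ->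
  exists g : R -> R, [/\ cancel g f, cancel f g, smooth1 g & forall y, is_deriv y g (f' (g y))^-1].
Proof.
move=> d0 D sf' fd; have cf' := smooth1_cont sf'; have cf := is_derive_cont D.
have mono x y : x <= y -> d * (y - x) <= f y - f x.
  move=> xy; have DD z : is_deriv z (fun z => f z - d * z) (f' z - d).
    by apply: (ide_eq (ideB (D z) (ideM (ide_cst d z) (ide_id z)))); ring.
  have f'd z : x <= z <= y -> 0 <= f' z - d by rewrite subr_ge0.
  by have := ide_le xy (fun z _ => DD z) f'd; lra.
have inj x y : f x = f y -> x = y.
  move=> E; apply/eqP; rewrite eq_le; apply/andP; split; rewrite leNgt; apply/negP => xy;
    by have := mono _ _ (ltW xy); rewrite E subrr leNgt mulr_gt0 // subr_gt0.
have /choice[g gf] : forall y, exists x, f x = y.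
  move=> y; pose r := (`|y - f 0|) / d; have r0 : 0 <= r by rewrite divr_ge0 // ltW.
  have dr : d * r = `|y - f 0| by rewrite /r mulrC divfK // gt_eqF.
  have rN : - r <= 0 by lra.
  have m1 := mono 0 r r0; have m2 := mono (- r) 0 rN.
  rewrite subr0 in m1; rewrite sub0r opprK in m2; rewrite dr in m1 m2.
  have := ler_norm (y - f 0); have := ler_norm (- (y - f 0)); rewrite normrN => n2 n1.
  have rr : - r <= r by lra.
  have [c _ fc] : exists2 c, c \in `[- r, r]%R & f c = y.
    apply: IVT => //; first exact: continuous_subspaceT.
    by apply/andP; split; [rewrite ge_min|rewrite le_max]; apply/orP; [left|right]; lra.
  by exists c.
have fg x : g (f x) = x by apply: inj; rewrite gf.
have gl y y' : `|g y - g y'| <= d^-1 * `|y - y'|.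
  wlog yy : y y' / g y' <= g y.
    move=> H; case: (leP (g y') (g y)) => [|/ltW] h; first exact: H.
    by rewrite distrC [`|y - y'|]distrC; exact: H.
  rewrite ger0_norm ?subr_ge0 // mulrC ler_pdivlMr // mulrC.
  by apply: le_trans (mono _ _ yy) _; rewrite !gf; exact: ler_norm.
have cg : continuous g.
  move=> y; apply/cvgrPdist_lt => e e0; apply/nbhs_ballP; exists (d * e); first exact: mulr_gt0.
  move=> z /=; rewrite /ball /= => yz; apply: le_lt_trans (gl _ _) _.
  by rewrite mulrC ltr_pdivrMr // mulrC.
have Dg y : is_deriv y g (f' (g y))^-1.
  pose h (q : R * R) := f q.2 - q.1.
  have h1 u v : is_deriv u (fun u => h (u, v)) ((fun _ : R * R => - 1 : R) (u, v)).
    by apply: (ide_eq (ideB (ide_cst (f v) u) (ide_id u))); ring.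
  have h2 u v : is_deriv v (fun v => h (u, v)) ((fun q : R * R => f' q.2) (u, v)).
    by apply: (ide_eq (ideB (D v) (ide_cst u v))); rewrite /=; ring.
  have fp : f' (g y) != 0 by rewrite gt_eqF // (lt_le_trans d0).
  have N : \forall u \near y, h (u, g u) = 0 by exists 1 => //= u _; rewrite /h /= gf subrr.
  have := ide_implicit h1 h2 (@cont2_cst R (- 1)) (cont1snd cf') (cg y) N fp.
  by move=> H; apply: (ide_eq H); rewrite /= mulN1r opprK.
exists g; split=> //; apply/smooth1P; elim=> // k IH y.
exists (fun y => (f' (g y))^-1); first by exists 1 => //= t _; exact: Dg.
apply: smatV; first by rewrite gt_eqF // (lt_le_trans d0).
by apply: (@smat_comp _ k f' g); [exact: ((smooth1P f').1 sf')|exact: IH].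
Qed.

(** * Parametrization of the boundary *)

Section PolarRadius.
Context {R : realType} (Omega : set (R * R)).
Variables (a b M : R).
Hypotheses (oO : open Omega) (Oab : Omega (a, b)).
Hypothesis (cvx : segment_closed Omega).
Hypothesis (bnd : forall q, Omega q -> edist q (a, b) <= M).
Implicit Types (w t : R) (p q z : R * R).

Lemma open_near q : Omega q -> exists2 e, 0 < e & forall z, edist z q < e -> Omega z.
Proof. by move=> Oq; apply/near_edist; exact: open_nbhs_nbhs. Qed.

Lemma closure_near (A : set (R * R)) q : closure A q <-> forall e, 0 < e -> exists2 z, A z & edist z q < e.
Proof.
split=> [cq e e0|H B /near_edist[e e0 eB]].
  have /cq[z [Az Bz]] : \forall z \near q, edist z q < e by apply/near_edist; exists e.
  by exists z.
by have [z Az zq] := H e e0; exists z; split=> //; exact: eB.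
Qed.

(** The boundary end [q] is replaced by a nearby point [q'] of [Omega], and the other end is moved
    to compensate. *)
Lemma segment_interior z q t : Omega z -> closure Omega q -> 0 <= t < 1 ->
  Omega (z.1 + t * (q.1 - z.1), z.2 + t * (q.2 - z.2)).
Proof.
move=> Oz cq /andP[t0 t1]; have [e e0 He] := open_near Oz.
have t1' : 0 < 1 - t by lra.
case: (eqVneq t 0) => [->|tn]; first by rewrite !mul0r !addr0 -surjective_pairing.
have tp : 0 < t by rewrite lt_neqAle eq_sym tn.
have d0 : 0 < e * (1 - t) / 2 by rewrite divr_gt0 // mulr_gt0.
have [q' Oq' dq] := (closure_near Omega q).1 cq _ d0.
(* The point at parameter [t] on the segment from [z'] to [q'] is the one on the segment from [z] to
   [q]; openness keeps [z'] in [Omega]. *)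
pose z' := (z.1 + t * (q.1 - q'.1) / (1 - t), z.2 + t * (q.2 - q'.2) / (1 - t)).
have Oz' : Omega z'.
  pose c := t / (1 - t); have c0 : 0 <= c by rewrite divr_ge0 // ltW.
  have le1 : edist z' z <= c * edist q q'.
    have ce : 0 <= c * edist q q' by rewrite mulr_ge0 ?edist_ge0.
    rewrite (edist_le _ _ ce) exprMn sqr_edist /z' /c /=.
    by rewrite le_eqVlt; apply/orP; left; apply/eqP; field; rewrite gt_eqF.
  apply: He; apply: (le_lt_trans le1).
  have le2 : c * edist q q' <= c * (e * (1 - t) / 2) by rewrite ler_wpM2l // edistC ltW.
  apply: (le_lt_trans le2); have -> : c * (e * (1 - t) / 2) = t * e / 2 by rewrite /c; field; rewrite gt_eqF.
  by have : t * e < 1 * e by [rewrite ltr_pM2r]; lra.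
have := cvx Oz' Oq' (t := t); rewrite t0 (ltW t1) => /(_ isT).
by congr (Omega (_, _)); rewrite /z' /=; field; rewrite gt_eqF.
Qed.

Definition polar w (r : R) : R * R := (a + r * cos w, b + r * sin w).

Lemma edist_polar w r r' : edist (polar w r) (polar w r') = `|r - r'|.
Proof.
rewrite /edist /= -sqrtr_sqr; congr Num.sqrt.
by rewrite -[RHS]mulr1 -(cos2Dsin2 w); ring.
Qed.

Lemma polar0 w : polar w 0 = (a, b). Proof. by rewrite /polar !mul0r !addr0. Qed.

Definition radius w : R := sup [set r | 0 <= r /\ Omega (polar w r)].

Let has_sup_radius w : has_sup [set r | 0 <= r /\ Omega (polar w r)].
Proof.
split; first by exists 0 => /=; rewrite polar0.
exists M => r /= [r0 /bnd]; rewrite -(polar0 w) edist_polar subr0 ger0_norm //.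
Qed.

Lemma radiusP w r : 0 <= r -> Omega (polar w r) <-> r < radius w.
Proof.
move=> r0; split=> [Or|rr].
  have [e e0 He] := open_near Or.
  have : Omega (polar w (r + e / 2)).
    by apply: He; rewrite edist_polar addrAC subrr add0r gtr0_norm; lra.
  move=> H; have : r + e / 2 <= radius w.
    by apply: sup_upper_bound => //=; split=> //; lra.
  by lra.
have d0 : 0 < radius w - r by rewrite subr_gt0.
have [r' /= [r'0 Or']] := sup_adherent d0 (has_sup_radius w).
rewrite -/(radius w) subKr => rr'; have r'p : 0 < r' by lra.
have := cvx Oab Or' (t := r / r'); rewrite divr_ge0 //= ler_pdivrMr // mul1r (ltW rr') => /(_ isT).
by congr (Omega (_, _)); field; rewrite gt_eqF.
Qed.

Lemma radius_ge : exists2 d, 0 < d & forall w, d <= radius w.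
Proof.
have [e e0 He] := open_near Oab; exists (e / 2); first by lra.
move=> w; apply: ltW; apply/(radiusP w); first by lra.
by apply: He; rewrite -(polar0 w) edist_polar subr0 gtr0_norm; lra.
Qed.

Lemma radius_gt0 w : 0 < radius w.
Proof. by have [d d0 H] := radius_ge; exact: lt_le_trans (H w). Qed.

Lemma closure_radius w r : 0 <= r -> closure Omega (polar w r) -> r <= radius w.
Proof.
move=> r0 cr; rewrite leNgt; apply/negP => lr.
have rp : 0 < r := lt_trans (radius_gt0 w) lr.
have := segment_interior (t := radius w / r) Oab cr.
rewrite divr_ge0 ?(ltW (radius_gt0 w)) // ltr_pdivrMr // mul1r lr => /(_ isT) /=.
have -> : (a + radius w / r * (a + r * cos w - a), b + radius w / r * (b + r * sin w - b)) = polar w (radius w).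
  by rewrite /polar; congr (_, _); field; rewrite gt_eqF.
by move/(radiusP w (ltW (radius_gt0 w))).1; rewrite ltxx.
Qed.

Lemma boundary_polar w : boundary Omega (polar w (radius w)).
Proof.
have r0 := radius_gt0 w; split; last first.
  by move/interior_subset/(radiusP w (ltW r0)).1; rewrite ltxx.
apply/closure_near => e e0.
pose m := Num.min (e / 2) (radius w).
have m0 : 0 < m by rewrite lt_min r0 andbT; lra.
have [me mr] : m <= e / 2 /\ m <= radius w by rewrite /m !ge_min !lexx orbT.
exists (polar w (radius w - m)).
  by apply/radiusP; lra.
by rewrite edist_polar addrAC subrr add0r normrN gtr0_norm //; lra.
Qed.

Lemma boundaryP q : boundary Omega q <-> exists w, q = polar w (radius w).
Proof.
split=> [[cq niq]|[w ->]]; last exact: boundary_polar.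
have [r [w [r0 Eu Ev]]] := polar_coordinates (q.1 - a) (q.2 - b).
have Eq : q = polar w r.
  by rewrite /polar -Eu -Ev !addrA ![_ + _ - _]addrAC !subrr !add0r -surjective_pairing.
exists w; rewrite Eq; congr (polar w _); apply/eqP; rewrite eq_le closure_radius ?andbT -?Eq //.
rewrite leNgt; apply/negP => /(radiusP w r0).2; rewrite -Eq => Oq; apply: niq.
by have /interior_id -> := oO.
Qed.

Lemma boundary_not q : boundary Omega q -> ~ Omega q.
Proof. by move=> [_ nq] Oq; apply: nq; have /interior_id -> := oO. Qed.

(** A point of the ray just inside [Omega] and one just outside its closure keep their positions
    under small rotations, and they enclose the radius. *)
Lemma cont_radius : continuous radius.
Proof.
move=> w; apply/cvgrPdist_le => e e0; have r0 := radius_gt0 w.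
have near_polar r d : 0 < d -> \forall w' \near w, edist (polar w' r) (polar w r) < d.
  move=> d0.
  have cu : continuous (fun w' : R => a + r * cos w').
    by apply: cont1D; [exact: cont1_cst|apply: cont1Z; exact: continuous_cos].
  have cv : continuous (fun w' : R => b + r * sin w').
    by apply: cont1D; [exact: cont1_cst|apply: cont1Z; exact: continuous_sin].
  have cg := cont1_pair (@cont_edist R (polar w r)) cu cv.
  by apply: (cvgr_lt _ (cg w)); rewrite -/(polar w r) edistpp.
pose r1 := Num.max 0 (radius w - e).
have r10 : 0 <= r1 by rewrite le_max lexx.
have r1r : r1 < radius w by rewrite gt_max r0 /=; lra.
have [d1 d10 H1] := open_near ((radiusP w r10).2 r1r).
have nc : ~ closure Omega (polar w (radius w + e)).
  by move/closure_radius => H; have := H (addr_ge0 (ltW r0) (ltW e0)); lra.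
have oc : open (~` closure Omega) by rewrite openC; exact: closed_closure.
have [d2 d20 H2] := (near_edist _ _).1 (open_nbhs_nbhs (conj oc nc)).
have n1 := near_polar r1 d1 d10; have n2 := near_polar (radius w + e) d2 d20.
near=> w'.
have h1 : r1 < radius w' by apply/(radiusP w' r10); apply: H1; near: w'.
have h2 : radius w' <= radius w + e.
  rewrite leNgt; apply/negP => /(radiusP w' (addr_ge0 (ltW r0) (ltW e0))).2 Ow.
  have := H2 (polar w' (radius w + e)); apply; last exact: subset_closure.
  by near: w'.
have : radius w - e <= r1 by rewrite /r1 le_max lexx orbT.
by rewrite ler_norml => ?; apply/andP; split; lra.
Unshelve. all: by end_near. Qed.

Lemma radius_per w : radius (w + 2 * pi) = radius w.
Proof.
have E : 2 * pi = pi *+ 2 :> R by rewrite mulr_natl.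
by rewrite /radius; congr sup; apply/seteqP; split=> r /=; rewrite /polar E cosD2pi sinD2pi.
Qed.

(** Moving from a boundary point towards a point of [Omega] stays in [Omega], which makes the
    derivative of [F] in that direction nonpositive. Applying this to [z] shifted along the
    gradient, still in the open set, makes it strictly negative. *)
Lemma local_defining p : smooth_boundary Omega -> boundary Omega p -> exists (F : R * R -> R) (e : R),
  [/\ smooth F, 0 < e & forall q, edist q p < e -> [/\ Omega q <-> F q < 0,
    boundary Omega q -> F q = 0 & forall z, boundary Omega q -> Omega z ->
      partial 0 F q * (z.1 - q.1) + partial 1 F q * (z.2 - q.2) < 0]].
Proof.
move=> sm bp; have [F sF /near_edist[e e0 He]] := sm p bp.
exists F, e; split => // q qp; have [gq Oq] := He q qp.
have Fb q' : edist q' p < e -> boundary Omega q' -> F q' = 0.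
  move=> q'p bq'; apply/eqP; rewrite eq_le; apply/andP; split; last first.
    by rewrite leNgt; apply/negP => /((He q' q'p).2).2; exact: boundary_not.
  rewrite leNgt; apply/negP => Fq'.
  have /near_edist[d d0 Hd] : \forall z \near q', 0 < F z.
    by have cF := smooth_cont sF; apply: (cvgr_gt (F q') (cF q')).
  have m0 : 0 < Num.min d (e - edist q' p) by rewrite lt_min d0 subr_gt0.
  have [z Oz zq] := (closure_near Omega q').1 bq'.1 _ m0.
  move: zq; rewrite lt_min => /andP[zd ze].
  have zp : edist z p < e by have := edist_triangle q' z p; lra.
  by have := ((He z zp).2).1 Oz; have := Hd z zd; lra.
split=> //; first exact: Fb.
move=> z bq Oz.
have weak z' : Omega z' -> partial 0 F q * (z'.1 - q.1) + partial 1 F q * (z'.2 - q.2) <= 0.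
  move=> Oz'.
  pose u t := q.1 + t * (z'.1 - q.1); pose v t := q.2 + t * (z'.2 - q.2).
  have Du : is_deriv (0 : R) u (z'.1 - q.1).
    by apply: (ide_eq (ideD (ide_cst q.1 0) (ideM (ide_id 0) (ide_cst (z'.1 - q.1) 0)))); ring.
  have Dv : is_deriv (0 : R) v (z'.2 - q.2).
    by apply: (ide_eq (ideD (ide_cst q.2 0) (ideM (ide_id 0) (ide_cst (z'.2 - q.2) 0)))); ring.
  have D := smooth_chain sF Du Dv.
  have uv0 : (u 0, v 0) = q by rewrite /u /v !mul0r !addr0 -surjective_pairing.
  rewrite uv0 in D.
  pose l := edist z' q + 1; have l0 : 0 < l by rewrite ltr_wpDl ?edist_ge0.
  have r0 : 0 < e - edist q p by rewrite subr_gt0.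
  have d0 : 0 < Num.min 1 ((e - edist q p) / l) by rewrite lt_min ltr01 divr_gt0.
  apply: (ide_sign D d0) => t; rewrite add0r uv0 (Fb q qp bq) => /andP[t0].
  rewrite lt_min => /andP[t1 te]; apply: ltW; apply/((He (u t, v t) _).2).1.
    have le1 : edist (u t, v t) q <= t * edist z' q.
      rewrite edist_le ?mulr_ge0 ?edist_ge0 ?(ltW t0) // exprMn sqr_edist /u /v /=.
      by rewrite le_eqVlt; apply/orP; left; apply/eqP; ring.
    have le2 : t * edist z' q <= t * l by rewrite ler_wpM2l ?(ltW t0) // lerDl.
    have le3 : t * l < e - edist q p by rewrite -ltr_pdivlMr.
    by have := edist_triangle q (u t, v t) p; lra.
  have := segment_interior (t := 1 - t) Oz' bq.1.
  have -> : (0 <= 1 - t < 1) by lra.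
  by move=> /(_ isT); congr (Omega (_, _)); rewrite /u /v /=; ring.
have [d d0 Hd] := open_near Oz.
pose A := partial 0 F q; pose B := partial 1 F q.
have AB : 0 < A ^+ 2 + B ^+ 2.
  have [i] := gq; have := sqr_ge0 A; have := sqr_ge0 B.
  case: (ord2 i) => ->; rewrite -/A -/B => B2 A2 n0; have : 0 < A ^+ 2 \/ 0 < B ^+ 2.
  - by left; rewrite exprn_even_gt0.
  - by case; lra.
  - by right; rewrite exprn_even_gt0.
  - by case; lra.
pose N := Num.sqrt (A ^+ 2 + B ^+ 2) + 1.
have N0 : 0 < N by rewrite ltr_wpDl ?sqrtr_ge0.
pose c := d / (2 * N); have c0 : 0 < c by rewrite divr_gt0 // mulr_gt0.
have Oz' : Omega (z.1 + c * A, z.2 + c * B).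
  apply: Hd; rewrite /edist /=.
  have -> : (z.1 + c * A - z.1) ^+ 2 + (z.2 + c * B - z.2) ^+ 2 = c ^+ 2 * (A ^+ 2 + B ^+ 2) by ring.
  rewrite sqrtrM ?sqr_ge0 // sqrtr_sqr gtr0_norm //.
  apply: (@le_lt_trans _ _ (c * N)); first by rewrite ler_wpM2l ?(ltW c0) // /N lerDl.
  have -> : c * N = d / 2 by rewrite /c; field; rewrite gt_eqF.
  by lra.
have := weak _ Oz'; rewrite /= -/A -/B.
have : 0 < c * (A ^+ 2 + B ^+ 2) by rewrite mulr_gt0.
have -> : A * (z.1 + c * A - q.1) + B * (z.2 + c * B - q.2) =
  A * (z.1 - q.1) + B * (z.2 - q.2) + c * (A ^+ 2 + B ^+ 2) by ring.
by move: (A * _ + _) => X; lra.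
Qed.

(** The radius solves [F (polar w r) = 0], and the radial derivative of [F] is nonzero because the
    gradient strictly separates [(a, b)] from the boundary point. The formula for the derivative
    involves the radius itself and gains one order at each step. *)
Lemma smooth_radius : smooth_boundary Omega -> smooth1 radius.
Proof.
move=> sm; apply/smooth1P; elim=> // k IH w0.
have [F [e [sF e0 HF]]] := local_defining sm (boundary_polar w0).
have cr := cont_radius.
have csn : continuous (@sin R) by exact: continuous_sin.
have ccs : continuous (@cos R) by exact: continuous_cos.
pose px w := a + radius w * cos w; pose py w := b + radius w * sin w.
have cpx : continuous px by apply: cont1D; [exact: cont1_cst|exact: cont1M].
have cpy : continuous py by apply: cont1D; [exact: cont1_cst|exact: cont1M].
have Nw : \forall w \near w0, edist (px w, py w) (polar w0 (radius w0)) < e.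
  have cg := cont1_pair (@cont_edist R (polar w0 (radius w0))) cpx cpy.
  by apply: (cvgr_lt _ (cg w0)); rewrite edistpp.
pose g0 (q : R * R) := partial 0 F (polar q.1 q.2); pose g1 (q : R * R) := partial 1 F (polar q.1 q.2).
pose fx (q : R * R) := g0 q * (- (q.2 * sin q.1)) + g1 q * (q.2 * cos q.1).
pose fy (q : R * R) := g0 q * cos q.1 + g1 q * sin q.1.
have Dx w r : is_deriv w (fun w => F (polar w r)) (fx (w, r)).
  have Du : is_deriv w (fun w => a + r * cos w) (- (r * sin w)).
    by apply: (ide_eq (ideD (ide_cst a w) (ideM (ide_cst r w) (is_derive_cos w)))); ring.
  have Dv : is_deriv w (fun w => b + r * sin w) (r * cos w).
    by apply: (ide_eq (ideD (ide_cst b w) (ideM (ide_cst r w) (is_derive_sin w)))); ring.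
  exact: (smooth_chain sF Du Dv).
have Dy w r : is_deriv r (fun r => F (polar w r)) (fy (w, r)).
  have Du : is_deriv r (fun r => a + r * cos w) (cos w).
    by apply: (ide_eq (ideD (ide_cst a r) (ideM (ide_id r) (ide_cst (cos w) r)))); ring.
  have Dv : is_deriv r (fun r => b + r * sin w) (sin w).
    by apply: (ide_eq (ideD (ide_cst b r) (ideM (ide_id r) (ide_cst (sin w) r)))); ring.
  exact: (smooth_chain sF Du Dv).
have c1 : continuous (fun q : R * R => cos q.1) by exact: cont1fst ccs.
have c2 : continuous (fun q : R * R => sin q.1) by exact: cont1fst csn.
have c3 : continuous (fun q : R * R => q.2) by exact: cont2_snd.
have cpol f : continuous f -> continuous (fun q : R * R => f (polar q.1 q.2) : R).
  move=> cf; apply: cont2_pair cf _ _.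
    by apply: cont2D; [exact: cont2_cst|exact: cont2M].
  by apply: cont2D; [exact: cont2_cst|exact: cont2M].
have cg0 : continuous g0 by apply: cpol; exact: smooth_partial_cont.
have cg1 : continuous g1 by apply: cpol; exact: smooth_partial_cont.
have cfx : continuous fx.
  by apply: cont2D; apply: cont2M => //; [apply: cont2N; exact: cont2M|exact: cont2M].
have cfy : continuous fy by apply: cont2D; exact: cont2M.
have fyN w : edist (px w, py w) (polar w0 (radius w0)) < e -> fy (w, radius w) != 0.
  move=> we; have [_ _ G] := HF _ we; have := G (a, b) (boundary_polar w) Oab.
  rewrite /px /py /= -/(polar w (radius w)) -/(g0 (w, radius w)) -/(g1 (w, radius w)).
  have -> : g0 (w, radius w) * (a - (a + radius w * cos w)) + g1 (w, radius w) * (b - (b + radius w * sin w)) =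
    - radius w * fy (w, radius w) by rewrite /fy /=; ring.
  by rewrite nmulr_rlt0 ?oppr_lt0 ?radius_gt0 // => /gt_eqF ->.
exists (fun w => - (fx (w, radius w) / fy (w, radius w))).
  move: Nw => /near_join Nw; near=> w.
  have Nw' : \forall w' \near w, edist (px w', py w') (polar w0 (radius w0)) < e by near: w.
  have we := nbhs_singleton Nw'.
  apply: (ide_implicit (f := fun q => F (polar q.1 q.2)) Dx Dy cfx cfy (cr w)); last exact: fyN.
  near=> w'; have w'e : edist (px w', py w') (polar w0 (radius w0)) < e by near: w'.
  by have [_ H _] := HF _ w'e; exact: H (boundary_polar w').
have [ss sc] := smat_sincos k w0; have sr := IH w0.
have spx : smat k px w0 by apply: smatD; [exact: smat_cst|exact: smatM].
have spy : smat k py w0 by apply: smatD; [exact: smat_cst|exact: smatM].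
have sg0 : smat k (fun w => g0 (w, radius w)) w0 := smat_pair (smooth_partial 0 sF) spx spy.
have sg1 : smat k (fun w => g1 (w, radius w)) w0 := smat_pair (smooth_partial 1 sF) spx spy.
apply: smatN; apply: smatM.
  by apply: smatD; apply: smatM => //; [apply: smatN; exact: smatM|exact: smatM].
apply: smatV; first by apply: fyN; exact: nbhs_singleton Nw.
by apply: smatD; exact: smatM.
Unshelve. all: by end_near. Qed.

End PolarRadius.

Lemma circle_point_uniq {R : realType} (w w' : R) : 0 <= w < 2 * pi -> 0 <= w' < 2 * pi ->
  cos w = cos w' -> sin w = sin w' -> w = w'.
Proof.
wlog ww : w w' / w' <= w.
  move=> H h h' c s; case: (leP w' w) => [|/ltW] le; first exact: H.
  by apply/esym; exact: H.
move=> /andP[w0 w1] /andP[w'0 w'1] Ec Es; apply/eqP; apply: contraT => nw.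
have h : 0 < (w - w') / 2 < pi by lra.
have := sin_gt0_pi h; have E : cos (w - w') = 1.
  by rewrite cosB Ec Es -!expr2 cos2Dsin2.
have : cos (w - w') = 1 - (sin ((w - w') / 2) ^+ 2) *+ 2.
  rewrite {1}(_ : w - w' = (w - w') / 2 + (w - w') / 2); last by field.
  by rewrite cosD -!expr2 cos2sin2 mulr2n; ring.
rewrite E => E2 sp; have := exprn_gt0 2 sp; lra.
Qed.

Lemma normal_neq0 {R : realFieldType} (A B u v : R) : A != 0 \/ B != 0 -> u ^+ 2 + v ^+ 2 = 1 ->
  A * u + B * v = 0 -> A * v - B * u != 0.
Proof.
move=> AB U E; apply/eqP => E2.
have S : A ^+ 2 + B ^+ 2 = 0.
  have -> : A ^+ 2 + B ^+ 2 = (A * u + B * v) ^+ 2 + (A * v - B * u) ^+ 2.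
    by rewrite -[LHS]mulr1 -U; ring.
  by rewrite E E2 expr0n addr0.
have A2 := sqr_ge0 A; have B2 := sqr_ge0 B.
have Az : A ^+ 2 = 0 by lra.
have Bz : B ^+ 2 = 0 by lra.
by move/eqP: Az; move/eqP: Bz; rewrite !sqrf_eq0 => /eqP Bz /eqP Az; case: AB; rewrite ?Az ?Bz eqxx.
Qed.

(** Here [(u, v)] is the unit tangent, [(A, B)] the gradient and [(P, Q)] the Hessian applied to the
    tangent. The derivatives [u'], [v'] of the parametrization drop out, so the curvature depends on
    the defining function and the tangent only. *)
Lemma curvature_identity {R : realFieldType} (A B u v u' v' P Q : R) : u ^+ 2 + v ^+ 2 = 1 ->
  P * u + A * u' + (Q * v + B * v') = 0 -> 2 * (u * u' + v * v') = 0 ->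
  (u * v' - v * u') * (A * v - B * u) = P * u + Q * v.
Proof.
move=> U E O; have O' : u * u' + v * v' = 0 by lra.
have -> : P * u + Q * v = - (A * u' + B * v') * (u ^+ 2 + v ^+ 2).
  by rewrite U mulr1; lra.
transitivity ((A * u + B * v) * (u * u' + v * v') - (A * u' + B * v') * (u ^+ 2 + v ^+ 2)); first by ring.
by rewrite O'; ring.
Qed.

Lemma ide_cst_near {R : realType} (f : R -> R) (c x : R) : (\forall u \near x, f u = c) -> is_deriv x f 0.
Proof.
by move=> H; apply: (ide_near _ (ide_cst c x)); apply: filterS H => u ->.
Qed.

Lemma ide_neg_right {R : realType} (f : R -> R) (x d : R) : is_deriv x f d -> d < 0 ->
  exists2 e, 0 < e & forall t, x < t < x + e -> f t < f x.
Proof.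
move=> D d0; have [h [hE ch hx]] := (is_derive1_caratheodory f x d).1 D.
have /nbhs_ballP[r /= r0 Hr] : \forall t \near x, h t < 0.
  by apply: (cvgr_lt (h x) ch); rewrite hx.
exists r => // t /andP[xt te]; rewrite -subr_lt0 hE nmulr_rlt0 ?subr_gt0 //.
by apply: Hr; rewrite /ball /= distrC gtr0_norm ?subr_gt0 //; lra.
Qed.

(** * Independence of the curvature from the parametrization *)

Section Curvature.
Context {R : realType} (Omega : set (R * R)).
Variables (a b : R).
Hypotheses (oO : open Omega) (Oab : Omega (a, b)).
Hypothesis (cvx : segment_closed Omega).
Hypothesis (sm : smooth_boundary Omega).
Implicit Types (x y : R -> R) (p : R * R).

(* Differentiate [F (x t, y t) = 0] twice at 0. *)
Lemma curvature_uniq p (k k' : R) : boundary Omega p -> is_curvature Omega p k -> is_curvature Omega p k' -> k = k'.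
Proof.
move=> bp; have [F [e [sF e0 HF]]] := local_defining oO cvx sm bp.
pose A := partial 0 F p; pose B := partial 1 F p.
pose H00 := partial 0 (partial 0 F) p; pose H01 := partial 1 (partial 0 F) p.
pose H10 := partial 0 (partial 1 F) p; pose H11 := partial 1 (partial 1 F) p.
have AB0 : A != 0 \/ B != 0.
  have pp : edist p p < e by rewrite edistpp.
  have [_ _ /(_ (a, b) bp Oab)] := HF p pp; rewrite -/A -/B.
  case: (eqVneq A 0) => [->|]; last by left.
  by case: (eqVneq B 0) => [->|]; [rewrite !mul0r addr0 ltxx|right].
have key k1 : is_curvature Omega p k1 -> exists u v : R,
    [/\ u ^+ 2 + v ^+ 2 = 1, A * u + B * v = 0, 0 < A * v - B * u &
        k1 * (A * v - B * u) = (H00 * u + H01 * v) * u + (H10 * u + H11 * v) * v].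
  move=> [x [y [[sx sy] xy0 N1 N2 ->]]].
  have Dx t := smooth1_ide sx t; have Dy t := smooth1_ide sy t.
  have Dx2 t := smooth1_ide (smooth1_derive sx) t; have Dy2 t := smooth1_ide (smooth1_derive sy) t.
  have cx := smooth1_cont sx; have cy := smooth1_cont sy.
  have Np : \forall t \near (0 : R), edist (x t, y t) p < e.
    have cg := cont1_pair (@cont_edist R p) cx cy.
    by apply: (cvgr_lt _ (cg 0)); rewrite xy0 edistpp.
  have NF : \forall t \near (0 : R), F (x t, y t) = 0.
    near=> t; have xyt : edist (x t, y t) p < e by near: t.
    have [_ H _] := HF (x t, y t) xyt; apply: H.
    by have [] : boundary Omega (x t, y t) /\ derive1 x t ^+ 2 + derive1 y t ^+ 2 = 1 by near: t.
  pose G t := partial 0 F (x t, y t) * derive1 x t + partial 1 F (x t, y t) * derive1 y t.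
  have NG : \forall t \near (0 : R), G t = 0.
    move: NF => /near_join NF; near=> t.
    have D1 := smooth_chain sF (Dx t) (Dy t).
    have D2 : is_deriv t (fun t => F (x t, y t)) 0.
      by apply: (@ide_cst_near _ _ 0); near: t.
    exact: ide_uniq D1 D2.
  have G0 : G 0 = 0 := nbhs_singleton NG.
  have Ux := nbhs_singleton N1; have U0 : derive1 x 0 ^+ 2 + derive1 y 0 ^+ 2 = 1 := Ux.2.
  have DG : is_deriv (0 : R) G
      ((H00 * derive1 x 0 + H01 * derive1 y 0) * derive1 x 0 + A * derive1 (derive1 x) 0 +
       ((H10 * derive1 x 0 + H11 * derive1 y 0) * derive1 y 0 + B * derive1 (derive1 y) 0)).
    have D0 := smooth_chain (smooth_partial 0 sF) (Dx 0) (Dy 0).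
    have D1 := smooth_chain (smooth_partial 1 sF) (Dx 0) (Dy 0).
    have := ideD (ideM D0 (Dx2 0)) (ideM D1 (Dy2 0)); rewrite xy0 -/A -/B -/H00 -/H01 -/H10 -/H11.
    exact.
  have DG0 : is_deriv (0 : R) G 0.
    exact: ide_cst_near NG.
  have E2 := ide_uniq DG DG0.
  have DU : is_deriv (0 : R) (fun t => derive1 x t ^+ 2 + derive1 y t ^+ 2)
      (2 * (derive1 x 0 * derive1 (derive1 x) 0 + derive1 y 0 * derive1 (derive1 y) 0)).
    apply: (ide_eq (ideD (ideX 1 (Dx2 0)) (ideX 1 (Dy2 0)))); rewrite !expr1.
    by rewrite -!mulrA -mulrDr.
  have DU0 : is_deriv (0 : R) (fun t => derive1 x t ^+ 2 + derive1 y t ^+ 2) 0.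
    by apply: (@ide_cst_near _ _ 1); apply: filterS N1 => u [].
  have E3 := ide_uniq DU DU0.
  have E1 : A * derive1 x 0 + B * derive1 y 0 = 0 by move: G0; rewrite /G xy0.
  set u := derive1 x 0 in U0 E1 E2 E3 N2 *; set v := derive1 y 0 in U0 E1 E2 E3 N2 *.
  rewrite /derive1n /=; set u' := derive1 (derive1 x) 0 in E2 E3 *; set v' := derive1 (derive1 y) 0 in E2 E3 *.
  exists u, v; split => //.
    have ge : 0 <= A * v - B * u.
      have Du : is_deriv (0 : R) (fun h => x 0 - h * v) (- v).
        by apply: (ide_eq (ideB (ide_cst (x 0) 0) (ideM (ide_id 0) (ide_cst v 0)))); ring.
      have Dv : is_deriv (0 : R) (fun h => y 0 + h * u) u.
        by apply: (ide_eq (ideD (ide_cst (y 0) 0) (ideM (ide_id 0) (ide_cst u 0)))); ring.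
      have := smooth_chain sF Du Dv; rewrite !mul0r subr0 addr0 xy0 -/A -/B => D.
      have [d /= d0 Hd] := N2.
      have m0 : 0 < Num.min d e by rewrite lt_min d0.
      suff : A * - v + B * u <= 0 by lra.
      apply: (ide_sign D m0) => t; rewrite add0r lt_min => /andP[t0 /andP[td te]].
      rewrite !mul0r subr0 addr0 xy0.
      have pp : edist p p < e by rewrite edistpp.
      have [_ Fp _] := HF p pp; rewrite (Fp bp).
      have tp : edist (x 0 - t * v, y 0 + t * u) p < e.
        rewrite -xy0 /edist /= (_ : _ + _ = t ^+ 2) ?sqrtr_sqr ?gtr0_norm //.
        by rewrite -[RHS]mulr1 -U0; ring.
      apply: ltW; apply/(let: And3 i _ _ := HF _ tp in i).
      by apply: (Hd t) => //=; rewrite sub0r normrN gtr0_norm.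
    by rewrite lt_neqAle ge andbT eq_sym; exact: (normal_neq0 AB0 U0 E1).
  exact: curvature_identity U0 E2 E3.
move=> /key[u [v [U E P Ek]]] /key[u2 [v2 [U2 E2 P2 Ek2]]].
set c := A * v - B * u in P Ek; set c2 := A * v2 - B * u2 in P2 Ek2.
have Ac : A = c * v.
  have : A * (u ^+ 2 + v ^+ 2) = u * (A * u + B * v) + c * v by rewrite /c; ring.
  by rewrite U E mulr1 mulr0 add0r.
have Bc : B = - c * u.
  have : B * (u ^+ 2 + v ^+ 2) = v * (A * u + B * v) - c * u by rewrite /c; ring.
  by rewrite U E mulr1 mulr0 sub0r mulNr.
have Ac2 : A = c2 * v2.
  have : A * (u2 ^+ 2 + v2 ^+ 2) = u2 * (A * u2 + B * v2) + c2 * v2 by rewrite /c2; ring.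
  by rewrite U2 E2 mulr1 mulr0 add0r.
have Bc2 : B = - c2 * u2.
  have : B * (u2 ^+ 2 + v2 ^+ 2) = v2 * (A * u2 + B * v2) - c2 * u2 by rewrite /c2; ring.
  by rewrite U2 E2 mulr1 mulr0 sub0r mulNr.
(* Both are the norm of the gradient; positivity, which comes from [Omega] lying on the left, fixes
   the sign and hence the orientation of the tangent. *)
have cc : c = c2.
  apply/eqP; rewrite -(eqrXn2 (n := 2)) ?ltW //; apply/eqP.
  have -> : c ^+ 2 = A ^+ 2 + B ^+ 2 by rewrite {1}Ac {1}Bc -[LHS]mulr1 -U; ring.
  by rewrite {1}Ac2 {1}Bc2 -[RHS]mulr1 -U2; ring.
have vv : v = v2 by apply: (mulfI (_ : c != 0)); [rewrite gt_eqF|rewrite -Ac cc -Ac2].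
have uu : u = u2 by apply: (mulfI (_ : - c != 0)); [rewrite oppr_eq0 gt_eqF|rewrite -Bc cc -Bc2].
apply: (mulIf (_ : c != 0)); first by rewrite gt_eqF.
by rewrite Ek vv uu -Ek2 cc.
Unshelve. all: by end_near. Qed.

Lemma curvatureE p (k : R) : boundary Omega p -> is_curvature Omega p k -> curvature Omega p = k.
Proof.
move=> bp Hk; apply: (curvature_uniq bp _ Hk).
by rewrite /curvature; exact: (getPex (P := is_curvature Omega p)) (ex_intro _ k Hk).
Qed.

End Curvature.

(** * Arc length parametrization *)

Section BoundaryCurve.
Context {R : realType} (Omega : set (R * R)).
Variables (a b M : R).
Hypotheses (oO : open Omega) (Oab : Omega (a, b)).
Hypothesis (cvx : segment_closed Omega).
Hypothesis (bnd : forall q, Omega q -> edist q (a, b) <= M).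
Hypothesis (sm : smooth_boundary Omega).
Implicit Types (w s t : R) (p q : R * R).

Notation rho := (radius Omega a b).
Let srho : smooth1 rho. Proof. exact: smooth_radius bnd sm. Qed.
Let rho0 w : 0 < rho w. Proof. exact: radius_gt0 bnd w. Qed.
Let Dr w := smooth1_ide srho w.

(* [dev w] is the angle between the outward normal and the radial direction [w],
   [vel w] the speed of the polar parametrization. *)
Let dev w : R := atan (derive1 rho w / rho w).
Let vel w : R := rho w / cos (dev w).
(** The angle of the tangent: the outward normal has angle [w - dev w], and a right angle is
    added. *)
Let dir w : R := w + pi / 2 - dev w.

Let cdev w : 0 < cos (dev w).
Proof. by apply: cos_gt0_pihalf; rewrite atan_gtNpi2 atan_ltpi2. Qed.

Let sdevE w : sin (dev w) = derive1 rho w / rho w * cos (dev w).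
Proof. by have <- : tan (dev w) = derive1 rho w / rho w := atanK _; rewrite /tan divfK // gt_eqF. Qed.

Let smooth_dev : smooth1 dev.
Proof.
apply/smooth1P => k w; apply: (@smat_comp _ k atan (fun w => derive1 rho w / rho w)); first exact: smat_atan.
apply: smatM; first exact: ((smooth1P _).1 (smooth1_derive srho)).
by apply: smatV; [rewrite gt_eqF|exact: ((smooth1P _).1 srho)].
Qed.

Let smooth_dir : smooth1 dir.
Proof.
apply/smooth1P => k w; apply: smatB; last exact: ((smooth1P _).1 smooth_dev).
by apply: smatD; [exact: smat_id|exact: smat_cst].
Qed.

Let smooth_vel : smooth1 vel.
Proof.
apply/smooth1P => k w; apply: smatM; first exact: ((smooth1P _).1 srho).
apply: smatV; first by rewrite gt_eqF.
apply: (@smat_comp _ k cos dev); last exact: ((smooth1P _).1 smooth_dev).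
by have [] := smat_sincos k (dev w).
Qed.

Let rho_per w : rho (w + 2 * pi) = rho w. Proof. exact: radius_per. Qed.

Let drho_per w : derive1 rho (w + 2 * pi) = derive1 rho w.
Proof.
have D1 := @ide_comp R rho (fun w => w + 2 * pi) w _ _ (Dr (w + 2 * pi)) (ideD (ide_id w) (ide_cst (2 * pi) w)).
have D2 : is_deriv w (fun w => rho (w + 2 * pi)) (derive1 rho w).
  by apply: (ide_near _ (Dr w)); exists 1 => //= z _; rewrite rho_per.
by rewrite -(ide_uniq D1 D2); ring.
Qed.

Let dev_per w : dev (w + 2 * pi) = dev w. Proof. by rewrite /dev drho_per rho_per. Qed.

Let vel_per w : vel (w + 2 * pi) = vel w. Proof. by rewrite /vel dev_per rho_per. Qed.

Let px w : R := a + rho w * cos w.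
Let py w : R := b + rho w * sin w.

Let cos_dir w : cos (dir w) = - sin (w - dev w).
Proof. by rewrite /dir addrAC cosDpihalf. Qed.

Let sin_dir w : sin (dir w) = cos (w - dev w).
Proof. by rewrite /dir addrAC sinDpihalf. Qed.

Let Dpx w : is_deriv w px (vel w * cos (dir w)).
Proof.
apply: (ide_eq (ideD (ide_cst a w) (ideM (Dr w) (is_derive_cos w)))).
rewrite cos_dir sinB sdevE /vel; have := rho0 w; have := cdev w.
move: (derive1 rho w) (rho w) (cos (dev w)) (cos w) (sin w) => d r c C S c0 r0.
by field; rewrite !gt_eqF.
Qed.

Let Dpy w : is_deriv w py (vel w * sin (dir w)).
Proof.
apply: (ide_eq (ideD (ide_cst b w) (ideM (Dr w) (is_derive_sin w)))).
rewrite sin_dir cosB sdevE /vel; have := rho0 w; have := cdev w.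
move: (derive1 rho w) (rho w) (cos (dev w)) (cos w) (sin w) => d r c C S c0 r0.
by field; rewrite !gt_eqF.
Qed.

Let vel_ge : exists2 d, 0 < d & forall w, d <= vel w.
Proof.
have [d d0 H] := radius_ge oO Oab cvx bnd; exists d => // w.
apply: (le_trans (H w)); rewrite /vel ler_pdivlMr; last exact: cdev.
by rewrite ler_piMr ?cos_le1 // ltW.
Qed.

Let boundary_px w : boundary Omega (px w, py w).
Proof. exact: (boundary_polar oO Oab cvx bnd w). Qed.

(* The gradient of a local defining function points along the outward normal. *)
Let normal_gradient w : exists (F : R * R -> R) (e l : R),
  [/\ smooth F, 0 < e, 0 < l, F (px w, py w) = 0 &
  [/\ forall q, edist q (px w, py w) < e -> Omega q <-> F q < 0,
      forall q, Omega q -> partial 0 F (px w, py w) * (q.1 - px w) + partial 1 F (px w, py w) * (q.2 - py w) < 0,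
      partial 0 F (px w, py w) = l * sin (dir w) & partial 1 F (px w, py w) = - l * cos (dir w)]].
Proof.
have bp := boundary_px w.
have [F [e [sF e0 HF]]] := local_defining oO cvx sm bp.
have pp : edist (px w, py w) (px w, py w) < e by rewrite edistpp.
have [_ Fp G] := HF _ pp.
set A := partial 0 F (px w, py w) in G *; set B := partial 1 F (px w, py w) in G *.
have v0 : 0 < vel w by rewrite divr_gt0.
have E : A * cos (dir w) + B * sin (dir w) = 0.
  have D1 := smooth_chain sF (Dpx w) (Dpy w).
  have D2 : is_deriv w (fun w => F (px w, py w)) 0.
    apply: (@ide_cst_near _ _ 0).
    have cg := cont1_pair (@cont_edist R (px w, py w)) (is_derive_cont Dpx) (is_derive_cont Dpy).
    have : \forall u \near w, edist (px u, py u) (px w, py w) < e by apply: (cvgr_lt _ (cg w)); rewrite edistpp.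
    by apply: filterS => u /HF[_ H _]; exact: H.
  have := ide_uniq D1 D2; rewrite -/A -/B => H; apply: (mulfI (_ : vel w != 0)); first by rewrite gt_eqF.
  by rewrite mulr0 -H; ring.
have U : cos (dir w) ^+ 2 + sin (dir w) ^+ 2 = 1 by exact: cos2Dsin2.
pose l := A * sin (dir w) - B * cos (dir w).
have AE : A = l * sin (dir w).
  have : A * (cos (dir w) ^+ 2 + sin (dir w) ^+ 2) =
    cos (dir w) * (A * cos (dir w) + B * sin (dir w)) + l * sin (dir w) by rewrite /l; ring.
  by rewrite U E mulr1 mulr0 add0r.
have BE : B = - l * cos (dir w).
  have : B * (cos (dir w) ^+ 2 + sin (dir w) ^+ 2) =
    sin (dir w) * (A * cos (dir w) + B * sin (dir w)) - l * cos (dir w) by rewrite /l; ring.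
  by rewrite U E mulr1 mulr0 sub0r mulNr.
have l0 : 0 < l.
  have := G (a, b) bp Oab; rewrite /= AE BE sin_dir cos_dir sinB cosB /px /py.
  have -> : l * (cos w * cos (dev w) + sin w * sin (dev w)) * (a - (a + rho w * cos w)) +
      - l * - (sin w * cos (dev w) - cos w * sin (dev w)) * (b - (b + rho w * sin w)) =
      - (l * (rho w * cos (dev w))) * (cos w ^+ 2 + sin w ^+ 2) by ring.
  by rewrite cos2Dsin2 mulr1 oppr_lt0 pmulr_lgt0 // mulr_gt0.
exists F, e, l; split; [exact: sF|exact: e0|exact: l0|exact: Fp|split => //].
  by move=> q /HF[].
by move=> q; exact: (G q bp).
Qed.

Let normal_support q w : Omega q -> (q.1 - px w) * sin (dir w) - (q.2 - py w) * cos (dir w) < 0.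
Proof.
have [F [e [l [sF e0 l0 _ [_ G AE BE]]]]] := normal_gradient w.
move=> /G; rewrite AE BE.
have -> : l * sin (dir w) * (q.1 - px w) + - l * cos (dir w) * (q.2 - py w) =
  l * ((q.1 - px w) * sin (dir w) - (q.2 - py w) * cos (dir w)) by ring.
by rewrite pmulr_rlt0.
Qed.

Let normal_inside w : exists2 d, 0 < d & forall h, 0 < h < d -> Omega (px w - h * sin (dir w), py w + h * cos (dir w)).
Proof.
have [F [e [l [sF e0 l0 Fp [H _ AE BE]]]]] := normal_gradient w.
have Du : is_deriv (0 : R) (fun h => px w - h * sin (dir w)) (- sin (dir w)).
  by apply: (ide_eq (ideB (ide_cst (px w) 0) (ideM (ide_id 0) (ide_cst (sin (dir w)) 0)))); ring.
have Dv : is_deriv (0 : R) (fun h => py w + h * cos (dir w)) (cos (dir w)).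
  by apply: (ide_eq (ideD (ide_cst (py w) 0) (ideM (ide_id 0) (ide_cst (cos (dir w)) 0)))); ring.
have := smooth_chain sF Du Dv; rewrite !mul0r subr0 addr0 AE BE => D.
have Dl : l * sin (dir w) * - sin (dir w) + - l * cos (dir w) * cos (dir w) < 0.
  have -> : l * sin (dir w) * - sin (dir w) + - l * cos (dir w) * cos (dir w) =
    - l * (cos (dir w) ^+ 2 + sin (dir w) ^+ 2) by ring.
  by rewrite cos2Dsin2 mulr1 oppr_lt0.
have [r r0 Hr] := ide_neg_right D Dl.
exists (Num.min r e); first by rewrite lt_min r0.
move=> h /andP[h0]; rewrite lt_min => /andP[hr he]; apply/H.
  rewrite /edist /= (_ : _ + _ = h ^+ 2) ?sqrtr_sqr ?gtr0_norm //.
  by rewrite -[RHS]mulr1 -(cos2Dsin2 (dir w)); ring.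
by have := Hr h; rewrite add0r h0 hr !mul0r subr0 addr0 Fp => /(_ isT).
Qed.

(** If a boundary point lay strictly beyond the tangent, so would points of [Omega] on the segment
    from [(a, b)] to it, against [normal_support]. *)
Let boundary_support w w' : (px w' - px w) * sin (dir w) - (py w' - py w) * cos (dir w) <= 0.
Proof.
rewrite leNgt; apply/negP => H.
have H0 := normal_support w Oab; rewrite /= in H0.
set X := _ - _ in H; set Y := _ - _ in H0.
have XY : 0 < X - Y by lra.
(* At this parameter the affine function with values [Y] at [(a, b)] and [X] at the boundary point
   is at least [X / 2]. *)
pose t := Num.max 0 (1 - X / (2 * (X - Y))).
have h0 : 0 < X / (2 * (X - Y)) by rewrite divr_gt0 // mulr_gt0.
have t01 : 0 <= t < 1 by rewrite /t le_max lexx gt_max ltr01 /=; lra.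
have := segment_interior oO cvx Oab (boundary_px w').1 t01.
move/(normal_support w) => /=.
have -> : (a + t * (px w' - a) - px w) * sin (dir w) - (b + t * (py w' - b) - py w) * cos (dir w) =
  Y + t * (X - Y) by rewrite /X /Y; ring.
have tge : 1 - X / (2 * (X - Y)) <= t by rewrite /t le_max lexx orbT.
have : (1 - X / (2 * (X - Y))) * (X - Y) <= t * (X - Y) by rewrite ler_wpM2r // ltW.
have -> : (1 - X / (2 * (X - Y))) * (X - Y) = X / 2 - Y by field; rewrite gt_eqF.
by lra.
Qed.

(** The speed of the polar parametrization is bounded below, so its arc length [sg] has a smooth
    inverse [tau]. Every field of the record is a property in the polar angle transported by
    [tau]. *)
Lemma convex_curve_exists : inhabited (convex_curve Omega).
Proof.
have [d d0 dvel] := vel_ge; have cvel := smooth1_cont smooth_vel.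
have pi0 := pi_gt0 R.
have [S0 DS0] := antiderivative cvel.
pose sg w := S0 w - S0 0.
have Dsg w : is_deriv w sg (vel w).
  by apply: (ide_eq (ideB (DS0 w) (ide_cst (S0 0) w))); ring.
have sg0 : sg 0 = 0 by rewrite /sg subrr.
have [tau [tauK sgK stau Dtau]] := smooth_inverse d0 Dsg smooth_vel dvel.
pose L := sg (2 * pi).
have sg_mono w w' : w < w' -> sg w < sg w'.
  move=> ww; have DD z : is_deriv z (fun z => sg z - d * z) (vel z - d).
    by apply: (ide_eq (ideB (Dsg z) (ideM (ide_cst d z) (ide_id z)))); ring.
  have dv z : w <= z <= w' -> 0 <= vel z - d by rewrite subr_ge0.
  have := ide_le (ltW ww) (fun z _ => DD z) dv.
  have : 0 < d * (w' - w) by rewrite mulr_gt0 // subr_gt0.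
  by lra.
have L0 : 0 < L by rewrite /L -sg0; apply: sg_mono; lra.
have sg_per w : sg (w + 2 * pi) = sg w + L.
  have D z : is_deriv z (fun z => sg (z + 2 * pi) - sg z) 0.
    apply: (ide_eq (ideB (@ide_comp R sg (fun z => z + 2 * pi) z _ _ (Dsg _) (ideD (ide_id z) (ide_cst (2 * pi) z))) (Dsg z))).
    by rewrite vel_per; ring.
  have [c _] := @mean_value R _ (fun=> 0) 0 w D; rewrite mul0r add0r sg0 subr0 -/L => E.
  by lra.
have tau_per s : tau (s + L) = tau s + 2 * pi.
  by rewrite -[LHS](sgK) tauK -{1}(tauK s) -sg_per sgK.
have tau_mono s s' : s < s' -> tau s < tau s'.
  move=> ss; rewrite ltNge; apply/negP; rewrite le_eqVlt => /orP[/eqP E|/sg_mono].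
    by move: ss; rewrite -(tauK s) -E tauK ltxx.
  by rewrite !tauK; lra.
have tau0 : tau 0 = 0 by rewrite -{1}sg0 sgK.
have tauL : tau L = 2 * pi by rewrite /L sgK.
pose cgx s := px (tau s); pose cgy s := py (tau s); pose cang s := dir (tau s).
have vn0 w : vel w != 0 by rewrite gt_eqF // (lt_le_trans d0).
have Dx s : is_deriv s cgx (cos (cang s)).
  by apply: (ide_eq (ide_comp (Dpx (tau s)) (Dtau s))); rewrite mulrAC mulfV // mul1r.
have Dy s : is_deriv s cgy (sin (cang s)).
  by apply: (ide_eq (ide_comp (Dpy (tau s)) (Dtau s))); rewrite mulrAC mulfV // mul1r.
have sang : smooth1 cang.
  apply/smooth1P => k s; apply: (@smat_comp _ k dir tau); first exact: ((smooth1P _).1 smooth_dir).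
  exact: ((smooth1P _).1 stau).
have Da s := smooth1_ide sang s.
have ang_p s : cang (s + L) = cang s + 2 * pi.
  by rewrite /cang /dir tau_per dev_per; ring.
have px_per w : px (w + 2 * pi) = px w.
  by rewrite /px rho_per (_ : 2 * pi = pi *+ 2) ?cosD2pi // mulr_natl.
have py_per w : py (w + 2 * pi) = py w.
  by rewrite /py rho_per (_ : 2 * pi = pi *+ 2) ?sinD2pi // mulr_natl.
have gxp s : cgx (s + L) = cgx s by rewrite /cgx tau_per px_per.
have gyp s : cgy (s + L) = cgy s by rewrite /cgy tau_per py_per.
have bc : boundary Omega = [set (cgx s, cgy s) | s in `[0, L[].
  apply/seteqP; split=> [p|_ [s _ <-]]; last exact: boundary_px.
  move=> /(boundaryP oO Oab cvx bnd p)[w ->].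
  have [z zL zf] := periodic_reduce (sg w) L0; exists (sg w - L * z%:~R).
    by rewrite /= in_itv.
  by rewrite (zf cgx gxp) (zf cgy gyp) /cgx /cgy sgK.
have inj s s' : 0 <= s < L -> 0 <= s' < L -> cgx s = cgx s' -> cgy s = cgy s' -> s = s'.
  move=> /andP[s0 sL] /andP[s'0 s'L] Ex Ey.
  have rng r : 0 <= r -> r < L -> 0 <= tau r < 2 * pi.
    move=> r0 rL; rewrite -tauL tau_mono // andbT.
    by move: r0; rewrite le_eqVlt => /orP[/eqP <-|/tau_mono]; rewrite tau0 // => /ltW.
  rewrite -(tauK s) -(tauK s'); congr sg.
  have Ex' : rho (tau s) * cos (tau s) = rho (tau s') * cos (tau s').
    by apply: (addrI a); exact: Ex.
  have Ey' : rho (tau s) * sin (tau s) = rho (tau s') * sin (tau s').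
    by apply: (addrI b); exact: Ey.
  have Er : rho (tau s) = rho (tau s').
    apply/eqP; rewrite -(eqrXn2 (n := 2)) ?ltW //; apply/eqP.
    have sq w : rho w ^+ 2 = (rho w * cos w) ^+ 2 + (rho w * sin w) ^+ 2.
      by rewrite !exprMn -mulrDr cos2Dsin2 mulr1.
    by rewrite !sq Ex' Ey'.
  have rn : rho (tau s') != 0 by rewrite gt_eqF.
  by apply: circle_point_uniq; [exact: rng|exact: rng|apply: (mulfI rn); rewrite -{1}Er|apply: (mulfI rn); rewrite -{1}Er].
have supp q s : Omega q -> (q.1 - cgx s) * sin (cang s) - (q.2 - cgy s) * cos (cang s) < 0.
  exact: normal_support.
have mvt (f f' : R -> R) x y : x < y -> (forall z, is_deriv z f (f' z)) ->
    exists2 c, x < c < y & f y - f x = f' c * (y - x).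
  move=> xy D; have [c|c] := MVT xy (fun z _ => D z).
    by apply: continuous_subspaceT; exact: (is_derive_cont D).
  by rewrite in_itv /= => cxy E; exists c.
have dang0 s : 0 <= derive1 cang s.
  (* If the tangent turned clockwise at [s], the curve just after [s] would be on the outer side of
     its tangent there, against [boundary_support]. *)
  rewrite leNgt; apply/negP => k0; set c := cang s.
  have ck : continuous (derive1 cang) by apply: smooth1_cont; exact: smooth1_derive.
  have ca : continuous cang by exact: smooth1_cont.
  have /nbhs_ballP[r /= r0 Hr] : \forall u \near s, derive1 cang u < 0 /\ c - pi < cang u.
    have n1 : \forall u \near s, derive1 cang u < 0 by apply: (cvgr_lt (derive1 cang s) (ck s)).
    have n2 : \forall u \near s, c - pi < cang u by apply: (cvgr_gt (cang s) (ca s)); rewrite gtrBl.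
    by apply: filterS2 n1 n2.
  have inr z : s < z < s + r -> derive1 cang z < 0 /\ c - pi < cang z.
    by move=> /andP[z1 z2]; apply: Hr; rewrite /ball /= distrC gtr0_norm ?subr_gt0 //; lra.
  pose h u := (cgx u - cgx s) * sin c - (cgy u - cgy s) * cos c.
  have Dh u : is_deriv u h (sin (c - cang u)).
    apply: (ide_eq (ideB (ideM (ideB (Dx u) (ide_cst (cgx s) u)) (ide_cst (sin c) u))
      (ideM (ideB (Dy u) (ide_cst (cgy s) u)) (ide_cst (cos c) u)))).
    by rewrite sinB; ring.
  have su : s < s + r / 2 by lra.
  have [z /andP[z1 z2] Ez] := mvt _ _ _ _ su Dh.
  have [y /andP[y1 y2] Ey] := mvt _ _ _ _ z1 Da.
  have zr : s < z < s + r by lra.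
  have yr : s < y < s + r by lra.
  have [ky _] := inr y yr; have [_ cz] := inr z zr.
  have zc : cang z - c < 0 by rewrite Ey nmulr_rlt0 // subr_gt0.
  have sp : 0 < sin (c - cang z) by apply: sin_gt0_pi; lra.
  have h0 : h s = 0 by rewrite /h !subrr !mul0r subrr.
  have : h (s + r / 2) <= 0 by exact: boundary_support.
  have : 0 < sin (c - cang z) * (s + r / 2 - s) by rewrite mulr_gt0 // subr_gt0.
  by rewrite -Ez h0; lra.
have curv s : curvature Omega (cgx s, cgy s) = derive1 cang s.
  apply: (curvatureE oO Oab cvx sm (boundary_px (tau s))).
  have sh t : is_deriv t (fun t => s + t) 1.
    by apply: (ide_eq (ideD (ide_cst s t) (ide_id t))); rewrite add0r.
  have DX t : is_deriv t (fun t => cgx (s + t)) (cos (cang (s + t))).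
    by apply: (ide_eq (@ide_comp R cgx (fun t => s + t) t _ _ (Dx (s + t)) (sh t))); rewrite mulr1.
  have DY t : is_deriv t (fun t => cgy (s + t)) (sin (cang (s + t))).
    by apply: (ide_eq (@ide_comp R cgy (fun t => s + t) t _ _ (Dy (s + t)) (sh t))); rewrite mulr1.
  have DA t : is_deriv t (fun t => cang (s + t)) (derive1 cang (s + t)).
    by apply: (ide_eq (@ide_comp R cang (fun t => s + t) t _ _ (Da (s + t)) (sh t))); rewrite mulr1.
  have DC t := @ide_comp R cos (fun t => cang (s + t)) t _ _ (is_derive_cos _) (DA t).
  have DS t := @ide_comp R sin (fun t => cang (s + t)) t _ _ (is_derive_sin _) (DA t).
  have sA k t : smat k (fun t => cang (s + t)) t.
    apply: (@smat_comp _ k cang (fun t => s + t)); first exact: ((smooth1P _).1 sang).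
    by apply: smatD; [exact: smat_cst|exact: smat_id].
  have EX : derive1 (fun t => cgx (s + t)) = fun t => cos (cang (s + t)).
    by apply/funext => t; rewrite derive1E; have D := DX t; exact: derive_val.
  have EY : derive1 (fun t => cgy (s + t)) = fun t => sin (cang (s + t)).
    by apply/funext => t; rewrite derive1E; have D := DY t; exact: derive_val.
  exists (fun t => cgx (s + t)), (fun t => cgy (s + t)); rewrite /derive1n /= EX EY !addr0; split.
  - split; [apply: (smooth1_primitive DX)|apply: (smooth1_primitive DY)]; apply/smooth1P => k t.
      by apply: (@smat_comp _ k cos (fun t => cang (s + t))); [have [] := smat_sincos k (cang (s + t))|exact: sA].
    by apply: (@smat_comp _ k sin (fun t => cang (s + t))); [have [] := smat_sincos k (cang (s + t))|exact: sA].
  - by [].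
  - by exists 1 => //= t _; split; [exact: boundary_px|exact: cos2Dsin2].
  - have [e e0 He] := normal_inside (tau s); exists e => //= h.
    by rewrite /ball_ /= sub0r normrN => he h0; apply: He; rewrite h0 /=; apply: le_lt_trans he; exact: ler_norm.
  - have D1 := DC 0; have D2 := DS 0; rewrite addr0 in D1 D2.
    rewrite (derive1E (fun t => sin _)) (derive1E (fun t => cos _)) (@derive_val _ _ _ _ _ _ _ D1) (@derive_val _ _ _ _ _ _ _ D2).
    by rewrite -[LHS]mul1r -(cos2Dsin2 (cang s)); ring.
constructor; exact: (ConvexCurve L0 Dx Dy sang ang_p dang0 gxp gyp bc inj supp curv).
Qed.

End BoundaryCurve.

(** * Conclusion *)

Section Disk.
Context {R : realType} (c : R * R) (r : R).
Hypothesis r0 : 0 < r.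
Notation D := (disk c r).
Implicit Types (p q z : R * R) (t w : R).

Lemma diskE q : D q <-> (q.1 - c.1) ^+ 2 + (q.2 - c.2) ^+ 2 < r ^+ 2.
Proof.
have H : (edist q c < r) = ((q.1 - c.1) ^+ 2 + (q.2 - c.2) ^+ 2 < r ^+ 2).
  by rewrite -sqr_edist ltr_pXn2r // nnegrE ?edist_ge0 // ltW.
by rewrite /disk /= -H edistC.
Qed.

Lemma diskP q : D q <-> edist q c < r.
Proof. by rewrite /disk /= edistC. Qed.

Lemma disk_center : D (c.1, c.2).
Proof. by apply/diskE; rewrite /= !subrr expr0n addr0 exprn_gt0. Qed.

Lemma open_disk : open D.
Proof.
rewrite (_ : D = (fun p => edist p c) @^-1` [set x | x < r]).
  by apply: open_comp => [x _|]; [exact: cont_edist|exact: open_lt].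
by apply/seteqP; split=> q /=; rewrite /disk /= edistC.
Qed.

Lemma disk_convex : segment_closed D.
Proof.
move=> p q t /diskE Dp /diskE Dq /andP[t0 t1]; apply/diskE => /=.
have t1' : 0 <= 1 - t by lra.
set x1 := p.1 - c.1 in Dp *; set x2 := p.2 - c.2 in Dp; set y1 := q.1 - c.1 in Dq; set y2 := q.2 - c.2 in Dq.
have -> : (p.1 + t * (q.1 - p.1) - c.1) ^+ 2 + (p.2 + t * (q.2 - p.2) - c.2) ^+ 2 =
    (1 - t) * (x1 ^+ 2 + x2 ^+ 2) + t * (y1 ^+ 2 + y2 ^+ 2) - t * (1 - t) * ((x1 - y1) ^+ 2 + (x2 - y2) ^+ 2).
  by rewrite /x1 /x2 /y1 /y2; ring.
have P : 0 <= t * (1 - t) * ((x1 - y1) ^+ 2 + (x2 - y2) ^+ 2).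
  by rewrite mulr_ge0 ?addr_ge0 ?sqr_ge0 // mulr_ge0.
move: (x1 ^+ 2 + x2 ^+ 2) (y1 ^+ 2 + y2 ^+ 2) (t * (1 - t) * _) P Dp Dq => X Y Z P Dp Dq.
case: (eqVneq t 0) => [->|tn]; first by lra.
have tp : 0 < t by rewrite lt_neqAle eq_sym tn.
have h1 : t * Y < t * r ^+ 2 by rewrite ltr_pM2l.
have h2 : (1 - t) * X <= (1 - t) * r ^+ 2 by rewrite ler_wpM2l // ltW.
by lra.
Qed.

Lemma disk_bounded q : D q -> edist q (c.1, c.2) <= r.
Proof. by move=> /diskP/ltW; rewrite -surjective_pairing. Qed.

Lemma edist_polar_center w t : edist (polar c.1 c.2 w t) c = `|t|.
Proof.
have -> : edist (polar c.1 c.2 w t) c = edist (polar c.1 c.2 w t) (polar c.1 c.2 w 0).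
  by rewrite polar0 -surjective_pairing.
by rewrite edist_polar subr0.
Qed.

Lemma disk_radius w : radius D c.1 c.2 w = r.
Proof.
have P := radiusP open_disk disk_center disk_convex disk_bounded w.
apply/eqP; rewrite eq_le; apply/andP; split; rewrite leNgt; apply/negP => H.
  by have /diskP := (P r (ltW r0)).2 H; rewrite edist_polar_center gtr0_norm // ltxx.
have R0 : 0 <= radius D c.1 c.2 w by apply: ltW; exact: (radius_gt0 open_disk disk_center disk_convex disk_bounded w).
have : D (polar c.1 c.2 w (radius D c.1 c.2 w)) by apply/diskP; rewrite edist_polar_center ger0_norm.
by move/((P _ R0).1); rewrite ltxx.
Qed.

Lemma disk_boundary p : boundary D p <-> exists w, p = polar c.1 c.2 w r.
Proof.
rewrite (boundaryP open_disk disk_center disk_convex disk_bounded).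
by split=> -[w ->]; exists w; rewrite disk_radius.
Qed.

Lemma disk_smooth : smooth_boundary D.
Proof.
move=> p /disk_boundary[w Ep].
pose f x := (x - c.1) ^+ 2; pose g y := (y - c.2) ^+ 2 - r ^+ 2.
have sX (d : R) : smooth1 (fun x => (x - d) ^+ 2).
  apply/smooth1P => k x; rewrite (_ : (fun x => _) = fun x => (x - d) * (x - d)); last by apply/funext => y; rewrite expr2.
  by apply: smatM; apply: smatB; [exact: smat_id|exact: smat_cst|exact: smat_id|exact: smat_cst].
have sf : smooth1 f by exact: sX.
have sg : smooth1 g by apply/smooth1P => k x; apply: smatB; [exact: ((smooth1P _).1 (sX c.2))|exact: smat_cst].
have s1 : smooth1 (fun _ : R => 1 : R) by apply/smooth1P => k x; exact: smat_cst.
exists (fun q => f q.1 * 1 + 1 * g q.2); first by apply: smoothD; [exact: (smooth_tensor sf s1)|exact: (smooth_tensor s1 sg)].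
(* Within distance [r] of a boundary point the center is avoided, and the gradient of the defining
   function vanishes only there. *)
apply/near_edist; exists r => // q qr; split; last first.
  by rewrite diskE /f /g mulr1 mul1r addrA subr_lt0.
have Dx : is_deriv q.1 (fun x => f x * 1 + 1 * g q.2) (2 * (q.1 - c.1)).
  by apply: (ide_eq (ideD (ideM (ideX 1 (ideB (ide_id q.1) (ide_cst c.1 q.1))) (ide_cst 1 q.1)) (ide_cst (1 * g q.2) q.1))); ring.
have Dy : is_deriv q.2 (fun y => f q.1 * 1 + 1 * g y) (2 * (q.2 - c.2)).
  apply: (ide_eq (ideD (ide_cst (f q.1 * 1) q.2) (ideM (ide_cst 1 q.2)
    (ideB (ideX 1 (ideB (ide_id q.2) (ide_cst c.2 q.2))) (ide_cst (r ^+ 2) q.2))))); ring.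
have E0 := @partial0E R (fun q => f q.1 * 1 + 1 * g q.2) q.1 q.2 _ Dx.
have E1 := @partial1E R (fun q => f q.1 * 1 + 1 * g q.2) q.1 q.2 _ Dy.
rewrite -surjective_pairing in E0 E1.
case: (eqVneq q.1 c.1) => [e1|n1]; last first.
  by exists 0; rewrite E0 mulf_neq0 ?subr_eq0.
case: (eqVneq q.2 c.2) => [e2|n2]; last first.
  by exists 1; rewrite E1 mulf_neq0 ?subr_eq0.
move: qr; have -> : q = polar c.1 c.2 w 0 by rewrite polar0 -e1 -e2 -surjective_pairing.
by rewrite Ep edist_polar sub0r normrN gtr0_norm // ltxx.
Qed.

Lemma disk_curvature p : boundary D p -> curvature D p = r^-1.
Proof.
move=> bp; apply: (curvatureE open_disk disk_center disk_convex disk_smooth bp).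
move/disk_boundary: bp => [w Ep].
have rn : r != 0 by rewrite gt_eqF.
pose th t := w + t / r.
have Dth t : is_deriv t th r^-1.
  by apply: (ide_eq (ideD (ide_cst w t) (ideM (ide_id t) (ide_cst r^-1 t)))); ring.
have Dc t := @ide_comp R cos th t _ _ (is_derive_cos _) (Dth t).
have Ds t := @ide_comp R sin th t _ _ (is_derive_sin _) (Dth t).
have Dx t : is_deriv t (fun t => c.1 + r * cos (th t)) (- sin (th t)).
  by apply: (ide_eq (ideD (ide_cst c.1 t) (ideM (ide_cst r t) (Dc t)))); field.
have Dy t : is_deriv t (fun t => c.2 + r * sin (th t)) (cos (th t)).
  by apply: (ide_eq (ideD (ide_cst c.2 t) (ideM (ide_cst r t) (Ds t)))); field.
have EX : derive1 (fun t => c.1 + r * cos (th t)) = fun t => - sin (th t).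
  by apply/funext => t; rewrite derive1E; have D := Dx t; exact: derive_val.
have EY : derive1 (fun t => c.2 + r * sin (th t)) = fun t => cos (th t).
  by apply/funext => t; rewrite derive1E; have D := Dy t; exact: derive_val.
have sth k t : smat k th t.
  by apply: smatD; [exact: smat_cst|apply: smatM; [exact: smat_id|exact: smat_cst]].
have sc : smooth1 (fun t => cos (th t)).
  by apply/smooth1P => k t; apply: (@smat_comp _ k cos th); [have [] := smat_sincos k (th t)|exact: sth].
have ss : smooth1 (fun t => - sin (th t)).
  by apply/smooth1P => k t; apply: smatN; apply: (@smat_comp _ k sin th); [have [] := smat_sincos k (th t)|exact: sth].
have th0 : th 0 = w by rewrite /th mul0r addr0.
exists (fun t => c.1 + r * cos (th t)), (fun t => c.2 + r * sin (th t)); rewrite /derive1n /= EX EY th0; split.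
- by split; [exact: smooth1_primitive Dx ss|exact: smooth1_primitive Dy sc].
- by rewrite Ep.
- exists 1 => //= t _; split; last by rewrite sqrrN addrC cos2Dsin2.
  by apply/disk_boundary; exists (th t).
- exists (2 * r) => [|h /=]; first by rewrite /= mulr_gt0.
  rewrite /ball_ /= sub0r normrN => hr h0; rewrite gtr0_norm // in hr.
  have -> : (c.1 + r * cos w - h * cos w, c.2 + r * sin w + h * - sin w) = polar c.1 c.2 w (r - h).
    by rewrite /polar; congr (_, _); ring.
  apply/diskP; rewrite edist_polar_center.
  by rewrite ltr_norml; apply/andP; split; lra.
- have D1 : is_deriv (0 : R) (fun t => cos (th t)) (- sin w / r) by apply: (ide_eq (Dc 0)); rewrite th0.
  have D2 : is_deriv (0 : R) (fun t => - sin (th t)) (- (cos w / r)) by apply: (ide_eq (ideN (Ds 0))); rewrite th0.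
  rewrite (derive1E (fun t => - sin _)) (derive1E (fun t => cos _)) (@derive_val _ _ _ _ _ _ _ D1) (@derive_val _ _ _ _ _ _ _ D2).
  by rewrite -[LHS]mul1r -(cos2Dsin2 w); ring.
Qed.

Lemma disk_ka (K : convex_curve D) s : ka K s = r^-1.
Proof. by rewrite -curvature_ka disk_curvature //; exact: boundary_gamma. Qed.

End Disk.

(** * Elastic energy and comparison with the disk *)

Section EllipticFacts.
Context {R : realType} (Omega : set (R * R)) (K : convex_curve Omega).
Notation mu := (@lebesgue_measure R).
Notation L := (len K).
Notation ka := (ka K).

(** The average of the curvature for the measure [ka ds], equal to the elastic energy over [pi]: the
    number [k] of the comparison disk of radius [1 / k]. *)
Definition mean_sqr_ka : R := (\int[mu]_(s in `[0, L]) (ka s ^+ 2)) / (2 * pi).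

Lemma elastic_energyE : elastic_energy Omega = (pi * mean_sqr_ka)%:E.
Proof.
have c2 : continuous (fun s => ka s ^+ 2) by apply: cont1X; exact: cont_ka.
have E := @boundary_integral R Omega K (fun p => curvature Omega p ^+ 2) _ c2.
rewrite /elastic_energy E -?EFinM.
- have pin : (pi : R) != 0 := lt0r_neq0 (pi_gt0 R).
  have two : (2 : R) != 0 by rewrite pnatr_eq0.
  congr EFin; apply: (mulfI two); rewrite mulrA divff // mul1r [RHS]mulrA /mean_sqr_ka.
  by rewrite [RHS]mulrC divfK // mulf_neq0.
- by move=> s; rewrite curvature_ka.
- by move=> s; exact: sqr_ge0.
Qed.

Lemma mean_sqr_kaE : \int[mu]_(s in `[0, L]) (ka s ^+ 2) = 2 * pi * mean_sqr_ka.
Proof. by rewrite mulrC divfK // mulf_neq0 // lt0r_neq0 // pi_gt0. Qed.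

Lemma mean_sqr_ka_gt0 : 0 < mean_sqr_ka.
Proof.
have pi0 := pi_gt0 R; have L0 := len_gt0 K; have [C C0 HC] := ka_bounded K.
rewrite divr_gt0 ?mulr_gt0 //.
have ck : continuous (fun s => ka s) by exact: cont_ka.
have ck2 : continuous (fun s => ka s ^+ 2) by exact: cont1X.
have c1 : continuous (fun s => L^-1 + L / 4 * ka s ^+ 2).
  by apply: cont1D; [exact: cont1_cst|apply: cont1Z; exact: ck2].
have cL : continuous (fun s => L / 4 * ka s ^+ 2) by apply: cont1Z; exact: ck2.
(* The arithmetic-geometric inequality [ka <= 1 / L + L * ka ^ 2 / 4] integrates to
   [2 * pi <= 1 + L / 4] times the integral of the squared curvature, and [2 * pi > 1]. *)
have H : \int[mu]_(s in `[0, L]) ka s <= \int[mu]_(s in `[0, L]) (L^-1 + L / 4 * ka s ^+ 2).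
  apply: int_le => // s _; rewrite -subr_ge0.
  have -> : L^-1 + L / 4 * ka s ^+ 2 - ka s = L^-1 * (1 - L * ka s / 2) ^+ 2 by field; rewrite gt_eqF.
  by rewrite mulr_ge0 ?sqr_ge0 // invr_ge0 ltW.
move: H; rewrite int_ka (intD _ _ (@cont1_cst R L^-1) cL) (intZ _ _ _ ck2) int_cst ?(ltW L0) // subr0 mulVf ?gt_eqF //.
have p2 := pi_ge2 R; move=> H; have H2 : 0 < L / 4 * \int[mu]_(s in `[0, L]) ka s ^+ 2 by lra.
by rewrite pmulr_rgt0 // in H2; rewrite divr_gt0.
Qed.

End EllipticFacts.

Lemma mean_sqr_ka_disk {R : realType} (c : R * R) (r : R) (K : convex_curve (disk c r)) : 0 < r ->
  mean_sqr_ka K = r^-1.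
Proof.
move=> r0; have kE s := disk_ka r0 K s; have pi0 := pi_gt0 R.
have ck : continuous (fun s => ka K s) by exact: cont_ka.
rewrite /mean_sqr_ka (@int_eq _ _ (fun s => r^-1 * ka K s)); last first.
  by move=> s _; rewrite kE expr2.
by rewrite (intZ _ _ _ ck) int_ka mulfK // gt_eqF // mulr_gt0.
Qed.

Lemma convex_setP {R : realType} (Omega : set (R * R)) :
  convex_set (Omega : set (convex_lmodType (R * R)%type)) ->
  segment_closed Omega.
Proof.
move=> cv p q t Op Oq /andP[t0 t1].
have := cv q p (Itv01 t0 t1) (mem_set Oq) (mem_set Op) => /set_mem.
by congr (Omega _); rewrite [RHS]surjective_pairing; congr (_, _); rewrite /conv /= /unstable.onem -[_ *: _]/(_ * _) -[X in _ + X = _]/(_ * _); ring.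
Qed.

Section Comparison.
Context {R : realType} (Omega : set (R * R)) (K : convex_curve Omega).
Variables (a b : R).
Hypothesis (Oab : Omega (a, b)).
Hypothesis (cvx : segment_closed Omega).

Lemma lambda2_le_disk (c : R * R) (r alpha : R) (KD : convex_curve (disk c r)) : 0 < r ->
  mean_sqr_ka K = r^-1 -> (lambda2 alpha Omega <= lambda2 alpha (disk c r))%E.
Proof.
move=> r0 kr; have ri0 : 0 < r^-1 by rewrite invr_gt0.
have O0 := lambda2_le0 K Oab cvx alpha.
rewrite leNgt; apply/negP => H.
(* A number strictly between the two values is nonpositive since [lambda2 alpha Omega <= 0]; the
   value [-oo] for the disk is treated apart. *)
have [lam [H1 H2 l0]] : exists lam : R, [/\ (lambda2 alpha (disk c r) < lam%:E)%E,
    (lam%:E < lambda2 alpha Omega)%E & lam <= 0].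
  move: H O0; case: (lambda2 alpha Omega) => [n||] //=; last by rewrite ltNge leNye.
  case: (lambda2 alpha (disk c r)) => [m||] //=.
    rewrite lte_fin lee_fin => mn n0; exists ((m + n) / 2).
    by split; rewrite ?lte_fin; lra.
  by rewrite lee_fin => _ n0; exists (n - 1); split; rewrite ?ltNyr ?lte_fin //; lra.
have [phi [M0 [M [sphi phi0 M01 Q]]]] :=
  disk_converse (disk_center c r0) (disk_convex r0) ri0 (disk_ka r0 KD) l0 H1.
have Ek := mean_sqr_kaE K; rewrite kr in Ek.
have := radial_trial Oab cvx ri0 l0 sphi M01 phi0 Ek Q.
by rewrite leNgt H2.
Qed.

(** For every coupling below [- k] the radial form takes negative values at some [lam < 0], and the
    trial planes carry this over to [lambda2]. *)
Lemma alpha_star_ge : ((- mean_sqr_ka K)%:E <= alpha_star Omega)%E.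
Proof.
have k0 := mean_sqr_ka_gt0 K.
apply/lee_subgt0Pr => e e0; rewrite -EFinB; apply: ereal_sup_ubound.
exists (- mean_sqr_ka K - e) => //=.
have ak : - mean_sqr_ka K - e < - mean_sqr_ka K by rewrite gtrBl.
have [phi [M0 [M [lam [sphi phi0 M01 l0 Q]]]]] := radial_energy_lt0 (ltW k0) ak.
have := radial_trial Oab cvx k0 (ltW l0) sphi M01 phi0 (mean_sqr_kaE K) Q.
by move=> H; apply: le_lt_trans H _; rewrite lte_fin.
Qed.

End Comparison.

(** With [lam = 0], a negative [lambda2] would produce a profile of negative radial energy, which
    the completed square excludes for [alpha >= - k]. *)
Lemma alpha_star_disk {R : realType} (c : R * R) (r : R) (K : convex_curve (disk c r)) : 0 < r ->
  (alpha_star (disk c r) <= (- r^-1)%:E)%E.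
Proof.
move=> r0; have ri0 : 0 < r^-1 by rewrite invr_gt0.
apply: ge_ereal_sup => _ [alpha /= H <-]; rewrite lee_fin leNgt; apply/negP => ak.
have [phi [M0 [M [sphi phi0 /andP[M00 M0M] Q]]]] :=
  disk_converse (disk_center c r0) (disk_convex r0) ri0 (disk_ka r0 K) (lexx 0) H.
have := @radial_energy_ge0 R r^-1 phi M alpha 0 (ltW ri0) (ltW (lt_trans M00 M0M)) sphi
  (phi0 _ (ltW M0M)) (ltW ak) (lexx 0).
by rewrite leNgt Q.
Qed.

Lemma convex_domain_curve {R : realType} (Omega : set (R * R)) (a b : R) :
  open Omega -> Omega (a, b) -> bounded_set Omega ->
  segment_closed Omega ->
  smooth_boundary Omega -> inhabited (convex_curve Omega).
Proof.
move=> oO Oab [M0 [_ HM]] cvx sm.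
have H q : Omega q -> `|q| <= M0 + 1 by apply: (HM (M0 + 1)); rewrite ltrDl.
apply: (convex_curve_exists (M := 2 * (2 * (M0 + 1))) oO Oab cvx _ sm) => q Oq.
have n1 := H q Oq; have n2 := H _ Oab.
have b1 (p : R * R) : `|p.1| <= `|p| by rewrite prod_normE le_max lexx.
have b2 (p : R * R) : `|p.2| <= `|p| by rewrite prod_normE le_max lexx orbT.
apply: edist_le_sup.
  by have := ler_normB q.1 (a, b).1; have := b1 q; have := b1 (a, b); lra.
by have := ler_normB q.2 (a, b).2; have := b2 q; have := b2 (a, b); lra.
Qed.

Theorem theorem1p3 (R : realType) (Omega : set (R * R))
    (Omega_nonempty : Omega !=set0) (Omega_open : open Omega)
    (Omega_bounded : bounded_set Omega)
    (Omega_convex : convex_set (Omega : set (convex_lmodType (R * R)%type)))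
    (Omega_smooth : smooth_boundary Omega) :
  (forall (c : R * R) (r : R), 0 < r ->
     elastic_energy (disk c r) = elastic_energy Omega ->
     forall alpha : R, (lambda2 alpha Omega <= lambda2 alpha (disk c r))%E)
  /\
  ((- ((pi : R)^-1)%:E * elastic_energy Omega <= alpha_star Omega)%E /\
   ((exists (c : R * R) (r : R), 0 < r /\ Omega = disk c r) ->
      alpha_star Omega = (- ((pi : R)^-1)%:E * elastic_energy Omega)%E)).
Proof.
have cvx := convex_setP Omega_convex; have [[a b] Oab] := Omega_nonempty.
have [K] := convex_domain_curve Omega_open Oab Omega_bounded cvx Omega_smooth.
have pi0 := pi_gt0 R.
have disk_curve (c : R * R) (r : R) : 0 < r -> inhabited (convex_curve (disk c r)).
  move=> r0; have H := @convex_curve_exists R (disk c r) c.1 c.2 r (@open_disk R c r) (disk_center c r0) (disk_convex r0).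
  apply: H; last exact: disk_smooth.
  by move=> q; exact: disk_bounded.
have E : (- ((pi : R)^-1)%:E * elastic_energy Omega)%E = (- mean_sqr_ka K)%:E.
  rewrite (elastic_energyE K) -EFinN -EFinM; by congr EFin; rewrite mulNr mulKf // lt0r_neq0.
split=> [c r r0 EE alpha|].
  have [KD] := disk_curve c r r0; apply: (lambda2_le_disk Oab cvx alpha KD r0).
  move: EE; rewrite (elastic_energyE K) (elastic_energyE KD) (mean_sqr_ka_disk KD r0) => -[].
  by move=> /(mulfI (lt0r_neq0 pi0)) ->.
rewrite E; split=> [|[c [r [r0 EO]]]]; first exact: (alpha_star_ge K Oab cvx).
apply/eqP; rewrite eq_le (alpha_star_ge K Oab cvx) andbT.
move: K E; rewrite EO => K E; rewrite (mean_sqr_ka_disk K r0); exact: alpha_star_disk K r0.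
Qed.
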